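(* Assume $(\mathbf H_\Omega)$ and (C1)--(C4) (see context). If $u$ is a bounded usc subsolution of $w_t+\mathbb H^-(x,t,Dw)=0$ in $\mathbb R^N\times(0,T)$ and $v$ is a bounded lsc supersolution of the same equation, $u$ and $v$ being defined (and semicontinuous) up to $t=0$ and satisfying $u(x,0)\le v(x,0)$ for all $x\in\mathbb R^N$, then $u\le v$ in $\mathbb R^N\times(0,T)$.
   Context: Geometry $(\mathbf H_\Omega)$: $\mathbb R^N=\Omega_1\cup\Omega_2\cup\mathcal H$, where $\Omega_1,\Omega_2$ are disjoint open sets and $\mathcal H=\partial\Omega_1=\partial\Omega_2$ is a $W^{2,\infty}$-hypersurface (the signed distance to $\mathcal H$ is $W^{2,\infty}$ in a neighbourhood of $\mathcal H$). For $z\in\mathcal H$, $\mathbf n_i(z)$ is the unit normal to $\partial\Omega_i$ at $z$ pointing outwards $\Omega_i$. $D_{\mathcal H}$ is the tangential gradient on $\mathcal H$, $T_z\mathcal H$ the tangent space. Control data: $T>0$; for $i=1,2$, $b_i:\overline{\Omega_i}\times[0,T]\times A_i\to\mathbb R^N$, $l_i:\overline{\Omega_i}\times[0,T]\times A_i\to\mathbb R$. (C1) $A_i$ is a compact metric space, $b_i$ is continuous, $|b_i|\le M_b$ and $|b_i(z,s,\alpha_i)-b_i(z',s',\alpha_i)|\le L_b(|z-z'|+|s-s'|)$. (C2) $l_i$ is uniformly continuous, $|l_i|\le M_l$, and $|l_i(z,s,\alpha_i)-l_i(z',s',\alpha_i)|\le m_l(|z-z'|+|s-s'|)$ for a modulus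 of continuity $m_l$. (C3) For all $z\in\overline{\Omega_i}$, $s\in[0,T]$, the set $\{(b_i(z,s,\alpha_i),l_i(z,s,\alpha_i)):\alpha_i\in A_i\}$ is closed and convex. (C4) There is $\delta>0$ such that for $i=1,2$, $z\in\mathcal H$, $s\in[0,T]$: $\{b_i(z,s,\alpha_i)\cdot\mathbf n_i(z):\alpha_i\in A_i\}\supset[-\delta,\delta]$. Hamiltonians: $H_i(x,t,p)=\sup_{\alpha_i\in A_i}\{-b_i(x,t,\alpha_i)\cdot p-l_i(x,t,\alpha_i)\}$ for $x\in\overline{\Omega_i}$. With $A:=A_1\times A_2\times[0,1]$ and $a=(\alpha_1,\alpha_2,\mu)$, for $z\in\mathcal H$: $b_{\mathcal H}(z,s,a)=\mu b_1(z,s,\alpha_1)+(1-\mu)b_2(z,s,\alpha_2)$, $l_{\mathcal H}(z,s,a)=\mu l_1(z,s,\alpha_1)+(1-\mu)l_2(z,s,\alpha_2)$, $A_0(z,s)=\{a\in A: b_{\mathcal H}(z,s,a)\cdot\mathbf n_1(z)=0\}$, and for $p\in T_z\mathcal H$, $H_T(z,s,p)=\sup_{a\in A_0(z,s)}\{-b_{\mathcal H}(z,s,a)\cdot p-l_{\mathcal H}(z,s,a)\}$. Sub/supersolutions of $w_t+\mathbb H^-(x,t,Dw)=0$ in $\mathbb R^N\times(0,T)$: a bounded usc $u$ is a subsolution if, in the viscosity sense (local maxima of $u-\phi$ in $\mathbb R^N\times(0,T)$, $\phi\in C^1$), $u_t+H_i(x,t,Du)\le0$ in $\Omega_i\times(0,T)$,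 $i=1,2$, $u_t+\min\{H_1,H_2\}(x,t,Du)\le0$ on $\mathcal H\times(0,T)$, and in addition $u_t+H_T(x,t,D_{\mathcal H}u)\le0$ on $\mathcal H\times(0,T)$, meaning that for every $\phi\in C^1(\mathcal H\times[0,T])$ and every maximum point $(x,t)\in\mathcal H\times(0,T)$ of $u|_{\mathcal H\times(0,T)}-\phi$ one has $\phi_t(x,t)+H_T(x,t,D_{\mathcal H}\phi(x,t))\le0$. A bounded lsc $v$ is a supersolution if $v_t+H_i(x,t,Dv)\ge0$ in $\Omega_i\times(0,T)$, $i=1,2$, and $v_t+\max\{H_1,H_2\}(x,t,Dv)\ge0$ on $\mathcal H\times(0,T)$ (local minima in $\mathbb R^N\times(0,T)$); no tangential condition is required of $v$. *)

(* Defs.v *)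
From HB Require Import structures.
From mathcomp Require Import all_boot all_order all_algebra.
From mathcomp Require Import all_classical all_reals all_analysis.

Set Implicit Arguments.
Unset Strict Implicit.
Unset Printing Implicit Defensive.

Import Order.TTheory GRing.Theory Num.Theory.
Import numFieldNormedType.Exports.

Local Open Scope classical_set_scope.
Local Open Scope ring_scope.

(** The library norm on ['rV[R]_N] is the sup norm (same topology); all
    quantitative conditions below use the Euclidean norm [enorm]. *)

Section Euclidean.
Context {R : realType} {N : nat}.
Implicit Types (u v x : 'rV[R]_N) (S : set 'rV[R]_N).

Definition dotv u v : R := \sum_i u 0 i * v 0 i.

Definition enorm u : R := Num.sqrt (dotv u u).

Definition edist x S : R := inf [set enorm (x - z) | z in S].

Definition frontier S : set 'rV[R]_N := closure S `\` interior S.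

End Euclidean.

(** For [V] finite-dimensional and [O] open, continuity of all the directional
    derivatives is continuity of the differential. *)
Definition C1_on {R : realType} {V : normedModType R} (O : set V)
    (phi : V -> R) : Prop :=
  (forall x, O x -> differentiable phi x) /\
  (forall v, {within O, continuous (fun x => 'D_v phi x)}).

Section Sobolev.
Context {R : realType}.

(** Lebesgue integral over [R^n], written as an iterated integral; it is only
    applied to bounded Borel functions with compact support, for which the two
    agree by Fubini's theorem. *)
Fixpoint integral_Rn (n : nat) : ('rV[R]_n -> R) -> R :=
  match n with
  | 0 => fun f => f 0
  | n'.+1 => fun f => Rintegral (@lebesgue_measure R) setT
      (fun x : R => integral_Rn (fun y : 'rV[R]_n' =>
        f (row_mx (x%:M : 'M[R]_1) y)))
  end.

Context {N : nat}.
Implicit Types (U : set 'rV[R]_N) (f g : 'rV[R]_N -> R).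

(** [C^1] functions with compact support in [U]. *)
Definition test_function U (phi : 'rV[R]_N -> R) : Prop :=
  C1_on setT phi /\
  exists K, [/\ compact K, K `<=` U & forall x, ~ K x -> phi x = 0].

(** [g] is the weak [i]-th partial derivative of [f] in [U]. *)
Definition weak_partial U (i : 'I_N) f g : Prop :=
  forall phi, test_function U phi ->
    integral_Rn (fun x => f x * 'D_(delta_mx 0 i) phi x) =
    - integral_Rn (fun x => g x * phi x).

(** Every class in [L^oo(U)] has a Borel representative that is bounded
    everywhere on [U]. *)
Definition Linfty U f : Prop :=
  (forall O : set R, open O -> <<s @open 'rV[R]_N >> (U `&` f @^-1` O)) /\
  (exists M : R, forall x, U x -> `|f x| <= M).

(** [f] belongs to the Sobolev space [W^{k,oo}(U)]. *)
Fixpoint Wkinfty (k : nat) U f : Prop :=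
  Linfty U f /\
  match k with
  | 0 => True
  | k'.+1 => forall i, exists g, weak_partial U i f g /\ Wkinfty k' U g
  end.

End Sobolev.

Section Geometry.
Context {R : realType} {N : nat}.
Implicit Types (Omega H : set 'rV[R]_N) (z n v : 'rV[R]_N).

(** Positive in [Omega1], negative in [Omega2], zero on [H]. *)
Definition sdist Omega1 H (x : 'rV[R]_N) : R :=
  if x \in Omega1 then edist x H else - edist x H.

Definition H_Omega Omega1 Omega2 H : Prop :=
  [/\ open Omega1, open Omega2, Omega1 `&` Omega2 = set0 &
      [/\ setT = Omega1 `|` Omega2 `|` H,
          H = frontier Omega1, H = frontier Omega2 &
          exists U, [/\ open U, H `<=` U & Wkinfty 2 U (sdist Omega1 H)]]].

(** [v] belongs to the tangent space [T_z H]. *)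
Definition tangent H z v : Prop :=
  exists gamma : R -> 'rV[R]_N,
    [/\ gamma 0 = z, \forall s \near (0 : R), H (gamma s) &
        is_derive (0 : R) (1 : R) gamma v].

Definition outward_normal Omega z n : Prop :=
  [/\ enorm n = 1,
      forall v, tangent (frontier Omega) z v -> dotv v n = 0 &
      \forall s \near (0 : R)^'+,
        Omega (z - s *: n) /\ ~ closure Omega (z + s *: n)].

(** [phi] is of class [C^1] on [H * [0, T]], with tangential gradient [p] and
    time derivative [q]: intrinsic first-order expansion along [H * [0, T]],
    with continuous coefficients and [p] tangent to [H]. Values of [phi], [p],
    [q] off [H * [0, T]] are irrelevant. *)
Definition tangential_C1 H (T : R) (phi : 'rV[R]_N * R -> R)
    (p : 'rV[R]_N * R -> 'rV[R]_N) (q : 'rV[R]_N * R -> R) : Prop :=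
  let D := H `*` `[0, T] in
  [/\ {within D, continuous p}, {within D, continuous q},
      forall y, D y -> tangent H y.1 (p y) &
      forall y, D y -> forall e : R, 0 < e ->
        \forall y' \near within D (nbhs y),
          `|phi y' - phi y - dotv (p y) (y'.1 - y.1) - q y * (y'.2 - y.2)|
            <= e * `|y' - y|].

End Geometry.

Section Control.
Context {R : realType} {N : nat} {A : metricType R}.
Variables (Omega : set 'rV[R]_N) (T : R).
Variables (b : 'rV[R]_N -> R -> A -> 'rV[R]_N) (l : 'rV[R]_N -> R -> A -> R).

Definition space_time : set ('rV[R]_N * R) := closure Omega `*` `[0, T].

Definition modulus (m : R -> R) : Prop :=
  [/\ m 0 = 0, forall r s : R, 0 <= r -> r <= s -> m r <= m s &
      m r @[r --> 0^'+] --> 0].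

Definition cond_C1 (Mb Lb : R) : Prop :=
  [/\ compact [set: A],
      {within space_time `*` [set: A],
        continuous (fun y : 'rV[R]_N * R * A => b y.1.1 y.1.2 y.2)},
      forall z s a, space_time (z, s) -> enorm (b z s a) <= Mb &
      forall z s z' s' a, space_time (z, s) -> space_time (z', s') ->
        enorm (b z s a - b z' s' a) <= Lb * (enorm (z - z') + `|s - s'|)].

Definition cond_C2 (Ml : R) (ml : R -> R) : Prop :=
  [/\ unif_continuous ((fun y : 'rV[R]_N * R * A => l y.1.1 y.1.2 y.2) :
        subspace (space_time `*` [set: A]) -> R),
      forall z s a, space_time (z, s) -> `|l z s a| <= Ml,
      modulus ml &
      forall z s z' s' a, space_time (z, s) -> space_time (z', s') ->
        `|l z s a - l z' s' a| <= ml (enorm (z - z') + `|s - s'|)].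

Definition cond_C3 : Prop :=
  forall z s, space_time (z, s) ->
    closed (range (fun a => (b z s a, l z s a))) /\
    convex_set (range (fun a => (b z s a, l z s a)) :
      set (convex_lmodType ('rV[R]_N * R^o)%type)).

Definition cond_C4 (H : set 'rV[R]_N) (n : 'rV[R]_N -> 'rV[R]_N) (delta : R)
    : Prop :=
  forall z s, H z -> 0 <= s <= T ->
    `[- delta, delta] `<=` range (fun a => dotv (b z s a) (n z)).

Definition Ham (x : 'rV[R]_N) (t : R) (p : 'rV[R]_N) : R :=
  sup (range (fun a => - dotv (b x t a) p - l x t a)).

End Control.

Section Tangential_Hamiltonian.
Context {R : realType} {N : nat} {A1 A2 : metricType R}.
Variables (b1 : 'rV[R]_N -> R -> A1 -> 'rV[R]_N) (l1 : 'rV[R]_N -> R -> A1 -> R).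
Variables (b2 : 'rV[R]_N -> R -> A2 -> 'rV[R]_N) (l2 : 'rV[R]_N -> R -> A2 -> R).
Variable n1 : 'rV[R]_N -> 'rV[R]_N.

Definition b_H (z : 'rV[R]_N) (s : R) (a : A1 * A2 * R) : 'rV[R]_N :=
  a.2 *: b1 z s a.1.1 + (1 - a.2) *: b2 z s a.1.2.

Definition l_H (z : 'rV[R]_N) (s : R) (a : A1 * A2 * R) : R :=
  a.2 * l1 z s a.1.1 + (1 - a.2) * l2 z s a.1.2.

Definition A_0 (z : 'rV[R]_N) (s : R) : set (A1 * A2 * R) :=
  [set a | 0 <= a.2 <= 1 /\ dotv (b_H z s a) (n1 z) = 0].

Definition Ham_T (z : 'rV[R]_N) (s : R) (p : 'rV[R]_N) : R :=
  sup [set - dotv (b_H z s a) p - l_H z s a | a in A_0 z s].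

End Tangential_Hamiltonian.

Section Viscosity.
Context {R : realType} {N : nat}.
Implicit Types (w phi : 'rV[R]_N * R -> R) (D : set ('rV[R]_N * R)).
Implicit Types (F : 'rV[R]_N -> R -> 'rV[R]_N -> R).

Definition grad_x phi (y : 'rV[R]_N * R) : 'rV[R]_N :=
  \row_i 'D_((delta_mx 0 i : 'rV[R]_N), 0 : R) phi y.

Definition deriv_t phi (y : 'rV[R]_N * R) : R :=
  'D_((0 : 'rV[R]_N), 1 : R) phi y.

Definition usc_on D w : Prop :=
  forall y, D y -> forall e : R, 0 < e ->
    \forall y' \near within D (nbhs y), w y' < w y + e.

Definition lsc_on D w : Prop :=
  forall y, D y -> forall e : R, 0 < e ->
    \forall y' \near within D (nbhs y), w y - e < w y'.

(** [w_t + F(x, t, Dw) <= 0] on [D], for test functions in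
    [C^1(R^N * ]0, T[)]. *)
Definition visc_sub (T : R) D F w : Prop :=
  forall phi y, C1_on (setT `*` `]0, T[) phi -> D y ->
    (\forall y' \near y, w y' - phi y' <= w y - phi y) ->
    deriv_t phi y + F y.1 y.2 (grad_x phi y) <= 0.

Definition visc_super (T : R) D F w : Prop :=
  forall phi y, C1_on (setT `*` `]0, T[) phi -> D y ->
    (\forall y' \near y, w y - phi y <= w y' - phi y') ->
    0 <= deriv_t phi y + F y.1 y.2 (grad_x phi y).

(** [w_t + F(x, t, D_H w) <= 0] on [H * ]0, T[], tested along [H] only. *)
Definition visc_sub_tangential (H : set 'rV[R]_N) (T : R) F w : Prop :=
  forall phi p q y, tangential_C1 H T phi p q -> (H `*` `]0, T[) y ->
    (forall y', (H `*` `]0, T[) y' -> w y' - phi y' <= w y - phi y) ->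
    q y + F y.1 y.2 (p y) <= 0.

End Viscosity.

Section Solutions.
Context {R : realType} {N : nat} {A1 A2 : metricType R}.
Variables (T : R) (Omega1 Omega2 H : set 'rV[R]_N) (n1 : 'rV[R]_N -> 'rV[R]_N).
Variables (b1 : 'rV[R]_N -> R -> A1 -> 'rV[R]_N) (l1 : 'rV[R]_N -> R -> A1 -> R).
Variables (b2 : 'rV[R]_N -> R -> A2 -> 'rV[R]_N) (l2 : 'rV[R]_N -> R -> A2 -> R).

Let H1 := Ham b1 l1.
Let H2 := Ham b2 l2.

Definition Hminus_subsolution (u : 'rV[R]_N * R -> R) : Prop :=
  [/\ exists M : R, forall y, (setT `*` `[0, T[) y -> `|u y| <= M,
      usc_on (setT `*` `[0, T[) u &
      [/\ visc_sub T (Omega1 `*` `]0, T[) H1 u,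
          visc_sub T (Omega2 `*` `]0, T[) H2 u,
          visc_sub T (H `*` `]0, T[)
            (fun x t p => Num.min (H1 x t p) (H2 x t p)) u &
          visc_sub_tangential H T (Ham_T b1 l1 b2 l2 n1) u]].

Definition Hminus_supersolution (v : 'rV[R]_N * R -> R) : Prop :=
  [/\ exists M : R, forall y, (setT `*` `[0, T[) y -> `|v y| <= M,
      lsc_on (setT `*` `[0, T[) v &
      [/\ visc_super T (Omega1 `*` `]0, T[) H1 v,
          visc_super T (Omega2 `*` `]0, T[) H2 v &
          visc_super T (H `*` `]0, T[)
            (fun x t p => Num.max (H1 x t p) (H2 x t p)) v]].

End Solutions.

(* Main.v *)
(** If [u > v] somewhere, the maximum of [u - v - penalty] is attained at some [(xb, tb)] with
    [0 < tb < T], and the penalty makes the subsolution inequalities strict. Away from [H] this is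
    contradicted by doubling the variables.

    At [xb] in [H] the variables [(x, t)] and [(y, s)] are doubled under the constraint
    [d x = d y], where [d] is the signed distance, so that the maximum point has [x0] and [y0] in the
    same [Omega_i] or both in [H]. In the first case a further penalization of [d x - d y] gives
    equal slopes up to a multiple of the gradient of [d], which is bounded thanks to (C4). In the
    second case the tangential inequality, (C3) and (C4) give one number [r*] such that the
    strict subsolution inequality holds on both sides of [H] for the slope [P + r* Dd], where [P] is
    the doubling slope. Transporting [w] along controls that leave [H] and comparing with [v] on the
    same level set of [d], then using a barrier in [d], shows that [v] lies above a test function of
    gradient [P + r* Dd], from both sides, which contradicts the supersolution inequality on [H].

    [W^{2,oo}] regularity of [d] is used only as a second-order expansion with Lipschitz gradient.
    It is obtained by testing the weak derivatives with products of B-splines, which bounds all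
    the mixed second differences of [d]. *)

(* The Hamiltonian jumps across [H], so unconstrained doubling could leave [x] and [y] on opposite
   sides, where no common control compares the two inequalities. The constraint [d x = d y] forbids
   this at the price of a multiplier along [Dd], which normal coercivity bounds by the doubling
   slope. When both points lie on [H], the constraint lets [w] be tested only along [H] and gives no
   test function for [v], which satisfies no tangential inequality: its normal slope has to be
   built. The strict inequalities at slope [P + r Dd] are linear in [r]: lower bounds from controls
   with [b . Dd > 0], upper bounds from those with [b . Dd < 0]. They are compatible because a
   control of each kind can be mixed into a tangential one, for which the tangential inequality
   holds. All errors are measured by [|x - y| (1 + n |x - y|)], which tends to 0 while the slopes
   may not stay bounded. *)
Require Import Defs.
From HB Require Import structures.
From mathcomp Require Import all_boot all_order all_algebra.
From mathcomp Require Import all_classical all_reals all_analysis.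
From mathcomp Require Import ring lra.
Import Order.TTheory GRing.Theory Num.Theory.
Import numFieldNormedType.Exports.
Local Open Scope classical_set_scope.
Local Open Scope ring_scope.

Set Implicit Arguments.
Unset Strict Implicit.
Unset Printing Implicit Defensive.

(** * Euclidean norm, compactness and semicontinuity *)

Section Euclid.
Context {R : realType} {N : nat}.
Implicit Types (u v w x y z : 'rV[R]_N) (c : R).

Lemma dotvC u v : dotv u v = dotv v u.
Proof. by rewrite /dotv; apply: eq_bigr => i _; rewrite mulrC. Qed.
Lemma dotvDl u v w : dotv (u + v) w = dotv u w + dotv v w.
Proof. by rewrite /dotv -big_split; apply: eq_bigr => i _; rewrite mxE mulrDl. Qed.
Lemma dotvZl c u w : dotv (c *: u) w = c * dotv u w.
Proof. by rewrite /dotv mulr_sumr; apply: eq_bigr => i _; rewrite mxE mulrA. Qed.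
Lemma dotvNl u w : dotv (- u) w = - dotv u w.
Proof. by rewrite -scaleN1r dotvZl mulN1r. Qed.
Lemma dotvBl u v w : dotv (u - v) w = dotv u w - dotv v w.
Proof. by rewrite dotvDl dotvNl. Qed.
Lemma dotv0l w : dotv 0 w = 0.
Proof. by rewrite -(scale0r w) dotvZl mul0r. Qed.
Lemma dotvDr u v w : dotv w (u + v) = dotv w u + dotv w v.
Proof. by rewrite dotvC dotvDl !(dotvC w). Qed.
Lemma dotvZr c u w : dotv w (c *: u) = c * dotv w u.
Proof. by rewrite dotvC dotvZl dotvC. Qed.
Lemma dotvNr u w : dotv w (- u) = - dotv w u.
Proof. by rewrite dotvC dotvNl dotvC. Qed.
Lemma dotvBr u v w : dotv w (u - v) = dotv w u - dotv w v.
Proof. by rewrite dotvDr dotvNr. Qed.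
Lemma dotv0r w : dotv w 0 = 0.
Proof. by rewrite dotvC dotv0l. Qed.
Definition dotvE := (dotvDl, dotvDr, dotvNl, dotvNr, dotvZl, dotvZr, dotv0l, dotv0r).

Lemma dotv_ge0 u : 0 <= dotv u u.
Proof. by apply: sumr_ge0 => i _; rewrite -expr2 sqr_ge0. Qed.
Lemma enorm_ge0 u : 0 <= enorm u. Proof. exact: sqrtr_ge0. Qed.
Lemma enorm2 u : enorm u ^+ 2 = dotv u u.
Proof. by rewrite sqr_sqrtr ?dotv_ge0. Qed.
Lemma enorm0 : enorm (0 : 'rV[R]_N) = 0.
Proof. by rewrite /enorm dotv0l sqrtr0. Qed.
Lemma enormN u : enorm (- u) = enorm u.
Proof. by rewrite /enorm dotvNl dotvNr opprK. Qed.
Lemma enormB u v : enorm (u - v) = enorm (v - u).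
Proof. by rewrite -enormN opprB. Qed.
Lemma enormZ c u : enorm (c *: u) = `|c| * enorm u.
Proof. by rewrite /enorm dotvZl dotvZr mulrA -expr2 sqrtrM ?sqr_ge0// sqrtr_sqr. Qed.

Lemma dotv_eq0 u : dotv u u = 0 -> u = 0.
Proof.
move=> /eqP; rewrite /dotv psumr_eq0; last by move=> i _; rewrite -expr2 sqr_ge0.
move=> /allP h; apply/rowP => i; rewrite mxE; apply/eqP.
by have := h i (mem_index_enum _); rewrite mulf_eq0 orbb.
Qed.

Lemma enorm_eq0 u : enorm u = 0 -> u = 0.
Proof. by move=> h; apply: dotv_eq0; rewrite -enorm2 h expr0n. Qed.

Lemma dotv_le u v : dotv u v <= enorm u * enorm v.
Proof.
have [->|u0] := eqVneq u 0; first by rewrite dotv0l enorm0 mul0r.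
have [->|v0] := eqVneq v 0; first by rewrite dotv0r enorm0 mulr0.
have pos z : z != 0 -> 0 < enorm z.
  move=> z0; rewrite lt_neqAle enorm_ge0 andbT eq_sym; apply: contra_neq z0.
  exact: enorm_eq0.
have /pos pu := u0; have /pos pv := v0.
have := dotv_ge0 (enorm v *: u - enorm u *: v).
rewrite !(dotvE, dotvBl, dotvBr) -!enorm2 (dotvC v u).
have := mulr_gt0 pu pv; nra.
Qed.

Lemma dotv_abs u v : `|dotv u v| <= enorm u * enorm v.
Proof.
by rewrite ler_norml dotv_le andbT lerNl -dotvNl -(enormN u) dotv_le.
Qed.

Lemma enormD u v : enorm (u + v) <= enorm u + enorm v.
Proof.
rewrite -(@ler_pXn2r _ 2)// ?nnegrE ?addr_ge0 ?enorm_ge0//.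
rewrite enorm2 sqrrD !dotvE (dotvC v u) -!enorm2.
have := dotv_le u v; lra.
Qed.

Lemma enorm_triangle x y z : enorm (x - z) <= enorm (x - y) + enorm (y - z).
Proof. by rewrite -[x - z](subrKA y); exact: enormD. Qed.

Lemma coord_enorm u i : `|u 0 i| <= enorm u.
Proof.
rewrite -(@ler_pXn2r _ 2)// ?nnegrE ?enorm_ge0// enorm2 real_normK ?num_real//.
rewrite /dotv (bigD1 i)//= -expr2 lerDl; apply: sumr_ge0 => j _.
by rewrite -expr2 sqr_ge0.
Qed.

Lemma norm_le_enorm u : `|u| <= enorm u.
Proof.
rewrite /Num.norm/= mx_normrE; apply/bigmax_leP; split; first exact: enorm_ge0.
by case=> i j _ /=; rewrite ord1 coord_enorm.
Qed.

Lemma coord_norm u i : `|u 0 i| <= `|u|.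
Proof.
rewrite [leRHS]/Num.norm/= mx_normrE.
exact: (le_bigmax _ (fun ij : 'I_1 * 'I_N => `|u ij.1 ij.2|) (0, i)).
Qed.

Lemma enorm_le_coord u (M : R) : 0 <= M -> (forall i, `|u 0 i| <= M) ->
  enorm u <= N%:R * M.
Proof.
move=> M0 h; rewrite -(@ler_pXn2r _ 2)// ?nnegrE ?enorm_ge0 ?mulr_ge0//.
rewrite enorm2 /dotv.
apply: (@le_trans _ _ (\sum_(i < N) M ^+ 2)).
  apply: ler_sum => i _; rewrite -expr2 -real_normK ?num_real//.
  by rewrite ler_pXn2r ?nnegrE.
rewrite sumr_const card_ord -[_ *+ N]mulr_natl exprMn ler_wpM2r ?sqr_ge0//.
rewrite -natrX ler_nat; case: (N) => // n; exact: leq_pmull.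
Qed.

Lemma enorm_le_norm u : enorm u <= N%:R * `|u|.
Proof. by apply: enorm_le_coord => // i; exact: coord_norm. Qed.

Lemma enorm_sq_expand x y z :
  enorm (z - y) ^+ 2 = enorm (x - y) ^+ 2 + dotv (2 *: (x - y)) (z - x) + enorm (z - x) ^+ 2.
Proof.
have -> : z - y = (x - y) + (z - x) by rewrite [RHS]addrC addrA subrK.
move: (x - y) (z - x) => a b.
rewrite !enorm2 !(dotvDl, dotvDr, dotvZl) (dotvC b a); ring.
Qed.

End Euclid.

Section Topology.
Context {R : realType} {N : nat}.
Local Notation V := 'rV[R]_N.

Lemma nbhs_enorm (x : V) (P : V -> Prop) :
  (\forall x' \near x, P x') <->
  exists2 r : R, 0 < r & forall x', enorm (x' - x) < r -> P x'.
Proof.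
split.
  move=> /nbhs_ballP[r r0 h]; exists r => // x' hx'; apply: h.
  rewrite -ball_normE/= distrC; exact: le_lt_trans (norm_le_enorm _) hx'.
move=> [r r0 h]; apply/nbhs_ballP; exists (r / (N%:R + 1)) => /=.
  by rewrite divr_gt0// ltr_wpDl.
move=> x'; rewrite -ball_normE/= distrC => hx'; apply: h.
apply: le_lt_trans (enorm_le_norm _) _.
move: hx'; rewrite ltr_pdivlMr ?ltr_wpDl//; have := normr_ge0 (x' - x).
have : 0 <= N%:R :> R by []; nra.
Qed.

Lemma nbhs_enormT (x : V) (t : R) (P : V * R -> Prop) :
  (\forall y \near (x, t), P y) <->
  exists2 r : R, 0 < r &
    forall x' t', enorm (x' - x) < r -> `|t' - t| < r -> P (x', t').
Proof.
split.
  move=> [[A B] [/= /nbhs_enorm[r r0 hA] /nbhs_ballP[s s0 hB]] hP].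
  exists (Num.min r s); first by rewrite lt_min r0.
  move=> x' t'; rewrite !lt_min => /andP[xr _] /andP[_ ts].
  by apply: hP; split => /=; [exact: hA|apply: hB; rewrite -ball_normE/= distrC].
move=> [r r0 h]; exists ([set x' | enorm (x' - x) < r], [set t' | `|t' - t| < r]).
  split => /=; first by apply/nbhs_enorm; exists r.
  by apply/nbhs_ballP; exists r => //= t'; rewrite -ball_normE/= distrC.
by move=> [x' t'] [/= h1 h2]; exact: h.
Qed.

Lemma compact_cball (x : V) (r : R) : compact [set y | enorm (y - x) <= r].
Proof.
apply: (@subclosed_compact _ _ [set y : V | forall i, `[x 0 i - r, x 0 i + r]%classic (y 0 i)]).
- rewrite -[X in closed X]setCK; apply: open_closedC.
  rewrite openE => y /= /negP; rewrite -ltNge => hy.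
  apply/nbhs_enorm; exists (enorm (y - x) - r); first by rewrite subr_gt0.
  move=> z hz /=; apply/negP; rewrite -ltNge.
  have := enorm_triangle y z x; rewrite (enormB y z); lra.
- by apply: (@rV_compact R N (fun i => `[x 0 i - r, x 0 i + r]%classic)) => i; exact: segment_compact.
- move=> y /= hy i /=; have := coord_enorm (y - x) i; rewrite !mxE => h.
  have := le_trans h hy; rewrite ler_norml in_itv/= => /andP[? ?].
  by apply/andP; split; lra.
Qed.

Lemma compact_cballT (x : V) (t r : R) :
  compact [set y : V * R | enorm (y.1 - x) <= r /\ `|y.2 - t| <= r].
Proof.
rewrite (_ : [set _ | _] = [set y | enorm (y - x) <= r] `*` `[t - r, t + r]).
  by apply: compact_setX; [exact: compact_cball|exact: segment_compact].
apply/seteqP; split => -[y s] /=; rewrite in_itv/= ler_distl => -[? ?] //.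
Qed.

End Topology.

Section Penalization.
Context {R : realType} {X : topologicalType}.
Implicit Types (K : set X) (F G : X -> R).

Definition usc_in K F := forall x, K x -> forall e : R, 0 < e ->
  \forall y \near x, K y -> F y < F x + e.

(** Without a maximum every [x] lies below some [F y], and so do its neighbours; compactness,
    applied to the filter of superlevel sets, gives one [y0] with [F < F y0] on all of [K], absurd
    at [y0]. *)
Lemma usc_in_max K F : compact K -> K !=set0 -> usc_in K F ->
  exists2 x, K x & forall y, K y -> F y <= F x.
Proof.
move=> cK [k0 Kk0] uF; apply: contrapT => nomax.
have big x : K x -> exists2 y, K y & F x < F y.
  move=> Kx; apply: contrapT => h; apply: nomax; exists x => // y Ky.
  by rewrite leNgt; apply/negP => xy; apply: h; exists y.
pose B y0 := [set y | K y /\ F y0 <= F y].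
have FF : Filter (filter_from K B).
  apply: filter_from_filter; first by exists k0.
  move=> i j Ki Kj; have [ij|ji] := leP (F i) (F j).
    by exists j => // y [Ky jy]; split; split => //; exact: le_trans jy.
  by exists i => // y [Ky jy]; split; split => //; apply: le_trans jy; exact: ltW.
have := (compact_near_coveringP K).1 cK X (filter_from K B) (fun y0 x => K x -> F x < F y0) FF.
case.
  move=> x Kx; have [y Ky xy] := big x Kx.
  have e0 : 0 < F y - F x by rewrite subr_gt0.
  exists ([set z | K z -> F z < F x + (F y - F x)], B y) => /=.
    by split; [exact: uF|exists y].
  move=> [z i] [/= hz [Ki yi]] Kz; have := hz Kz; rewrite addrC subrK => h.
  exact: lt_le_trans h yi.
move=> i Ki h; have := h i (conj Ki (lexx _)) i Ki Ki.
by rewrite ltxx.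
Qed.

(* For [n] large the maximum of [F - n G] is close to the strict maximum [Z] of [F] on [G = 0], and
   [n G] is small there. *)
Lemma penalty_localizes K F G (Z : X) (O : set X) (e : R) : compact K ->
  usc_in K F -> usc_in K (\- G) -> (forall z, K z -> 0 <= G z) ->
  K Z -> G Z = 0 -> (forall z, K z -> G z = 0 -> z <> Z -> F z < F Z) ->
  nbhs Z O -> 0 < e ->
  exists n : nat, exists z, [/\ (0 < n)%N, K z, O z, n%:R * G z <= e &
    forall z', K z' -> F z' - n%:R * G z' <= F z - n%:R * G z].
Proof.
move=> cK uF uG G0 KZ GZ strict OZ e0.
(* Either [x] is close to [Z] with [F] not much above [F Z], or the penalized value falls below
   [F Z] once [n] is large. Compactness makes [n] uniform, and a maximizer is never in the second
   case since [Z] itself has the value [F Z]. *)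
pose P (n : nat) x := K x -> (O x /\ F x < F Z + e) \/ F x - n%:R * G x < F Z.
have := (compact_near_coveringP K).1 cK nat \oo P _.
case.
  move=> x Kx.
  have [xZ|xZ] := pselect (x = Z).
    subst x; exists ([set x | O x /\ (K x -> F x < F Z + e)], setT) => /=.
      by split; [apply: filterI => //; exact: uF|exact: filterT].
    by move=> [x n] [/= [Ox h] _] Kx'; left; split => //; exact: h.
  have [Gx|Gx] := eqVneq (G x) 0.
    have h := strict x Kx Gx xZ.
    exists ([set y | K y -> F y < F x + (F Z - F x)], setT) => /=.
      by split; [apply: uF => //; rewrite subr_gt0|exact: filterT].
    move=> [y n] [/= hy _] Ky; right; have := hy Ky; rewrite addrC subrK.
    by apply: le_lt_trans; rewrite gerBl mulr_ge0// G0.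
  have Gx0 : 0 < G x by rewrite lt_neqAle eq_sym Gx G0.
  pose n0 := Num.bound ((`|F x| + 1 + `|F Z|) / (G x / 2)).
  exists ([set y | (K y -> F y < F x + 1) /\ (K y -> - G y < - G x + G x / 2)],
          [set n | n0 <= n]%N) => /=.
    split; last by exists n0.
    by apply: filterI; [exact: uF|apply: uG => //; rewrite divr_gt0].
  move=> [y n] [/= [h1 h2] n0n] Ky; right; have {}h1 := h1 Ky; have {}h2 := h2 Ky.
  have Gx2 : 0 < G x / 2 by rewrite divr_gt0.
  have : (`|F x| + 1 + `|F Z|) / (G x / 2) < n%:R.
    apply: lt_le_trans (_ : n0%:R <= _); last by rewrite ler_nat.
    apply: archi_boundP; apply: divr_ge0; last exact: ltW.
      by rewrite addr_ge0// addr_ge0.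
  rewrite ltr_pdivrMr// => h3.
  have h4 : n%:R * (G x / 2) <= n%:R * G y.
    by rewrite ler_wpM2l//; lra.
  have := ler_norm (F x); have := ler_norm (- F Z); rewrite normrN; lra.
move=> n0 _ hn; pose n := n0.+1.
have uFG : usc_in K (fun x => F x - n%:R * G x).
  move=> x Kx e' e'0.
  have e1 : 0 < e' / 2 by rewrite divr_gt0.
  have e2 : 0 < e' / 2 / n%:R by rewrite divr_gt0// ltr0n.
  have h1 := uF x Kx _ e1; have h2 := uG x Kx _ e2.
  apply: filterS2 h1 h2 => y h1 h2 Ky; have {}h1 := h1 Ky; have {}h2 := h2 Ky.
  have : - (n%:R * G y) < - (n%:R * G x) + e' / 2.
    rewrite -mulrN -ltr_pdivlMl ?ltr0n// mulrDr mulrN mulrA mulVf ?pnatr_eq0//.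
    by rewrite mul1r mulrC.
  by lra.
have [z Kz zmax] := usc_in_max cK (ex_intro _ Z KZ) uFG.
have hZ := zmax Z KZ; rewrite GZ mulr0 subr0 in hZ.
have [|[Oz Fz]|] := hn n _ z Kz Kz.
- exact: leqnSn.
- by exists n, z; split => //; lra.
- by rewrite ltNge hZ.
Qed.

End Penalization.

(** * Second-order jets *)

Section UscTools.
Context {R : realType} {N : nat}.
Local Notation V := 'rV[R]_N.
Local Notation X := ((V * R) * (V * R))%type.

Lemma usc_inD (Y : topologicalType) (K : set Y) (F G : Y -> R) :
  usc_in K F -> usc_in K G -> usc_in K (F \+ G).
Proof.
move=> hF hG x Kx e e0; have e2 : 0 < e / 2 by rewrite divr_gt0.
apply: filterS2 (hF x Kx _ e2) (hG x Kx _ e2) => y h1 h2 Ky /=.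
have := h1 Ky; have := h2 Ky; lra.
Qed.

Lemma cont_usc_in (Y : topologicalType) (K : set Y) (F : Y -> R) :
  continuous F -> usc_in K F.
Proof.
move=> cF x Kx e e0.
have /cvgrPdist_lt/(_ e e0) := cF x; apply: filterS => y + _.
by rewrite ltr_distlC => /andP[? ?]; lra.
Qed.

Lemma continuous_enorm : continuous (@enorm R N).
Proof.
move=> x; apply/(@cvgrPdist_lt _ _ _ _ (nbhs_filter x)) => e e0; apply/nbhs_enorm; exists e => // y hy.
apply: le_lt_trans hy; rewrite ler_norml.
have := enormD (x - y) y; have := enormD (y - x) x; rewrite !subrK (enormB y x); lra.
Qed.

Lemma continuous_lip (d : V -> R) : (forall x y, `|d x - d y| <= enorm (x - y)) ->
  continuous d.
Proof.
move=> dl x; apply/(@cvgrPdist_lt _ _ _ _ (nbhs_filter x)) => e e0; apply/nbhs_enorm; exists e => // y hy.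
by apply: le_lt_trans (dl _ _) _; rewrite enormB.
Qed.

Lemma continuous_sqd (Y : topologicalType) (f g : Y -> V) :
  continuous f -> continuous g -> continuous (fun y => enorm (f y - g y) ^+ 2).
Proof.
move=> cf cg y; apply: cvgM; apply: continuous_comp.
1,3: by apply: cvgB; [exact: cf|exact: cg].
all: exact: continuous_enorm.
Qed.

Lemma continuous_sqr (Y : topologicalType) (f g : Y -> R) :
  continuous f -> continuous g -> continuous (fun y => (f y - g y) ^+ 2).
Proof. by move=> cf cg y; apply: cvgM; apply: cvgB; [exact: cf|exact: cg|exact: cf|exact: cg]. Qed.

End UscTools.

Section Jets.
Context {R : realType} {N : nat}.
Local Notation V := 'rV[R]_N.
Implicit Types (w v : V * R -> R) (D : set V).

(** The remainder is quadratic with an unspecified constant, so that a jet is realized by an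
    explicit polynomial test function. [D] is the whole space, or the interface when only tangential
    variations are allowed. *)
Definition sub_jet D w (x : V) (t : R) (p : V) (a : R) := exists C r : R, 0 < r /\
  forall x' t', D x' -> enorm (x' - x) < r -> `|t' - t| < r ->
    w (x', t') <= w (x, t) + dotv p (x' - x) + a * (t' - t)
      + C * (enorm (x' - x) ^+ 2 + (t' - t) ^+ 2).

Definition sup_jet v (x : V) (t : R) (p : V) (a : R) := exists C r : R, 0 < r /\
  forall x' t', enorm (x' - x) < r -> `|t' - t| < r ->
    v (x, t) + dotv p (x' - x) + a * (t' - t)
      - C * (enorm (x' - x) ^+ 2 + (t' - t) ^+ 2) <= v (x', t').

Definition near_pt (xb : V) (tb r : R) (x : V) (t : R) :=
  enorm (x - xb) < r /\ `|t - tb| < r.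

Definition locally_usc (P : V -> R -> Prop) w := forall x t, P x t -> forall e : R, 0 < e ->
  \forall y \near (x, t), w y < w (x, t) + e.

(** One side of the interface, with the Hamiltonian unfolded into one inequality per control. [eta]
    is the strictness won by the penalty; [e] accounts for a supremum that may not be attained.
    Coefficients are controlled on [cl], the equations hold on [dom]. An arbitrary index type lets
    [unit] stand for an empty control set. *)
Record side_hyp (I : Type) (b : V -> R -> I -> V) (l : V -> R -> I -> R)
  (dom cl : set V) w v (P : V -> R -> Prop) (eta Mb Ml L : R) : Prop := SideHyp {
  side_eta : 0 < eta;
  side_Mb : 0 <= Mb;
  side_Ml : 0 <= Ml;
  side_L : 0 <= L;
  side_cl : dom `<=` cl;
  side_b : forall x t i, P x t -> cl x -> enorm (b x t i) <= Mb;
  side_l : forall x t i, P x t -> cl x -> `|l x t i| <= Ml;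
  side_blip : forall x t x' t' i, P x t -> P x' t' -> cl x -> cl x' ->
    enorm (b x t i - b x' t' i) <= L * (enorm (x - x') + `|t - t'|);
  side_lcont : forall e : R, 0 < e -> exists2 r : R, 0 < r &
    forall x t x' t' i, P x t -> P x' t' -> cl x -> cl x' ->
    enorm (x - x') + `|t - t'| < r -> `|l x t i - l x' t' i| <= e;
  side_sub : forall x t p a, P x t -> dom x -> sub_jet setT w x t p a ->
    forall i, a - dotv (b x t i) p - l x t i <= - eta;
  side_super : forall x t p a, P x t -> dom x -> sup_jet v x t p a ->
    forall e : R, 0 < e -> exists i, - e <= a - dotv (b x t i) p - l x t i }.

(** [g] plays the gradient of [d]. The choice [d = 0], [g = 0] satisfies these conditions, so that
    unconstrained doubling is a special case of the constrained one. *)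
Record dist_hyp (d : V -> R) (g : V -> V) (Q : V -> Prop) (Cd : R) : Prop := DistHyp {
  dist_Cd : 0 <= Cd;
  dist_lip : forall x y, `|d x - d y| <= enorm (x - y);
  dist_exp : forall x y, Q x -> Q y ->
    `|d y - d x - dotv (g x) (y - x)| <= Cd * enorm (y - x) ^+ 2;
  dist_glip : forall x y, Q x -> Q y -> enorm (g x - g y) <= Cd * enorm (x - y);
  dist_g1 : forall x, Q x -> enorm (g x) <= 1 }.

(** Both inequalities are read for the same control and subtracted. The error on the drift is
    multiplied by the slope, hence the factor [1 + 2 n (...)] in [doubling_scale]. *)
Lemma compare_at (b b' p p' : V) (a a' l l' eta e Mb : R) :
  a - dotv b p - l <= - eta -> - e <= a' - dotv b' p' - l' ->
  enorm b' <= Mb ->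
  eta <= e + `|a - a'| + Mb * enorm (p - p') + enorm (b - b') * enorm p + `|l - l'|.
Proof.
move=> h1 h2 hb.
have h3 : dotv b p - dotv b' p' = dotv (b - b') p + dotv b' (p - p').
  by rewrite dotvBl dotvBr; ring.
have h4 := dotv_le (b - b') p.
have h5 := dotv_le b' (p - p').
have h6 : enorm b' * enorm (p - p') <= Mb * enorm (p - p').
  by rewrite ler_wpM2r// enorm_ge0.
have := ler_norm (- (a - a')); have := ler_norm (l - l').
rewrite normrN; lra.
Qed.

End Jets.

(** * Doubling away from the interface *)

Section Neighborhoods.
Context {R : realType} {N : nat}.
Local Notation V := 'rV[R]_N.

(* Distance of the doubled points times (1 + size of the doubling slopes): the error made by moving
   the data from one doubled point to the other. *)
Definition doubling_scale (n : R) (x : V) (t : R) (y : V) (s : R) :=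
  (enorm (x - y) + `|t - s|) * (1 + 2 * n * (enorm (x - y) + `|t - s|)).

(** Expands [(d x - d y)^2] when one point moves by a length [h]: the linear part is [2 D] times the
    differential of [d], and the remainder stays quadratic thanks to the second-order expansion of
    [d]. *)
Lemma sq_shift_le (D e gh h c : R) : `|e - gh| <= c * h ^+ 2 -> `|e| <= h ->
  (D + e) ^+ 2 <= D ^+ 2 + 2 * D * gh + (2 * `|D| * c + 1) * h ^+ 2.
Proof.
move=> h1 h2.
have h3 : e ^+ 2 <= h ^+ 2.
  by rewrite -(real_normK (num_real e)) ler_pXn2r ?nnegrE//; exact: le_trans h2.
have h4 : D * (e - gh) <= `|D| * (c * h ^+ 2).
  apply: le_trans (ler_norm _) _; rewrite normrM ler_wpM2l//.
have -> : (D + e) ^+ 2 = D ^+ 2 + 2 * D * gh + 2 * (D * (e - gh)) + e ^+ 2 by ring.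
rewrite (_ : (2 * `|D| * c + 1) * h ^+ 2 = 2 * (`|D| * (c * h ^+ 2)) + h ^+ 2); last by ring.
lra.
Qed.

Lemma doubling_scaleE (n : R) (x : V) (t : R) (y : V) (s : R) (A : R := enorm (x - y) + `|t - s|) (B : R := 2 * n * A) : 0 < n ->
  [/\ 0 <= A, 0 <= B, A * (1 + B) = doubling_scale n x t y s & A <= doubling_scale n x t y s] /\
  (n * 2 * enorm (x - y) <= B /\ n * 2 * `|t - s| <= B).
Proof.
move=> n0; have h1 := enorm_ge0 (x - y); have h2 := normr_ge0 (t - s).
have A0 : 0 <= A by rewrite addr_ge0.
have B0 : 0 <= B by rewrite !mulr_ge0// ltW.
split; [split => //; rewrite /doubling_scale -/A|split].
- by rewrite ler_peMr//; rewrite lerDl.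
- by rewrite /B (mulrC 2) ler_wpM2l ?mulr_ge0 ?(ltW n0)// /A lerDl.
- by rewrite /B (mulrC 2) ler_wpM2l ?mulr_ge0 ?(ltW n0)// /A lerDr.
Qed.

Lemma near_quad (A : V -> Prop) (B : R -> Prop) (A' : V -> Prop) (B' : R -> Prop) (x : V) (t : R) (y : V) (s : R) :
  (\forall x' \near x, A x') -> (\forall t' \near t, B t') ->
  (\forall y' \near y, A' y') -> (\forall s' \near s, B' s') ->
  \forall z \near ((x, t), (y, s)), [/\ A z.1.1, B z.1.2, A' z.2.1 & B' z.2.2].
Proof.
move=> hA hB hA' hB'.
exists ([set z | A z.1 /\ B z.2], [set z | A' z.1 /\ B' z.2]) => /=.
  by split; [exists (A, B)|exists (A', B')].
by move=> [[? ?] [? ?]] [/= [? ?] [? ?]].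
Qed.

Lemma near_eball (x : V) r : 0 < r -> \forall x' \near x, enorm (x' - x) < r.
Proof. by move=> r0'; apply/nbhs_enorm; exists r. Qed.

Lemma near_rball (x r : R) : 0 < r -> \forall x' \near x, `|x' - x| < r.
Proof.
move=> r0'; apply/nbhs_ballP; exists r => //= x'.
by rewrite -ball_normE/= distrC.
Qed.

Lemma near_ineball (x c : V) r : enorm (x - c) < r -> \forall x' \near x, enorm (x' - c) < r.
Proof.
move=> h; apply/nbhs_enorm; exists (r - enorm (x - c)); first by rewrite subr_gt0.
move=> x' hx'; have := enorm_triangle x' x c; lra.
Qed.

Lemma near_inrball (x c r : R) : `|x - c| < r -> \forall x' \near x, `|x' - c| < r.
Proof.
move=> h; apply: filterS (near_rball x (_ : 0 < r - `|x - c|)) => [x' hx'|].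
  have := ler_normD (x' - x) (x - c); rewrite addrA subrK; lra.
by rewrite subr_gt0.
Qed.

Lemma continuous_doubling_scale (n : R) : continuous (fun z : (V * R) * (V * R) => doubling_scale n z.1.1 z.1.2 z.2.1 z.2.2).
Proof.
have cA : continuous (fun z : (V * R) * (V * R) => enorm (z.1.1 - z.2.1) + `|z.1.2 - z.2.2|).
  move=> [[x t] [y s]]; apply/(@cvgrPdist_lt _ _ _ _ (nbhs_filter _)) => e e0.
  have e4 : 0 < e / 4 by rewrite divr_gt0.
  apply: filterS (near_quad (near_eball x e4) (near_rball t e4)
    (near_eball y e4) (near_rball s e4)) => -[[x' t'] [y' s']] /= [h1 h2 h3 h4].
  have k1 := enorm_triangle x x' y; have k2 := enorm_triangle x' y' y.
  have k3 := enorm_triangle x' x y'; have k4 := enorm_triangle x y y'.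
  rewrite (enormB y y') in k4; rewrite (enormB x x') in k1.
  have m1 := ler_normD (t - s) (t' - t - (s' - s)).
  have m2 := ler_normD (t' - s') (- (t' - t - (s' - s))).
  have m3 := ler_normB (t' - t) (s' - s).
  rewrite normrN (_ : t' - s' + _ = t - s) in m2; last by ring.
  rewrite (_ : t - s + _ = t' - s') in m1; last by ring.
  rewrite ltr_norml; apply/andP; split; lra.
move=> z; apply: cvgM; first exact: cA.
apply: cvgD; first exact: cvg_cst.
by apply: cvgM; [exact: cvg_cst|exact: cA].
Qed.

End Neighborhoods.

Definition doubled_ball (R : realType) (N : nat) (xb : 'rV[R]_N) (tb r1 : R) : set (('rV[R]_N * R) * ('rV[R]_N * R)) :=
  [set y : 'rV[R]_N * R | enorm (y.1 - xb) <= r1 /\ `|y.2 - tb| <= r1] `*`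
  [set y : 'rV[R]_N * R | enorm (y.1 - xb) <= r1 /\ `|y.2 - tb| <= r1].

Definition doubled (R : realType) (N : nat) (w v : 'rV[R]_N * R -> R) (n : R)
  (z : ('rV[R]_N * R) * ('rV[R]_N * R)) :=
  w z.1 - v z.2 - n * (enorm (z.1.1 - z.2.1) ^+ 2 + (z.1.2 - z.2.2) ^+ 2).

Lemma usc_doubled (R : realType) (N : nat) (w v : 'rV[R]_N * R -> R) (xb : 'rV[R]_N) (tb r0 n r1 : R)
  (P := near_pt xb tb r0) : locally_usc P w -> locally_usc P (\- v) ->
  r1 < r0 -> usc_in (doubled_ball xb tb r1) (doubled w v n).
Proof.
move=> wusc vlsc.
move=> r10.
have cfst : continuous (fun z : ('rV[R]_N * R) * ('rV[R]_N * R) => z.1) by move=> z; exact: cvg_fst.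
have csnd : continuous (fun z : ('rV[R]_N * R) * ('rV[R]_N * R) => z.2) by move=> z; exact: cvg_snd.
have c11 : continuous (fun z : ('rV[R]_N * R) * ('rV[R]_N * R) => z.1.1).
  by move=> z; apply: (continuous_comp (cfst z)); exact: cvg_fst.
have c12 : continuous (fun z : ('rV[R]_N * R) * ('rV[R]_N * R) => z.1.2).
  by move=> z; apply: (continuous_comp (cfst z)); exact: cvg_snd.
have c21 : continuous (fun z : ('rV[R]_N * R) * ('rV[R]_N * R) => z.2.1).
  by move=> z; apply: (continuous_comp (csnd z)); exact: cvg_fst.
have c22 : continuous (fun z : ('rV[R]_N * R) * ('rV[R]_N * R) => z.2.2).
  by move=> z; apply: (continuous_comp (csnd z)); exact: cvg_snd.
rewrite [doubled w v n](_ : _ = ((fun z => w z.1) \+ (fun z => - v z.2)) \+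
  (fun z => - (n * (enorm (z.1.1 - z.2.1) ^+ 2 + (z.1.2 - z.2.2) ^+ 2))))//.
refine (usc_inD (usc_inD _ _) _).
- move=> [[x t] [y s]] [/= [h1 h2] _] e e0.
  have h : P x t by split; [exact: le_lt_trans h1 r10|exact: le_lt_trans h2 r10].
  have h3 : \forall z \near ((x, t), (y, s)), w z.1 < w (x, t) + e.
    exact: (cfst ((x, t), (y, s)) _ (wusc _ _ h _ e0)).
  by apply: filterS h3 => z h3 _.
- move=> [[x t] [y s]] [/= _ [h1 h2]] e e0.
  have h : P y s by split; [exact: le_lt_trans h1 r10|exact: le_lt_trans h2 r10].
  have h3 : \forall z \near ((x, t), (y, s)), - v z.2 < - v (y, s) + e.
    exact: (csnd ((x, t), (y, s)) _ (vlsc _ _ h _ e0)).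
  by apply: filterS h3 => z h3 _.
- apply: cont_usc_in => z; apply: cvgN; apply: cvgM; first exact: cvg_cst.
  apply: cvgD; first exact: (continuous_sqd c11 c21).
  exact: (continuous_sqr c12 c22).
Qed.


(* With [d = 0] this is the usual doubling argument; otherwise the constraint [d x = d y] is removed
   by the additional penalization [m (d x - d y)^2]. *)
Lemma interior_absurd (R : realType) (N : nat) (I : Type) (b : 'rV[R]_N -> R -> I -> 'rV[R]_N)
  (l : 'rV[R]_N -> R -> I -> R) (dom cl : set 'rV[R]_N) (w v : 'rV[R]_N * R -> R)
  (xb : 'rV[R]_N) (tb r0 eta Mb Ml L : R) (d : 'rV[R]_N -> R) (g : 'rV[R]_N -> 'rV[R]_N)
  (Cd dl : R) (P := near_pt xb tb r0) :
  side_hyp b l dom cl w v P eta Mb Ml L ->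
  dist_hyp d g (fun x => enorm (x - xb) < r0) Cd ->
  open dom -> 0 < dl ->
  (forall x, d x = 0) \/ (forall x t, P x t -> dom x ->
    (exists i, dl <= dotv (b x t i) (g x)) /\ (exists i, dotv (b x t i) (g x) <= - dl)) ->
  locally_usc P w -> locally_usc P (\- v) ->
  exists2 k0 : R, 0 < k0 &
  forall (n r1 : R) (x0 : 'rV[R]_N) (t0 : R) (y0 : 'rV[R]_N) (s0 : R), 0 < n -> r1 < r0 ->
  near_pt xb tb r1 x0 t0 -> near_pt xb tb r1 y0 s0 -> dom x0 -> dom y0 ->
  d x0 = d y0 -> doubling_scale n x0 t0 y0 s0 < k0 ->
  ~ (forall z, doubled_ball xb tb r1 z -> d z.1.1 = d z.2.1 ->
      doubled w v n z <= doubled w v n ((x0, t0), (y0, s0))).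
Proof.
move=> S Dh odom dl0 coer wusc vlsc; have eta0 := side_eta S; have L0 := side_L S.
have Mb0 := side_Mb S; have Ml0 := side_Ml S.
have e8 : 0 < eta / 8 by rewrite divr_gt0.
have [rl rl0 hl] := side_lcont S e8.
pose C1 : R := (2 + 2 * Mb + Ml) / dl.
pose C2 : R := Mb * C1 * Cd + L * (2 + C1).
have Cd0 := dist_Cd Dh.
have C10 : 0 <= C1.
  have h : 0 <= 2 + 2 * Mb + Ml by lra.
  exact: divr_ge0 h (ltW dl0).
have C20 : 0 <= C2.
  have h : 0 <= 2 + C1 by lra.
  have h1 := mulr_ge0 L0 h.
  have := mulr_ge0 (mulr_ge0 Mb0 C10) Cd0; rewrite /C2; lra.
exists (Num.min rl (eta / (8 * (C2 + 1)))).
  by rewrite lt_min rl0 divr_gt0// mulr_gt0// ltr_wpDl.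
move=> n r1 x0 t0 y0 s0 n0 r10 [Px0 Pt0] [Py0 Ps0] dx0 dy0 dxy.
rewrite lt_min => /andP[kap1 kap2] Hmax.
(* Within [rho] of [Z] the localizing squares below change the slopes by at most [4 rho], in space
   and in time, and [4 rho (1 + Mb) <= eta / 8]. *)
pose rho := Num.min 1 (eta / (32 * (1 + Mb))).
have rhop : 0 < rho by rewrite lt_min ltr01 divr_gt0// mulr_gt0// ltr_wpDr.
have rho1 : rho <= 1 by rewrite ge_min lexx.
have rho2 : rho * (32 * (1 + Mb)) <= eta.
  by rewrite -ler_pdivlMr ?mulr_gt0 ?ltr_wpDr// ge_min lexx orbT.
pose Z := ((x0, t0), (y0, s0)).
pose K := doubled_ball xb tb r1.
have cK : compact K by apply: compact_setX; exact: compact_cballT.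
(* The four squares make [Z] the only maximum on the constraint set, as localization requires. *)
pose F z := doubled w v n z - (enorm (z.1.1 - x0) ^+ 2 + (z.1.2 - t0) ^+ 2 +
  enorm (z.2.1 - y0) ^+ 2 + (z.2.2 - s0) ^+ 2).
pose G (z : ('rV[R]_N * R) * ('rV[R]_N * R)) := (d z.1.1 - d z.2.1) ^+ 2.
pose O1 (z : ('rV[R]_N * R) * ('rV[R]_N * R)) := doubling_scale n z.1.1 z.1.2 z.2.1 z.2.2 < rl /\
   doubling_scale n z.1.1 z.1.2 z.2.1 z.2.2 < eta / (8 * (C2 + 1)).
pose O2 (z : ('rV[R]_N * R) * ('rV[R]_N * R)) := 
   [/\ enorm (z.1.1 - x0) < rho, `|z.1.2 - t0| < rho, enorm (z.2.1 - y0) < rho &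
       `|z.2.2 - s0| < rho].
pose O3 (z : ('rV[R]_N * R) * ('rV[R]_N * R)) := [/\ enorm (z.1.1 - xb) < r1 /\ dom z.1.1, `|z.1.2 - tb| < r1,
      enorm (z.2.1 - xb) < r1 /\ dom z.2.1 & `|z.2.2 - tb| < r1].
have OZ : nbhs Z (fun z => [/\ O1 z, O2 z & O3 z]).
  have nO1 : nbhs Z O1.
    have near_lt (c : R) : doubling_scale n x0 t0 y0 s0 < c ->
      \forall z \near Z, doubling_scale n z.1.1 z.1.2 z.2.1 z.2.2 < c.
      move=> hc; have /cvgrPdist_lt/(_ (c - doubling_scale n x0 t0 y0 s0)) := @continuous_doubling_scale R N n Z.
      rewrite subr_gt0 => /(_ hc); apply: filterS => z; rewrite /= ltr_norml; lra.
    by apply: filterI; exact: near_lt.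
  have nO2 : nbhs Z O2.
    exact: (near_quad (near_eball x0 rhop) (near_rball t0 rhop) (near_eball y0 rhop)
      (near_rball s0 rhop)).
  have nO3 : nbhs Z O3.
    have hdom x1 : enorm (x1 - xb) < r1 -> dom x1 ->
      \forall x' \near x1, enorm (x' - xb) < r1 /\ dom x'.
      by move=> h1 h2; apply: filterI; [exact: near_ineball|exact: open_nbhs_nbhs].
    exact: (near_quad (hdom _ Px0 dx0) (near_inrball Pt0) (hdom _ Py0 dy0)
      (near_inrball Ps0)).
  by apply: filterS3 nO1 nO2 nO3.
have [c11 [c12 [c21 c22]]] : continuous (fun z : ('rV[R]_N * R) * ('rV[R]_N * R) => z.1.1) /\
  continuous (fun z : ('rV[R]_N * R) * ('rV[R]_N * R) => z.1.2) /\
  continuous (fun z : ('rV[R]_N * R) * ('rV[R]_N * R) => z.2.1) /\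
  continuous (fun z : ('rV[R]_N * R) * ('rV[R]_N * R) => z.2.2).
  have cfst : continuous (fun z : ('rV[R]_N * R) * ('rV[R]_N * R) => z.1) by move=> z; exact: cvg_fst.
  have csnd : continuous (fun z : ('rV[R]_N * R) * ('rV[R]_N * R) => z.2) by move=> z; exact: cvg_snd.
  split; first by move=> z; apply: (continuous_comp (cfst z)); exact: cvg_fst.
  split; first by move=> z; apply: (continuous_comp (cfst z)); exact: cvg_snd.
  split; first by move=> z; apply: (continuous_comp (csnd z)); exact: cvg_fst.
  by move=> z; apply: (continuous_comp (csnd z)); exact: cvg_snd.
have cstV (c : 'rV[R]_N) : continuous (fun z : ('rV[R]_N * R) * ('rV[R]_N * R) => c).
  by move=> z; exact: cvg_cst.
have cstR (c : R) : continuous (fun z : ('rV[R]_N * R) * ('rV[R]_N * R) => c).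
  by move=> z; exact: cvg_cst.
have uF : usc_in K F.
  refine (usc_inD (usc_doubled n wusc vlsc r10) _); apply: cont_usc_in => z.
  apply: cvgN; apply: cvgD; last exact: (continuous_sqr c22 (cstR s0)).
  apply: cvgD; last exact: (continuous_sqd c21 (cstV y0)).
  apply: cvgD; last exact: (continuous_sqr c12 (cstR t0)).
  exact: (continuous_sqd c11 (cstV x0)).
have cd : continuous d by apply: continuous_lip; exact: dist_lip Dh.
have uG : usc_in K (\- G).
  apply: cont_usc_in => z; apply: cvgN.
  have c1 : continuous (fun z : ('rV[R]_N * R) * ('rV[R]_N * R) => d z.1.1).
    by move=> z'; apply: (continuous_comp (c11 z')); exact: cd.
  have c2 : continuous (fun z : ('rV[R]_N * R) * ('rV[R]_N * R) => d z.2.1).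
    by move=> z'; apply: (continuous_comp (c21 z')); exact: cd.
  exact: (continuous_sqr c1 c2).
have KZ : K Z by split => /=; split; exact: ltW.
have GZ : G Z = 0 by rewrite /G /= dxy subrr expr0n.
have FZ : F Z = doubled w v n Z.
  by rewrite /F /= !subrr enorm0 expr0n /= !addr0 subr0.
have strict z : K z -> G z = 0 -> z <> Z -> F z < F Z.
  move=> Kz /eqP; rewrite sqrf_eq0 subr_eq0 => /eqP dz zZ.
  have h := Hmax z Kz dz; rewrite FZ /F.
  rewrite ltNge; apply/negP => h2; apply: zZ.
  have h3 := sqr_ge0 (z.1.2 - t0); have h4 := sqr_ge0 (z.2.2 - s0).
  have h5 := sqr_ge0 (enorm (z.1.1 - x0)); have h6 := sqr_ge0 (enorm (z.2.1 - y0)).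
  rewrite /Z in h2.
  have /eqP : enorm (z.1.1 - x0) ^+ 2 = 0 by move: h h2 h3 h4 h5 h6; clear; lra.
  have /eqP : enorm (z.2.1 - y0) ^+ 2 = 0 by move: h h2 h3 h4 h5 h6; clear; lra.
  have /eqP : (z.1.2 - t0) ^+ 2 = 0 by move: h h2 h3 h4 h5 h6; clear; lra.
  have /eqP : (z.2.2 - s0) ^+ 2 = 0 by move: h h2 h3 h4 h5 h6; clear; lra.
  rewrite !sqrf_eq0 !subr_eq0 => /eqP e1 /eqP e2 /eqP/enorm_eq0/eqP.
  rewrite subr_eq0 => /eqP e3 /eqP/enorm_eq0/eqP; rewrite subr_eq0 => /eqP e4.
  by rewrite /Z -e1 -e2 -e3 -e4; case: z {Kz dz h h2 h3 h4 h5 h6 e1 e2 e3 e4} => [[] ? ? []].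
have G0 z : K z -> 0 <= G z by move=> _; exact: sqr_ge0.
have [m [[[x t] [y s]] [m0 Kz [[/= k1 k2] [/= a1 a2 a3 a4] [/= [b1 domx] b2 [b3 domy] b4]] _ zmax]]] :=
  penalty_localizes cK uF uG G0 KZ GZ strict OZ ltr01.
have Px : P x t by split; [exact: lt_trans b1 r10|exact: lt_trans b2 r10].
have Py : P y s by split; [exact: lt_trans b3 r10|exact: lt_trans b4 r10].
(* [q] is the multiplier of the constraint. Both slopes contain the same [q], so that their
   difference only sees [q (g x - g y)], although [m] is not controlled. *)
pose D := d x - d y; pose q := 2 * m%:R * D.
pose pw := 2 * n *: (x - y) + 2 *: (x - x0) + q *: g x.
pose aw := 2 * n * (t - s) + 2 * (t - t0).
pose pv := 2 * n *: (x - y) - 2 *: (y - y0) + q *: g y.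
pose av := 2 * n * (t - s) - 2 * (s - s0).
have hK : 0 <= m%:R * (2 * `|D| * Cd + 1).
  have hD := mulr_ge0 (normr_ge0 D) Cd0.
  have h1 : 0 <= 2 * `|D| * Cd + 1 by move: hD; clear; lra.
  exact: mulr_ge0 (ler0n R m) h1.
have jw : sub_jet setT w x t pw aw.
  exists (n + 1 + m%:R * (2 * `|D| * Cd + 1)).
  exists (Num.min (r1 - enorm (x - xb)) (r1 - `|t - tb|)).
  split; first by rewrite lt_min !subr_gt0 b1.
  move=> x' t' _; rewrite !lt_min => /andP[hx' _] /andP[_ ht'].
  have Kx : K ((x', t'), (y, s)).
    split => /=; split; try exact: ltW.
      have := enorm_triangle x' x xb; move: hx'; clear; lra.
    have := ler_normD (t' - t) (t - tb); rewrite addrA subrK; move: ht'; clear; lra.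
  have Qx' : enorm (x' - xb) < r0 by apply: le_lt_trans r10; case: Kx => -[].
  have := zmax _ Kx; rewrite /F /G /doubled /=.
  have hs := @sq_shift_le R D _ _ _ _ (dist_exp Dh (proj1 Px) Qx') (dist_lip Dh x' x).
  have {hs} := ler_wpM2l (ler0n R m) hs.
  rewrite (_ : D + (d x' - d x) = d x' - d y); last by rewrite /D; ring.
  rewrite (enorm_sq_expand x y x') (enorm_sq_expand x x0 x').
  rewrite /pw /aw /q !dotvDl !dotvZl -/D.
  move=> hs hmax.
  have hm0 : 0 <= m%:R * (2 * `|D| * Cd + 1) * (t' - t) ^+ 2.
    by apply: mulr_ge0; [exact: hK|exact: sqr_ge0].
  move: hs hmax hm0; clear; lra.
have jv : sup_jet v y s pv av.
  exists (n + 1 + m%:R * (2 * `|D| * Cd + 1)).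
  exists (Num.min (r1 - enorm (y - xb)) (r1 - `|s - tb|)).
  split; first by rewrite lt_min !subr_gt0 b3.
  move=> x' t'; rewrite !lt_min => /andP[hx' _] /andP[_ ht'].
  have Kx : K ((x, t), (x', t')).
    split => /=; split; try exact: ltW.
      have := enorm_triangle x' y xb; move: hx'; clear; lra.
    have := ler_normD (t' - s) (s - tb); rewrite addrA subrK; move: ht'; clear; lra.
  have Qx' : enorm (x' - xb) < r0 by apply: le_lt_trans r10; case: Kx => _ [].
  have := zmax _ Kx; rewrite /F /G /doubled /=.
  have hs := @sq_shift_le R (- D) _ _ _ _ (dist_exp Dh (proj1 Py) Qx') (dist_lip Dh x' y).
  have {hs} := ler_wpM2l (ler0n R m) hs.
  rewrite normrN sqrrN (_ : - D + (d x' - d y) = - (d x - d x')); last by rewrite /D; ring.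
  rewrite sqrrN (enormB x x') (enormB x y).
  rewrite (enorm_sq_expand y x x') (enorm_sq_expand y y0 x').
  rewrite /pv /av /q !dotvDl !dotvNl !dotvZl -/D !dotvBl.
  move=> hs hmax.
  have hm0 : 0 <= m%:R * (2 * `|D| * Cd + 1) * (t' - s) ^+ 2.
    by apply: mulr_ge0; [exact: hK|exact: sqr_ge0].
  move: hs hmax hm0; clear; lra.
have hw := side_sub S Px domx jw.
have [i hv] := side_super S Py domy jv e8.
have [[A0 B0 AB AK] [B1 B2]] := doubling_scaleE x t y s n0.
set A := enorm (x - y) + `|t - s| in A0 B0 AB AK B1 B2.
set B := 2 * n * A in B0 AB B1 B2.
have hB1 : 2 * n * enorm (x - y) <= B by move: B1; clear; lra.
have normp0 : enorm (2 * n *: (x - y) + 2 *: (x - x0)) <= B + 2 * rho.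
  have := enormD (2 * n *: (x - y)) (2 *: (x - x0)).
  rewrite !enormZ !ger0_norm ?mulr_ge0 ?(ltW n0)//; move: hB1 a1; clear; lra.
have Qx := proj1 Px; have Qy := proj1 Py.
have normpw : enorm pw <= B + 2 * rho + `|q|.
  have := enormD (2 * n *: (x - y) + 2 *: (x - x0)) (q *: g x).
  have := ler_wpM2l (normr_ge0 q) (dist_g1 Dh Qx).
  rewrite -/pw enormZ mulr1; move: normp0; clear; lra.
have normaw : `|aw| <= B + 2 * rho.
  have := ler_normD (2 * n * (t - s)) (2 * (t - t0)); rewrite -/aw.
  rewrite !normrM (ger0_norm (ltW n0)) (ger0_norm (_ : 0 <= 2))//.
  move: a2 B2; clear; lra.
(* If [d] vanishes, so does [q]. Otherwise take a control whose normal component has the sign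
   opposite to [q]: the subsolution inequality then bounds [|q| dl]. *)
have normq : `|q| <= C1 * (1 + B).
  case: coer => [d0|/(_ _ _ Px domx)[[i1 ci1] [i2 ci2]]].
    have -> : q = 0 by rewrite /q /D !d0 subrr mulr0.
    by rewrite normr0 mulr_ge0// addr_ge0.
  rewrite /C1 mulrAC ler_pdivlMr//.
  have [i0 hi0] : exists i0, `|q| * dl <= - (q * dotv (b x t i0) (g x)).
    have [q0|q0] := leP 0 q.
      exists i2; rewrite (ger0_norm q0).
      have := ler_wpM2l q0 ci2; clear; lra.
    exists i1; rewrite (ltr0_norm q0).
    have := ler_wnM2l (ltW q0) ci1; clear; lra.
  have := hw i0; have := side_l S i0 Px (side_cl S domx).
  have hb := side_b S i0 Px (side_cl S domx).
  rewrite /pw dotvDr dotvZr.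
  have := dotv_abs (b x t i0) (2 * n *: (x - y) + 2 *: (x - x0)).
  have h5 := ler_pM (enorm_ge0 _) (enorm_ge0 _) hb normp0.
  have h6 : Mb * (B + 2 * rho) <= Mb * (B + 2) by rewrite ler_wpM2l//; move: rho1; clear; lra.
  have h7 : 0 <= Mb * B by exact: mulr_ge0.
  have h8 : 0 <= Ml * B by exact: mulr_ge0.
  move: h5 h6 h7 h8 normaw hi0 eta0 rho1 Mb0 Ml0 B0.
  clear; rewrite !ler_norml.
  move: (dotv (b x t i0) (2 * n *: (x - y) + _)) (dotv (b x t i0) (g x)) (enorm _ * enorm _).
  move=> e1 e2 e3 h5 h6 h7 h8 /andP[h9 h10] h11 h12 h13 h14 h15 h16 /andP[h17 h18] /andP[h19 h20] h21.
  lra.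
have err1 : `|aw - av| <= 4 * rho.
  have -> : aw - av = 2 * (t - t0) + 2 * (s - s0) by rewrite /aw /av; ring.
  have := ler_normD (2 * (t - t0)) (2 * (s - s0)).
  rewrite !normrM (ger0_norm (_ : 0 <= 2))//; move: a2 a4; clear; lra.
have err2 : enorm (pw - pv) <= 4 * rho + `|q| * Cd * enorm (x - y).
  have -> : pw - pv = 2 *: (x - x0) + 2 *: (y - y0) + q *: (g x - g y).
    by apply/rowP => j; rewrite /pw /pv !mxE; ring.
  have := enormD (2 *: (x - x0) + 2 *: (y - y0)) (q *: (g x - g y)).
  have := enormD (2 *: (x - x0)) (2 *: (y - y0)).
  have := ler_wpM2l (normr_ge0 q) (dist_glip Dh Qx Qy).
  rewrite !enormZ (ger0_norm (_ : 0 <= 2))// mulrA; move: a1 a3; clear; lra.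
have err3 := side_blip S i Px Py (side_cl S domx) (side_cl S domy).
have err4 := hl x t y s i Px Py (side_cl S domx) (side_cl S domy) (le_lt_trans AK k1).
have := compare_at (hw i) hv (side_b S i Py (side_cl S domy)).
have k3 : doubling_scale n x t y s * (C2 + 1) < eta / 8.
  have C3 : 0 < 8 * (C2 + 1) by move: C20; clear; lra.
  move: k2; rewrite ltr_pdivlMr//; clear; lra.
have hA1 : enorm (x - y) <= A by rewrite /A lerDl.
have E2 : Mb * enorm (pw - pv) <= Mb * (4 * rho) + Mb * C1 * Cd * (A * (1 + B)).
  have h1 := ler_pM (normr_ge0 q) (enorm_ge0 (x - y)) normq hA1.
  have := ler_wpM2l Mb0 (ler_wpM2l Cd0 h1); have := ler_wpM2l Mb0 err2.
  clear; lra.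
have E3 : enorm (b x t i - b y s i) * enorm pw <= L * (2 + C1) * (A * (1 + B)).
  have h1 : enorm pw <= (2 + C1) * (1 + B).
    have h2 := mulr_ge0 C10 B0.
    move: normpw normq rho1 B0 h2; clear; lra.
  have := ler_pM (enorm_ge0 _) (enorm_ge0 _) err3 h1; rewrite -/A; clear; lra.
have E4 : (Mb * C1 * Cd + L * (2 + C1)) * (A * (1 + B)) <= eta / 8.
  have K0 : 0 <= doubling_scale n x t y s by exact: le_trans AK.
  rewrite AB -/C2; move: k3 K0; clear; lra.
have E5 : 4 * rho + Mb * (4 * rho) <= eta / 8.
  move: rho2; clear; lra.
move: E2 E3 E4 E5 err1 err4 eta0; clear; lra.
Qed.

(** * Quadratic expansions *)

Section QuadraticExpansion.
Context {R : realType} {N : nat}.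
Local Notation V := 'rV[R]_N.

(** A two-sided expansion at a single point, which is all that a jet needs. It is stable under sums
    and compositions and holds for functions of [d] and for squared positive parts, which need not
    be of class [C^2]. *)
Definition qexp (f : V * R -> R) (x : V) (t : R) (p : V) (a : R) := exists C r : R,
  [/\ 0 <= C, 0 < r & forall x' t', enorm (x' - x) < r -> `|t' - t| < r ->
  `|f (x', t') - f (x, t) - dotv p (x' - x) - a * (t' - t)| <=
    C * (enorm (x' - x) ^+ 2 + (t' - t) ^+ 2)].

Lemma qexp_cst (c : R) x t : qexp (fun=> c) x t 0 0.
Proof.
exists 0, 1; split => // x' t' _ _.
by rewrite dotv0l mul0r !subr0 subrr mul0r normr0.
Qed.

Lemma qexp_time x t : qexp snd x t 0 1.
Proof.
exists 0, 1; split => // x' t' _ _.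
by rewrite dotv0l mul1r subr0 /= subrr mul0r normr0.
Qed.

Lemma qexp_tsq (s : R) x t : qexp (fun y => (y.2 - s) ^+ 2) x t 0 (2 * (t - s)).
Proof.
exists 1, 1; split => // x' t' _ _ /=.
rewrite dotv0l mul1r (_ : _ - _ - 0 - _ = (t' - t) ^+ 2); last by ring.
by rewrite ger0_norm ?sqr_ge0// lerDr sqr_ge0.
Qed.

Lemma qexpD f1 f2 x t p1 a1 p2 a2 : qexp f1 x t p1 a1 -> qexp f2 x t p2 a2 ->
  qexp (f1 \+ f2) x t (p1 + p2) (a1 + a2).
Proof.
move=> [C1 [r1 [C10 r10 h1]]] [C2 [r2 [C20 r20 h2]]].
exists (C1 + C2), (Num.min r1 r2); split; [exact: addr_ge0|by rewrite lt_min r10|].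
move=> x' t'; rewrite !lt_min => /andP[hx1 hx2] /andP[ht1 ht2].
have := h1 x' t' hx1 ht1; have := h2 x' t' hx2 ht2.
rewrite /= dotvDl; set A := enorm _ ^+ 2 + _; rewrite !mulrDl.
move: (C1 * A) (C2 * A) (dotv p1 _) (dotv p2 _) => k1 k2 d1 d2; clear.
rewrite !ler_norml => /andP[u1 u2] /andP[u3 u4]; apply/andP; lra.
Qed.

Lemma qexpZ c f x t p a : qexp f x t p a -> qexp (fun y => c * f y) x t (c *: p) (c * a).
Proof.
move=> [C [r [C0 r0 h]]]; exists (`|c| * C), r; split => //; first exact: mulr_ge0.
move=> x' t' hx ht; rewrite dotvZl -mulrA -!mulrBr normrM -mulrA.
by rewrite ler_wpM2l// h.
Qed.

Lemma qexp_eq f g x t p a q b : qexp f x t p a -> f =1 g -> p = q -> a = b -> qexp g x t q b.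
Proof.
move=> [C [r [C0 r0 h]]] fg <- <-; exists C, r; split => // x' t' hx ht.
by rewrite -!fg h.
Qed.

Lemma qexp_sq (y c : V) x t (E := x - y + t *: c) :
  qexp (fun z => enorm (z.1 - y + z.2 *: c) ^+ 2) x t (2 *: E) (2 * dotv E c).
Proof.
exists (2 + 2 * enorm c ^+ 2), 1; split => //.
  by rewrite addr_ge0// mulr_ge0// sqr_ge0.
move=> x' t' _ _ /=.
have -> : x' - y + t' *: c = E + (x' - x + (t' - t) *: c).
  by apply/rowP => j; rewrite /E !mxE; ring.
move: (x' - x) (t' - t) => h k; rewrite -/E; clearbody E.
rewrite !enorm2 !(dotvDl, dotvDr, dotvZl, dotvZr).
rewrite (dotvC h E) (dotvC c E) (dotvC c h).
have h1 := dotv_ge0 (h - k *: c).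
rewrite !(dotvBl, dotvBr, dotvZl, dotvZr) (dotvC c h) in h1.
have h2 := dotv_ge0 (h + k *: c).
rewrite !(dotvDl, dotvDr, dotvZl, dotvZr) (dotvC c h) in h2.
have h3 := dotv_ge0 h; have h4 := dotv_ge0 c; have h5 := sqr_ge0 k.
have h6 := mulr_ge0 h3 h4; have h7 := mulr_ge0 h4 h5.
move: (dotv E E) (dotv E h) (dotv E c) (dotv h h) (dotv h c) (dotv c c) h1 h2 h3 h4 h5 h6 h7.
clear => EE Eh Ec hh hc cc h1 h2 h3 h4 h5 h6 h7.
rewrite ler_norml; apply/andP; split; lra.
Qed.

Lemma qexp_dist (d : V -> R) (g : V -> V) (x0 : V) (r0 Cd : R) x t :
  dist_hyp d g (fun x => enorm (x - x0) < r0) Cd -> enorm (x - x0) < r0 ->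
  qexp (d \o fst) x t (g x) 0.
Proof.
move=> Dh Qx; exists Cd, (r0 - enorm (x - x0)); split; [exact: dist_Cd Dh|by rewrite subr_gt0|].
move=> x' t' hx' _ /=; rewrite mul0r subr0.
have Qx' : enorm (x' - x0) < r0.
  by have := enorm_triangle x' x x0; move: hx'; clear; lra.
apply: le_trans (dist_exp Dh Qx Qx') _.
by apply: ler_wpM2l; [exact: dist_Cd Dh|rewrite lerDl sqr_ge0].
Qed.

Lemma qexp_comp (chi : R -> R) (c K s0 : R) f x t p a : 0 < s0 -> 0 <= K ->
  (forall s, `|s - f (x, t)| < s0 -> `|chi s - chi (f (x, t)) - c * (s - f (x, t))| <= K * (s - f (x, t)) ^+ 2) ->
  qexp f x t p a -> qexp (chi \o f) x t (c *: p) (c * a).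
Proof.
move=> s00 K0 hchi [C [r [C0 r0 h]]].
pose B := enorm p + `|a| + 2 * C.
have B0 : 0 <= B.
  by have := enorm_ge0 p; have := normr_ge0 a; move: C0; rewrite /B; clear; lra.
pose r' := Num.min (Num.min r 1) (s0 / (2 * B + 1)).
have r'0 : 0 < r'.
  rewrite !lt_min r0 ltr01 /= divr_gt0//; move: B0; clear; lra.
exists (`|c| * C + 2 * K * B ^+ 2), r'; split => //.
  by rewrite addr_ge0// !mulr_ge0// sqr_ge0.
move=> x' t'; rewrite !lt_min => /andP[/andP[hx hx1] hxs] /andP[/andP[ht ht1] hts] /=.
have h1 := h x' t' hx ht.
move: (enorm_ge0 (x' - x)) (normr_ge0 (t' - t)) => n1 n2.
set h' := enorm (x' - x) in hx1 hxs h1 n1 *; set k := t' - t in ht1 hts h1 n2 *.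
have k2 : k ^+ 2 = `|k| ^+ 2 by rewrite real_normK ?num_real.
set df := f (x', t') - f (x, t) in h1 *.
have hdf : `|df| <= B * (h' + `|k|).
  have e1 : C * (h' ^+ 2 + k ^+ 2) <= C * (h' + `|k|).
    rewrite ler_wpM2l// k2 lerD// expr2 ler_piMl// ltW//.
  have e2 := ler_normD (df - dotv p (x' - x) - a * k) (dotv p (x' - x) + a * k).
  rewrite (_ : _ + (_ + _) = df) in e2; last by ring.
  have e3 := ler_normD (dotv p (x' - x)) (a * k).
  have e4 := dotv_abs p (x' - x).
  rewrite normrM -/h' in e3 e4.
  have e5 := mulr_ge0 (normr_ge0 a) n1; have e6 := mulr_ge0 (enorm_ge0 p) n2.
  have e7 := mulr_ge0 C0 n1; have e8 := mulr_ge0 C0 n2.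
  rewrite /B; move: e1 e2 e3 e4 e5 e6 e7 e8 h1; clear; lra.
have dfs : `|df| < s0.
  apply: le_lt_trans hdf _.
  have B1 : 0 < 2 * B + 1 by move: B0; clear; lra.
  move: hxs hts; rewrite !ltr_pdivlMr//.
  move: n1 n2 B0; clear; nra.
have h2 := hchi (f (x', t')) dfs; rewrite -/df in h2.
have h3 : df ^+ 2 <= 2 * B ^+ 2 * (h' ^+ 2 + k ^+ 2).
  have : `|df| ^+ 2 <= (B * (h' + `|k|)) ^+ 2.
    have hh := mulr_ge0 B0 (addr_ge0 n1 n2).
    by rewrite ler_pXn2r ?nnegrE.
  rewrite real_normK ?num_real// k2 exprMn => /le_trans; apply.
  rewrite (_ : 2 * B ^+ 2 * _ = B ^+ 2 * (2 * (h' ^+ 2 + `|k| ^+ 2))); last by ring.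
  rewrite ler_wpM2l ?sqr_ge0//; have := sqr_ge0 (h' - `|k|); clear; lra.
have h4 := ler_wpM2l K0 h3.
have h5 := ler_wpM2l (normr_ge0 c) h1; rewrite -normrM in h5.
rewrite dotvZl.
have := ler_normD (chi (f (x', t')) - chi (f (x, t)) - c * df) (c * (df - dotv p (x' - x) - a * k)).
rewrite (_ : _ + c * _ = chi (f (x', t')) - chi (f (x, t)) - c * dotv p (x' - x) - c * a * k); last by ring.
move: h2 h4 h5; clear; lra.
Qed.

Lemma qexp_cont f x t p a : qexp f x t p a -> {for (x, t), continuous f}.
Proof.
move=> [C [r [C0 r0 h]]]; apply/(@cvgrPdist_lt _ _ _ _ (nbhs_filter _)) => e e0.
pose B := enorm p + `|a| + 2 * C + 1.
have B0 : 0 < B.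
  by have := enorm_ge0 p; have := normr_ge0 a; move: C0; rewrite /B; clear; lra.
apply/nbhs_enormT; exists (Num.min (Num.min r 1) (e / B)).
  by rewrite !lt_min r0 ltr01 divr_gt0.
move=> x' t'; rewrite !lt_min => /andP[/andP[hx hx1] hxe] /andP[/andP[ht ht1] hte].
have h1 := h x' t' hx ht; rewrite distrC.
rewrite ltr_pdivlMr// in hxe; rewrite ltr_pdivlMr// in hte.
move: (enorm_ge0 (x' - x)) (normr_ge0 (t' - t)) => n1 n2.
set h' := enorm (x' - x) in hx1 hxe h1 n1 *; set k := t' - t in ht1 hte h1 n2 *.
set df := f (x', t') - f (x, t) in h1 *.
have k2 : k ^+ 2 = `|k| ^+ 2 by rewrite real_normK ?num_real.
have e1 : C * (h' ^+ 2 + k ^+ 2) <= C * (h' + `|k|).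
  by rewrite ler_wpM2l// k2 lerD// expr2 ler_piMl// ltW.
have e2 := ler_normD (df - dotv p (x' - x) - a * k) (dotv p (x' - x) + a * k).
rewrite (_ : _ + (_ + _) = df) in e2; last by ring.
have e3 := ler_normD (dotv p (x' - x)) (a * k).
have e4 := dotv_abs p (x' - x); rewrite normrM -/h' in e3 e4.
have pg := enorm_ge0 p; have ag := normr_ge0 a.
pose m := Num.max h' `|k|.
have [m1 m2] : h' <= m /\ `|k| <= m by split; rewrite /m le_max lexx ?orbT.
have hm : m * B < e by rewrite /m maxEle; case: ifP.
have m0 : 0 <= m := le_trans n1 m1.
have e5 := ler_wpM2l pg m1; have e6 := ler_wpM2l ag m2.
have e7 := ler_wpM2l C0 m1; have e8 := ler_wpM2l C0 m2.
rewrite /B in hm; move: e1 e2 e3 e4 e5 e6 e7 e8 h1 hm m0; clear; lra.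
Qed.

(** [(s_+)^2] has a second-order expansion with constant 1 at every point, 0 included; this is why
    the cone barrier uses squares of positive parts. *)
Lemma qexp_pos2 f x t p a : qexp f x t p a ->
  qexp (fun y => Num.max (f y) 0 ^+ 2) x t ((2 * Num.max (f (x, t)) 0) *: p)
    (2 * Num.max (f (x, t)) 0 * a).
Proof.
apply: (@qexp_comp (fun s => Num.max s 0 ^+ 2) _ 1 1) => // s _.
move: (f (x, t)) => u; rewrite mul1r ler_norml.
have q1 := sqr_ge0 s; have q2 := sqr_ge0 u; have q3 := sqr_ge0 (s - u).
have [h1|h1] := leP s 0; have [h2|h2] := leP u 0; rewrite ?expr0n /=.
- by move: q3; clear; lra.
- have := mulr_le0_ge0 h1 (ltW h2); move: q1 q2 q3; clear; lra.
- have := mulr_ge0_le0 (ltW h1) h2; move: q1 q2 q3; clear; lra.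
- by move: q3; clear; lra.
Qed.

Lemma max_sub_jet (D : set V) (w phi : V * R -> R) x t p a r : 0 < r -> qexp phi x t p a ->
  (forall x' t', D x' -> enorm (x' - x) < r -> `|t' - t| < r ->
    w (x', t') - phi (x', t') <= w (x, t) - phi (x, t)) ->
  sub_jet D w x t p a.
Proof.
move=> r0 [C [r' [C0 r'0 h]]] hm; exists C, (Num.min r r'); split; first by rewrite lt_min r0.
move=> x' t' Dx; rewrite !lt_min => /andP[hx1 hx2] /andP[ht1 ht2].
have := h x' t' hx2 ht2; have := hm x' t' Dx hx1 ht1; rewrite ler_norml.
clear=> h1 /andP[_ h2]; lra.
Qed.

Lemma min_sup_jet (v phi : V * R -> R) x t p a r : 0 < r -> qexp phi x t p a ->
  (forall x' t', enorm (x' - x) < r -> `|t' - t| < r ->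
    v (x, t) - phi (x, t) <= v (x', t') - phi (x', t')) ->
  sup_jet v x t p a.
Proof.
move=> r0 [C [r' [C0 r'0 h]]] hm; exists C, (Num.min r r'); split; first by rewrite lt_min r0.
move=> x' t'; rewrite !lt_min => /andP[hx1 hx2] /andP[ht1 ht2].
have := h x' t' hx2 ht2; have := hm x' t' hx1 ht1; rewrite ler_norml.
clear=> h1 /andP[h2 _]; lra.
Qed.

End QuadraticExpansion.

(** * Regularity at the interface *)

Section Interface.
Context {R : realType} {N : nat}.
Local Notation V := 'rV[R]_N.

(** [d] is positive on side 1. Coercivity is required with both signs on each closed side, near [xb]
    and not only on the interface. [if_ishii] is the inequality with the minimum of the two
    Hamiltonians, read as an alternative. *)
Record iface (I1 I2 : Type) (b1 : V -> R -> I1 -> V) (l1 : V -> R -> I1 -> R)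
    (b2 : V -> R -> I2 -> V) (l2 : V -> R -> I2 -> R) (dom1 dom2 cl1 cl2 : set V)
    (w v : V * R -> R) (xb : V) (tb r0 eta Mb Ml L : R) (d : V -> R) (g : V -> V)
    (Cd dl : R) : Prop := IFace {
  if_s1 : side_hyp b1 l1 dom1 cl1 w v (near_pt xb tb r0) eta Mb Ml L;
  if_s2 : side_hyp b2 l2 dom2 cl2 w v (near_pt xb tb r0) eta Mb Ml L;
  if_d : dist_hyp d g (fun x => enorm (x - xb) < r0) Cd;
  if_dl : 0 < dl;
  if_dom1 : forall x, enorm (x - xb) < r0 -> 0 < d x -> dom1 x;
  if_dom2 : forall x, enorm (x - xb) < r0 -> d x < 0 -> dom2 x;
  if_cl1 : forall x, enorm (x - xb) < r0 -> 0 <= d x -> cl1 x;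
  if_cl2 : forall x, enorm (x - xb) < r0 -> d x <= 0 -> cl2 x;
  if_coer1 : forall x t, near_pt xb tb r0 x t -> 0 <= d x ->
    (exists i, dl <= dotv (b1 x t i) (g x)) /\ (exists i, dotv (b1 x t i) (g x) <= - dl);
  if_coer2 : forall x t, near_pt xb tb r0 x t -> d x <= 0 ->
    (exists i, dl <= dotv (b2 x t i) (g x)) /\ (exists i, dotv (b2 x t i) (g x) <= - dl);
  if_ishii : forall x t p a, near_pt xb tb r0 x t -> d x = 0 -> sub_jet setT w x t p a ->
    (forall i, a - dotv (b1 x t i) p - l1 x t i <= - eta) \/
    (forall i, a - dotv (b2 x t i) p - l2 x t i <= - eta);
  if_usc : locally_usc (near_pt xb tb r0) w;
  if_lsc : locally_usc (near_pt xb tb r0) (\- v) }.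

Lemma dist_hypN (d : V -> R) (g : V -> V) Q Cd : dist_hyp d g Q Cd -> dist_hyp (\- d) (\- g) Q Cd.
Proof.
move=> [C0 dl de gl g1]; split => //.
- by move=> x y /=; rewrite -opprD normrN dl.
- by move=> x y Qx Qy /=; rewrite dotvNl -opprD -opprD normrN; exact: de.
- by move=> x y Qx Qy /=; rewrite -opprD enormN gl.
- by move=> x Qx /=; rewrite enormN g1.
Qed.

(** Thanks to this symmetry only the side [d > 0] has to be studied. *)
Lemma iface_swap (I1 I2 : Type) (b1 : V -> R -> I1 -> V) (l1 : V -> R -> I1 -> R)
    (b2 : V -> R -> I2 -> V) (l2 : V -> R -> I2 -> R) (dom1 dom2 cl1 cl2 : set V)
    (w v : V * R -> R) (xb : V) (tb r0 eta Mb Ml L : R) (d : V -> R) (g : V -> V) (Cd dl : R) :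
  iface b1 l1 b2 l2 dom1 dom2 cl1 cl2 w v xb tb r0 eta Mb Ml L d g Cd dl ->
  iface b2 l2 b1 l1 dom2 dom1 cl2 cl1 w v xb tb r0 eta Mb Ml L (\- d) (\- g) Cd dl.
Proof.
case=> s1 s2 hd hdl pos neg c1 c2 k1 k2 ish wu vl; split => //.
- exact: dist_hypN.
- by move=> x Qx; rewrite /= oppr_gt0; exact: neg.
- by move=> x Qx; rewrite /= oppr_lt0; exact: pos.
- by move=> x Qx; rewrite /= oppr_ge0; exact: c2.
- by move=> x Qx; rewrite /= oppr_le0; exact: c1.
- move=> x t Px; rewrite /= oppr_ge0 => dx; have [[i hi] [j hj]] := k2 x t Px dx.
  by split; [exists j|exists i]; rewrite dotvNr; [rewrite lerNr|rewrite lerN2].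
- move=> x t Px; rewrite /= oppr_le0 => dx; have [[i hi] [j hj]] := k1 x t Px dx.
  by split; [exists j|exists i]; rewrite dotvNr; [rewrite lerNr|rewrite lerN2].
- move=> x t p a Px /eqP; rewrite oppr_eq0 => /eqP dx jw.
  by have [h|h] := ish x t p a Px dx jw; [right|left].
Qed.

Lemma compact_le0 (Y : topologicalType) (K : set Y) (f : Y -> R) :
  compact K -> continuous f -> compact (K `&` [set y | f y <= 0]).
Proof.
move=> cK cf; apply: compact_closedI => //.
by apply: (closed_comp (f := f) (D := [set x | x <= 0])) => [y _|]; [exact: cf|exact: closed_le].
Qed.

Lemma near_pt_shrink (xb : V) (tb r0 : R) x t : near_pt xb tb r0 x t ->
  exists2 r, 0 < r & forall x' t', enorm (x' - x) <= r -> `|t' - t| <= r ->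
    near_pt xb tb r0 x' t'.
Proof.
move=> [h1 h2]; pose r : R := Num.min (r0 - enorm (x - xb)) (r0 - `|t - tb|).
have r'0 : 0 < r by rewrite lt_min !subr_gt0 h1.
have [r1 r2] : r <= r0 - enorm (x - xb) /\ r <= r0 - `|t - tb|.
  by split; rewrite ge_min lexx ?orbT.
exists (r / 2); first by rewrite divr_gt0.
move=> x' t' k1 k2; split.
  by have := enorm_triangle x' x xb; move: k1 r1 r'0; clear; lra.
have := ler_normD (t' - t) (t - tb); rewrite addrA subrK.
by move: k2 r2 r'0; clear; lra.
Qed.

End Interface.

(* Otherwise [A (|x - x0|^2 + |t - t0|^2) - K d] touches [w] from above near [(x0, t0)], for [A] and
   then [K] arbitrarily large, which the coercivity of the Hamiltonians excludes. *)
Lemma interface_regular (R : realType) (N : nat) (I1 I2 : Type)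
    (b1 : 'rV[R]_N -> R -> I1 -> 'rV[R]_N) (l1 : 'rV[R]_N -> R -> I1 -> R)
    (b2 : 'rV[R]_N -> R -> I2 -> 'rV[R]_N) (l2 : 'rV[R]_N -> R -> I2 -> R)
    (dom1 dom2 cl1 cl2 : set 'rV[R]_N) (w v : 'rV[R]_N * R -> R) (xb : 'rV[R]_N)
    (tb r0 eta Mb Ml L : R) (d : 'rV[R]_N -> R) (g : 'rV[R]_N -> 'rV[R]_N) (Cd dl : R)
    (x0 : 'rV[R]_N) (t0 e : R) :
  iface b1 l1 b2 l2 dom1 dom2 cl1 cl2 w v xb tb r0 eta Mb Ml L d g Cd dl ->
  near_pt xb tb r0 x0 t0 -> d x0 = 0 -> 0 < e ->
  exists x1 t1, [/\ enorm (x1 - x0) < e, `|t1 - t0| < e, 0 < d x1 & w (x0, t0) - e < w (x1, t1)].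
Proof.
move=> F P0 d0 e0; apply: contrapT => hno.
have far x t : enorm (x - x0) < e -> `|t - t0| < e -> 0 < d x -> w (x, t) <= w (x0, t0) - e.
  by move=> h1 h2 h3; rewrite leNgt; apply/negP => h4; apply: hno; exists x, t.
have [ra ra0 hra] := near_pt_shrink P0.
have [rb rb0 hrb] := (nbhs_enormT _ _ _).1 (if_usc F P0 ltr01).
pose r : R := Num.min ra (Num.min rb e) / 2.
have [r'0 [ra1 rb1 re1]] : 0 < r /\ [/\ r < ra, r < rb & r < e].
  have h : 0 < Num.min ra (Num.min rb e) by rewrite !lt_min ra0 rb0.
  have h1 : Num.min ra (Num.min rb e) <= ra by rewrite ge_min lexx.
  have h2 : Num.min ra (Num.min rb e) <= rb by rewrite !ge_min lexx orbT.
  have h3 : Num.min ra (Num.min rb e) <= e by rewrite !ge_min lexx !orbT.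
  by rewrite /r; move: h h1 h2 h3; clear; do !split; lra.
(* [A r^2 = 2] exceeds the increase allowed by [w < w (x0, t0) + 1], which keeps the maximum off the
   boundary of the ball. *)
pose A : R := 2 / r ^+ 2.
have A0 : 0 < A by rewrite divr_gt0// exprn_gt0.
have Mb0 := side_Mb (if_s1 F); have Ml0 := side_Ml (if_s1 F).
have dl0 := if_dl F; have eta0 := side_eta (if_s1 F).
have hdl := dist_lip (if_d F); have Cd0 := dist_Cd (if_d F).
(* [K dl] bounds all the terms of the subsolution inequality other than the one in [K]; a control
   with normal component at least [dl] then contradicts strictness. *)
pose K : R := (2 * A * r + Mb * (2 * A * r) + Ml) / dl.
have K0 : 0 <= K.
  have h1 := mulr_ge0 (ltW A0) (ltW r'0); have h2 := mulr_ge0 Mb0 h1.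
  have h3 : 0 <= 2 * A * r + Mb * (2 * A * r) + Ml by move: h1 h2 Ml0; clear; lra.
  exact: divr_ge0 h3 (ltW dl0).
have cd : continuous d by exact: continuous_lip.
pose phi (y : 'rV[R]_N * R) :=
  A * (enorm (y.1 - x0 + y.2 *: 0) ^+ 2 + (y.2 - t0) ^+ 2) + - K * (d \o fst) y.
have phiE x t : phi (x, t) = A * (enorm (x - x0) ^+ 2 + (t - t0) ^+ 2) - K * d x.
  by rewrite /phi /= scaler0 addr0 mulNr.
pose B := [set y : 'rV[R]_N * R | enorm (y.1 - x0) <= r /\ `|y.2 - t0| <= r] `&` [set y | (d \o fst) y <= 0].
have cB : compact B.
  apply: compact_le0; first exact: compact_cballT.
  by move=> y; apply: continuous_comp; [exact: cvg_fst|exact: cd].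
have B0 : B (x0, t0).
  by split; rewrite /= ?d0// !subrr enorm0 normr0; split; exact: ltW.
have uF : usc_in B (w \+ (fun y => - phi y)).
  refine (usc_inD _ _).
    move=> [x t] [[/= h1 h2] _] e' e'0.
    have Px : near_pt xb tb r0 x t.
      by apply: hra; [exact: le_trans h1 (ltW ra1)|exact: le_trans h2 (ltW ra1)].
    by apply: filterS (if_usc F Px e'0) => y + _.
  apply: cont_usc_in => y; apply: cvgN.
  rewrite (_ : phi = fun y => A * (enorm (y.1 - x0) ^+ 2 + (y.2 - t0) ^+ 2) - K * d y.1); last first.
    by apply/funext => -[x t]; exact: phiE.
  have cx0 : continuous (fun z : 'rV[R]_N * R => x0) by move=> z; exact: cvg_cst.
  have ct0 : continuous (fun z : 'rV[R]_N * R => t0) by move=> z; exact: cvg_cst.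
  have c1 : continuous (fun z : 'rV[R]_N * R => z.1) by move=> z; exact: cvg_fst.
  have c2 : continuous (fun z : 'rV[R]_N * R => z.2) by move=> z; exact: cvg_snd.
  apply: cvgB; apply: cvgM; try exact: cvg_cst.
    by apply: cvgD; [exact: (continuous_sqd c1 cx0)|exact: (continuous_sqr c2 ct0)].
  by apply: continuous_comp; [exact: cvg_fst|exact: cd].
have [[x t] [[/= Bx Bt] Bd] zmax] := usc_in_max cB (ex_intro _ _ B0) uF.
have hZ := zmax _ B0; rewrite /= !phiE d0 !subrr enorm0 expr0n /= addr0 mulr0 mulr0 subr0 subr0 in hZ.
have Kd : K * d x <= 0 by rewrite mulr_ge0_le0.
have r20 : 0 < r ^+ 2 by rewrite exprn_gt0.
have wlt : w (x, t) < w (x0, t0) + 1.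
  by apply: hrb; [exact: le_lt_trans Bx rb1|exact: le_lt_trans Bt rb1].
have hA : A * (enorm (x - x0) ^+ 2 + (t - t0) ^+ 2) < A * r ^+ 2.
  rewrite {2}/A divfK ?gt_eqF//; move: hZ Kd wlt; clear; lra.
rewrite ltr_pM2l// in hA.
have n1 := enorm_ge0 (x - x0); have n2 := normr_ge0 (t - t0).
have Sx : enorm (x - x0) < r.
  rewrite -(@ltr_pXn2r _ 2)// ?nnegrE ?(ltW r'0)//.
  by have := sqr_ge0 (t - t0); move: hA; clear; lra.
have St : `|t - t0| < r.
  rewrite -(@ltr_pXn2r _ 2)// ?nnegrE ?(ltW r'0)// real_normK ?num_real//.
  by have := sqr_ge0 (enorm (x - x0)); move: hA; clear; lra.
have Px : near_pt xb tb r0 x t.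
  by apply: hra; [exact: le_trans Bx (ltW ra1)|exact: le_trans Bt (ltW ra1)].
pose p := A *: (2 *: (x - x0) + 0) + - K *: g x.
pose a := A * (0 + 2 * (t - t0)) + - K * 0.
have jw : sub_jet setT w x t p a.
  pose s := Num.min (Num.min (r - enorm (x - x0)) (r - `|t - t0|)) (e / (K + 1)).
  have K1 : 0 < K + 1 by move: K0; clear; lra.
  have s0 : 0 < s by rewrite !lt_min !subr_gt0 Sx St divr_gt0.
  apply: (@max_sub_jet _ _ _ _ phi _ _ _ _ s) => //.
    apply: qexpD; apply: qexpZ; last exact: qexp_dist (if_d F) (proj1 Px).
    apply: qexpD; last exact: qexp_tsq.
    apply: (qexp_eq (@qexp_sq _ _ x0 0 x t)) => //; first by rewrite scaler0 addr0.
    by rewrite dotv0r mulr0.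
  move=> x' t' _; rewrite !lt_min => /andP[/andP[hx _] hxe] /andP[/andP[_ ht] _].
  have hx' : enorm (x' - x0) < r.
    by have := enorm_triangle x' x x0; move: hx; clear; lra.
  have ht' : `|t' - t0| < r.
    by have := ler_normD (t' - t) (t - t0); rewrite addrA subrK; move: ht; clear; lra.
  (* The maximum was taken over [d <= 0] only. On [d > 0] the function [w] is lower by [e], and in
     this radius the term [K d x' <= e] does not make up for it. *)
  have [dx'|dx'] := leP (d x') 0.
    have Bx' : B (x', t') by split => //; split => /=; exact: ltW.
    exact: (zmax _ Bx').
  have h1 := far x' t' (lt_trans hx' re1) (lt_trans ht' re1) dx'.
  have h2 := hdl x' x; rewrite ler_norml in h2; move/andP: h2 => [_ h2].
  have h3 : K * d x' <= e.
    have h4 : d x' <= e / (K + 1) by move: Bd h2 hxe; rewrite /=; clear; lra.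
    rewrite ler_pdivlMr// in h4; move: h4 dx' K0; clear; nra.
  have h5 : 0 <= A * (enorm (x' - x0) ^+ 2 + (t' - t0) ^+ 2).
    by rewrite mulr_ge0 ?(ltW A0)// addr_ge0// sqr_ge0.
  rewrite !phiE; move: h1 h3 h5 hZ; clear; lra.
have hp0 : enorm (2 * A *: (x - x0)) <= 2 * A * r.
  by rewrite enormZ ger0_norm ?ler_wpM2l// mulr_ge0// ltW.
have ha : `|a| <= 2 * A * r.
  have A2 : 0 <= 2 * A by rewrite mulr_ge0// ltW.
  have -> : a = 2 * A * (t - t0) by rewrite /a; ring.
  by rewrite normrM ger0_norm// ler_wpM2l.
have key (bb : 'rV[R]_N) (ll : R) : enorm bb <= Mb -> `|ll| <= Ml -> dl <= dotv bb (g x) ->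
    ~ (a - dotv bb p - ll <= - eta).
  move=> hb hl hg; rewrite /p addr0 scalerA (mulrC A) dotvDr (dotvZr (- K)) => h.
  have h1 := dotv_abs bb (2 * A *: (x - x0)).
  have h2 := ler_pM (enorm_ge0 _) (enorm_ge0 _) hb hp0.
  have h3 := ler_wpM2l K0 hg.
  have h4 : K * dl = 2 * A * r + Mb * (2 * A * r) + Ml by rewrite /K divfK ?gt_eqF.
  move: h h1 h2 h3 h4 ha hl eta0; clear; rewrite !ler_norml.
  move: (dotv bb (2 * A *: _)) (enorm bb * _) => q1 q2.
  move=> h /andP[h1 h1'] h2 h3 h4 /andP[h5 h6] /andP[h7 h8] h9; lra.
have d0x : d x <= 0 := Bd.
have cl2x := if_cl2 F (proj1 Px) d0x.
have [dx|dx] := eqVneq (d x) 0.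
  have d1x : 0 <= d x by rewrite dx.
  have cl1x := if_cl1 F (proj1 Px) d1x.
  have [h|h] := if_ishii F Px dx jw.
    have [[i hi] _] := if_coer1 F Px d1x.
    exact: key (side_b (if_s1 F) i Px cl1x) (side_l (if_s1 F) i Px cl1x) hi (h i).
  have [[i hi] _] := if_coer2 F Px d0x.
  exact: key (side_b (if_s2 F) i Px cl2x) (side_l (if_s2 F) i Px cl2x) hi (h i).
have dom2x : dom2 x by apply: (if_dom2 F (proj1 Px)); rewrite lt_neqAle dx.
have [[i hi] _] := if_coer2 F Px d0x.
exact: key (side_b (if_s2 F) i Px cl2x) (side_l (if_s2 F) i Px cl2x) hi
  (side_sub (if_s2 F) Px dom2x jw i).
Qed.

(** * Transport of the subsolution along controls *)

(* Dynamic programming without dynamics: the subsolution [w] decreases at most at rate [lam] along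
   the control [i]. The barrier [C ((|x - x1 - th b|^2 - k^2 (th + sg)^2)_+^2 + (th_-)^2) - lam th]
   prevents the maximum from leaving a thin cone around the ray of direction [b] before [d] reaches
   [rho]. *)
Lemma cone_transport (R : realType) (N : nat) (I1 I2 : Type)
    (b1 : 'rV[R]_N -> R -> I1 -> 'rV[R]_N) (l1 : 'rV[R]_N -> R -> I1 -> R)
    (b2 : 'rV[R]_N -> R -> I2 -> 'rV[R]_N) (l2 : 'rV[R]_N -> R -> I2 -> R)
    (dom1 dom2 cl1 cl2 : set 'rV[R]_N) (w v : 'rV[R]_N * R -> R) (xb : 'rV[R]_N)
    (tb r0 eta Mb Ml L : R) (d : 'rV[R]_N -> R) (g : 'rV[R]_N -> 'rV[R]_N) (Cd dl : R)
    (x0 : 'rV[R]_N) (t0 : R) (i : I1) (k k1 : R)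
    (bb := b1 x0 t0 i) (beta := dotv bb (g x0)) (lam := l1 x0 t0 i - eta + k1) :
  iface b1 l1 b2 l2 dom1 dom2 cl1 cl2 w v xb tb r0 eta Mb Ml L d g Cd dl ->
  near_pt xb tb r0 x0 t0 -> d x0 = 0 -> 0 < k -> 0 < k1 -> 8 * k <= beta ->
  exists2 rho0 : R, 0 < rho0 & forall rho e : R, 0 < rho -> rho < rho0 -> 0 < e ->
  exists x t th, [/\ d x = rho, enorm (x - x0 - th *: bb) <= 2 * k * `|th| + e,
    `|t - (t0 - th)| <= e, w (x0, t0) - lam * th - e <= w (x, t) &
    - e <= th <= 8 * rho / beta].
Proof.
move=> F P0 d0 k0 k10 kbeta.
have Mb0 := side_Mb (if_s1 F); have L0 := side_L (if_s1 F).
have hdl := dist_lip (if_d F); have Cd0 := dist_Cd (if_d F).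
have beta0 : 0 < beta by move: k0 kbeta; clear; lra.
have cl0 : cl1 x0 by apply: (if_cl1 F (proj1 P0)); rewrite d0.
have hbb : enorm bb <= Mb := side_b (if_s1 F) i P0 cl0.
have [ra ra0 hra] := near_pt_shrink P0.
have [rb rb0 hrb] := (nbhs_enormT _ _ _).1 (if_usc F P0 ltr01).
have k12 : 0 < k1 / 2 by rewrite divr_gt0.
have [rl rl0 hrl] := side_lcont (if_s1 F) k12.
(* In this radius the drift moves by at most [k / 2], the running cost by [k1 / 2], and the normal
   component of [bb] by [beta / 8]. *)
have [R1 R10 [Ra Rb Rl Rk Rd]] : exists2 R1 : R, 0 < R1 & [/\ R1 <= ra, R1 < rb,
    2 * R1 < rl, L * (2 * R1) <= k / 2 & Cd * Mb * R1 <= beta / 8].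
  pose m := Num.min (Num.min ra rb) (Num.min rl (Num.min (k / (L + 1)) (beta / (Cd * Mb + 1)))).
  have L1 : 0 < L + 1 by move: L0; clear; lra.
  have CM := mulr_ge0 Cd0 Mb0.
  have CM1 : 0 < Cd * Mb + 1 by move: CM; clear; lra.
  have m0 : 0 < m by rewrite !lt_min ra0 rb0 rl0 !divr_gt0.
  have h1 : m <= ra by rewrite !ge_min lexx.
  have h2 : m <= rb by rewrite !ge_min lexx !orbT.
  have h3 : m <= rl by rewrite !ge_min lexx !orbT.
  have h4 : m <= k / (L + 1) by rewrite !ge_min lexx !orbT.
  have h5 : m <= beta / (Cd * Mb + 1) by rewrite !ge_min lexx !orbT.
  rewrite ler_pdivlMr// in h4; rewrite ler_pdivlMr// in h5.
  exists (m / 8); first by rewrite divr_gt0.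
  by split; move: h1 h2 h3 h4 h5 m0 k0 beta0; clear; lra.
pose S := Mb + 4 * k + 1.
have S1 : 1 <= S by rewrite /S; move: Mb0 k0; clear; lra.
have S0 : 0 < S by move: S1; clear; lra.
exists (beta * R1 / (32 * S)).
  by rewrite divr_gt0 ?mulr_gt0.
move=> rho e rho0 rhole e0.
(* In the cone [d] is at least [beta / 4] times the elapsed time [th], so at [th = h] it would be at
   least [2 rho]: the level [rho] is reached before. *)
pose h := 8 * rho / beta.
have h0 : 0 < h by rewrite divr_gt0// mulr_gt0.
have hbeta : h * beta = 8 * rho by rewrite /h divfK ?gt_eqF.
have hS : h * S < R1 / 4.
  move: rhole; rewrite ltr_pdivlMr ?mulr_gt0// => rhole.
  rewrite -(ltr_pM2r beta0) mulrAC hbeta; move: rhole; clear; lra.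
have [e1 e10 [e1e e1R e1rho e11]] : exists2 e1 : R, 0 < e1 &
    [/\ 8 * e1 <= e, 8 * e1 <= R1, 8 * e1 <= rho & e1 <= 1].
  pose m := Num.min (Num.min e R1) (Num.min rho 1).
  have m0 : 0 < m by rewrite !lt_min e0 R10 rho0 ltr01.
  have h1 : m <= e by rewrite !ge_min lexx.
  have h2 : m <= R1 by rewrite !ge_min lexx !orbT.
  have h3 : m <= rho by rewrite !ge_min lexx !orbT.
  have h4 : m <= 1 by rewrite !ge_min lexx !orbT.
  exists (m / 8); first by rewrite divr_gt0.
  by split; move: h1 h2 h3 h4 m0; clear; lra.
(* The equation of the side holds only for [d > 0], so the cone starts from a nearby [x1] inside,
   where [w] is almost as large as at [(x0, t0)]. *)
have [x1 [t1 [hx1 ht1 dx1 w1]]] := interface_regular F P0 d0 e10.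
(* The vertex of the cone is set back to [th = - sg], with [sg] small compared with [d x1] so that
   the part [th < 0] stays in [d > 0]. *)
have [sg sg0 [sge sgd]] : exists2 sg : R, 0 < sg & sg * S <= e1 /\ sg * S < d x1.
  pose m := Num.min e1 (d x1 / 2).
  have m0 : 0 < m by rewrite lt_min e10 divr_gt0.
  have h1 : m <= e1 by rewrite ge_min lexx.
  have h2 : m <= d x1 / 2 by rewrite ge_min lexx orbT.
  exists (m / S); first by rewrite divr_gt0.
  by rewrite divfK ?gt_eqF//; split=> //; move: h2 dx1; clear; lra.
have sgS : sg <= e1.
  by have := ler_wpM2l (ltW sg0) S1; move: sge; clear; lra.
pose Y := x1 + t1 *: bb.
pose e2 (y : 'rV[R]_N * R) := enorm (y.1 - Y + y.2 *: bb) ^+ 2.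
pose ts (y : 'rV[R]_N * R) := (y.2 - (t1 + sg)) ^+ 2.
pose Q y := e2 y + - k ^+ 2 * ts y.
pose tp (y : 'rV[R]_N * R) := y.2 + - t1.
pose B0 := 2 + `|lam| * (h + 1).
have B00 : 0 < B0.
  have hh : 0 <= h + 1 by move: h0; clear; lra.
  by have := mulr_ge0 (normr_ge0 lam) hh; rewrite /B0; clear; lra.
pose q0 := (k * sg) ^+ 2.
have q00 : 0 < q0 by rewrite exprn_gt0// mulr_gt0.
(* The barrier must exceed [B0], the most that [w] can gain, on the lateral boundary, where
   [Q >= 3 q0 / 4], and at the bottom [th = - sg / 2], where [tp = sg / 2]. *)
pose C := 4 * (B0 + 1) / q0 ^+ 2 + 8 * (B0 + 1) / sg ^+ 2.
have [Cp [Cq Cs]] : 0 < C /\ 4 * (B0 + 1) <= C * q0 ^+ 2 /\ 8 * (B0 + 1) <= C * sg ^+ 2.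
  have p1 : 0 < q0 ^+ 2 by rewrite exprn_gt0.
  have p2 : 0 < sg ^+ 2 by rewrite exprn_gt0.
  have B1 : 0 < B0 + 1 by move: B00; clear; lra.
  have c1 : 0 < 4 * (B0 + 1) / q0 ^+ 2 by rewrite divr_gt0// mulr_gt0.
  have c2 : 0 < 8 * (B0 + 1) / sg ^+ 2 by rewrite divr_gt0// mulr_gt0.
  have d1 : 4 * (B0 + 1) / q0 ^+ 2 * q0 ^+ 2 = 4 * (B0 + 1) by rewrite divfK ?gt_eqF.
  have d2 : 8 * (B0 + 1) / sg ^+ 2 * sg ^+ 2 = 8 * (B0 + 1) by rewrite divfK ?gt_eqF.
  have f1 := mulr_ge0 (ltW c1) (ltW p2); have f2 := mulr_ge0 (ltW c2) (ltW p1).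
  rewrite /C; move: c1 c2 d1 d2 f1 f2.
  move: (4 * (B0 + 1) / _) (8 * (B0 + 1) / _) => u1 u2; clear => c1 c2 d1 d2 f1 f2.
  by split; [lra|split; lra].
pose phi y := C * (Num.max (Q y) 0 ^+ 2 + Num.max (tp y) 0 ^+ 2) + lam * tp y.
pose E (y : 'rV[R]_N * R) := y.1 - Y + y.2 *: bb.
have geo y (th := t1 - y.2) : enorm (E y) <= 2 * k * (th + sg) -> - sg / 2 <= th -> th <= h ->
  [/\ enorm (y.1 - x0) < R1, `|y.2 - t0| < R1, 0 < d y.1 & 0 <= th -> beta / 4 * th < d y.1].
  move=> hE th1 th2.
  have Eth : y.1 = x1 + th *: bb + E y.
    by rewrite /E /Y /th; apply/rowP => j; rewrite !mxE; ring.
  have thM : `|th| <= h + sg.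
    by rewrite ler_norml; move: th1 th2 sg0 h0; clear => *; apply/andP; split; lra.
  have nE : enorm (y.1 - x1) <= `|th| * Mb + 2 * k * (th + sg).
    have -> : y.1 - x1 = th *: bb + E y.
      by rewrite /E /Y /th; apply/rowP => j; rewrite !mxE; ring.
    apply: le_trans (enormD _ _) _; rewrite lerD// enormZ ler_wpM2l//.
  have thM' : `|th| <= h \/ (th < 0 /\ `|th| <= sg / 2).
    have [th0|th0] := leP 0 th; [left|right].
      by rewrite ger0_norm.
    by rewrite ltr0_norm//; split => //; move: th1; clear; lra.
  have nE' : enorm (y.1 - x1) <= h * S + sg * S.
    have h1 : `|th| * Mb <= (h + sg) * Mb by rewrite ler_wpM2r.
    have h2 : 2 * k * (th + sg) <= 2 * k * (h + sg).
      by rewrite ler_wpM2l ?lerD2r// mulr_ge0// ltW.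
    have h3 : 0 <= (h + sg) * (2 * k + 1).
      by apply: mulr_ge0; move: h0 sg0 k0; clear; lra.
    rewrite /S; move: nE h1 h2 h3; clear; lra.
  have b1' : enorm (y.1 - x0) < R1.
    have := enorm_triangle y.1 x1 x0; move: nE' hx1 sge e1R hS R10; clear; lra.
  have hh : h < R1 / 4.
    apply: le_lt_trans hS; rewrite -[leLHS]mulr1 ler_wpM2l// ltW//.
  have b2' : `|y.2 - t0| < R1.
    have -> : y.2 - t0 = - th + (t1 - t0) by rewrite /th; ring.
    apply: le_lt_trans (ler_normD _ _) _; rewrite normrN.
    move: thM ht1 hh sgS e1R R10; clear; lra.
  have dE : d y.1 >= d (x1 + th *: bb) - enorm (E y).
    have := hdl (x1 + th *: bb) y.1; rewrite Eth (_ : x1 + _ - _ = - E y); last first.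
      by rewrite opprD addrA subrr add0r.
    by rewrite enormN ler_norml => /andP[_]; clear; lra.
  have sk := mulr_gt0 sg0 k0; have sM := mulr_ge0 (ltW sg0) Mb0.
  have sgd' : sg * Mb + 4 * (sg * k) < d x1.
    by rewrite /S in sgd; move: sgd sg0; clear; lra.
  have posd : 0 <= th -> d x1 + th * (3 / 4 * beta) <= d (x1 + th *: bb).
    move=> th0.
    have Q1 : enorm (x1 - xb) < r0.
      by case: (hra x1 t1 _ _) => //; [move: hx1|move: ht1]; move: e1R Ra R10; clear; lra.
    have thMR : th * Mb <= R1 / 4.
      apply: ltW; apply: le_lt_trans hS; apply: ler_pM => //.
      by rewrite /S; move: k0; clear; lra.
    have n1 : enorm (x1 + th *: bb - x1) <= th * Mb.
      by rewrite addrAC subrr add0r enormZ ger0_norm// ler_wpM2l.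
    have Q2 : enorm (x1 + th *: bb - xb) < r0.
      case: (hra (x1 + th *: bb) t1 _ _) => //.
        have := enorm_triangle (x1 + th *: bb) x1 x0; move: n1 thMR hx1 e1R Ra R10; clear; lra.
      by move: ht1 e1R Ra R10; clear; lra.
    have := dist_exp (if_d F) Q1 Q2; rewrite ler_norml => /andP[h1 _].
    have h2 := ler_wpM2l Cd0 (ler_pM (enorm_ge0 _) (enorm_ge0 _) n1 n1).
    have h3 : Cd * (th * Mb * (th * Mb)) <= th * (beta / 32).
      have := ler_wpM2l (mulr_ge0 (mulr_ge0 Cd0 th0) Mb0) thMR.
      have := ler_wpM2l th0 Rd; clear; lra.
    have h4 : 7 / 8 * beta <= dotv (g x1) bb.
      have h5 := dotv_abs (g x0 - g x1) bb.
      have h6 := dist_glip (if_d F) (proj1 P0) Q1.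
      have h7 := ler_pM (enorm_ge0 _) (enorm_ge0 _) h6 hbb.
      have h8 : Cd * Mb * enorm (x0 - x1) <= Cd * Mb * R1.
        by apply: ler_wpM2l; [exact: mulr_ge0|rewrite enormB; move: hx1 e1R R10; clear; lra].
      rewrite dotvBl ler_norml in h5; move/andP: h5 => [_ h5].
      move: h5 h7 h8 Rd; rewrite /beta (dotvC bb (g x0)); clear; lra.
    have h9 := ler_wpM2l th0 h4.
    move: h1; rewrite (_ : x1 + th *: bb - x1 = th *: bb); last by rewrite addrAC subrr add0r.
    rewrite dotvZr; rewrite (_ : x1 + th *: bb - x1 = th *: bb) in h2; last by rewrite addrAC subrr add0r.
    move: (mulr_ge0 th0 (ltW beta0)) h2 h3 h9; rewrite expr2; clear; lra.
  have posd2 : 0 <= th -> beta / 4 * th < d y.1.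
    move=> th0; have := posd th0; have := ler_wpM2r th0 kbeta; have := mulr_ge0 th0 (ltW beta0).
    move: dE hE sgd' sk sM; clear; lra.
  split => //.
  have [th0|th0] := leP 0 th.
    apply: le_lt_trans (posd2 th0); apply: mulr_ge0 => //; move: beta0; clear; lra.
  have := hdl x1 (x1 + th *: bb).
  rewrite opprD addrA subrr add0r enormN enormZ ler_norml => /andP[_ h1].
  have h2 : `|th| * enorm bb <= sg / 2 * Mb.
    apply: ler_pM => //; first exact: enorm_ge0.
    by rewrite ltr0_norm//; move: th1; clear; lra.
  have h3 : k * th < 0 by rewrite pmulr_rlt0.
  move: dE hE sgd' sk sM h1 h2 h3; clear; lra.
have qE2 x t : qexp e2 x t (2 *: E (x, t)) (2 * dotv (E (x, t)) bb) by exact: qexp_sq.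
have qts x t : qexp ts x t 0 (2 * (t - (t1 + sg))) by exact: qexp_tsq.
have qQ x t := qexpD (qE2 x t) (qexpZ (- k ^+ 2) (qts x t)).
have qtp (x : 'rV[R]_N) t := qexpD (qexp_time x t) (qexp_cst (- t1) x t).
have qphi x t := qexpD (qexpZ C (qexpD (qexp_pos2 (qQ x t)) (qexp_pos2 (qtp x t))))
  (qexpZ lam (qtp x t)).
have cphi : continuous phi by move=> [x t]; exact: qexp_cont (qphi x t).
pose f1 y := e2 y + - (2 * k) ^+ 2 * ts y.
pose f2 (y : 'rV[R]_N * R) := y.2 + - (t1 + sg / 2).
pose f3 (y : 'rV[R]_N * R) := (t1 - h) + - 1 * y.2.
pose f4 (y : 'rV[R]_N * R) := d y.1 - rho.
have cf1 : continuous f1.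
  by move=> [x t]; exact: qexp_cont (qexpD (qE2 x t) (qexpZ (- (2 * k) ^+ 2) (qts x t))).
have cf2 : continuous f2.
  by move=> [x t]; exact: qexp_cont (qexpD (qexp_time x t) (qexp_cst (- (t1 + sg / 2)) x t)).
have cf3 : continuous f3.
  by move=> [x t]; exact: qexp_cont (qexpD (qexp_cst (t1 - h) x t) (qexpZ (- 1) (qexp_time x t))).
have cd : continuous d by exact: continuous_lip.
have cf4 : continuous f4.
  move=> y; apply: cvgB; last exact: cvg_cst.
  by apply: continuous_comp; [exact: cvg_fst|exact: cd].
pose K1 := [set y : 'rV[R]_N * R | enorm (y.1 - x0) <= R1 /\ `|y.2 - t0| <= R1].
pose K := K1 `&` [set y | f1 y <= 0] `&` [set y | f2 y <= 0] `&` [set y | f3 y <= 0] `&` [set y | f4 y <= 0].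
have cK : compact K.
  by do 4 (apply: compact_le0 => //); exact: compact_cballT.
have E1 : E (x1, t1) = 0.
  by rewrite /E /Y; apply/rowP => j; rewrite !mxE /=; ring.
have Kx1 : K (x1, t1).
  split; last first.
    rewrite /= /f4 /=; have := hdl x1 x0; rewrite d0 subr0 ler_norml => /andP[_].
    by move: hx1 e1rho e10; clear; lra.
  split; last by rewrite /= /f3 /=; move: h0; clear; lra.
  split; last by rewrite /= /f2 /=; move: sg0; clear; lra.
  split; last first.
    rewrite /= /f1 /e2 -/(E (x1, t1)) E1 enorm0 /ts /=.
    rewrite (_ : t1 - (t1 + sg) = - sg); last by ring.
    by have := sqr_ge0 (2 * k * sg); clear; lra.
  by split => /=; [move: hx1|move: ht1]; move: e1R R10; clear; lra.
have phi1 : phi (x1, t1) = 0.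
  rewrite /phi /Q /e2 -/(E (x1, t1)) E1 enorm0 /ts /tp /= subrr mulr0 addr0 expr0n /= add0r.
  rewrite (_ : t1 - (t1 + sg) = - sg); last by ring.
  rewrite !max_r ?expr0n ?addr0 ?mulr0//.
  by have := sqr_ge0 (k * sg); clear; lra.
have uF : usc_in K (w \+ (fun y => - phi y)).
  refine (usc_inD _ _).
    move=> [x t] [[[[[/= h1 h2] _] _] _] _] e' e'0.
    have Px : near_pt xb tb r0 x t.
      by apply: hra; [exact: le_trans h1 Ra|exact: le_trans h2 Ra].
    by apply: filterS (if_usc F Px e'0) => y + _.
  by apply: cont_usc_in => y; apply: cvgN; exact: cphi.
have [[x t] Kx zmax] := usc_in_max cK (ex_intro _ _ Kx1) uF.
have hZ := zmax _ Kx1; rewrite /= phi1 subr0 in hZ.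
case: (Kx) => -[[[[/= Kx0 Kt0] Kf1] Kf2] Kf3] Kf4.
pose th := t1 - t.
have thsg : sg / 2 <= th + sg by move: Kf2; rewrite /= /f2 /th /=; clear; lra.
have thlo : - sg / 2 <= th by move: thsg; clear; lra.
have thhi : th <= h by move: Kf3; rewrite /= /f3 /th /=; clear; lra.
have EE : enorm (E (x, t)) <= 2 * k * (th + sg).
  have h1 : 0 <= 2 * k * (th + sg).
    by apply: mulr_ge0; [move: k0|move: thsg sg0]; clear; lra.
  rewrite -(@ler_pXn2r _ 2)// ?nnegrE ?enorm_ge0//.
  have h2 : (t - (t1 + sg)) ^+ 2 = (th + sg) ^+ 2 by rewrite /th; ring.
  by move: Kf1; rewrite /= /f1 /e2 -/(E (x, t)) /ts /= h2; clear; lra.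
have [gx gt gd gth] := geo (x, t) EE thlo thhi.
rewrite /= in gx gt gd gth.
have Px : near_pt xb tb r0 x t.
  by apply: hra; [exact: le_trans Kx0 Ra|exact: le_trans Kt0 Ra].
have wlt : w (x, t) < w (x0, t0) + 1.
  by apply: hrb; [exact: lt_trans gx Rb|exact: lt_trans gt Rb].
have pos1 : 0 <= C * Num.max (Q (x, t)) 0 ^+ 2.
  by apply: mulr_ge0; [exact: ltW|exact: sqr_ge0].
have pos2 : 0 <= C * Num.max (tp (x, t)) 0 ^+ 2.
  by apply: mulr_ge0; [exact: ltW|exact: sqr_ge0].
have phiE : phi (x, t) = C * Num.max (Q (x, t)) 0 ^+ 2 + C * Num.max (tp (x, t)) 0 ^+ 2 - lam * th.
  by rewrite /phi /tp /th /=; ring.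
have [dx|dx] := eqVneq (d x) rho.
  exists x, t, th; split => //.
  - have -> : x - x0 - th *: bb = (x1 - x0) + E (x, t).
      by rewrite /E /Y /th; apply/rowP => j; rewrite !mxE /=; ring.
    apply: le_trans (enormD _ _) _.
    have h1 := ler_wpM2l (ltW k0) (ler_norm th).
    have h2 : 4 * (sg * k) <= e1.
      have := mulr_ge0 (ltW sg0) Mb0; rewrite /S in sge; move: sge sg0; clear; lra.
    by move: EE hx1 h1 h2 e1e e10; clear; lra.
  - rewrite (_ : t - (t0 - th) = t1 - t0); last by rewrite /th; ring.
    by move: ht1 e1e e10; clear; lra.
  - by move: hZ; rewrite phiE; move: pos1 pos2 w1 e1e e10; clear; lra.
  - by apply/andP; split; [move: thlo sgS e1e e10; clear; lra|exact: thhi].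
exfalso.
have dxlt : d x < rho.
  by rewrite lt_neqAle dx; move: Kf4; rewrite /= /f4 subr_le0.
have lamth : lam * th <= `|lam| * (h + 1).
  apply: le_trans (ler_norm _) _; rewrite normrM ler_wpM2l// ler_norml.
  by apply/andP; split; [move: thlo sgS e11 h0 sg0|move: thhi]; clear; lra.
have bounded : C * Num.max (Q (x, t)) 0 ^+ 2 + C * Num.max (tp (x, t)) 0 ^+ 2 < B0.
  by move: hZ; rewrite phiE /B0; move: w1 wlt lamth e11; clear; lra.
have sE : enorm (E (x, t)) < 2 * k * (th + sg).
  rewrite lt_neqAle EE andbT; apply/eqP => hEq.
  have hQ : Q (x, t) = 3 * (k * (th + sg)) ^+ 2.
    by rewrite /Q /e2 -/(E (x, t)) hEq /ts /th /=; ring.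
  have hq : q0 / 4 <= (k * (th + sg)) ^+ 2.
    have h1 : k * (sg / 2) <= k * (th + sg) by rewrite ler_wpM2l// ltW.
    have h2 : 0 <= k * (sg / 2) by apply: mulr_ge0; move: k0 sg0; clear; lra.
    have := ler_pM h2 h2 h1 h1; rewrite /q0; clear; lra.
  have h3 : 3 / 4 * q0 <= Num.max (Q (x, t)) 0.
    by rewrite le_max hQ; apply/orP; left; move: hq; clear; lra.
  have h4 : 0 <= 3 / 4 * q0 by move: q00; clear; lra.
  have := ler_wpM2l (ltW Cp) (ler_pM h4 h4 h3 h3); rewrite -expr2.
  move: bounded pos1 pos2 Cq B00; clear; lra.
have sth : - sg / 2 < th.
  rewrite lt_neqAle thlo andbT; apply/eqP => hEq.
  have h3 : Num.max (tp (x, t)) 0 = sg / 2.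
    have -> : tp (x, t) = sg / 2 by rewrite /tp /=; move: hEq; rewrite /th; clear; lra.
    by rewrite max_l//; move: sg0; clear; lra.
  by move: bounded; rewrite h3; move: pos1 pos2 Cs B00; clear; lra.
have sth2 : th < h.
  rewrite lt_neqAle thhi andbT; apply/eqP => hEq.
  have := gth _; rewrite -/th hEq (mulrC (beta / 4)) mulrA hbeta => /(_ (ltW h0)).
  by move: dxlt rho0; clear; lra.
have jw : exists2 r, 0 < r & forall x' t', enorm (x' - x) < r -> `|t' - t| < r -> K (x', t').
  have neg (f : 'rV[R]_N * R -> R) : continuous f -> f (x, t) < 0 -> \forall y \near (x, t), f y < 0.
    move=> cf hf; have /(@cvgrPdist_lt _ _ _ _ (nbhs_filter _))/(_ (- f (x, t))) := cf (x, t).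
    rewrite oppr_gt0 => /(_ hf); apply: filterS => y; rewrite ltr_norml => /andP[h1 h2].
    by move: h1; clear; lra.
  have g1 : f1 (x, t) < 0.
    have h1 := ler_pM (enorm_ge0 _) (enorm_ge0 _) (ltW sE) (lexx (enorm (E (x, t)))).
    have h2 : 0 < 2 * k * (th + sg) by apply: le_lt_trans sE; exact: enorm_ge0.
    have h3 := sE; rewrite -(ltr_pM2l h2) in h3.
    have h4 : (t - (t1 + sg)) ^+ 2 = (th + sg) ^+ 2 by rewrite /th; ring.
    by rewrite /f1 /e2 -/(E (x, t)) /ts /= h4; move: h1 h3; clear; lra.
  have g2 : f2 (x, t) < 0 by move: sth; rewrite /f2 /th /=; clear; lra.
  have g3 : f3 (x, t) < 0 by move: sth2; rewrite /f3 /th /=; clear; lra.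
  have g4 : f4 (x, t) < 0 by rewrite /f4 /= subr_lt0.
  have [s1 s10 hs1] := (nbhs_enormT _ _ _).1 (neg _ cf1 g1).
  have [s2 s20 hs2] := (nbhs_enormT _ _ _).1 (neg _ cf2 g2).
  have [s3 s30 hs3] := (nbhs_enormT _ _ _).1 (neg _ cf3 g3).
  have [s4 s40 hs4] := (nbhs_enormT _ _ _).1 (neg _ cf4 g4).
  exists (Num.min (Num.min (Num.min s1 s2) (Num.min s3 s4)) (Num.min (R1 - enorm (x - x0)) (R1 - `|t - t0|))).
    by rewrite !lt_min !subr_gt0 s10 s20 s30 s40 gx gt.
  move=> x' t'; rewrite !lt_min => /andP[/andP[/andP[a1 a2] /andP[a3 a4]] /andP[a5 _]].
  move=> /andP[/andP[/andP[c1 c2] /andP[c3 c4]] /andP[_ c6]].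
  split; last exact: ltW (hs4 _ _ a4 c4).
  split; last exact: ltW (hs3 _ _ a3 c3).
  split; last exact: ltW (hs2 _ _ a2 c2).
  split; last exact: ltW (hs1 _ _ a1 c1).
  split => /=.
    by have := enorm_triangle x' x x0; move: a5; clear; lra.
  by have := ler_normD (t' - t) (t - t0); rewrite addrA subrK; move: c6; clear; lra.
have [r r'0 hr] := jw.
have {}jw := max_sub_jet (D := setT) (w := w) r'0 (qphi x t)
  (fun x' t' _ hx ht => zmax _ (hr x' t' hx ht)).
have domx := if_dom1 F (proj1 Px) gd.
have clx := side_cl (if_s1 F) domx.
have := side_sub (if_s1 F) Px domx jw i.
set mx := Num.max (Q (x, t)) 0; set mt := Num.max _ 0.
have mx0 : 0 <= mx by rewrite le_max lexx orbT.
have mt0 : 0 <= mt by rewrite le_max lexx orbT.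
have [Ex hEx] : exists Ex, E (x, t) = Ex by exists (E (x, t)).
rewrite hEx !(dotvDr, dotvZr, dotv0r) (_ : t - (t1 + sg) = - (th + sg)) => [hsub|]; last by rewrite /th; ring.
rewrite hEx in EE.
have hb : enorm (bb - b1 x t i) <= k / 2.
  apply: le_trans (side_blip (if_s1 F) i P0 Px cl0 clx) _; apply: le_trans Rk.
  by rewrite ler_wpM2l// enormB distrC; move: gx gt; clear; lra.
have hl : `|l1 x0 t0 i - l1 x t i| <= k1 / 2.
  apply: hrl => //; rewrite enormB distrC; move: gx gt Rl; clear; lra.
(* The cone opens with speed [k], while [bb] differs from the current drift by at most [k / 2] and
   [|E| <= 2 k (th + sg)]: the lateral part of the barrier has the favourable sign, and the slack
   [k1] yields the contradiction. *)
have hE : - (k * (k * (th + sg))) <= dotv (Ex) bb - dotv (b1 x t i) (Ex).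
  rewrite (dotvC (b1 x t i)) -dotvBr.
  have := dotv_abs (Ex) (bb - b1 x t i); rewrite ler_norml => /andP[h1 _].
  have := ler_pM (enorm_ge0 _) (enorm_ge0 _) EE hb.
  by move: h1; clear; lra.
have Cm := mulr_ge0 (ltW Cp) mx0; have Cm' := mulr_ge0 (ltW Cp) mt0.
have hE' := ler_wpM2l Cm hE.
rewrite distrC in hl; have hl' := le_trans (ler_norm _) hl.
move: hsub hE' hl' Cm' k10; rewrite /lam; clear; lra.
Qed.

(** * Lower bounds on the supersolution *)

Lemma sq_shift (R : realType) (N : nat) (x x0 y : 'rV[R]_N) :
  enorm (x - y) ^+ 2 = enorm (x0 - y) ^+ 2 + 2 * dotv (x0 - y) (x - x0) + enorm (x - x0) ^+ 2.
Proof. by rewrite (enorm_sq_expand x0 y x) dotvZl. Qed.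

(** The doubling penalty with the first point frozen, normalized to vanish at [(y0, s0)]; its
    gradient there is the doubling slope. *)
Definition doubled_slice (R : realType) (N : nat) (n : R) (x0 : 'rV[R]_N) (t0 : R) (y0 : 'rV[R]_N) (s0 : R)
    (y : 'rV[R]_N * R) :=
  - n * (enorm (y.1 - x0) ^+ 2 + (y.2 - t0) ^+ 2)
  + n * (enorm (y0 - x0) ^+ 2 + (s0 - t0) ^+ 2).

(* Compare the value of [w] transported to the level set [d = d y] with [v] at [y]. *)
Lemma slope_lower (R : realType) (N : nat) (I1 I2 : Type)
    (b1 : 'rV[R]_N -> R -> I1 -> 'rV[R]_N) (l1 : 'rV[R]_N -> R -> I1 -> R)
    (b2 : 'rV[R]_N -> R -> I2 -> 'rV[R]_N) (l2 : 'rV[R]_N -> R -> I2 -> R)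
    (dom1 dom2 cl1 cl2 : set 'rV[R]_N) (w v : 'rV[R]_N * R -> R) (xb : 'rV[R]_N)
    (tb r0 eta Mb Ml L : R) (d : 'rV[R]_N -> R) (g : 'rV[R]_N -> 'rV[R]_N) (Cd dl : R)
    (n r1 : R) (x0 : 'rV[R]_N) (t0 : R) (y0 : 'rV[R]_N) (s0 : R) (i : I1) (kappa : R)
    (P := (2 * n) *: (x0 - y0)) (tau := 2 * n * (t0 - s0))
    (bb := b1 x0 t0 i) (beta := dotv bb (g x0))
    (c := (tau - dotv bb P - l1 x0 t0 i + eta) / beta) :
  iface b1 l1 b2 l2 dom1 dom2 cl1 cl2 w v xb tb r0 eta Mb Ml L d g Cd dl ->
  r1 < r0 -> 0 < n -> near_pt xb tb r1 x0 t0 -> near_pt xb tb r1 y0 s0 ->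
  d x0 = 0 -> d y0 = 0 -> 0 < beta -> 0 < kappa ->
  (forall z, doubled_ball xb tb r1 z -> d z.1.1 = d z.2.1 ->
    doubled w v n z <= doubled w v n ((x0, t0), (y0, s0))) ->
  exists2 r, 0 < r & forall y s, enorm (y - y0) < r -> `|s - s0| < r -> 0 < d y ->
    v (y0, s0) + doubled_slice n x0 t0 y0 s0 (y, s) + (c - kappa) * d y <= v (y, s).
Proof.
move=> F r10 n0 Px0 Py0 dx0 dy0 beta0 kap0 Hmax.
have P0 : near_pt xb tb r0 x0 t0.
  by case: Px0 => p1 p2; split; [exact: lt_trans p1 r10|exact: lt_trans p2 r10].
have Mb0 := side_Mb (if_s1 F).
have hdl := dist_lip (if_d F); have Cd0 := dist_Cd (if_d F).
have cl0 : cl1 x0 by apply: (if_cl1 F (proj1 P0)); rewrite dx0.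
have hbb : enorm bb <= Mb := side_b (if_s1 F) i P0 cl0.
have [ma ma0 hma] := near_pt_shrink Px0.
have [mb mb0 hmb] := near_pt_shrink Py0.
(* [Th] bounds the transport time and [Th2] the displacement, both per unit of [rho]. *)
pose Th : R := 8 / beta + 1.
have Th1 : 1 <= Th.
  by have : 0 <= 8 / beta by [rewrite divr_ge0// ltW]; rewrite /Th; clear; lra.
pose Th2 : R := Th * Mb + 3 * Th.
have Th21 : 1 <= Th2.
  have Th0 : 0 <= Th by move: Th1; clear; lra.
  by have := mulr_ge0 Th0 Mb0; move: Th1; rewrite /Th2; clear; lra.
(* Errors of size [k rho] are collected in [A1], those of size [r rho] in [A2]; these two and the
   term [k1 Th] receive a third of [kappa] each. *)
pose A1 : R := 1 + enorm P * (3 * Th) + `|tau| + `|c| * (3 * Th).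
pose A2 : R := 4 * n * Th2 + 2 * n * Th2 ^+ 2 + `|c| * (Cd * Th2 ^+ 2).
have A10 : 0 <= A1.
  have h : 0 <= 3 * Th by move: Th1; clear; lra.
  have := mulr_ge0 (enorm_ge0 P) h; have := mulr_ge0 (normr_ge0 c) h.
  by have := normr_ge0 tau; rewrite /A1; clear; lra.
have A20 : 0 <= A2.
  have h : 0 <= Th2 by move: Th21; clear; lra.
  have := mulr_ge0 (ltW n0) h; have := mulr_ge0 (ltW n0) (sqr_ge0 Th2).
  have := mulr_ge0 (normr_ge0 c) (mulr_ge0 Cd0 (sqr_ge0 Th2)).
  by rewrite /A2; clear; lra.
have [k k0 [kk1 kb kA]] : exists2 k : R, 0 < k & [/\ k <= 1, 8 * k <= beta & 3 * (k * A1) <= kappa].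
  pose m := Num.min 1 (Num.min beta (kappa / (A1 + 1))).
  have A11 : 0 < A1 + 1 by move: A10; clear; lra.
  have m0 : 0 < m by rewrite !lt_min ltr01 beta0 divr_gt0.
  have h1 : m <= 1 by rewrite !ge_min lexx.
  have h2 : m <= beta by rewrite !ge_min lexx !orbT.
  have h3 : m <= kappa / (A1 + 1) by rewrite !ge_min lexx !orbT.
  rewrite ler_pdivlMr// in h3.
  have h4 := mulr_ge0 (ltW m0) A10.
  by exists (m / 8); [rewrite divr_gt0|split; move: h1 h2 h3 m0 h4; clear; lra].
have [k1 k10 kT] : exists2 k1 : R, 0 < k1 & 3 * (k1 * Th) <= kappa.
  have Th0 : 0 < Th by move: Th1; clear; lra.
  exists (kappa / (3 * Th)); first by rewrite divr_gt0// mulr_gt0.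
  by rewrite mulrCA divfK// gt_eqF// mulr_gt0.
have [rho0 rho00 hcone] := cone_transport F P0 dx0 k0 k10 kb.
have [r r'0 [rma rmb rrho rA rr]] : exists2 r : R, 0 < r & [/\ r * Th2 <= ma, r <= mb, r <= rho0,
   3 * (r * A2) <= kappa & r <= 1].
  pose m := Num.min (Num.min (ma / Th2) mb) (Num.min rho0 (Num.min (kappa / (3 * (A2 + 1))) 1)).
  have Th20 : 0 < Th2 by move: Th21; clear; lra.
  have A21 : 0 < 3 * (A2 + 1) by move: A20; clear; lra.
  have m0 : 0 < m by rewrite !lt_min mb0 rho00 ltr01 !divr_gt0.
  have h1 : m <= ma / Th2 by rewrite !ge_min lexx.
  have h2 : m <= mb by rewrite !ge_min lexx !orbT.
  have h3 : m <= rho0 by rewrite !ge_min lexx !orbT.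
  have h4 : m <= kappa / (3 * (A2 + 1)) by rewrite !ge_min lexx !orbT.
  have h5 : m <= 1 by rewrite !ge_min lexx !orbT.
  rewrite ler_pdivlMr// in h1; rewrite ler_pdivlMr// in h4.
  exists m => //; split => //; move: h4 m0; clear; lra.
exists r => // y s hy hs dy.
pose rho := d y; have rho_r : rho < r.
  apply: le_lt_trans hy; have := hdl y y0; rewrite dy0 subr0; apply: le_trans; exact: ler_norm.
have e0 : 0 < k * rho by rewrite mulr_gt0.
have [x [t [th [dx hx ht hw /andP[th1 th2]]]]] := hcone rho (k * rho) dy (lt_le_trans rho_r rrho) e0.
have rhop : 0 < rho := dy.
have krho : k * rho <= rho by rewrite ler_piMl// ltW.
have thT : `|th| <= Th * rho.
  have h1 : 8 * rho / beta = 8 / beta * rho by rewrite mulrAC.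
  have h2 : 0 <= 8 / beta * rho by apply: mulr_ge0; [rewrite divr_ge0// ltW|exact: ltW].
  rewrite h1 in th2; rewrite ler_norml /Th; move: th1 th2 h2 krho rhop.
  by clear => *; apply/andP; split; lra.
have [X XE] : exists X, x - x0 = X by exists (x - x0).
have [E EE] : exists E, X = th *: bb + E by exists (X - th *: bb); rewrite addrC subrK.
have hE : enorm E <= 3 * Th * (k * rho).
  have -> : E = x - x0 - th *: bb by rewrite XE EE addrAC subrr add0r.
  apply: le_trans hx _.
  have h1 := ler_wpM2l (ltW k0) thT.
  have h2 := ler_wpM2r (ltW e0) Th1.
  by move: h1 h2; clear; lra.
have hX : enorm X <= Th2 * rho.
  rewrite EE; apply: le_trans (enormD _ _) _; rewrite enormZ.
  have h1 := ler_pM (normr_ge0 th) (enorm_ge0 bb) thT hbb.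
  have h2 : 3 * Th * (k * rho) <= 3 * Th * rho.
    by apply: ler_wpM2l => //; move: Th1; clear; lra.
  by rewrite /Th2; move: hE h1 h2; clear; lra.
pose T := t - t0; pose e' := T + th.
have he' : `|e'| <= k * rho by move: ht; rewrite /e' /T (_ : t - (t0 - th) = t - t0 + th)//; ring.
have hT : `|T| <= Th2 * rho.
  have -> : T = e' - th by rewrite /e'; ring.
  apply: le_trans (ler_normB _ _) _.
  have h1 := ler_wpM2r (ltW rhop) Th1.
  have Th0 : 0 <= Th by move: Th1; clear; lra.
  have h2 := mulr_ge0 (mulr_ge0 Th0 Mb0) (ltW rhop).
  by rewrite /Th2; move: he' thT krho h1 h2 rhop; clear; lra.
have Th20 : 0 < Th2 by move: Th21; clear; lra.
have Th2r : Th2 * rho <= ma.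
  apply: le_trans rma; rewrite mulrC; apply: ler_wpM2r; exact: ltW.
have hX' : enorm (x - x0) <= Th2 * rho by rewrite XE.
have Bz : doubled_ball xb tb r1 ((x, t), (y, s)).
  split; split => /=.
  - by case: (hma x t (le_trans hX' Th2r) (le_trans hT Th2r)) => /ltW.
  - by case: (hma x t (le_trans hX' Th2r) (le_trans hT Th2r)) => _ /ltW.
  - by case: (hmb y s (ltW (lt_le_trans hy rmb)) (ltW (lt_le_trans hs rmb))) => /ltW.
  - by case: (hmb y s (ltW (lt_le_trans hy rmb)) (ltW (lt_le_trans hs rmb))) => _ /ltW.
have := Hmax _ Bz dx; rewrite /doubled /= => hm.
have Qx : enorm (x - xb) < r0.
  by case: (hma x t (le_trans hX' Th2r) (le_trans hT Th2r)) => h _; exact: lt_trans h r10.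
(* Reaching the level [d = rho] fixes the time: [beta th] is [rho] up to errors, which turns the
   rate [c beta] in time into the slope [c] in [d]. *)
have hd : `|rho - beta * th| <= 3 * Th * (k * rho) + Cd * Th2 ^+ 2 * rho ^+ 2.
  have h1 := dist_exp (if_d F) (proj1 P0) Qx.
  rewrite dx dx0 subr0 XE -/rho in h1.
  have h2 : dotv (g x0) X = beta * th + dotv (g x0) E.
    by rewrite EE dotvDr dotvZr (dotvC (g x0) bb) -/beta; ring.
  have h3 := dotv_abs (g x0) E.
  have h4 : enorm (g x0) * enorm E <= enorm E.
    by rewrite ler_piMl ?enorm_ge0// (dist_g1 (if_d F) (proj1 P0)).
  have h5 : Cd * enorm X ^+ 2 <= Cd * Th2 ^+ 2 * rho ^+ 2.
    rewrite -mulrA -exprMn; apply: ler_wpM2l => //.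
    by rewrite ler_pXn2r ?nnegrE ?enorm_ge0// mulr_ge0 ?(ltW Th20) ?(ltW rhop).
  have h6 := ler_normD (rho - dotv (g x0) X) (dotv (g x0) E).
  rewrite h2 (_ : rho - _ + _ = rho - beta * th) in h6; last by ring.
  rewrite h2 in h1.
  by move: h1 h3 h4 h5 h6 hE; clear; lra.
have hc : c * beta = tau - dotv bb P - l1 x0 t0 i + eta by rewrite /c divfK// gt_eqF.
have hcd : c * rho - `|c| * (3 * Th * (k * rho) + Cd * Th2 ^+ 2 * rho ^+ 2) <= c * beta * th.
  have h1 := ler_wpM2l (normr_ge0 c) hd; rewrite -normrM in h1.
  by have := ler_norm (c * (rho - beta * th)); move: h1; clear; lra.
have rr2 : rho ^+ 2 <= r * rho by rewrite expr2 ler_wpM2r ?ltW.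
have ex : n * (enorm (x - y) ^+ 2) <= n * enorm (x0 - y) ^+ 2 + th * dotv bb P +
   enorm P * (3 * Th * (k * rho)) + 2 * n * Th2 * (r * rho) + n * Th2 ^+ 2 * (r * rho).
  rewrite (sq_shift x x0 y) XE.
  have h1 : 2 * n * dotv (x0 - y) X = th * dotv bb P + dotv P E + 2 * n * dotv (y0 - y) X.
    rewrite EE /P -(subrKA y0 x0 (- y)); rewrite !(dotvDl, dotvDr, dotvZl, dotvZr, dotvNl, dotvNr).
    rewrite !(dotvC bb); ring.
  have h2 := dotv_le P E.
  have h3 := ler_wpM2l (enorm_ge0 P) hE.
  have h4 := dotv_le (y0 - y) X.
  have h5 : enorm (y0 - y) * enorm X <= r * (Th2 * rho).
    by apply: ler_pM; rewrite ?enorm_ge0// enormB ltW.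
  have h6 : enorm X ^+ 2 <= Th2 ^+ 2 * (r * rho).
    apply: (@le_trans _ _ (Th2 ^+ 2 * rho ^+ 2)); last by rewrite ler_wpM2l ?sqr_ge0.
    rewrite -exprMn.
    by rewrite ler_pXn2r ?nnegrE ?enorm_ge0// mulr_ge0 ?(ltW Th20) ?(ltW rhop).
  have h7 := ler_wpM2l (ltW n0) (le_trans h4 h5).
  have h8 := ler_wpM2l (ltW n0) h6.
  by move: h1 h2 h3 h7 h8; clear; lra.
have et : n * (t - s) ^+ 2 <= n * (t0 - s) ^+ 2 - tau * th + `|tau| * (k * rho) +
    2 * n * Th2 * (r * rho) + n * Th2 ^+ 2 * (r * rho).
  have -> : n * (t - s) ^+ 2 = n * (t0 - s) ^+ 2 - tau * th + tau * e' + 2 * n * ((s0 - s) * T) + n * T ^+ 2.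
    by rewrite /tau /e' /T; ring.
  have h2 : tau * e' <= `|tau| * (k * rho).
    by apply: le_trans (ler_norm _) _; rewrite normrM ler_wpM2l.
  have h5 : (s0 - s) * T <= r * (Th2 * rho).
    apply: le_trans (ler_norm _) _; rewrite normrM; apply: ler_pM => //.
    by rewrite distrC ltW.
  have h6 : T ^+ 2 <= Th2 ^+ 2 * (r * rho).
    apply: (@le_trans _ _ (Th2 ^+ 2 * rho ^+ 2)); last by rewrite ler_wpM2l ?sqr_ge0.
    rewrite -exprMn -(real_normK (num_real T)).
    by rewrite ler_pXn2r ?nnegrE// mulr_ge0 ?(ltW Th20) ?(ltW rhop).
  have h7 := ler_wpM2l (ltW n0) h5.
  have h8 := ler_wpM2l (ltW n0) h6.
  by move: h2 h7 h8; clear; lra.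
have hk1 : k1 * th <= k1 * (Th * rho).
  by apply: ler_wpM2l; [exact: ltW|exact: le_trans (ler_norm _) thT].
have m1 := ler_wpM2r (ltW rhop) kA; have m2 := ler_wpM2r (ltW rhop) kT.
have m3 := ler_wpM2r (ltW rhop) rA.
have hcr := ler_wpM2l (mulr_ge0 (normr_ge0 c) (mulr_ge0 Cd0 (sqr_ge0 Th2))) rr2.
rewrite /doubled_slice /= (enormB y x0) (enormB y0 x0).
have sq1 : (s - t0) ^+ 2 = (t0 - s) ^+ 2 by ring.
have sq2 : (s0 - t0) ^+ 2 = (t0 - s0) ^+ 2 by ring.
rewrite sq1 sq2 -/rho.
move: hw hm ex et hk1 m1 m2 m3 hcr hcd; rewrite hc /A1 /A2; clear; lra.
Qed.

(* Its slope decreases from [c + B] to [c] and its excess over [c s] is at most [B sg]; every slope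
   between the one of [slope_lower] and [r*] keeps the subsolution inequality strict. *)
Definition barrier (R : realType) (c B sg s : R) := c * s + B * (sg - sg ^+ 2 / (s + sg)).
Definition barrier' (R : realType) (c B sg s : R) := c + B * (sg / (s + sg)) ^+ 2.

(** The remainder is exactly [- B sg^2 / ((s0 + sg)^2 (s + sg)) (s - s0)^2]. Since [s] may be
    negative, the bound by [sg / 2] keeps it away from the pole [- sg]. *)
Lemma barrier_expansion (R : realType) (c B sg s0 s : R) : 0 < sg -> 0 <= B -> 0 <= s0 -> `|s - s0| < sg / 2 ->
  `|barrier c B sg s - barrier c B sg s0 - barrier' c B sg s0 * (s - s0)| <= 2 * B / sg * (s - s0) ^+ 2.
Proof.
move=> sg0 B0 s00 hs.
have h1 : sg / 2 < s + sg by move: hs; rewrite ltr_norml => /andP[]; move: s00; clear; lra.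
have h2 : 0 < s + sg by move: h1 sg0; clear; lra.
have h3 : sg <= s0 + sg by move: s00; clear; lra.
have h4 : 0 < s0 + sg by move: h3 sg0; clear; lra.
have -> : barrier c B sg s - barrier c B sg s0 - barrier' c B sg s0 * (s - s0) =
   - (B * (sg ^+ 2 / (s0 + sg) ^+ 2 / (s + sg)) * (s - s0) ^+ 2).
  by rewrite /barrier /barrier'; field; rewrite !gt_eqF.
have h5 : 0 <= sg ^+ 2 / (s0 + sg) ^+ 2 / (s + sg).
  by rewrite !divr_ge0 ?sqr_ge0 ?(ltW h2).
have hB := mulr_ge0 (mulr_ge0 B0 h5) (sqr_ge0 (s - s0)).
rewrite normrN ger0_norm//; apply: ler_wpM2r; first exact: sqr_ge0.
rewrite (_ : 2 * B / sg = B * (2 / sg)); last by rewrite mulrAC mulrC.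
apply: ler_wpM2l => //; rewrite ler_pdivrMr//.
have h6 : sg ^+ 2 / (s0 + sg) ^+ 2 <= 1.
  by rewrite ler_pdivrMr ?exprn_gt0// mul1r ler_pXn2r// nnegrE ltW.
apply: (le_trans h6); rewrite mulrAC ler_pdivlMr//.
by move: h1; clear; lra.
Qed.

Lemma barrier'_bounds (R : realType) (c B sg s : R) : 0 < sg -> 0 <= B -> 0 <= s ->
  c <= barrier' c B sg s <= c + B.
Proof.
move=> sg0 B0 s0; rewrite /barrier'.
have h1 : 0 < s + sg by move: sg0 s0; clear; lra.
have h2 : 0 <= sg / (s + sg) by rewrite divr_ge0// ltW.
have h3 : sg / (s + sg) <= 1 by rewrite ler_pdivrMr// mul1r lerDr.
have h4 : (sg / (s + sg)) ^+ 2 <= 1 by rewrite expr_le1.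
rewrite lerDl mulr_ge0 ?sqr_ge0//= lerD2l.
by have := ler_wpM2l B0 h4; rewrite mulr1.
Qed.

Lemma barrier_le (R : realType) (c B sg s : R) : 0 < sg -> 0 <= B -> 0 <= s ->
  barrier c B sg s <= c * s + B * sg.
Proof.
move=> sg0 B0 s0; rewrite /barrier lerD2l ler_wpM2l// lerBlDr lerDl.
by rewrite divr_ge0 ?sqr_ge0// addr_ge0// ltW.
Qed.

(** Recovers almost the initial slope [c + B] for small [s]; the loss [k] is compensated by starting
    the barrier slightly above the wanted slope. *)
Lemma barrier_ge (R : realType) (c B sg s k : R) : 0 < sg -> 0 < k -> k <= B -> 0 <= s ->
  s * B <= k * sg -> (c + B - k) * s <= barrier c B sg s.
Proof.
move=> sg0 k0 kB s0 hs; rewrite /barrier.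
have h1 : 0 < s + sg by move: sg0 s0; clear; lra.
have -> : sg - sg ^+ 2 / (s + sg) = s * (sg / (s + sg)) by field; rewrite gt_eqF.
have h2 : B - k <= B * (sg / (s + sg)).
  rewrite mulrA ler_pdivlMr//; have := mulr_ge0 (ltW k0) s0; move: hs; clear; lra.
have := ler_wpM2r s0 h2; clear; lra.
Qed.

Lemma qexp_doubled_slice (R : realType) (N : nat) (n : R) (x0 : 'rV[R]_N) (t0 : R) (y0 : 'rV[R]_N) (s0 : R) y s :
  qexp (doubled_slice n x0 t0 y0 s0) y s ((2 * n) *: (x0 - y)) (2 * n * (t0 - s)).
Proof.
have h1 := qexp_sq x0 0 y s; have h2 := qexp_tsq t0 y s.
have h3 := qexpD (qexpZ (- n) (qexpD h1 h2)) (qexp_cst (n * (enorm (y0 - x0) ^+ 2 + (s0 - t0) ^+ 2)) y s).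
apply: (qexp_eq h3) => [[y' s']||]; rewrite /doubled_slice /=.
- by rewrite scaler0 addr0.
- by apply/rowP => j; rewrite !mxE; ring.
- by rewrite dotv0r; ring.
Qed.

Lemma qexp_usc_in (R : realType) (N : nat) (K : set ('rV[R]_N * R)) (f : 'rV[R]_N * R -> R) :
  (forall x t, K (x, t) -> exists p a, qexp f x t p a) -> usc_in K f.
Proof.
move=> h [x t] Kx e e0; have [p [a q]] := h x t Kx.
have /(@cvgrPdist_lt _ _ _ _ (nbhs_filter _))/(_ e e0) := qexp_cont q.
apply: filterS => y; rewrite ltr_distlC => /andP[_ h2] _.
by move: h2; clear; lra.
Qed.

Lemma doubled_slice_ge (R : realType) (N : nat) (w v : 'rV[R]_N * R -> R) (n : R) (x0 : 'rV[R]_N) (t0 : R)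
    (y0 : 'rV[R]_N) (s0 : R) (y : 'rV[R]_N) (s : R) :
  doubled w v n ((x0, t0), (y, s)) <= doubled w v n ((x0, t0), (y0, s0)) ->
  v (y0, s0) + doubled_slice n x0 t0 y0 s0 (y, s) <= v (y, s).
Proof.
rewrite /doubled /doubled_slice /= (enormB y x0) (enormB y0 x0).
have sq1 : (s - t0) ^+ 2 = (t0 - s) ^+ 2 by ring.
have sq2 : (s0 - t0) ^+ 2 = (t0 - s0) ^+ 2 by ring.
by rewrite sq1 sq2; clear; lra.
Qed.

(** [slope_lower] gives the slopes forced by the controls entering the side, whose supremum may be
    less than [rs]. In between, the inequality at [(x0, t0)] stays strict: entering controls need a
    slope at least this supremum, the others a slope at most [rs]. Hence a barrier with slopes in
    this range cannot touch [v] from below inside the side. *)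
Lemma side_lower (R : realType) (N : nat) (I1 I2 : Type)
    (b1 : 'rV[R]_N -> R -> I1 -> 'rV[R]_N) (l1 : 'rV[R]_N -> R -> I1 -> R)
    (b2 : 'rV[R]_N -> R -> I2 -> 'rV[R]_N) (l2 : 'rV[R]_N -> R -> I2 -> R)
    (dom1 dom2 cl1 cl2 : set 'rV[R]_N) (w v : 'rV[R]_N * R -> R) (xb : 'rV[R]_N)
    (tb r0 eta Mb Ml L : R) (d : 'rV[R]_N -> R) (g : 'rV[R]_N -> 'rV[R]_N) (Cd dl : R) :
  iface b1 l1 b2 l2 dom1 dom2 cl1 cl2 w v xb tb r0 eta Mb Ml L d g Cd dl ->
  exists2 k0 : R, 0 < k0 &
  forall (n r1 : R) (x0 : 'rV[R]_N) (t0 : R) (y0 : 'rV[R]_N) (s0 rs : R)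
    (P := (2 * n) *: (x0 - y0)) (tau := 2 * n * (t0 - s0)),
  r1 < r0 -> 0 < n -> near_pt xb tb r1 x0 t0 -> near_pt xb tb r1 y0 s0 ->
  d x0 = 0 -> d y0 = 0 -> doubling_scale n x0 t0 y0 s0 < k0 ->
  (forall z, doubled_ball xb tb r1 z -> d z.1.1 = d z.2.1 ->
    doubled w v n z <= doubled w v n ((x0, t0), (y0, s0))) ->
  (forall i, tau - dotv (b1 x0 t0 i) P - l1 x0 t0 i + eta <= rs * dotv (b1 x0 t0 i) (g x0)) ->
  exists2 r, 0 < r & forall y s, enorm (y - y0) < r -> `|s - s0| < r -> 0 < d y ->
    v (y0, s0) + doubled_slice n x0 t0 y0 s0 (y, s) + rs * d y
      - (enorm (y - y0) ^+ 2 + (s - s0) ^+ 2) <= v (y, s).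
Proof.
move=> F.
have Mb0 := side_Mb (if_s1 F); have Ml0 := side_Ml (if_s1 F); have L0 := side_L (if_s1 F).
have hdl := dist_lip (if_d F); have Cd0 := dist_Cd (if_d F).
have dl0 := if_dl F; have eta0 := side_eta (if_s1 F).
have e16 : 0 < eta / 16 by rewrite divr_gt0.
have [rl rl0 hrl] := side_lcont (if_s1 F) e16.
pose C1 : R := (1 + Mb + Ml + eta) / dl + 3.
have C10 : 0 <= C1.
  have h1 : 0 <= 1 + Mb + Ml + eta by move: Mb0 Ml0 eta0; clear; lra.
  by have := divr_ge0 h1 (ltW dl0); rewrite /C1; clear; lra.
pose C2 : R := Mb * C1 * Cd + L * (1 + C1).
have C20 : 0 <= C2.
  have h : 0 <= 1 + C1 by move: C10; clear; lra.
  have h1 := mulr_ge0 L0 h.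
  by have := mulr_ge0 (mulr_ge0 Mb0 C10) Cd0; rewrite /C2; move: h1; clear; lra.
exists (Num.min (rl / 2) (eta / (16 * (C2 + 1)))).
  by rewrite lt_min !divr_gt0// mulr_gt0// ltr_wpDl.
move=> n r1 x0 t0 y0 s0 rs P tau r10 n0 Px0 Py0 dx0 dy0.
rewrite lt_min => /andP[kap1 kap2] Hmax hrs.
have P0 : near_pt xb tb r0 x0 t0.
  by case: Px0 => p1 p2; split; [exact: lt_trans p1 r10|exact: lt_trans p2 r10].
have dx00 : 0 <= d x0 by rewrite dx0.
have cl0 : cl1 x0 := if_cl1 F (proj1 P0) dx00.
have hb i : enorm (b1 x0 t0 i) <= Mb := side_b (if_s1 F) i P0 cl0.
have hl i : `|l1 x0 t0 i| <= Ml := side_l (if_s1 F) i P0 cl0.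
have hbg i : `|dotv (b1 x0 t0 i) (g x0)| <= Mb.
  apply: le_trans (dotv_abs _ _) _; rewrite -[leRHS]mulr1.
  exact: ler_pM (enorm_ge0 _) (enorm_ge0 _) (hb i) (dist_g1 (if_d F) (proj1 P0)).
have [[A0 B0 AB AK] [B1 B2]] := doubling_scaleE x0 t0 y0 s0 n0.
set A := enorm (x0 - y0) + `|t0 - s0| in A0 B0 AB AK B1 B2.
set B := 2 * n * A in B0 AB B1 B2.
have nP : enorm P <= B.
  by rewrite enormZ ger0_norm ?mulr_ge0 ?(ltW n0)//; move: B1; clear; lra.
have ntau : `|tau| <= B.
  by rewrite normrM ger0_norm ?mulr_ge0 ?(ltW n0)//; move: B2; clear; lra.
have ga i : `|tau - dotv (b1 x0 t0 i) P - l1 x0 t0 i + eta| <= (1 + Mb + Ml + eta) * (1 + B).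
  have h1 := dotv_abs (b1 x0 t0 i) P.
  have h2 := ler_pM (enorm_ge0 _) (enorm_ge0 _) (hb i) nP.
  have h3 := ler_normD (tau - dotv (b1 x0 t0 i) P - l1 x0 t0 i) eta.
  have h4 := ler_normB (tau - dotv (b1 x0 t0 i) P) (l1 x0 t0 i).
  have h5 := ler_normB tau (dotv (b1 x0 t0 i) P).
  rewrite (gtr0_norm eta0) in h3.
  have h6 := mulr_ge0 Ml0 B0; have h7 := mulr_ge0 (ltW eta0) B0.
  by move: (hl i) h1 h2 h3 h4 h5 h6 h7 ntau B0 Mb0; clear; lra.
have [[ip hip] [im him]] := if_coer1 F P0 dx00.
pose cc i := (tau - dotv (b1 x0 t0 i) P - l1 x0 t0 i + eta) / dotv (b1 x0 t0 i) (g x0).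
pose S := [set cc i | i in [set i | 0 < dotv (b1 x0 t0 i) (g x0)]].
have Sip : 0 < dotv (b1 x0 t0 ip) (g x0) by exact: lt_le_trans dl0 hip.
have Sub : ubound S rs.
  by move=> _ [i /= hi <-]; rewrite /cc ler_pdivrMr.
have hsup : has_sup S.
  by split; [exists (cc ip), ip|exists rs].
(* Moving the slope by [3 kpa] changes each inequality by at most [3 kpa Mb <= eta / 2], half of the
   strictness. *)
pose kpa := Num.min 1 (eta / (6 * (Mb + 1))).
have Mb6 : 0 < 6 * (Mb + 1) by move: Mb0; clear; lra.
have kpa0 : 0 < kpa by rewrite lt_min ltr01 divr_gt0.
have kpa1 : kpa <= 1 by rewrite ge_min lexx.
have kpaM : 6 * (kpa * Mb) <= eta.
  have : kpa <= eta / (6 * (Mb + 1)) by rewrite ge_min lexx orbT.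
  by rewrite ler_pdivlMr//; move: kpa0; clear; lra.
have [_ [i0 /= bi0 <-] hi0] := sup_adherent kpa0 hsup.
set c := cc i0 in hi0.
have c_sup i : 0 < dotv (b1 x0 t0 i) (g x0) -> cc i < c + kpa.
  move=> hi; have : cc i <= sup S by apply: sup_upper_bound => //; exists i.
  by move: hi0; clear; lra.
have c_rs : c <= rs by apply: Sub; exists i0.
have rs_up : rs * dl <= (1 + Mb + Ml + eta) * (1 + B).
  have h1 := hrs im; have := ga im; rewrite ler_norml => /andP[h2 _].
  have [r0'|r0'] := leP rs 0.
    have h3 : 0 <= (1 + Mb + Ml + eta) * (1 + B).
      by apply: mulr_ge0; move: Mb0 Ml0 eta0 B0; clear; lra.
    by apply: le_trans h3; rewrite mulr_le0_ge0// ltW.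
  have h3 := ler_wpM2l (ltW r0') him.
  by move: h1 h2 h3; clear; lra.
have c_lo : - ((1 + Mb + Ml + eta) * (1 + B)) <= (c + kpa) * dl.
  have h1 := c_sup ip Sip; have := ga ip; rewrite ler_norml => /andP[h2 _].
  have h3 : cc ip * dotv (b1 x0 t0 ip) (g x0) = tau - dotv (b1 x0 t0 ip) P - l1 x0 t0 ip + eta.
    by rewrite /cc divfK// gt_eqF.
  have [r0'|r0'] := leP 0 (c + kpa).
    have h4 : 0 <= (1 + Mb + Ml + eta) * (1 + B).
      by apply: mulr_ge0; move: Mb0 Ml0 eta0 B0; clear; lra.
    by have := mulr_ge0 r0' (ltW dl0); move: h4; clear; lra.
  have h4 := ler_wnM2l (ltW r0') hip.
  have h5 := ler_wpM2r (ltW Sip) (ltW h1).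
  by move: h2 h3 h4 h5; clear; lra.
have qbound q : c - 2 * kpa <= q -> q <= rs + kpa -> `|q| <= C1 * (1 + B).
  move=> q1 q2.
  have h1 : (1 + Mb + Ml + eta) * (1 + B) = (1 + Mb + Ml + eta) / dl * (1 + B) * dl.
    by rewrite mulrAC divfK// gt_eqF.
  rewrite h1 in rs_up c_lo; rewrite -mulNr in c_lo.
  rewrite ler_pM2r// in rs_up; rewrite ler_pM2r// in c_lo.
  rewrite /C1 mulrDl ler_norml; move: q1 q2 rs_up c_lo kpa1 kpa0 B0; clear => *.
  by apply/andP; split; lra.
have Fq q i : c - 2 * kpa <= q -> q <= rs + kpa ->
    tau - dotv (b1 x0 t0 i) (P + q *: g x0) - l1 x0 t0 i <= - (eta / 2).
  move=> q1 q2; rewrite dotvDr (dotvZr q).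
  have := hbg i; rewrite ler_norml => /andP[g1 g2].
  have [bi|bi] := leP (dotv (b1 x0 t0 i) (g x0)) 0.
    have h1 := ler_wnM2r bi q2; have h2 := hrs i.
    have h3 := ler_wpM2l (ltW kpa0) g1.
    by move: h1 h2 h3 kpaM eta0; clear; lra.
  have h1 : cc i * dotv (b1 x0 t0 i) (g x0) = tau - dotv (b1 x0 t0 i) P - l1 x0 t0 i + eta.
    by rewrite /cc divfK// gt_eqF.
  have h2 : cc i - 3 * kpa <= q by have := c_sup i bi; move: q1; clear; lra.
  have h3 := ler_wpM2r (ltW bi) h2.
  have h4 := ler_wpM2l (ltW kpa0) g2.
  by move: h1 h3 h4 kpaM; clear; lra.
have [ra ra0 hra] := slope_lower (i := i0) F r10 n0 Px0 Py0 dx0 dy0 bi0 kpa0 Hmax.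
have [mb mb0 hmb] := near_pt_shrink Py0.
pose M3 := (2 * n + 2) * (1 + Mb) + Mb * (C1 * (1 + B)) * Cd + 2 * L * (B + C1 * (1 + B)).
have CB0 : 0 <= C1 * (1 + B) by apply: mulr_ge0 => //; move: B0; clear; lra.
have M30 : 0 <= M3.
  have h1 := mulr_ge0 (mulr_ge0 Mb0 CB0) Cd0.
  have h2 : 0 <= B + C1 * (1 + B) by move: CB0 B0; clear; lra.
  have h3 := mulr_ge0 L0 h2; have h4 := mulr_ge0 (ltW n0) Mb0.
  by rewrite /M3; move: h1 h3 h4 n0 Mb0; clear; lra.
have [rr rr0 [rra rrb rrl rrM]] : exists2 rr : R, 0 < rr & [/\ rr < ra, rr <= mb, 4 * rr <= rl &
    16 * (rr * M3) <= eta].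
  pose m := Num.min (Num.min ra mb) (Num.min rl (eta / (M3 + 1))).
  have M31 : 0 < M3 + 1 by move: M30; clear; lra.
  have m0 : 0 < m by rewrite !lt_min ra0 mb0 rl0 divr_gt0.
  have h1 : m <= ra by rewrite !ge_min lexx.
  have h2 : m <= mb by rewrite !ge_min lexx !orbT.
  have h3 : m <= rl by rewrite !ge_min lexx !orbT.
  have h4 : m <= eta / (M3 + 1) by rewrite !ge_min lexx !orbT.
  rewrite ler_pdivlMr// in h4.
  exists (m / 16); first by rewrite divr_gt0.
  by split; move: h1 h2 h3 h4 m0; clear; lra.
(* The slope starts at [c0 + Bc = rs + kpa] and decreases towards [c - 2 kpa], below the [c - kpa]
   granted by [slope_lower]. With [2 Bc sg = rr^2] the excess of the barrier is smaller than the
   quadratic term on the boundary of the ball. *)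
pose c0 := c - 2 * kpa; pose Bc := rs - c + 3 * kpa.
have Bc0 : 0 < Bc by rewrite /Bc; move: c_rs kpa0; clear; lra.
have rr20 : 0 < rr ^+ 2 by rewrite exprn_gt0.
pose sg := rr ^+ 2 / (2 * Bc).
have sg0 : 0 < sg by rewrite divr_gt0// mulr_gt0.
have Bsg : 2 * (Bc * sg) = rr ^+ 2.
  by rewrite mulrA (mulrC _ sg) divfK// gt_eqF// mulr_gt0.
pose quad (y : 'rV[R]_N * R) := enorm (y.1 - y0 + y.2 *: 0) ^+ 2 + (y.2 - s0) ^+ 2.
have quadE y s : quad (y, s) = enorm (y - y0) ^+ 2 + (s - s0) ^+ 2.
  by rewrite /quad /= scaler0 addr0.
pose phi y := (doubled_slice n x0 t0 y0 s0 y + (barrier c0 Bc sg \o (d \o fst)) y) + -1 * quad y.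
pose K3 := [set y : 'rV[R]_N * R | enorm (y.1 - y0) <= rr /\ `|y.2 - s0| <= rr] `&`
  [set y | ((\- d) \o fst) y <= 0].
have cK : compact K3.
  apply: compact_le0; first exact: compact_cballT.
  have cnd : continuous (\- d) by apply: continuous_lip => p q; rewrite /= -opprD normrN; exact: hdl.
  by move=> y; apply: continuous_comp; [exact: cvg_fst|exact: cnd].
have K3r1 y s : enorm (y - y0) <= rr -> `|s - s0| <= rr -> near_pt xb tb r1 y s.
  by move=> h1 h2; apply: hmb; [exact: le_trans h1 rrb|exact: le_trans h2 rrb].
have K3r0 y s : enorm (y - y0) <= rr -> `|s - s0| <= rr -> near_pt xb tb r0 y s.
  by move=> h1 h2; case: (K3r1 y s h1 h2) => k1 k2; split; [exact: lt_trans k1 r10|exact: lt_trans k2 r10].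
have qphi y s : near_pt xb tb r0 y s -> 0 <= d y ->
  qexp phi y s (((2 * n) *: (x0 - y) + barrier' c0 Bc sg (d y) *: g y) + -1 *: (2 *: (y - y0)))
   ((2 * n * (t0 - s) + 0) + -1 * (2 * (s - s0))).
  move=> Py dy; apply: qexpD.
    apply: qexpD; first exact: qexp_doubled_slice.
    have hs : 0 < sg / 2 by rewrite divr_gt0.
    have hK : 0 <= 2 * Bc / sg by rewrite divr_ge0 ?(ltW sg0)// mulr_ge0// ltW.
    have := @qexp_comp R N (barrier c0 Bc sg) (barrier' c0 Bc sg (d y)) _ _ (d \o fst) y s (g y) 0 hs hK _ (qexp_dist s (if_d F) (proj1 Py)).
    rewrite mulr0; apply => s' hs'; exact: barrier_expansion sg0 (ltW Bc0) dy hs'.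
  apply: qexpZ; apply: (qexp_eq (qexpD (qexp_sq y0 0 y s) (qexp_tsq s0 y s))) => //.
    by rewrite scaler0 !addr0.
  by rewrite dotv0r mulr0 add0r.
have uG : usc_in K3 ((\- v) \+ phi).
  refine (usc_inD _ _).
    move=> [y s] [[/= h1 h2] _] e e0.
    by apply: filterS (if_lsc F (K3r0 y s h1 h2) e0) => z + _.
  apply: qexp_usc_in => y s [[/= h1 h2] h3]; rewrite /= oppr_le0 in h3.
  by eexists; eexists; exact: qphi (K3r0 y s h1 h2) h3.
have K30 : K3 (y0, s0).
  by split; rewrite /= ?dy0 ?oppr0// !subrr enorm0 normr0; split; exact: ltW.
have [[y s] [[/= Ky Ks] Kd] ymax] := usc_in_max cK (ex_intro _ _ K30) uG.
rewrite /= oppr_le0 in Kd.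
have n1 := sqr_ge0 (enorm (y - y0)); have n2 := sqr_ge0 (s - s0).
have main : phi (y, s) - v (y, s) <= - v (y0, s0).
  rewrite leNgt; apply/negP => hlt.
  have dy : 0 < d y.
    rewrite lt_neqAle Kd andbT eq_sym; apply/eqP => dy.
    have Bz : doubled_ball xb tb r1 ((x0, t0), (y, s)).
      case: (K3r1 y s Ky Ks) => k1 k2; case: Px0 => k3 k4.
      by split; split => /=; exact: ltW.
    have h1 := doubled_slice_ge (Hmax _ Bz (etrans dx0 (esym dy))).
    have h2 : barrier c0 Bc sg (d y) = 0.
      by rewrite dy /barrier add0r mulr0 add0r expr2 mulfK ?gt_eqF// subrr mulr0.
    by move: hlt; rewrite /phi /= h2 quadE; move: h1 n1 n2; clear; lra.
  have h1 := hra y s (le_lt_trans Ky rra) (le_lt_trans Ks rra) dy.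
  have h2 := barrier_le c0 sg0 (ltW Bc0) Kd.
  have h3 : quad (y, s) < rr ^+ 2.
    move: hlt; rewrite /phi /=; move: h1 h2 Bsg (mulr_gt0 kpa0 dy) rr20; rewrite -/P -/tau -/(cc i0) -/c /c0.
    by clear; lra.
  rewrite quadE in h3.
  have Sy : enorm (y - y0) < rr.
    rewrite -(@ltr_pXn2r _ 2)// ?nnegrE ?enorm_ge0 ?(ltW rr0)//; move: h3 n2; clear; lra.
  have Ss : `|s - s0| < rr.
    rewrite -(@ltr_pXn2r _ 2)// ?nnegrE ?(ltW rr0)// real_normK ?num_real//.
    by move: h3 n1; clear; lra.
  have Py := K3r0 y s Ky Ks.
  pose q := barrier' c0 Bc sg (d y).
  have /andP[q1 q2] := barrier'_bounds c0 sg0 (ltW Bc0) Kd.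
  have q2' : q <= rs + kpa by move: q2; rewrite -/q /c0 /Bc; clear; lra.
  have jv : sup_jet v y s (((2 * n) *: (x0 - y) + q *: g y) + -1 *: (2 *: (y - y0)))
   ((2 * n * (t0 - s) + 0) + -1 * (2 * (s - s0))).
    pose r := Num.min (Num.min (rr - enorm (y - y0)) (rr - `|s - s0|)) (d y).
    have r'0 : 0 < r by rewrite !lt_min !subr_gt0 Sy Ss dy.
    apply: (min_sup_jet r'0 (qphi y s Py Kd)) => y' s'.
    rewrite !lt_min => /andP[/andP[a1 _] a3] /andP[/andP[_ a2] _].
    have Ky' : K3 (y', s').
      split; first split => /=.
      - by have := enorm_triangle y' y y0; move: a1; clear; lra.
      - by have := ler_normD (s' - s) (s - s0); rewrite addrA subrK; move: a2; clear; lra.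
      - rewrite /= oppr_le0; have := hdl y' y; rewrite ler_norml => /andP[h _].
        by move: h a3; clear; lra.
    by have := ymax _ Ky'; rewrite /=; clear; lra.
  have domy := if_dom1 F (proj1 Py) dy.
  have cly := side_cl (if_s1 F) domy.
  have [i hv] := side_super (if_s1 F) Py domy jv e16.
  have := compare_at (Fq q i q1 q2') hv (side_b (if_s1 F) i Py cly).
  have nq := qbound q q1 q2'.
  have hy0 : enorm (x0 - y) <= A + rr.
    have := enorm_triangle x0 y0 y; rewrite (enormB y0 y); have := normr_ge0 (t0 - s0).
    by move: Ky; rewrite /A; clear; lra.
  have hs0 : enorm (x0 - y) + `|t0 - s| <= A + 2 * rr.
    have := enorm_triangle x0 y0 y; rewrite (enormB y0 y).
    have := ler_normD (t0 - s0) (s0 - s); rewrite addrA subrK (distrC s0 s).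
    by move: Ky Ks; rewrite /A; clear; lra.
  have E1 : `|tau - ((2 * n * (t0 - s) + 0) + -1 * (2 * (s - s0)))| <= (2 * n + 2) * rr.
    have -> : tau - ((2 * n * (t0 - s) + 0) + -1 * (2 * (s - s0))) = (2 * n + 2) * (s - s0).
      by rewrite /tau; ring.
    have n22 : 0 <= 2 * n + 2 by move: n0; clear; lra.
    by rewrite normrM ger0_norm// ler_wpM2l.
  have E2 : enorm (P + q *: g x0 - ((2 * n) *: (x0 - y) + q *: g y + -1 *: (2 *: (y - y0)))) <=
      (2 * n + 2) * rr + C1 * (1 + B) * Cd * (A + rr).
    have -> : P + q *: g x0 - ((2 * n) *: (x0 - y) + q *: g y + -1 *: (2 *: (y - y0))) =
      (2 * n + 2) *: (y - y0) + q *: (g x0 - g y).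
      by apply/rowP => j; rewrite /P !mxE; ring.
    apply: le_trans (enormD _ _) _; rewrite !enormZ; apply: lerD.
      have n22 : 0 <= 2 * n + 2 by move: n0; clear; lra.
      by rewrite ger0_norm// ler_wpM2l.
    rewrite -mulrA; apply: ler_pM => //; first exact: enorm_ge0.
    apply: le_trans (dist_glip (if_d F) (proj1 P0) (proj1 Py)) _.
    by rewrite ler_wpM2l.
  have E3 : enorm (P + q *: g x0) <= B + C1 * (1 + B).
    apply: le_trans (enormD _ _) _; apply: lerD => //; rewrite enormZ.
    rewrite -[leRHS]mulr1.
    exact: ler_pM (normr_ge0 _) (enorm_ge0 _) nq (dist_g1 (if_d F) (proj1 P0)).
  have E4 : enorm (b1 x0 t0 i - b1 y s i) <= L * (A + 2 * rr).
    by apply: le_trans (side_blip (if_s1 F) i P0 Py cl0 cly) _; rewrite ler_wpM2l.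
  have E5 : `|l1 x0 t0 i - l1 y s i| <= eta / 16.
    apply: hrl => //; apply: le_lt_trans hs0 _.
    by move: AK kap1 rrl; clear; lra.
  have E6 := ler_pM (enorm_ge0 _) (enorm_ge0 _) E4 E3.
  have E7 := ler_wpM2l Mb0 E2.
  have E8 : C2 * (A * (1 + B)) <= eta / 16.
    have C21 : 0 < 16 * (C2 + 1) by move: C20; clear; lra.
    move: kap2; rewrite ltr_pdivlMr// -AB.
    have := mulr_ge0 A0 (_ : 0 <= 1 + B).
    have -> : 0 <= 1 + B by move: B0; clear; lra.
    by move=> /(_ isT); clear; lra.
  have E9 := mulr_ge0 L0 A0; have E10 := mulr_ge0 E9 CB0.
  move: E1 E5 E6 E7 E8 rrM eta0 E9; rewrite /C2 /M3; clear; lra.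
(* For [d y] below [kpa sg / Bc] the barrier has lost at most [kpa] of its initial slope
   [rs + kpa]. *)
pose r := Num.min rr (kpa * sg / Bc).
have r'0 : 0 < r by rewrite lt_min rr0 divr_gt0// mulr_gt0.
exists r => // y' s'; rewrite !lt_min => /andP[hy1 hy2] /andP[hs1 _] dy'.
have Ky' : K3 (y', s').
  split; first by split => /=; exact: ltW.
  by rewrite /= oppr_le0 ltW.
have h1 := ymax _ Ky'; rewrite /= {1}/phi /= quadE in h1.
have kB : kpa <= Bc by rewrite /Bc; move: c_rs kpa0; clear; lra.
have h2 : d y' * Bc <= kpa * sg.
  rewrite -ler_pdivlMr//; apply: le_trans (ltW hy2).
  by have := hdl y' y0; rewrite dy0 subr0; apply: le_trans; exact: ler_norm.
have h3 := barrier_ge c0 sg0 kpa0 kB (ltW dy') h2.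
rewrite (_ : c0 + Bc - kpa = rs) in h3; last by rewrite /c0 /Bc; ring.
by move: h1 h3 main; clear; lra.
Qed.

(* [r] is the supremum over [h1 > 0] of [f1 / h1]. Mixtures with [h = 0] of controls of
   different sides are covered by the last hypothesis, those of one side by convexity. *)
Lemma common_slope (R : realType) (I1 I2 : Type) (f1 h1 : I1 -> R) (f2 h2 : I2 -> R) (dl : R) :
  0 < dl ->
  (exists i, dl <= h1 i) -> (exists i, h1 i <= - dl) ->
  (exists i, dl <= h2 i) ->
  (forall i j (m : R), 0 <= m <= 1 ->
    exists k, h1 k = m * h1 i + (1 - m) * h1 j /\ f1 k = m * f1 i + (1 - m) * f1 j) ->
  (forall i j (m : R), 0 <= m <= 1 ->
    exists k, h2 k = m * h2 i + (1 - m) * h2 j /\ f2 k = m * f2 i + (1 - m) * f2 j) ->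
  (forall i j (m : R), 0 <= m <= 1 -> m * h1 i + (1 - m) * h2 j = 0 ->
    m * f1 i + (1 - m) * f2 j <= 0) ->
  exists r, (forall i, f1 i <= r * h1 i) /\ (forall j, f2 j <= r * h2 j).
Proof.
move=> dl0 [ip hip] [im him] [jp hjp] conv1 conv2 mix.
have z1 i : h1 i = 0 -> f1 i <= 0.
  move=> hi; have := mix i jp 1; rewrite ler01 lexx hi subrr !mul0r mulr0 addr0 mul1r addr0.
  by apply.
have z2 j : h2 j = 0 -> f2 j <= 0.
  move=> hj; have := mix ip j 0; rewrite ler01 lexx hj subr0 !mul0r !mulr0 addr0 mul1r add0r.
  by apply.
pose f (a : I1 + I2) := match a with inl i => f1 i | inr j => f2 j end.
pose h (a : I1 + I2) := match a with inl i => h1 i | inr j => h2 j end.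
have z a : h a = 0 -> f a <= 0 by case: a => [i|j] /=; [exact: z1|exact: z2].
(* With weights that cancel the normal component the combination is nonpositive; multiplied by
   [h a - h b], this says that each lower bound on [r] is below each upper bound. *)
have pair a b : 0 < h a -> h b < 0 -> f a * - h b + f b * h a <= 0.
  move=> ha hb; have D : 0 < h a - h b by move: ha hb; clear; lra.
  have [m [mD m0 m1]] : exists m, [/\ m * (h a - h b) = - h b, 0 <= m & m <= 1].
    exists (- h b / (h a - h b)); split; first by rewrite divfK// gt_eqF.
      by rewrite divr_ge0 ?oppr_ge0 ?ltW.
    by rewrite ler_pdivrMr//; move: ha; clear; lra.
  have m01 : 0 <= m <= 1 by rewrite m0.
  have n01 : 0 <= 1 - m <= 1 by move: m0 m1; clear => *; apply/andP; split; lra.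
  have nm : 1 - (1 - m) = m by ring.
  have hz : m * h a + (1 - m) * h b = 0 by move: mD; clear; lra.
  have hz' : (1 - m) * h b + m * h a = 0 by move: mD; clear; lra.
  suff : m * f a + (1 - m) * f b <= 0.
    move=> H; have := ler_wpM2r (ltW D) H; rewrite mul0r mulrDl.
    rewrite (mulrAC m) (mulrAC (1 - m)) mD mulrBl mul1r mD; clear; lra.
  case: a b ha hb D mD m0 m1 m01 n01 nm hz hz' => [i|i] [j|j] /= ha hb D mD m0 m1 m01 n01 nm hz hz'.
  - have [k [hk <-]] := conv1 i j m m01; apply: z1; by rewrite hk.
  - exact: mix.
  - have := mix j i (1 - m) n01; rewrite nm => /(_ hz'); clear; lra.
  - have [k [hk <-]] := conv2 i j m m01; apply: z2; by rewrite hk.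
pose S := [set f a / h a | a in [set a | 0 < h a]].
have hp : 0 < h (inl ip) by exact: lt_le_trans dl0 hip.
have hm : h (inl im) < 0 by apply: le_lt_trans him _; rewrite oppr_lt0.
have Sub b : h b < 0 -> ubound S (f b / h b).
  move=> hb _ [a /= ha <-]; rewrite ler_ndivlMr// mulrAC ler_pdivlMr//.
  have := pair a b ha hb; clear; lra.
have hsup : has_sup S by split; [exists (f (inl ip) / h (inl ip)), (inl ip)|exists (f (inl im) / h (inl im)); exact: Sub].
have key a : f a <= sup S * h a.
  have [ha|ha|ha] := ltgtP (h a) 0.
  - rewrite -ler_ndivlMr//; apply: sup_le_ub; [by case: hsup|exact: Sub].
  - rewrite -ler_pdivrMr//; apply: sup_upper_bound => //; by exists a.
  - by rewrite ha mulr0; exact: z.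
by exists (sup S); split => i; [exact: (key (inl i))|exact: (key (inr i))].
Qed.

Lemma interface_absurd (R : realType) (N : nat) (I1 I2 : Type)
    (b1 : 'rV[R]_N -> R -> I1 -> 'rV[R]_N) (l1 : 'rV[R]_N -> R -> I1 -> R)
    (b2 : 'rV[R]_N -> R -> I2 -> 'rV[R]_N) (l2 : 'rV[R]_N -> R -> I2 -> R)
    (dom1 dom2 cl1 cl2 : set 'rV[R]_N) (w v : 'rV[R]_N * R -> R) (xb : 'rV[R]_N)
    (tb r0 eta Mb Ml L : R) (d : 'rV[R]_N -> R) (g : 'rV[R]_N -> 'rV[R]_N) (Cd dl : R) :
  iface b1 l1 b2 l2 dom1 dom2 cl1 cl2 w v xb tb r0 eta Mb Ml L d g Cd dl ->
  (forall x t p a, near_pt xb tb r0 x t -> d x = 0 -> sup_jet v x t p a ->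
    forall e : R, 0 < e -> (exists i, - e <= a - dotv (b1 x t i) p - l1 x t i) \/
      (exists i, - e <= a - dotv (b2 x t i) p - l2 x t i)) ->
  (forall x t p a, near_pt xb tb r0 x t -> d x = 0 -> sub_jet [set x | d x = 0] w x t p a ->
    forall i j (m : R), 0 <= m <= 1 -> dotv (m *: b1 x t i + (1 - m) *: b2 x t j) (g x) = 0 ->
    a - dotv (m *: b1 x t i + (1 - m) *: b2 x t j) p - (m * l1 x t i + (1 - m) * l2 x t j) <= - eta) ->
  (forall x t i j (m : R), near_pt xb tb r0 x t -> d x = 0 -> 0 <= m <= 1 -> exists k,
     b1 x t k = m *: b1 x t i + (1 - m) *: b1 x t j /\ l1 x t k = m * l1 x t i + (1 - m) * l1 x t j) ->
  (forall x t i j (m : R), near_pt xb tb r0 x t -> d x = 0 -> 0 <= m <= 1 -> exists k,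
     b2 x t k = m *: b2 x t i + (1 - m) *: b2 x t j /\ l2 x t k = m * l2 x t i + (1 - m) * l2 x t j) ->
  exists2 k0 : R, 0 < k0 &
  forall (n r1 : R) (x0 : 'rV[R]_N) (t0 : R) (y0 : 'rV[R]_N) (s0 : R),
  r1 < r0 -> 0 < n -> near_pt xb tb r1 x0 t0 -> near_pt xb tb r1 y0 s0 ->
  d x0 = 0 -> d y0 = 0 -> doubling_scale n x0 t0 y0 s0 < k0 ->
  ~ (forall z, doubled_ball xb tb r1 z -> d z.1.1 = d z.2.1 ->
    doubled w v n z <= doubled w v n ((x0, t0), (y0, s0))).
Proof.
move=> F super tan conv1 conv2.
have [ka ka0 hka] := side_lower F.
have [kb kb0 hkb] := side_lower (iface_swap F).
have Mb0 := side_Mb (if_s1 F); have Ml0 := side_Ml (if_s1 F); have L0 := side_L (if_s1 F).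
have Cd0 := dist_Cd (if_d F).
have dl0 := if_dl F; have eta0 := side_eta (if_s1 F).
have e8 : 0 < eta / 8 by rewrite divr_gt0.
have [rl rl0 hrl] := side_lcont (if_s1 F) e8.
have [rl' rl'0 hrl'] := side_lcont (if_s2 F) e8.
pose C1 : R := (1 + Mb + Ml + eta) / dl.
have C10 : 0 <= C1.
  by apply: divr_ge0; move: dl0 Mb0 Ml0 eta0; clear; lra.
pose C2 : R := Mb * C1 * Cd + L * (1 + C1).
have C20 : 0 <= C2.
  have h : 0 <= 1 + C1 by move: C10; clear; lra.
  have h1 := mulr_ge0 L0 h.
  by have := mulr_ge0 (mulr_ge0 Mb0 C10) Cd0; rewrite /C2; move: h1; clear; lra.
exists (Num.min (Num.min ka kb) (Num.min (Num.min rl rl') (eta / (8 * (C2 + 1))))).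
  by rewrite !lt_min ka0 kb0 rl0 rl'0 divr_gt0// mulr_gt0// ltr_wpDl.
move=> n r1 x0 t0 y0 s0 r10 n0 Px0 Py0 dx0 dy0.
rewrite !lt_min => /andP[/andP[kapa kapb] /andP[/andP[kapl kapl'] kapC]] Hmax.
have P0 : near_pt xb tb r0 x0 t0.
  by case: Px0 => p1 p2; split; [exact: lt_trans p1 r10|exact: lt_trans p2 r10].
have Q0 : near_pt xb tb r0 y0 s0.
  by case: Py0 => p1 p2; split; [exact: lt_trans p1 r10|exact: lt_trans p2 r10].
have cx1 : cl1 x0 by apply: (if_cl1 F (proj1 P0)); rewrite dx0.
have cx2 : cl2 x0 by apply: (if_cl2 F (proj1 P0)); rewrite dx0.
have cy1 : cl1 y0 by apply: (if_cl1 F (proj1 Q0)); rewrite dy0.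
have cy2 : cl2 y0 by apply: (if_cl2 F (proj1 Q0)); rewrite dy0.
pose P := (2 * n) *: (x0 - y0); pose tau := 2 * n * (t0 - s0).
(* Only points with [d x = d y0 = 0] may be compared, so that [w] gets a jet along the interface and
   not a full one. *)
have jw : sub_jet [set x | d x = 0] w x0 t0 P tau.
  pose phi (y : 'rV[R]_N * R) := n * (enorm (y.1 - y0 + y.2 *: 0) ^+ 2 + (y.2 - s0) ^+ 2).
  have [ra ra0 hra] := near_pt_shrink Px0.
  have qphi : qexp phi x0 t0 P tau.
    apply: (qexp_eq (qexpZ n (qexpD (qexp_sq y0 0 x0 t0) (qexp_tsq s0 x0 t0)))) => //.
      by apply/rowP => j; rewrite /P !mxE; ring.
    by rewrite dotv0r /tau; ring.
  apply: (max_sub_jet ra0 qphi) => x' t' /= dx' hx ht.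
  have Bz : doubled_ball xb tb r1 ((x', t'), (y0, s0)).
    case: (hra x' t' (ltW hx) (ltW ht)) => k1 k2; case: Py0 => k3 k4.
    by split; split => /=; exact: ltW.
  have := Hmax _ Bz (etrans dx' (esym dy0)); rewrite /doubled /phi /= !scaler0 !addr0.
  by clear; lra.
have [[ip hip] [im him]] := if_coer1 F P0 (eq_ind_r (fun z => 0 <= z) (lexx 0) dx0).
have [[jp hjp] [jm hjm]] := if_coer2 F P0 (eq_ind_r (fun z => z <= 0) (lexx 0) dx0).
(* Here [f] is the left-hand side of the strict inequality at slope [P], and [h] the normal
   component of the drift. Convexity of the control sets settles pairs from one side, the tangential
   inequality pairs from both sides. *)
have [rs [hrs1 hrs2]] : exists rs,
   (forall i, tau - dotv (b1 x0 t0 i) P - l1 x0 t0 i + eta <= rs * dotv (b1 x0 t0 i) (g x0)) /\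
   (forall i, tau - dotv (b2 x0 t0 i) P - l2 x0 t0 i + eta <= rs * dotv (b2 x0 t0 i) (g x0)).
  apply: (@common_slope R I1 I2 _ _ _ _ dl) => //.
  - by exists ip.
  - by exists im.
  - by exists jp.
  - move=> i j m m01; have [k [hb hl]] := conv1 x0 t0 i j m P0 dx0 m01.
    by exists k; rewrite hb hl !dotvDl !dotvZl; split => //; ring.
  - move=> i j m m01; have [k [hb hl]] := conv2 x0 t0 i j m P0 dx0 m01.
    by exists k; rewrite hb hl !dotvDl !dotvZl; split => //; ring.
  - move=> i j m m01; have := tan x0 t0 P tau P0 dx0 jw i j m m01.
    rewrite !dotvDl !dotvZl => h1 h2; have := h1 h2; clear; lra.
have [r_1 r_10 h_1] := hka n r1 x0 t0 y0 s0 rs r10 n0 Px0 Py0 dx0 dy0 kapa Hmax hrs1.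
have [r_2 r_20 h_2] : exists2 r, 0 < r & forall y s, enorm (y - y0) < r -> `|s - s0| < r -> 0 < (\- d) y ->
    v (y0, s0) + doubled_slice n x0 t0 y0 s0 (y, s) + - rs * (\- d) y
      - (enorm (y - y0) ^+ 2 + (s - s0) ^+ 2) <= v (y, s).
  apply: (hkb n r1 x0 t0 y0 s0 (- rs) r10 n0 Px0 Py0 _ _ kapb).
  - by rewrite /= dx0 oppr0.
  - by rewrite /= dy0 oppr0.
  - by move=> z Bz /= /oppr_inj dz; exact: Hmax.
  - by move=> i /=; rewrite dotvNr mulrNN; exact: hrs2.
have [mb mb0 hmb] := near_pt_shrink Py0.
pose quad (y : 'rV[R]_N * R) := enorm (y.1 - y0 + y.2 *: 0) ^+ 2 + (y.2 - s0) ^+ 2.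
pose phi y := (doubled_slice n x0 t0 y0 s0 y + rs * (d \o fst) y) + -1 * quad y.
have qphi := qexpD (qexpD (qexp_doubled_slice n x0 t0 y0 s0 y0 s0) (qexpZ rs (qexp_dist s0 (if_d F) (proj1 Q0))))
  (qexpZ (-1) (qexpD (qexp_sq y0 0 y0 s0) (qexp_tsq s0 y0 s0))).
have psi0 : doubled_slice n x0 t0 y0 s0 (y0, s0) = 0 by rewrite /doubled_slice /=; ring.
(* One function bounds [v] from below for [d > 0], for [d < 0] and on the interface; the quadratic
   loss in [side_lower] goes into the remainder of the jet. *)
have jv : sup_jet v y0 s0 (P + rs *: g y0) tau.
  have r'0 : 0 < Num.min (Num.min r_1 r_2) mb by rewrite !lt_min r_10 r_20.
  have {}qphi : qexp phi y0 s0 (P + rs *: g y0) tau.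
    apply: (qexp_eq qphi) => //.
      by apply/rowP => j; rewrite /P !mxE; ring.
    by rewrite dotv0r /tau; ring.
  have phi0 : phi (y0, s0) = 0.
    rewrite /phi psi0 /quad /= scaler0 addr0 !subrr enorm0 expr0n /= addr0 mulr0 dy0 mulr0.
    by rewrite !addr0.
  apply: (min_sup_jet r'0 qphi) => y s; rewrite !lt_min => /andP[/andP[a1 a2] a3] /andP[/andP[c1 c2] c3].
  rewrite phi0 /phi /quad /= scaler0 addr0.
  have n1 := sqr_ge0 (enorm (y - y0)); have n2 := sqr_ge0 (s - s0).
  have [dy|dy|dy] := ltgtP (d y) 0.
  - have := h_2 y s a2 c2; rewrite /= oppr_gt0 => /(_ dy); clear; lra.
  - have := h_1 y s a1 c1 dy; clear; lra.
  - have Bz : doubled_ball xb tb r1 ((x0, t0), (y, s)).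
      case: (hmb y s (ltW a3) (ltW c3)) => k1 k2; case: Px0 => k3 k4.
      by split; split => /=; exact: ltW.
    have h1 := doubled_slice_ge (Hmax _ Bz (etrans dx0 (esym dy))).
    by rewrite dy; move: h1 n1 n2; clear; lra.
have [[A0 B0 AB AK] [B1 B2]] := doubling_scaleE x0 t0 y0 s0 n0.
set A := enorm (x0 - y0) + `|t0 - s0| in A0 B0 AB AK B1 B2.
set B := 2 * n * A in B0 AB B1 B2.
have nP : enorm P <= B.
  by rewrite enormZ ger0_norm ?mulr_ge0 ?(ltW n0)//; move: B1; clear; lra.
have ntau : `|tau| <= B.
  by rewrite normrM ger0_norm ?mulr_ge0 ?(ltW n0)//; move: B2; clear; lra.
have ga i : `|tau - dotv (b1 x0 t0 i) P - l1 x0 t0 i + eta| <= (1 + Mb + Ml + eta) * (1 + B).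
  have h1 := dotv_abs (b1 x0 t0 i) P.
  have h2 := ler_pM (enorm_ge0 _) (enorm_ge0 _) (side_b (if_s1 F) i P0 cx1) nP.
  have h3 := ler_normD (tau - dotv (b1 x0 t0 i) P - l1 x0 t0 i) eta.
  have h4 := ler_normB (tau - dotv (b1 x0 t0 i) P) (l1 x0 t0 i).
  have h5 := ler_normB tau (dotv (b1 x0 t0 i) P).
  rewrite (gtr0_norm eta0) in h3.
  have h6 := mulr_ge0 Ml0 B0; have h7 := mulr_ge0 (ltW eta0) B0.
  by move: (side_l (if_s1 F) i P0 cx1) h1 h2 h3 h4 h5 h6 h7 ntau B0 Mb0; clear; lra.
(* Coercivity bounds [rs] by the doubling slope, so that exchanging [g x0] for [g y0] costs no more
   than a multiple of [doubling_scale]. *)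
have nrs : `|rs| <= C1 * (1 + B).
  rewrite /C1 mulrAC ler_pdivlMr//.
  have [r0'|r0'] := leP 0 rs.
    have := ga im; rewrite ler_norml => /andP[h2 _].
    rewrite ger0_norm//; have := hrs1 im; have := ler_wpM2l r0' him; move: h2; clear; lra.
  have := ga ip; rewrite ler_norml => /andP[h2 _].
  rewrite ltr0_norm//; have := hrs1 ip; have := ler_wnM2l (ltW r0') hip; move: h2; clear; lra.
have E2 : enorm (P + rs *: g x0 - (P + rs *: g y0)) <= C1 * (1 + B) * Cd * A.
  have -> : P + rs *: g x0 - (P + rs *: g y0) = rs *: (g x0 - g y0).
    by apply/rowP => j; rewrite !mxE; ring.
  rewrite enormZ -mulrA; apply: ler_pM => //; first exact: enorm_ge0.
  apply: le_trans (dist_glip (if_d F) (proj1 P0) (proj1 Q0)) _.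
  by rewrite ler_wpM2l// /A lerDl.
have E3 : enorm (P + rs *: g x0) <= B + C1 * (1 + B).
  apply: le_trans (enormD _ _) _; apply: lerD => //; rewrite enormZ -[leRHS]mulr1.
  exact: ler_pM (normr_ge0 _) (enorm_ge0 _) nrs (dist_g1 (if_d F) (proj1 P0)).
have E7 := ler_wpM2l Mb0 E2.
have E8 : C2 * (A * (1 + B)) <= eta / 8.
  have C21 : 0 < 8 * (C2 + 1) by move: C20; clear; lra.
  move: kapC; rewrite ltr_pdivlMr// -AB.
  have B1' : 0 <= 1 + B by move: B0; clear; lra.
  by have := mulr_ge0 A0 B1'; clear; lra.
have E9 := mulr_ge0 L0 A0.
have final (bb bb' : 'rV[R]_N) (ll ll' : R) : enorm bb' <= Mb ->
    enorm (bb - bb') <= L * A -> `|ll - ll'| <= eta / 8 ->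
    tau - dotv bb P - ll + eta <= rs * dotv bb (g x0) ->
    - (eta / 8) <= tau - dotv bb' (P + rs *: g y0) - ll' -> False.
  move=> hb E4 E5 h1 h2.
  have h3 : tau - dotv bb (P + rs *: g x0) - ll <= - eta.
    by rewrite dotvDr (dotvZr rs); move: h1; clear; lra.
  have := compare_at h3 h2 hb; rewrite subrr normr0.
  have E6 := ler_pM (enorm_ge0 _) (enorm_ge0 _) E4 E3.
  move: E5 E6 E7 E8 E9 eta0; rewrite /C2; clear; lra.
have [[i hi]|[i hi]] := super y0 s0 _ _ Q0 dy0 jv _ e8.
- exact: (final _ _ _ _ (side_b (if_s1 F) i Q0 cy1) (side_blip (if_s1 F) i P0 Q0 cx1 cy1)
    (hrl _ _ _ _ i P0 Q0 cx1 cy1 (le_lt_trans AK kapl)) (hrs1 i) hi).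
- exact: (final _ _ _ _ (side_b (if_s2 F) i Q0 cy2) (side_blip (if_s2 F) i P0 Q0 cx2 cy2)
    (hrl' _ _ _ _ i P0 Q0 cx2 cy2 (le_lt_trans AK kapl')) (hrs2 i) hi).
Qed.

(** * Doubling of variables *)

(** The diagonal satisfies the constraint and the hypothesis gives a strict maximum on it, so that
    [penalty_localizes] applies on the compact set of constrained pairs. *)
Lemma doubling_points (R : realType) (N : nat) (w v : 'rV[R]_N * R -> R) (xb : 'rV[R]_N)
    (tb r0 : R) (d : 'rV[R]_N -> R) (k0 : R) :
  0 < r0 -> (forall x y, `|d x - d y| <= enorm (x - y)) ->
  locally_usc (near_pt xb tb r0) w -> locally_usc (near_pt xb tb r0) (\- v) ->
  (forall x t, near_pt xb tb r0 x t -> (x, t) <> (xb, tb) ->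
    w (x, t) - v (x, t) < w (xb, tb) - v (xb, tb)) -> 0 < k0 ->
  exists n r1 x0 t0 y0 s0, [/\ r1 < r0, 0 < n, near_pt xb tb r1 x0 t0, near_pt xb tb r1 y0 s0 &
    [/\ d x0 = d y0, doubling_scale n x0 t0 y0 s0 < k0 &
    forall z, doubled_ball xb tb r1 z -> d z.1.1 = d z.2.1 ->
      doubled w v n z <= doubled w v n ((x0, t0), (y0, s0))]].
Proof.
move=> r00 hdl wusc vlsc strict k00.
pose r1 := r0 / 2.
have r10 : 0 < r1 by rewrite divr_gt0.
have r1r0 : r1 < r0 by rewrite /r1; move: r00; clear; lra.
pose Z := ((xb, tb), (xb, tb)).
have [c11 [c12 [c21 c22]]] : continuous (fun z : ('rV[R]_N * R) * ('rV[R]_N * R) => z.1.1) /\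
  continuous (fun z : ('rV[R]_N * R) * ('rV[R]_N * R) => z.1.2) /\
  continuous (fun z : ('rV[R]_N * R) * ('rV[R]_N * R) => z.2.1) /\
  continuous (fun z : ('rV[R]_N * R) * ('rV[R]_N * R) => z.2.2).
  have cfst : continuous (fun z : ('rV[R]_N * R) * ('rV[R]_N * R) => z.1) by move=> z; exact: cvg_fst.
  have csnd : continuous (fun z : ('rV[R]_N * R) * ('rV[R]_N * R) => z.2) by move=> z; exact: cvg_snd.
  split; first by move=> z; apply: (continuous_comp (cfst z)); exact: cvg_fst.
  split; first by move=> z; apply: (continuous_comp (cfst z)); exact: cvg_snd.
  split; first by move=> z; apply: (continuous_comp (csnd z)); exact: cvg_fst.
  by move=> z; apply: (continuous_comp (csnd z)); exact: cvg_snd.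
pose dd (z : ('rV[R]_N * R) * ('rV[R]_N * R)) := (d z.1.1 - d z.2.1) ^+ 2.
have cdd : continuous dd.
  have cd : continuous d by exact: continuous_lip.
  have c1 : continuous (fun z : ('rV[R]_N * R) * ('rV[R]_N * R) => d z.1.1).
    by move=> z'; apply: (continuous_comp (c11 z')); exact: cd.
  have c2 : continuous (fun z : ('rV[R]_N * R) * ('rV[R]_N * R) => d z.2.1).
    by move=> z'; apply: (continuous_comp (c21 z')); exact: cd.
  exact: (continuous_sqr c1 c2).
pose K := doubled_ball xb tb r1 `&` [set z | dd z <= 0].
have cK : compact K.
  by apply: compact_le0 => //; apply: compact_setX; exact: compact_cballT.
have dd0 z : dd z <= 0 -> d z.1.1 = d z.2.1.
  move=> h; apply/eqP; rewrite -subr_eq0 -sqrf_eq0 eq_le; apply/andP; split => //; exact: sqr_ge0.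
pose G (z : ('rV[R]_N * R) * ('rV[R]_N * R)) := enorm (z.1.1 - z.2.1) ^+ 2 + (z.1.2 - z.2.2) ^+ 2.
have uF : usc_in K (doubled w v 0).
  move=> z [Bz _] e e0.
  by apply: filterS (usc_doubled 0 wusc vlsc r1r0 Bz e0) => z' h [Bz' _]; exact: h.
have uG : usc_in K (\- G).
  apply: cont_usc_in => z; apply: cvgN; apply: cvgD.
    exact: (continuous_sqd c11 c21).
  exact: (continuous_sqr c12 c22).
have KZ : K Z.
  by split; [split; split; rewrite /= subrr ?enorm0 ?normr0 ltW|rewrite /= /dd /= subrr expr0n].
have GZ : G Z = 0 by rewrite /G /= !subrr enorm0 expr0n /= addr0.
have G0 z : K z -> 0 <= G z by move=> _; rewrite addr_ge0 ?sqr_ge0.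
have st z : K z -> G z = 0 -> z <> Z -> doubled w v 0 z < doubled w v 0 Z.
  move: z => [[x t] [y s]] [[[/= h1 h2] _] _] /eqP.
  rewrite paddr_eq0 ?sqr_ge0// !sqrf_eq0 => /andP[/eqP/enorm_eq0/eqP].
  rewrite /= !subr_eq0 => /eqP <- /eqP <- zZ.
  rewrite /doubled /= !mul0r !subr0; apply: strict.
    by split; [exact: le_lt_trans h1 r1r0|exact: le_lt_trans h2 r1r0].
  by move=> h; apply: zZ; rewrite h.
(* [A <= 4 rho <= k0 / 4], and [A^2 <= 2 G] with [n G <= k0 / 16], give [A + 2 n A^2 <= k0 / 2] for
   the sum [A] of the two distances. *)
pose rho := Num.min r1 (k0 / 16).
have rho0 : 0 < rho by rewrite lt_min r10 divr_gt0.
have rho1 : rho <= r1 by rewrite ge_min lexx.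
have rho2 : rho <= k0 / 16 by rewrite ge_min lexx orbT.
have e0 : 0 < k0 / 16 by rewrite divr_gt0.
have OZ := near_quad (near_eball xb rho0) (near_rball tb rho0) (near_eball xb rho0) (near_rball tb rho0).
have [n [[[x0 t0] [y0 s0]] [n0 [Kz Kd] [/= O1 O2 O3 O4] nG zmax]]] :=
  penalty_localizes cK uF uG G0 KZ GZ st OZ e0.
exists n%:R, r1, x0, t0, y0, s0; split => //.
- by rewrite ltr0n.
- by split; [exact: lt_le_trans O1 rho1|exact: lt_le_trans O2 rho1].
- by split; [exact: lt_le_trans O3 rho1|exact: lt_le_trans O4 rho1].
split; first exact: dd0 Kd.
  have h1 := enorm_triangle x0 xb y0; rewrite (enormB xb y0) in h1.
  have h2 := ler_normD (t0 - tb) (tb - s0); rewrite addrA subrK (distrC tb s0) in h2.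
  rewrite /doubling_scale; set A := enorm (x0 - y0) + `|t0 - s0|.
  have hA : A <= 4 * rho by rewrite /A; move: h1 h2 O1 O2 O3 O4; clear; lra.
  have hA2 : A ^+ 2 <= 2 * G ((x0, t0), (y0, s0)).
    rewrite /G /A /= -(real_normK (num_real (t0 - s0))).
    by have := sqr_ge0 (enorm (x0 - y0) - `|t0 - s0|); clear; lra.
  have := ler_wpM2l (ler0n R n) hA2; move: nG hA rho2 k00; clear; lra.
move=> z Bz dz; have Kz' : K z by split => //; rewrite /= /dd dz subrr expr0n.
by have := zmax z Kz'; rewrite /doubled /G /=; clear; lra.
Qed.

Lemma interior_no_max (R : realType) (N : nat) (I : Type) (b : 'rV[R]_N -> R -> I -> 'rV[R]_N)
  (l : 'rV[R]_N -> R -> I -> R) (dom cl : set 'rV[R]_N) (w v : 'rV[R]_N * R -> R)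
  (xb : 'rV[R]_N) (tb r0 eta Mb Ml L : R) :
  side_hyp b l dom cl w v (near_pt xb tb r0) eta Mb Ml L ->
  open dom -> 0 < r0 -> (forall x, enorm (x - xb) < r0 -> dom x) ->
  locally_usc (near_pt xb tb r0) w -> locally_usc (near_pt xb tb r0) (\- v) ->
  ~ (forall x t, near_pt xb tb r0 x t -> (x, t) <> (xb, tb) ->
    w (x, t) - v (x, t) < w (xb, tb) - v (xb, tb)).
Proof.
move=> S odom r00 hdom wusc vlsc strict.
(* With [d = 0] the constraint is void: this is unconstrained doubling. *)
pose d (x : 'rV[R]_N) : R := 0; pose g (x : 'rV[R]_N) : 'rV[R]_N := 0.
have Dh : dist_hyp d g (fun x => enorm (x - xb) < r0) 0.
  split => //.
  - by move=> x y; rewrite subrr normr0 enorm_ge0.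
  - by move=> x y _ _; rewrite dotv0l !subrr normr0 mul0r.
  - by move=> x y _ _; rewrite subrr enorm0 mul0r.
  - by move=> x _; rewrite enorm0.
have [k0 k00 hk] := interior_absurd S Dh odom ltr01 (or_introl (fun x => erefl)) wusc vlsc.
have [n [r1 [x0 [t0 [y0 [s0 [r10 n0 P1 P2 [d12 kp Hmax]]]]]]]] :=
  doubling_points r00 (dist_lip Dh) wusc vlsc strict k00.
apply: (hk n r1 x0 t0 y0 s0) => //; apply: hdom.
  exact: lt_trans (proj1 P1) r10.
exact: lt_trans (proj1 P2) r10.
Qed.

Lemma interface_no_max (R : realType) (N : nat) (I1 I2 : Type)
    (b1 : 'rV[R]_N -> R -> I1 -> 'rV[R]_N) (l1 : 'rV[R]_N -> R -> I1 -> R)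
    (b2 : 'rV[R]_N -> R -> I2 -> 'rV[R]_N) (l2 : 'rV[R]_N -> R -> I2 -> R)
    (dom1 dom2 cl1 cl2 : set 'rV[R]_N) (w v : 'rV[R]_N * R -> R) (xb : 'rV[R]_N)
    (tb r0 eta Mb Ml L : R) (d : 'rV[R]_N -> R) (g : 'rV[R]_N -> 'rV[R]_N) (Cd dl : R) :
  iface b1 l1 b2 l2 dom1 dom2 cl1 cl2 w v xb tb r0 eta Mb Ml L d g Cd dl ->
  (forall x t p a, near_pt xb tb r0 x t -> d x = 0 -> sup_jet v x t p a ->
    forall e : R, 0 < e -> (exists i, - e <= a - dotv (b1 x t i) p - l1 x t i) \/
      (exists i, - e <= a - dotv (b2 x t i) p - l2 x t i)) ->
  (forall x t p a, near_pt xb tb r0 x t -> d x = 0 -> sub_jet [set x | d x = 0] w x t p a ->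
    forall i j (m : R), 0 <= m <= 1 -> dotv (m *: b1 x t i + (1 - m) *: b2 x t j) (g x) = 0 ->
    a - dotv (m *: b1 x t i + (1 - m) *: b2 x t j) p - (m * l1 x t i + (1 - m) * l2 x t j) <= - eta) ->
  (forall x t i j (m : R), near_pt xb tb r0 x t -> d x = 0 -> 0 <= m <= 1 -> exists k,
     b1 x t k = m *: b1 x t i + (1 - m) *: b1 x t j /\ l1 x t k = m * l1 x t i + (1 - m) * l1 x t j) ->
  (forall x t i j (m : R), near_pt xb tb r0 x t -> d x = 0 -> 0 <= m <= 1 -> exists k,
     b2 x t k = m *: b2 x t i + (1 - m) *: b2 x t j /\ l2 x t k = m * l2 x t i + (1 - m) * l2 x t j) ->
  open dom1 -> open dom2 -> (forall x, dom1 x -> 0 < d x) -> (forall x, dom2 x -> d x < 0) -> 0 < r0 ->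
  ~ (forall x t, near_pt xb tb r0 x t -> (x, t) <> (xb, tb) ->
    w (x, t) - v (x, t) < w (xb, tb) - v (xb, tb)).
Proof.
move=> F super tan conv1 conv2 o1 o2 pos neg r00 strict.
have [k1 k10 h1] := interior_absurd (if_s1 F) (if_d F) o1 (if_dl F)
  (or_intror (fun x t Px dx => if_coer1 F Px (ltW (pos x dx)))) (if_usc F) (if_lsc F).
have F' := iface_swap F.
have pos' x : dom2 x -> 0 <= (\- d) x by move=> /neg dx; rewrite /= oppr_ge0 ltW.
have [k2 k20 h2] := interior_absurd (if_s1 F') (if_d F') o2 (if_dl F)
  (or_intror (fun x t Px dx => if_coer1 F' Px (pos' x dx))) (if_usc F) (if_lsc F).
have [k3 k30 h3] := interface_absurd F super tan conv1 conv2.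
have k0 : 0 < Num.min k1 (Num.min k2 k3) by rewrite !lt_min k10 k20.
have [n [r1 [x0 [t0 [y0 [s0 [r10 n0 P1 P2 [d12]]]]]]]] :=
  doubling_points r00 (dist_lip (if_d F)) (if_usc F) (if_lsc F) strict k0.
rewrite !lt_min => /and3P[kp1 kp2 kp3] Hmax.
have Q1 := lt_trans (proj1 P1) r10; have Q2 := lt_trans (proj1 P2) r10.
have [dx|dx|dx] := ltgtP (d x0) 0.
- have dy : d y0 < 0 by rewrite -d12.
  have d12' : (\- d) x0 = (\- d) y0 by rewrite /= d12.
  have h4 := h2 n r1 x0 t0 y0 s0 n0 r10 P1 P2 (if_dom2 F Q1 dx) (if_dom2 F Q2 dy) d12' kp2.
  by apply: h4 => z Bz /= /oppr_inj dz; exact: Hmax.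
- have dy : 0 < d y0 by rewrite -d12.
  exact: (h1 n r1 x0 t0 y0 s0 n0 r10 P1 P2 (if_dom1 F Q1 dx) (if_dom1 F Q2 dy) d12 kp1 Hmax).
- have dy : d y0 = 0 by rewrite -d12.
  exact: (h3 n r1 x0 t0 y0 s0 r10 n0 P1 P2 dx dy kp3 Hmax).
Qed.

(** * Test functions and Hamiltonians *)

Section C1Calculus.
Context {R : realType} {V : normedModType R}.
Implicit Types (f g : V -> R) (D E : V -> V -> R).

Definition has_C1 f D := [/\ forall x, differentiable f x,
  forall x v, 'D_v f x = D x v & forall v, continuous (fun x => D x v)].

Lemma has_C1_on f D (O : set V) : has_C1 f D -> C1_on O f.
Proof.
move=> [df eD cD]; split => [x _|v]; first exact: df.
rewrite (_ : (fun x => 'D_v f x) = fun x => D x v); last by apply/funext => x; exact: eD.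
exact: continuous_subspaceT.
Qed.

Lemma has_C1_cst (c : R) : has_C1 (fun=> c) (fun _ _ => 0).
Proof.
split => [x|x v|v x]; first exact: differentiable_cst.
  exact: derive_cst.
exact: cvg_cst.
Qed.

Lemma has_C1D f g D E : has_C1 f D -> has_C1 g E -> has_C1 (fun x => f x + g x) (fun x v => D x v + E x v).
Proof.
move=> [df eD cD] [dg eE cE]; split => [x|x v|v x].
- exact: differentiableD.
- by rewrite deriveD ?eD ?eE//; exact: diff_derivable.
- by apply: cvgD; [exact: cD|exact: cE].
Qed.

Lemma has_C1M f g D E : has_C1 f D -> has_C1 g E ->
  has_C1 (fun x => f x * g x) (fun x v => f x * E x v + g x * D x v).
Proof.
move=> [df eD cD] [dg eE cE]; split => [x|x v|v x].
- exact: differentiableM.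
- by rewrite deriveM ?eD ?eE//; exact: diff_derivable.
- have cf := differentiable_continuous (df x); have cg := differentiable_continuous (dg x).
  by apply: cvgD; apply: cvgM => //; [exact: cE|exact: cD].
Qed.

Lemma has_C1_lin (f : {linear V -> R}) : continuous f -> has_C1 f (fun _ v => f v).
Proof.
move=> cf; split => [x|x v|v x]; first exact: linear_differentiable.
  by rewrite deriveE ?diff_lin//; exact: linear_differentiable.
exact: cvg_cst.
Qed.

Lemma has_C1_eq f g D E : has_C1 f D -> f =1 g -> (forall x v, D x v = E x v) -> has_C1 g E.
Proof.
move=> h fg DE; rewrite -(funext fg); suff -> : E = D by [].
by apply/funext => x; apply/funext => v; rewrite DE.
Qed.

Lemma has_C1_comp (h h' : R -> R) g E : (forall s : R, is_derive s (1 : R) h (h' s)) -> continuous h' ->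
  has_C1 g E -> has_C1 (fun x => h (g x)) (fun x v => h' (g x) * E x v).
Proof.
move=> dh ch [dg eE cE].
have dfh s : differentiable h s by apply/derivable1_diffP; case: (dh s).
split => [x|x v|v x].
- by apply: differentiable_comp.
- rewrite deriveE; last exact: differentiable_comp.
  rewrite (@diff_comp _ _ _ _ g h)//= -(deriveE _ (dg x)) eE.
  rewrite (diff1E (dfh (g x))) /= derive1E; case: (dh (g x)) => _ ->.
  by rewrite /GRing.scale /= mulrC.
- apply: cvgM; last exact: cE.
  by apply: continuous_comp; [exact: differentiable_continuous|exact: ch].
Qed.

Lemma has_C1_sum (I : Type) (r : seq I) (F : I -> V -> R) (D : I -> V -> V -> R) :
  (forall i, has_C1 (F i) (D i)) ->
  has_C1 (fun x => \sum_(i <- r) F i x) (fun x v => \sum_(i <- r) D i x v).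
Proof.
move=> h; elim: r => [|i r ih].
  by apply: (has_C1_eq (has_C1_cst 0)) => [x|x v]; rewrite big_nil.
by apply: (has_C1_eq (has_C1D (h i) ih)) => [x|x v]; rewrite big_cons.
Qed.

End C1Calculus.

Section TestFunctions.
Context {R : realType} {N : nat}.
Local Notation V := 'rV[R]_N.

Definition xcoord (i : 'I_N) (y : V * R) : R := y.1 0 i.
Definition tcoord (y : V * R) : R := y.2.
Definition vcoord (i : 'I_N) (y : V) : R := y 0 i.

Lemma xcoord_linear i : linear (xcoord i). Proof. by move=> a y z; rewrite /xcoord !mxE. Qed.
Lemma tcoord_linear : linear tcoord. Proof. by []. Qed.
Lemma vcoord_linear i : linear (vcoord i). Proof. by move=> a y z; rewrite /vcoord !mxE. Qed.

HB.instance Definition _ i := GRing.isLinear.Build R (V * R)%type R *:%R (xcoord i) (xcoord_linear i).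
HB.instance Definition _ := GRing.isLinear.Build R (V * R)%type R *:%R tcoord tcoord_linear.
HB.instance Definition _ i := GRing.isLinear.Build R V R *:%R (vcoord i) (vcoord_linear i).

Lemma has_C1_vcoord i : has_C1 (vcoord i) (fun _ v => v 0 i).
Proof. by apply: has_C1_lin; exact: coord_continuous. Qed.

Lemma has_C1_xcoord i : has_C1 (xcoord i) (fun _ v => v.1 0 i).
Proof.
apply: has_C1_lin => y; apply: (@continuous_comp _ _ _ fst (vcoord i)); first exact: cvg_fst.
exact: coord_continuous.
Qed.

Lemma has_C1_tcoord : has_C1 tcoord (fun _ v => v.2).
Proof. by apply: has_C1_lin => y; exact: cvg_snd. Qed.

Definition quad_test (p : V) (a C : R) (x0 : V) (t0 : R) (y : V * R) : R :=
  dotv p (y.1 - x0) + a * (y.2 - t0) + C * (enorm (y.1 - x0) ^+ 2 + (y.2 - t0) ^+ 2).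

Lemma quad_testP p a C x0 t0 : has_C1 (quad_test p a C x0 t0)
  (fun y h => dotv p h.1 + a * h.2 + C * (2 * dotv (y.1 - x0) h.1 + 2 * (y.2 - t0) * h.2)).
Proof.
have hx i := has_C1D (has_C1_xcoord i) (has_C1_cst (- x0 0 i)).
have ht := has_C1D has_C1_tcoord (has_C1_cst (- t0)).
have h1 := has_C1_sum (index_enum 'I_N) (fun i => has_C1M (has_C1_cst (p 0 i)) (hx i)).
have h2 := has_C1_sum (index_enum 'I_N) (fun i => has_C1M (hx i) (hx i)).
apply: (has_C1_eq (has_C1D (has_C1D h1 (has_C1M (has_C1_cst a) ht))
  (has_C1M (has_C1_cst C) (has_C1D h2 (has_C1M ht ht))))) => [y|y h].
  rewrite /quad_test enorm2 /dotv expr2; congr (_ + _ + _ * (_ + _)).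
    by apply: eq_bigr => i _; rewrite !mxE.
  by apply: eq_bigr => i _; rewrite !mxE.
rewrite /dotv mulr_sumr !mulr0 !addr0; congr (_ + _ + _ * (_ + _)).
- by apply: eq_bigr => i _; rewrite ?mulr0 ?addr0.
- by apply: eq_bigr => i _; rewrite !mxE /xcoord; ring.
- by rewrite /tcoord; ring.
Qed.

Lemma quad_test_grad p a C x0 t0 : grad_x (quad_test p a C x0 t0) (x0, t0) = p.
Proof.
have [_ hD _] := quad_testP p a C x0 t0.
apply/rowP => i; rewrite mxE hD /= !subrr dotv0l !(mulr0, mul0r, addr0).
rewrite /dotv (bigD1 i)//= !mxE !eqxx mulr1 big1 ?addr0// => j ji.
by rewrite !mxE eqxx /= (negbTE ji) mulr0.
Qed.

Lemma quad_test_dt p a C x0 t0 : deriv_t (quad_test p a C x0 t0) (x0, t0) = a.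
Proof.
have [_ hD _] := quad_testP p a C x0 t0.
by rewrite /deriv_t hD /= dotv0r add0r mulr1 !subrr dotv0l !(mulr0, mul0r, addr0).
Qed.

Lemma visc_sub_jet T (D : set (V * R)) (F : V -> R -> V -> R) w x t p a :
  visc_sub T D F w -> D (x, t) -> sub_jet setT w x t p a -> a + F x t p <= 0.
Proof.
move=> hw Dx [C [r [r0 h]]].
have := hw (quad_test p a C x t) (x, t) (has_C1_on _ (quad_testP p a C x t)) Dx.
rewrite quad_test_grad quad_test_dt; apply.
apply/nbhs_enormT; exists r => // x' t' hx ht; have := h x' t' I hx ht.
rewrite /quad_test /= !subrr dotv0r enorm0 expr0n /= !(mulr0, addr0, subr0); clear; lra.
Qed.

Lemma visc_super_jet T (D : set (V * R)) (F : V -> R -> V -> R) v x t p a :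
  visc_super T D F v -> D (x, t) -> sup_jet v x t p a -> 0 <= a + F x t p.
Proof.
move=> hw Dx [C [r [r0 h]]].
have := hw (quad_test p a (- C) x t) (x, t) (has_C1_on _ (quad_testP p a (- C) x t)) Dx.
rewrite quad_test_grad quad_test_dt; apply.
apply/nbhs_enormT; exists r => // x' t' hx ht; have := h x' t' hx ht.
rewrite /quad_test /= !subrr dotv0r enorm0 expr0n /= !(mulr0, addr0, subr0); clear; lra.
Qed.

End TestFunctions.

Section Hamiltonians.
Context {R : realType} {N : nat}.
Local Notation V := 'rV[R]_N.

Lemma Ham_ge (A : metricType R) (b : V -> R -> A -> V) (l : V -> R -> A -> R) Mb Ml x t p i :
  (forall i, enorm (b x t i) <= Mb) -> (forall i, `|l x t i| <= Ml) ->
  - dotv (b x t i) p - l x t i <= Ham b l x t p.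
Proof.
move=> hb hl; apply: sup_upper_bound; last by exists i.
split; first by exists (- dotv (b x t i) p - l x t i), i.
exists (Mb * enorm p + Ml) => _ [j _ <-].
have := dotv_abs (b x t j) p; have := ler_wpM2r (enorm_ge0 p) (hb j); have := hl j.
rewrite !ler_norml; clear => /andP[h1 _] h2 /andP[h3 _]; lra.
Qed.

Lemma Ham_near (A : metricType R) (b : V -> R -> A -> V) (l : V -> R -> A -> R) Mb Ml x t p (i0 : A) (e : R) :
  (forall i, enorm (b x t i) <= Mb) -> (forall i, `|l x t i| <= Ml) -> 0 < e ->
  exists i, Ham b l x t p - e < - dotv (b x t i) p - l x t i.
Proof.
move=> hb hl e0.
have hs : has_sup (range (fun a => - dotv (b x t a) p - l x t a)).
  split; first by exists (- dotv (b x t i0) p - l x t i0), i0.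
  exists (Mb * enorm p + Ml) => _ [j _ <-].
  have := dotv_abs (b x t j) p; have := ler_wpM2r (enorm_ge0 p) (hb j); have := hl j.
  rewrite !ler_norml; clear => /andP[h1 _] h2 /andP[h3 _]; lra.
by have [_ [i _ <-] hi] := sup_adherent e0 hs; exists i.
Qed.

Lemma Ham_empty (A : metricType R) (b : V -> R -> A -> V) (l : V -> R -> A -> R) x t p :
  ~ (exists i : A, True) -> Ham b l x t p = 0.
Proof.
move=> hA; rewrite /Ham.
have -> : range (fun a => - dotv (b x t a) p - l x t a) = set0; last exact: sup0.
apply/seteqP; split => [y [i _ _]|y []].
by apply: hA; exists i.
Qed.

End Hamiltonians.

(** * Iterated integrals *)

Section Integrals.
Context {R : realType}.
Local Notation mu := (@lebesgue_measure R).
Local Notation Rint f := (Rintegral mu setT f).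

Lemma ge0_integral_mono (f g : R -> \bar R) :
  (forall x, (0 <= f x)%E) -> (forall x, (f x <= g x)%E) ->
  (integral mu setT f <= integral mu setT g)%E.
Proof.
move=> f0 fg; have g0 x : (0 <= g x)%E by exact: le_trans (f0 x) (fg x).
rewrite !ge0_integralTE//; apply: le_ereal_sup => _ [h /= hf <-]; exists h => //= x.
exact: le_trans (hf x) (fg x).
Qed.

(** No measurability is required: the integral of a nonnegative function is a
    supremum over simple functions, hence monotone. *)
Lemma Rint_mono (f h G : R -> R) : mu.-integrable setT (EFin \o G) ->
  (forall x, f x <= h x) -> (forall x, `|f x| <= G x) -> (forall x, `|h x| <= G x) ->
  Rint f <= Rint h.
Proof.
move=> iG fh fG hG.
have G0 x : 0 <= G x by exact: le_trans (fG x).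
have fin (k : R -> \bar R) : (forall x, (0 <= k x)%E) -> (forall x, (k x <= (G x)%:E)%E) ->
   integral mu setT k \is a fin_num.
  move=> k0 kG; rewrite ge0_fin_numE ?integral_ge0//.
  apply: le_lt_trans (ge0_integral_mono k0 kG) _.
  have := integrable_fin_num measurableT iG; rewrite ge0_fin_numE ?integral_ge0// => x _.
  by rewrite lee_fin.
have iE (k : R -> R) : (\int[mu]_x (k x)%:E = \int[mu]_x (EFin \o k)^\+ x - \int[mu]_x (EFin \o k)^\- x)%E.
  exact: (integralE mu setT (EFin \o k)).
rewrite /Rintegral !iE.
have bnd (k : R -> R) : (forall x, `|k x| <= G x) ->
    (forall x, ((EFin \o k) ^\+ x <= (G x)%:E)%E) /\ (forall x, ((EFin \o k) ^\- x <= (G x)%:E)%E).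
  move=> kG; split => x; rewrite ?funeposE ?funenegE ge_max lee_fin; apply/andP; split; rewrite ?lee_fin//.
    exact: le_trans (ler_norm _) (kG x).
  by apply: le_trans (kG x); rewrite -normrN ler_norm.
have [f1 f2] := bnd f fG; have [h1 h2] := bnd h hG.
have F1 := fin _ (funepos_ge0 (EFin \o f)) f1; have F2 := fin _ (funeneg_ge0 (EFin \o f)) f2.
have H1 := fin _ (funepos_ge0 (EFin \o h)) h1; have H2 := fin _ (funeneg_ge0 (EFin \o h)) h2.
rewrite (fineB F1 F2) (fineB H1 H2); apply: lerB.
  apply: (fine_le F1 H1); apply: ge0_integral_mono => x; first exact: funepos_ge0.
  rewrite !funeposE ge_max !le_max lexx orbT andbT.
  by apply/orP; left; rewrite lee_fin.
apply: (fine_le H2 F2); apply: ge0_integral_mono => x; first exact: funeneg_ge0.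
rewrite !funenegE ge_max !le_max lexx orbT andbT.
by apply/orP; left; rewrite lee_fin lerN2.
Qed.

Lemma integrable_scale (G : R -> R) (K : R) : mu.-integrable setT (EFin \o G) ->
  mu.-integrable setT (EFin \o (fun x => K * G x)).
Proof.
move=> iG; have := integrableZl measurableT K iG; congr (integrable _ _ _).
Qed.

Lemma Rint_bound (f G : R -> R) (K : R) : 0 <= K -> mu.-integrable setT (EFin \o G) ->
  (forall x, `|f x| <= K * G x) -> `|Rint f| <= K * Rint G.
Proof.
move=> K0 iG fG.
have iKG : mu.-integrable setT (EFin \o (fun x => K * G x)).
  exact: integrable_scale.
have KG0 x : 0 <= K * G x by exact: le_trans (fG x).
rewrite -RintegralZl// ler_norml; apply/andP; split.
  have -> : - Rint (fun x => K * G x) = Rint (fun x => - 1 * (K * G x)).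
    by rewrite (@RintegralZl _ _ R mu setT (fun x => K * G x) (-1) measurableT iKG) mulN1r.
  apply: (Rint_mono iKG) => x //.
    by rewrite mulN1r lerNl; apply: le_trans (fG x); rewrite -normrN ler_norm.
  by rewrite mulN1r normrN ger0_norm.
apply: (Rint_mono iKG) => x //; first by apply: le_trans (fG x); exact: ler_norm.
by rewrite ger0_norm.
Qed.

Lemma row_mx_ord0 n (x : R) (y : 'rV[R]_n) : row_mx (x%:M : 'M[R]_1) y 0 (ord0 : 'I_(n.+1)) = x.
Proof.
have -> : (ord0 : 'I_(1 + n)) = lshift n (ord0 : 'I_1) by exact: val_inj.
by rewrite row_mxEl mxE eqxx.
Qed.

Lemma row_mx_lift n (x : R) (y : 'rV[R]_n) j : row_mx (x%:M : 'M[R]_1) y 0 (lift ord0 j : 'I_(n.+1)) = y 0 j.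
Proof.
have -> : (lift ord0 j : 'I_(1 + n)) = rshift 1 j by exact: val_inj.
by rewrite row_mxEr.
Qed.

(** A product majorant survives integration in one variable; the induction then needs neither
    Fubini's theorem nor the measurability of partial integrals. *)
Lemma intRn_bound n (f : 'rV[R]_n -> R) (G : 'I_n -> R -> R) (C : R) : 0 <= C ->
  (forall i, mu.-integrable setT (EFin \o G i)) -> (forall i s, 0 <= G i s) ->
  (forall x, `|f x| <= C * \prod_i G i (x 0 i)) ->
  `|integral_Rn f| <= C * \prod_i Rint (G i).
Proof.
elim: n f G C => [|n ih] f G C C0 iG G0 fG /=.
  by have := fG 0; rewrite !big_ord0.
rewrite big_ord_recl mulrA mulrAC; apply: Rint_bound => //.
  by rewrite mulr_ge0// prodr_ge0// => i _; apply: Rintegral_ge0 => x _; exact: G0.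
move=> x; rewrite mulrAC; apply: ih => // [|y]; first by rewrite mulr_ge0.
apply: le_trans (fG _) _; rewrite big_ord_recl row_mx_ord0 mulrA ler_wpM2l ?mulr_ge0//.
by apply: ler_prod => i _; rewrite G0 row_mx_lift lexx.
Qed.

Lemma intRn_mono n (f h : 'rV[R]_n -> R) (G : 'I_n -> R -> R) (C : R) : 0 <= C ->
  (forall i, mu.-integrable setT (EFin \o G i)) -> (forall i s, 0 <= G i s) ->
  (forall x, f x <= h x) ->
  (forall x, `|f x| <= C * \prod_i G i (x 0 i)) -> (forall x, `|h x| <= C * \prod_i G i (x 0 i)) ->
  integral_Rn f <= integral_Rn h.
Proof.
elim: n f h G C => [|n ih] f h G C C0 iG G0 fh fG hG /=; first exact: fh.
have prod_le x y : C * \prod_i G i (row_mx (x%:M : 'M[R]_1) y 0 i) <=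
    (C * G ord0 x) * \prod_i G (lift ord0 i) (y 0 i).
  rewrite big_ord_recl row_mx_ord0 mulrA ler_wpM2l ?mulr_ge0//.
  by apply: ler_prod => i _; rewrite G0 row_mx_lift lexx.
pose K := C * \prod_(i < n) Rint (G (lift ord0 i)).
have K0 : 0 <= K.
  by rewrite mulr_ge0// prodr_ge0// => i _; apply: Rintegral_ge0 => x _; exact: G0.
have iKG : mu.-integrable setT (EFin \o (fun x => K * G ord0 x)).
  exact: integrable_scale.
apply: (Rint_mono iKG) => x.
- apply: (ih _ _ (fun i => G (lift ord0 i)) (C * G ord0 x)) => // [|y|y].
  + exact: mulr_ge0.
  + exact: le_trans (fG _) (prod_le x y).
  + exact: le_trans (hG _) (prod_le x y).
- rewrite /K mulrAC; apply: intRn_bound => // [|y]; first exact: mulr_ge0.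
  exact: le_trans (fG _) (prod_le x y).
- rewrite /K mulrAC; apply: intRn_bound => // [|y]; first exact: mulr_ge0.
  exact: le_trans (hG _) (prod_le x y).
Qed.

Lemma intRn_ext n (f h : 'rV[R]_n -> R) : f =1 h -> integral_Rn f = integral_Rn h.
Proof. by move=> /funext->. Qed.

(** Linearity is used for sums of products only, whose factors are integrable; integrals containing
    [d] or a weak derivative are estimated through monotonicity. *)
Lemma intRn_sum n (S : Type) (r : seq S) (c : S -> R) (G : S -> 'I_n -> R -> R) :
  (forall s i, mu.-integrable setT (EFin \o G s i)) ->
  integral_Rn (fun x : 'rV[R]_n => \sum_(s <- r) c s * \prod_i G s i (x 0 i)) =
  \sum_(s <- r) c s * \prod_i Rint (G s i).
Proof.
elim: n c G => [|n ih] c G iG /=.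
  by apply: eq_bigr => s _; rewrite !big_ord0.
transitivity (Rint (fun x => \sum_(s <- r) (c s * \prod_i Rint (G s (lift ord0 i))) * G s ord0 x)).
  congr (Rintegral _ _ _); apply/funext => x.
  rewrite (intRn_ext (h := fun y => \sum_(s <- r) (c s * G s ord0 x) * \prod_i G s (lift ord0 i) (y 0 i))).
    by rewrite (ih (fun s => c s * G s ord0 x) (fun s i => G s (lift ord0 i)))//; apply: eq_bigr => s _; rewrite mulrAC.
  move=> y; apply: eq_bigr => s _; rewrite big_ord_recl row_mx_ord0 mulrA; congr (_ * _).
  by apply: eq_bigr => i _; rewrite row_mx_lift.
elim: r {ih} => [|s r ihr].
  rewrite big_nil (_ : (fun=> _) = fun=> 0) ?Rintegral_cst//; last by apply/funext => x; rewrite big_nil.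
  by rewrite mul0r.
have iZ s' : mu.-integrable setT (EFin \o (fun x => c s' * (\prod_i Rint (G s' (lift ord0 i))) * G s' ord0 x)).
  exact: integrable_scale.
have iS : mu.-integrable setT (EFin \o (fun x => \sum_(s <- r) c s * (\prod_i Rint (G s (lift ord0 i))) * G s ord0 x)).
  elim: r {ihr} => [|s' r ihr'].
    rewrite (_ : _ \o _ = cst 0%E); first exact: integrable0.
    by apply/funext => x; rewrite /= big_nil.
  have := integrableD measurableT (iZ s') ihr'; congr (integrable _ _ _).
  by apply/funext => x; rewrite /= big_cons EFinD.
rewrite big_cons -ihr big_ord_recl.
rewrite (_ : (fun x => \sum_(s <- s :: r) _) = (fun x => c s * (\prod_i Rint (G s (lift ord0 i))) * G s ord0 x
  + \sum_(s <- r) c s * (\prod_i Rint (G s (lift ord0 i))) * G s ord0 x)); last first.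
  by apply/funext => x; rewrite big_cons.
rewrite RintegralD// RintegralZl//; congr (_ + _).
by rewrite -!mulrA; congr (_ * _); rewrite mulrC.
Qed.

Lemma integrable_bump (f : R -> R) (a b : R) : continuous f ->
  (forall s, s <= a -> f s = 0) -> (forall s, b <= s -> f s = 0) ->
  mu.-integrable setT (EFin \o f).
Proof.
move=> cf fa fb.
have h : mu.-integrable `[a, b] (EFin \o f).
  by apply: continuous_compact_integrable; [exact: segment_compact|exact: continuous_subspaceT].
have := (integrable_mkcond (mu := mu) (EFin \o f) (measurable_itv `[a, b])).1 h.
apply: eq_integrable => // x _; rewrite /= patchE; case: ifPn => // xab.
congr (_%:E); move: xab; rewrite notin_setE /= in_itv /= => /negP; rewrite negb_and -!ltNge.
by move=> /orP[/ltW/fa|/ltW/fb].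
Qed.

Lemma Rint_bump (f F : R -> R) (a b : R) : a < b -> continuous f ->
  (forall s : R, is_derive s (1 : R) F (f s)) ->
  (forall s, s <= a -> f s = 0) -> (forall s, b <= s -> f s = 0) ->
  Rint f = F b - F a.
Proof.
move=> ab cf dF fa fb.
have dF' s : derivable F s 1 by case: (dF s).
have cF : continuous F by move=> s; apply: differentiable_continuous; apply/derivable1_diffP.
have FTC : (\int[mu]_(x in `[a, b]) (f x)%:E = (F b)%:E - (F a)%:E)%E.
  apply: (continuous_FTC2 ab (continuous_subspaceT cf)).
    split; first by move=> s _.
      by apply: cvg_at_right_filter; exact: cF.
    by apply: cvg_at_left_filter; exact: cF.
  by move=> s _; rewrite derive1E; case: (dF s).
suff -> : Rint f = fine (\int[mu]_(x in `[a, b]) (f x)%:E) by rewrite FTC.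
rewrite integral_mkcond; congr fine; apply: eq_integral => x _.
rewrite patchE; case: ifPn => // xab.
congr (_%:E); move: xab; rewrite notin_setE /= in_itv /= => /negP; rewrite negb_and -!ltNge.
by move=> /orP[/ltW/fa|/ltW/fb].
Qed.

End Integrals.

(** * Spline test functions *)

Section Splines.
Context {R : realType}.
Implicit Types (f : R -> R) (s h k e : R) (m : nat).

(** Vector-valued, so as to serve for the curves in the definition of [tangent] as well as for
    splines. *)
Lemma quad_is_derive (W : normedModType R) (f : R -> W) s (c : W) K r : 0 < r ->
  (forall h, `|h| < r -> `|f (s + h) - f s - h *: c| <= K * h ^+ 2) -> is_derive s (1 : R) f c.
Proof.
move=> r0 hf.
have H : h^-1 *: (f (h *: (1 : R) + s) - f s) @[h --> (0 : R)^'] --> c.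
  apply/cvgrPdist_lt => e e0; pose M := `|K| + 1.
  have M0 : 0 < M by rewrite ltr_wpDl.
  near=> h.
  have h0 : h != 0 by near: h; exact: nbhs_dnbhs_neq.
  have hr : `|h| < Num.min r (e / M).
    near: h; apply: dnbhs0_lt; by rewrite lt_min r0 divr_gt0.
  move: hr; rewrite lt_min => /andP[hr he].
  have H0 := hf h hr.
  rewrite ltr_pdivlMr// in he.
  have -> : c - h^-1 *: (f (h *: (1 : R) + s) - f s) = - h^-1 *: (f (s + h) - f s - h *: c).
    have hE : h *: (1 : R) = h by exact: mulr1.
    rewrite hE (addrC h s) [RHS]scalerBr scalerA mulNr mulVf// !scaleNr scale1r opprK.
    exact: addrC.
  have hp : 0 < `|h| by rewrite normr_gt0.
  rewrite normrZ normrN normfV mulrC ltr_pdivrMr//.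
  apply: (@le_lt_trans _ _ (`|K| * `|h| * `|h|)).
    rewrite -mulrA -expr2; apply: le_trans H0 _; rewrite real_normK ?num_real//.
    by rewrite ler_wpM2r ?sqr_ge0// ler_norm.
  rewrite ltr_pM2r//; apply: le_lt_trans he; rewrite mulrC /M mulrDr mulr1 lerDl ltW//.
have D : derivable f s (1 : R) by apply/cvg_ex; exists c.
by apply: (DeriveDef D); exact: cvg_lim H.
Unshelve. all: by end_near. Qed.

(** Truncated power. For [m = 0] this is the constant 1 and not a step function, hence the
    successors in [ppow_neg] and in the derivatives. *)
Definition ppow m s : R := Num.max s 0 ^+ m.

Lemma ppow_neg m s : s <= 0 -> ppow m.+1 s = 0.
Proof. by move=> s0; rewrite /ppow max_r// expr0n. Qed.

Lemma ppow_pos m s : 0 <= s -> ppow m s = s ^+ m.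
Proof. by move=> s0; rewrite /ppow max_l. Qed.

Lemma ppowS m s : ppow m.+2 s = s * ppow m.+1 s.
Proof.
by have [s0|s0] := leP s 0; [rewrite !ppow_neg// mulr0|rewrite !ppow_pos ?(ltW s0)// exprS].
Qed.

Lemma is_derive_ppow m s : is_derive s (1 : R) (ppow m.+2) (m.+2%:R * ppow m.+1 s).
Proof.
elim: m => [|m ih].
  apply: (@quad_is_derive _ _ _ _ 1 1) => // h _.
  rewrite /ppow expr1 [h *: _]mulrC; set u := s.
  have q1 := sqr_ge0 (u + h); have q2 := sqr_ge0 u; have q3 := sqr_ge0 h.
  have [h1|h1] := leP (u + h) 0; have [h2|h2] := leP u 0; rewrite ?expr0n /= ler_norml.
  - by move: q3; clear => *; apply/andP; split; lra.
  - have := mulr_le0_ge0 h1 (ltW h2); move: q1 q2 q3; clear => *; apply/andP; split; lra.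
  - have := mulr_ge0_le0 (ltW h1) h2; move: q1 q2 q3; clear => *; apply/andP; split; lra.
  - by move: q3; clear => *; apply/andP; split; lra.
have -> : ppow m.+3 = (id : R -> R) * ppow m.+2 by apply/funext => x; exact: ppowS.
apply: is_derive_eq; rewrite /GRing.scale /= mulr1 (ppowS m s) -[m.+3%:R]natr1.
by ring.
Qed.

Lemma continuous_ppow m : continuous (ppow m).
Proof.
have cm : continuous (fun s : R => Num.max s 0).
  move=> s; apply/cvgrPdist_lt => e e0; near=> t.
  have ht : `|s - t| < e by near: t; apply: cvgr_dist_lt.
  apply: le_lt_trans ht.
  have h1 := ler_norm (s - t); have h2 := ler_norm (- (s - t)); rewrite normrN in h2.
  have h3 := normr_ge0 (s - t).
  by have [|] := leP s 0; have [|] := leP t 0; rewrite ler_norml; move: h1 h2 h3; clear => *; apply/andP; split; lra.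
rewrite /ppow; elim: m => [|m ih].
  by move=> s; under eq_fun do rewrite expr0; exact: cvg_cst.
move=> s; under eq_fun do rewrite exprS; apply: cvgM; [exact: cm|exact: ih].
Unshelve. all: by end_near. Qed.

Lemma is_derive_sub f c s l : is_derive (s - c) (1 : R) f l ->
  is_derive s (1 : R) (fun t => f (t - c)) l.
Proof.
move=> h.
have hs : is_derive s (1 : R) (fun t => t - c) (1 : R).
  by have := @is_derive_shift R s 1 (- c); apply.
by have := @is_derive1_comp R f (fun t => t - c) s l 1 h hs; rewrite mulr1.
Qed.

(** Third backward difference with step [e], which annihilates polynomials of degree at most 2. *)
Definition diff3 (F : R -> R) e s := F s - 3 * F (s - e) + 3 * F (s - 2 * e) - F (s - 3 * e).

Lemma is_derive_diff3 F F' e : (forall s, is_derive s (1 : R) F (F' s)) ->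
  forall s, is_derive s (1 : R) (diff3 F e) (diff3 F' e s).
Proof.
move=> h s.
have h0 := h s; have h1 := is_derive_sub (h (s - e)).
have h2 := is_derive_sub (h (s - 2 * e)); have h3 := is_derive_sub (h (s - 3 * e)).
have H := is_deriveB (is_deriveD (is_deriveB h0 (is_deriveZ 3 h1)) (is_deriveZ 3 h2)) h3.
exact: is_derive_eq H _.
Qed.

Lemma is_derive_increment (f f' : R -> R) h : (forall s, is_derive s (1 : R) f (f' s)) ->
  forall s, is_derive s (1 : R) (fun s => f s - f (s - h)) (f' s - f' (s - h)).
Proof. by move=> hf s; exact: is_deriveB (hf s) (is_derive_sub (hf (s - h))). Qed.

(** Normalized so that differentiation lowers the index by one and [nppow 2] is the truncated square
    itself. *)
Definition nppow m s := 2 * ppow m s / m`!%:R.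

Lemma is_derive_nppow m s : is_derive s (1 : R) (nppow m.+2) (nppow m.+1 s).
Proof.
have H := is_deriveZ (2 / m.+2`!%:R) (is_derive_ppow m s).
have -> : nppow m.+2 = (2 / m.+2`!%:R) *: ppow m.+2.
  by apply/funext => x; rewrite /nppow /GRing.scale /= mulrAC.
apply: is_derive_eq H _; rewrite /nppow /GRing.scale /= factS natrM.
field; rewrite -natrD !pnatr_eq0 -lt0n fact_gt0.
by [].
Qed.

(* [bspline m.+1] is a primitive of [bspline m]; [bspline 2] is, up to a factor, the quadratic
   B-spline supported in [[0, 3 e]]. *)
Definition bspline m e : R -> R := diff3 (nppow m) e.

Lemma is_derive_bspline m e s : is_derive s (1 : R) (bspline m.+2 e) (bspline m.+1 e s).
Proof. by apply: is_derive_diff3 => {}s; exact: is_derive_nppow. Qed.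

Lemma continuous_sub f c : continuous f -> continuous (fun s => f (s - c)).
Proof.
move=> cf s; apply: (@continuous_comp _ _ _ (fun s => s - c) f); last exact: cf.
by apply: cvgB; [exact: cvg_id|exact: cvg_cst].
Qed.

Lemma continuous_bspline m e : continuous (bspline m e).
Proof.
have cF : continuous (nppow m).
  move=> s; rewrite /nppow; apply: cvgM; last exact: cvg_cst.
  by apply: cvgM; [exact: cvg_cst|exact: continuous_ppow].
move=> s; rewrite /bspline /diff3; apply: cvgB; last exact: (continuous_sub (c := 3 * e) cF).
apply: cvgD; last by apply: cvgM; [exact: cvg_cst|exact: (continuous_sub (c := 2 * e) cF)].
apply: cvgB; first exact: cF.
by apply: cvgM; [exact: cvg_cst|exact: (continuous_sub (c := e) cF)].
Qed.

Lemma bspline_left m e s : 0 < e -> s <= 0 -> bspline m.+1 e s = 0.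
Proof.
move=> e0 s0; rewrite /bspline /diff3 /nppow !ppow_neg; [by rewrite !(mulr0, mul0r, subr0, addr0)|..]; move: e0 s0; clear; lra.
Qed.

(** Beyond [3 e] no truncation is active and a third difference of [s^m] remains: 0 for [m = 2], a
    constant for [m = 3]. *)
Lemma bspline_right m e s : 0 < e -> 3 * e <= s ->
  bspline m e s = 2 / m`!%:R * (s ^+ m - 3 * (s - e) ^+ m + 3 * (s - 2 * e) ^+ m - (s - 3 * e) ^+ m).
Proof.
move=> e0 s0; rewrite /bspline /diff3 /nppow !ppow_pos; [by ring|..]; move: e0 s0; clear; lra.
Qed.

Lemma bspline2_ge0 e s : 0 < e -> 0 <= bspline 2 e s.
Proof.
move=> e0; have [s0|s0] := leP s 0; first by rewrite bspline_left.
have [s3|s3] := leP (3 * e) s.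
  by rewrite bspline_right// (_ : _ - _ = 0) ?mulr0//; ring.
have k t : nppow 2 t = ppow 2 t by rewrite /nppow (_ : 2`! = 2%N)// mulrAC divff ?pnatr_eq0// mul1r.
rewrite /bspline /diff3 !k (ppow_pos 2 (ltW s0)).
rewrite (@ppow_neg 1 (s - 3 * e)) ?subr0; last by move: s3; clear; lra.
have [s1|s1] := leP s e.
  rewrite !ppow_neg; [|move: s1 e0; clear; lra|move: s1; clear; lra].
  by rewrite mulr0 subr0 addr0 sqr_ge0.
have h1 : 0 <= s - e by move: s1; clear; lra.
rewrite (ppow_pos 2 h1).
have [s2|s2] := leP s (2 * e).
  rewrite ppow_neg; last by move: s2; clear; lra.
  have h2 : 0 <= 2 * e - s by move: s2; clear; lra.
  by have := mulr_ge0 h1 h2; have := sqr_ge0 e; clear; lra.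
rewrite ppow_pos; last by move: s2; clear; lra.
by have := sqr_ge0 (3 * e - s); clear; lra.
Qed.

Lemma nondecreasing_deriv (f f' : R -> R) : (forall s, is_derive s (1 : R) f (f' s)) ->
  (forall s, 0 <= f' s) -> forall s u, s <= u -> f s <= f u.
Proof.
move=> df f0 s u su.
have df' x : derivable f x 1 by case: (df x).
have cf : continuous f by move=> x; apply: differentiable_continuous; apply/derivable1_diffP.
apply: (@ger0_derive1_ndecr R f s u) => //.
  by move=> x _; rewrite derive1E; case: (df x) => _ ->.
exact: continuous_subspaceT.
Qed.

(** [bdiff1 e h] is [bspline 2 e] convolved with the indicator of [[0, h]], and [bdiff2 e h k] is
    convolved once more with that of [[0, k]]. Both are nonnegative with compact support, and
    differentiating them leaves first and second differences of [bspline 2 e]. *)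
Definition bdiff1 e h s := bspline 3 e s - bspline 3 e (s - h).
Definition dbdiff1 e h s := bspline 2 e s - bspline 2 e (s - h).
Definition bdiff2 e h k s := (bspline 4 e s - bspline 4 e (s - h)) - (bspline 4 e (s - k) - bspline 4 e (s - k - h)).
Definition dbdiff2 e h k s := (bspline 3 e s - bspline 3 e (s - h)) - (bspline 3 e (s - k) - bspline 3 e (s - k - h)).
Definition ddbdiff2 e h k s := (bspline 2 e s - bspline 2 e (s - h)) - (bspline 2 e (s - k) - bspline 2 e (s - k - h)).

Lemma is_derive_bdiff1 e h s : is_derive s (1 : R) (bdiff1 e h) (dbdiff1 e h s).
Proof. by apply: is_derive_increment => {}s; exact: is_derive_bspline. Qed.

Lemma is_derive_bdiff2 e h k s : is_derive s (1 : R) (bdiff2 e h k) (dbdiff2 e h k s).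
Proof.
by apply: (@is_derive_increment (fun s => bspline 4 e s - bspline 4 e (s - h)) (fun s => bspline 3 e s - bspline 3 e (s - h)));
  apply: is_derive_increment => {}s; exact: is_derive_bspline.
Qed.

Lemma is_derive_dbdiff2 e h k s : is_derive s (1 : R) (dbdiff2 e h k) (ddbdiff2 e h k s).
Proof.
by apply: (@is_derive_increment (fun s => bspline 3 e s - bspline 3 e (s - h)) (fun s => bspline 2 e s - bspline 2 e (s - h)));
  apply: is_derive_increment => {}s; exact: is_derive_bspline.
Qed.

Lemma bspline3_mono e : 0 < e -> forall s u, s <= u -> bspline 3 e s <= bspline 3 e u.
Proof.
move=> e0; apply: nondecreasing_deriv => s; first exact: is_derive_bspline.
exact: bspline2_ge0.
Qed.

Lemma bdiff1_ge0 e h s : 0 < e -> 0 <= h -> 0 <= bdiff1 e h s.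
Proof. by move=> e0 h0; rewrite subr_ge0; apply: bspline3_mono => //; rewrite gerBl. Qed.

Lemma bdiff2_ge0 e h k s : 0 < e -> 0 <= h -> 0 <= k -> 0 <= bdiff2 e h k s.
Proof.
move=> e0 h0 k0; rewrite subr_ge0.
apply: (@nondecreasing_deriv (fun s => bspline 4 e s - bspline 4 e (s - h)) (bdiff1 e h)).
- by apply: is_derive_increment => {}s; exact: is_derive_bspline.
- by move=> u; exact: bdiff1_ge0.
- by rewrite gerBl.
Qed.

Lemma bdiff1_left e h s : 0 < e -> 0 <= h -> s <= 0 -> bdiff1 e h s = 0.
Proof. by move=> e0 h0 s0; rewrite /bdiff1 !bspline_left ?subrr//; move: s0 h0; clear; lra. Qed.

Lemma bdiff2_left e h k s : 0 < e -> 0 <= h -> 0 <= k -> s <= 0 -> bdiff2 e h k s = 0.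
Proof.
move=> e0 h0 k0 s0; rewrite /bdiff2 !bspline_left; [by rewrite !subrr|..] => //; move: s0 h0 k0; clear; lra.
Qed.

Lemma bdiff1_right e h s : 0 < e -> 0 <= h -> 3 * e + h <= s -> bdiff1 e h s = 0.
Proof.
move=> e0 h0 s0; rewrite /bdiff1 !bspline_right//; [by ring|..]; move: s0 h0; clear; lra.
Qed.

Lemma bdiff2_right e h k s : 0 < e -> 0 <= h -> 0 <= k -> 3 * e + h + k <= s -> bdiff2 e h k s = 0.
Proof.
move=> e0 h0 k0 s0; rewrite /bdiff2 !bspline_right//; [by ring|..]; move: s0 h0 k0; clear; lra.
Qed.

Lemma bspline2_right e s : 0 < e -> 3 * e <= s -> bspline 2 e s = 0.
Proof. by move=> e0 s0; rewrite bspline_right// (_ : _ - _ = 0) ?mulr0//; ring. Qed.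

Local Notation Rint f := (Rintegral (@lebesgue_measure R) setT f).

Lemma Rint_bspline2 e : 0 < e -> Rint (bspline 2 e) = 2 * e ^+ 3.
Proof.
move=> e0; have e3 : 0 < 3 * e by move: e0; clear; lra.
rewrite (Rint_bump e3 (@continuous_bspline 2 e) (is_derive_bspline 1 e)).
- by rewrite (bspline_left 2 e0 (lexx 0)) subr0 bspline_right// (_ : 3`! = 6%N)//; field.
- by move=> s; exact: bspline_left.
- by move=> s; exact: bspline2_right.
Qed.

Lemma Rint_bdiff1 e h : 0 < e -> 0 < h -> Rint (bdiff1 e h) = h * (2 * e ^+ 3).
Proof.
move=> e0 h0; have e3 : 0 < 3 * e + h by move: e0 h0; clear; lra.
have cf : continuous (bdiff1 e h).
  by move=> s; apply: cvgB; [exact: continuous_bspline|exact: (continuous_sub (c := h) (@continuous_bspline 3 e))].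
rewrite (Rint_bump e3 cf (is_derive_increment h (is_derive_bspline 2 e))).
- rewrite (bspline_left 3 e0 (lexx 0)) (@bspline_left 3 e (0 - h))//; last by move: h0; clear; lra.
  rewrite !subr0 !bspline_right//; [|by move: h0; clear; lra|by move: h0; clear; lra].
  by rewrite (_ : 4`! = 24%N)//; field.
- by move=> s; apply: bdiff1_left => //; exact: ltW.
- by move=> s; apply: bdiff1_right => //; exact: ltW.
Qed.

Lemma Rint_bdiff2 e h k : 0 < e -> 0 < h -> 0 < k -> Rint (bdiff2 e h k) = h * k * (2 * e ^+ 3).
Proof.
move=> e0 h0 k0; have e3 : 0 < 3 * e + h + k by move: e0 h0 k0; clear; lra.
have cf : continuous (bdiff2 e h k).
  have c1 : continuous (fun s => bspline 4 e s - bspline 4 e (s - h)).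
    by move=> s; apply: cvgB; [exact: continuous_bspline|exact: (continuous_sub (c := h) (@continuous_bspline 4 e))].
  by move=> s; apply: cvgB; [exact: c1|exact: (continuous_sub (c := k) c1)].
have dF : forall s : R, is_derive s (1 : R)
    (fun s => (bspline 5 e s - bspline 5 e (s - h)) - (bspline 5 e (s - k) - bspline 5 e (s - k - h))) (bdiff2 e h k s).
  apply: (@is_derive_increment (fun s => bspline 5 e s - bspline 5 e (s - h)) (fun s => bspline 4 e s - bspline 4 e (s - h))).
  by apply: is_derive_increment => s; exact: is_derive_bspline.
rewrite (Rint_bump e3 cf dF).
- rewrite (bspline_left 4 e0 (lexx 0)) (@bspline_left 4 e (0 - h)) ?(@bspline_left 4 e (0 - k)) ?(@bspline_left 4 e (0 - k - h))//;
    try by move: h0 k0; clear; lra.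
  rewrite !subr0 !bspline_right//; try by move: h0 k0; clear; lra.
  by rewrite (_ : 5`! = 120%N)//; field.
- by move=> s; apply: bdiff2_left => //; exact: ltW.
- by move=> s; apply: bdiff2_right => //; exact: ltW.
Qed.

End Splines.

Section ProductTests.
Context {R : realType} {N : nat}.
Local Notation V := 'rV[R]_N.
Local Notation Rint f := (Rintegral (@lebesgue_measure R) setT f).
Implicit Types (F : 'I_N -> R -> R).

Definition prodf F (x : V) : R := \prod_i F i (x 0 i).

Lemma has_C1_prod_seq F F' (r : seq 'I_N) :
  (forall i (s : R), is_derive s (1 : R) (F i) (F' i s)) -> (forall i, continuous (F' i)) ->
  exists D, has_C1 (fun x : V => \prod_(i <- r) F i (x 0 i)) D /\
    forall x i0, uniq r -> D x (delta_mx 0 i0) =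
      if i0 \in r then \prod_(i <- r) (if i == i0 then F' i (x 0 i) else F i (x 0 i)) else 0.
Proof.
move=> dF cF; elim: r => [|i r [D [hD Dr]]].
  exists (fun _ _ => 0); split => //.
  by apply: (has_C1_eq (has_C1_cst 1)) => [x|x v]; rewrite ?big_nil.
have hi := has_C1_comp (dF i) (cF i) (has_C1_vcoord i).
eexists; split; first by apply: (has_C1_eq (has_C1M hi hD)) => [x|x v]; [rewrite big_cons|].
move=> x i0 /= /andP[ir ur]; rewrite (Dr x i0 ur) inE big_cons mxE eqxx /= /vcoord (eq_sym i0).
have [<-|ii] := eqVneq i i0; rewrite /=.
  rewrite (negbTE ir) mulr0 add0r mulr1 mulrC; congr (_ * _).
  apply: eq_big_seq => l lr; case: eqVneq => // li; by rewrite -li lr in ir.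
by rewrite mulr0 mulr0 addr0; case: ifP => // _; rewrite mulr0.
Qed.

Lemma prodf_C1 F F' (D := fun x i => prodf (fun l => if l == i then F' i else F l) x) :
  (forall i (s : R), is_derive s (1 : R) (F i) (F' i s)) -> (forall i, continuous (F' i)) ->
  C1_on setT (prodf F) /\ forall x i, 'D_(delta_mx 0 i) (prodf F) x = D x i.
Proof.
move=> dF cF; have [E [hE Er]] := has_C1_prod_seq (index_enum 'I_N) dF cF.
split; first exact: (has_C1_on setT hE).
have [_ eD _] := hE; move=> x i; rewrite (eD x) Er ?index_enum_uniq// mem_index_enum.
by apply: eq_bigr => l _; case: eqVneq => // ->.
Qed.

Lemma prodf_test F F' (U : set V) (a b : V) :
  (forall i (s : R), is_derive s (1 : R) (F i) (F' i s)) -> (forall i, continuous (F' i)) ->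
  (forall i s, s <= a 0 i -> F i s = 0) -> (forall i s, b 0 i <= s -> F i s = 0) ->
  (forall x : V, (forall i, a 0 i <= x 0 i <= b 0 i) -> U x) ->
  test_function U (prodf F).
Proof.
move=> dF cF Fa Fb Ux; split; first by case: (prodf_C1 dF cF).
exists [set x : V | forall i, `[a 0 i, b 0 i]%classic (x 0 i)]; split.
- by apply: (@rV_compact R N (fun i => `[a 0 i, b 0 i]%classic)) => i; exact: segment_compact.
- by move=> x /= hx; apply: Ux => i; have := hx i; rewrite in_itv.
- move=> x /= hx; have [i hi] : exists i, ~ (`[a 0 i, b 0 i]%classic (x 0 i)).
    by apply: contrapT => h; apply: hx => i; apply: contrapT => hi; apply: h; exists i.
  rewrite /prodf (bigD1 i)//=; suff -> : F i (x 0 i) = 0 by rewrite mul0r.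
  move: hi; rewrite /= in_itv /= => /negP; rewrite negb_and -!ltNge.
  by move=> /orP[/ltW/Fa|/ltW/Fb].
Qed.

Lemma Rint_shift (f G : R -> R) (a b c : R) : a < b -> continuous f ->
  (forall s : R, is_derive s (1 : R) G (f s)) ->
  (forall s, s <= a -> f s = 0) -> (forall s, b <= s -> f s = 0) ->
  Rint (fun s => f (s - c)) = Rint f.
Proof.
move=> ab cf dG fa fb; rewrite (Rint_bump ab cf dG fa fb).
have ab' : a + c < b + c by rewrite ltrD2r.
have dG' s : is_derive s (1 : R) (fun t => G (t - c)) (f (s - c)) by apply: is_derive_sub; exact: dG.
rewrite (Rint_bump ab' (continuous_sub (c := c) cf) dG').
- by rewrite !addrK.
- by move=> s h; apply: fa; rewrite lerBlDr.
- by move=> s h; apply: fb; rewrite lerBrDr.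
Qed.

Lemma integrable_shift (f : R -> R) (a b c : R) : continuous f ->
  (forall s, s <= a -> f s = 0) -> (forall s, b <= s -> f s = 0) ->
  (@lebesgue_measure R).-integrable setT (EFin \o (fun s => f (s - c))).
Proof.
move=> cf fa fb; apply: (@integrable_bump _ _ (a + c) (b + c)).
- exact: continuous_sub.
- by move=> s h; apply: fa; rewrite lerBlDr.
- by move=> s h; apply: fb; rewrite lerBrDr.
Qed.

(* The product spline based at [s.2] has mass [(2 e^3)^N] and a support of size [3 e]. *)
Lemma spline_average (d : V -> R) (e : R) (S : seq (R * V)) :
  (forall x z, `|d x - d z| <= enorm (x - z)) -> 0 < e ->
  `|integral_Rn (fun x => d x * \sum_(s <- S) s.1 * \prod_l bspline 2 e (x 0 l - s.2 0 l))
    - (\sum_(s <- S) s.1 * d s.2) * (2 * e ^+ 3) ^+ N| <=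
  (\sum_(s <- S) `|s.1|) * (N%:R * (3 * e)) * (2 * e ^+ 3) ^+ N.
Proof.
move=> dl e0; pose om : R := N%:R * (3 * e); pose chi (s : R * V) (x : V) : R := \prod_l bspline 2 e (x 0 l - s.2 0 l).
have B0 t : 0 <= bspline 2 e t by exact: bspline2_ge0.
have chi0 s x : 0 <= chi s x by apply: prodr_ge0 => l _.
have om0 : 0 <= om by rewrite mulr_ge0 ?ler0n// mulr_ge0// ltW.
have dx s x : `|d x - d s.2| * chi s x <= om * chi s x.
  have [->|c0] := eqVneq (chi s x) 0; first by rewrite !mulr0.
  rewrite ler_wpM2r//; apply: le_trans (dl _ _) _; apply: enorm_le_coord => [|l].
    by rewrite mulr_ge0// ltW.
  have bl : bspline 2 e (x 0 l - s.2 0 l) != 0.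
    by apply: contra_neq c0 => bl; rewrite /chi (bigD1 l)//= bl mul0r.
  rewrite !mxE ger0_norm ?subr_ge0; last first.
    rewrite leNgt; apply: contra bl => hl; apply/eqP; apply: bspline_left => //; by rewrite subr_le0 ltW.
  rewrite leNgt; apply: contra bl => hl; apply/eqP; apply: bspline2_right => //; exact: ltW.
pose GS (s : R * V) l (t : R) : R := bspline 2 e (t - s.2 0 l).
have iG s l : (@lebesgue_measure R).-integrable setT (EFin \o GS s l).
  apply: (@integrable_shift (bspline 2 e) 0 (3 * e)) => [|t t0|t t0].
  - exact: continuous_bspline.
  - exact: bspline_left.
  - exact: bspline2_right.
have intG s l : Rint (GS s l) = 2 * e ^+ 3.
  rewrite -(Rint_bspline2 e0); apply: (@Rint_shift (bspline 2 e) (bspline 3 e) 0 (3 * e)).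
  - by rewrite mulr_gt0.
  - exact: continuous_bspline.
  - exact: is_derive_bspline.
  - by move=> t t0; exact: bspline_left.
  - by move=> t t0; exact: bspline2_right.
(* A single product majorant for all the shifted splines: a product of terms is at most the product
   of the sums that contain them. *)
pose G l (t : R) : R := \sum_(s <- S) GS s l t.
have G0 l t : 0 <= G l t by apply: sumr_ge0 => s _; exact: B0.
have iGG l : (@lebesgue_measure R).-integrable setT (EFin \o G l).
  have H (r : seq (R * V)) : (@lebesgue_measure R).-integrable setT
      (EFin \o (fun t => \sum_(s <- r) GS s l t)).
    elim: r => [|s r ih].
      rewrite (_ : _ \o _ = cst 0%E); first exact: integrable0.
      by apply/funext => t /=; rewrite big_nil.
    have := integrableD measurableT (iG s l) ih.
    by congr (integrable _ _ _); apply/funext => t /=; rewrite big_cons EFinD.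
  exact: H.
pose C : R := \sum_(s <- S) `|s.1| * (`|d s.2| + om).
have C0 : 0 <= C by apply: sumr_ge0 => s _; rewrite mulr_ge0// addr_ge0.
have chiG s x : s \in S -> chi s x <= \prod_l G l (x 0 l).
  move=> sS; apply: ler_prod => l _; rewrite B0 /=.
  by rewrite /G (big_rem s)//= lerDl sumr_ge0// => s' _; exact: B0.
have dom (a : R * V -> R) x : (forall s, `|a s| <= `|s.1| * (`|d s.2| + om)) ->
    `|\sum_(s <- S) a s * chi s x| <= C * \prod_l G l (x 0 l).
  move=> ha; apply: le_trans (ler_norm_sum _ _ _) _; rewrite mulr_suml big_seq_cond [leRHS]big_seq_cond.
  apply: ler_sum => s /andP[sS _]; rewrite normrM (ger0_norm (chi0 s x)).
  by apply: ler_pM => //; exact: chiG.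
have val (a : R * V -> R) : integral_Rn (fun x => \sum_(s <- S) a s * chi s x) =
    (\sum_(s <- S) a s) * (2 * e ^+ 3) ^+ N.
  rewrite (intRn_sum S a iG) mulr_suml; apply: eq_bigr => s _; congr (_ * _).
  by rewrite (eq_bigr (fun=> 2 * e ^+ 3)) ?prodr_const ?card_ord// => l _.
have mid x : `|d x * \sum_(s <- S) s.1 * chi s x| <= C * \prod_l G l (x 0 l).
  rewrite mulr_sumr.
  apply: le_trans (ler_norm_sum _ _ _) _; rewrite mulr_suml big_seq_cond [leRHS]big_seq_cond.
  apply: ler_sum => s /andP[sS _].
  apply: (@le_trans _ _ (`|s.1| * (`|d s.2| + om) * chi s x)); last first.
    by rewrite ler_wpM2l ?chiG// mulr_ge0// addr_ge0.
  rewrite mulrCA normrM -mulrA ler_wpM2l// normrM (ger0_norm (chi0 s x)).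
  have := dx s x; have := ler_normD (d x - d s.2) (d s.2); rewrite subrK => h1 h2.
  rewrite mulrDl; apply: le_trans (ler_wpM2r (chi0 s x) h1) _.
  by rewrite mulrDl addrC lerD2l.
have pw x : `|d x * (\sum_(s <- S) s.1 * chi s x) - \sum_(s <- S) s.1 * d s.2 * chi s x| <=
    \sum_(s <- S) `|s.1| * om * chi s x.
  rewrite mulr_sumr -sumrB; apply: le_trans (ler_norm_sum _ _ _) _; apply: ler_sum => s _.
  have -> : d x * (s.1 * chi s x) - s.1 * d s.2 * chi s x = s.1 * ((d x - d s.2) * chi s x) by ring.
  by rewrite normrM -mulrA ler_wpM2l// normrM (ger0_norm (chi0 s x)).
(* On the support of each spline [d] differs from [d s.2] by at most [om], so that the integral is
   squeezed between two explicit combinations of product splines. *)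
have up := @intRn_mono R N _ (fun x => \sum_(s <- S) (s.1 * d s.2 + `|s.1| * om) * chi s x) G C C0 iGG G0 _ mid.
have lo := @intRn_mono R N (fun x => \sum_(s <- S) (s.1 * d s.2 - `|s.1| * om) * chi s x) _ G C C0 iGG G0 _ _ mid.
have {}up := up _ (fun x => dom (fun s => s.1 * d s.2 + `|s.1| * om) x _).
have {}lo := lo _ (fun x => dom (fun s => s.1 * d s.2 - `|s.1| * om) x _).
rewrite (val (fun s => s.1 * d s.2 + `|s.1| * om)) in up.
rewrite (val (fun s => s.1 * d s.2 - `|s.1| * om)) in lo.
have nb (s : R * V) (a : R) : `|a| <= `|s.1| * om -> `|s.1 * d s.2 + a| <= `|s.1| * (`|d s.2| + om).
  by move=> ha; rewrite mulrDr -normrM; apply: le_trans (ler_normD _ _) _; rewrite lerD2l.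
have so (s : R * V) : 0 <= `|s.1| * om by rewrite mulr_ge0.
have {}up := up _ (fun s => nb s _ _); have {}lo := lo _ (fun s => nb s _ _).
rewrite ler_distl; apply/andP; split.
- rewrite (_ : _ - _ = (\sum_(s <- S) (s.1 * d s.2 - `|s.1| * om)) * (2 * e ^+ 3) ^+ N).
    apply: lo => [x|s]; last by rewrite normrN ger0_norm.
    have := pw x; rewrite ler_distl => /andP[h _]; apply: le_trans h.
    by rewrite -sumrB le_eqVlt; apply/orP; left; apply/eqP; apply: eq_bigr => s _; rewrite mulrBl.
  by rewrite sumrB -mulr_suml mulrBl.
- rewrite (_ : _ + _ = (\sum_(s <- S) (s.1 * d s.2 + `|s.1| * om)) * (2 * e ^+ 3) ^+ N).
    apply: up => [x|s]; last by rewrite ger0_norm.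
    have := pw x; rewrite ler_distl => /andP[_ h]; apply: le_trans h _.
    by rewrite -big_split le_eqVlt; apply/orP; left; apply/eqP; apply: eq_bigr => s _; rewrite mulrDl.
  by rewrite big_split /= -mulr_suml [RHS]mulrDl.
Qed.

(* [P2] is the test function for the weak derivative along [i] and [j]; [P0], its classical
   derivative along [i] and [j], is a combination of four product splines based at the four vertices
   of the second difference. *)
Lemma mixed_diff_core (U : set V) (d gi gij : V -> R) (i j : 'I_N) (M h k r e : R) (y : V)
    (P2 P2' P1 P1' P0 : 'I_N -> R -> R) (I2 : 'I_N -> R)
    (S := [:: (1, y); (- 1, y + h *: delta_mx 0 i); (- 1, y + k *: delta_mx 0 j);
              (1, y + h *: delta_mx 0 i + k *: delta_mx 0 j)]) :
  (forall x z, `|d x - d z| <= enorm (x - z)) ->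
  weak_partial U i d gi -> weak_partial U j gi gij -> (forall x, U x -> `|gij x| <= M) ->
  0 < h -> 0 < k -> 0 < r -> 0 < e -> 3 * e <= r ->
  (forall x : V, (forall l, y 0 l <= x 0 l <= y 0 l + (h + k + r)) -> U x) ->
  (forall l (s : R), is_derive s (1 : R) (P2 l) (P2' l s)) -> (forall l, continuous (P2' l)) ->
  (forall l (s : R), is_derive s (1 : R) (P1 l) (P1' l s)) -> (forall l, continuous (P1' l)) ->
  (forall l, P1 l = if l == j then P2' j else P2 l) ->
  (forall l, P0 l = if l == i then P1' i else P1 l) ->
  (forall l s, s <= 0 -> P2 l s = 0 /\ P1 l s = 0) ->
  (forall l s, h + k + r <= s -> P2 l s = 0 /\ P1 l s = 0) ->
  (forall l s, 0 <= P2 l s) ->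
  (forall l c, Rint (fun s => P2 l (s - c)) = I2 l) ->
  \prod_l I2 l = h * k * (2 * e ^+ 3) ^+ N ->
  (forall x : V, \prod_l P0 l (x 0 l - y 0 l) = \sum_(s <- S) s.1 * \prod_l bspline 2 e (x 0 l - s.2 0 l)) ->
  `|\sum_(s <- S) s.1 * d s.2| <= M * (h * k) + 4 * (N%:R * (3 * e)).
Proof.
move=> dl wi wj gM h0 k0 r0 e0 er hU d2 c2 d1 c1 E1 E0 left right P2ge0 int2 I2E four.
have hkr : 0 < h + k + r by move: h0 k0 r0; clear; lra.
pose b : V := y + const_mx (h + k + r).
have bE l : b 0 l = y 0 l + (h + k + r) by rewrite !mxE.
have Ub (x : V) : (forall l, y 0 l <= x 0 l <= b 0 l) -> U x.
  by move=> hx; apply: hU => l; rewrite -bE.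
pose F2 l s := P2 l (s - y 0 l); pose F1 l s := P1 l (s - y 0 l).
have dF2 l (s : R) : is_derive s (1 : R) (F2 l) (P2' l (s - y 0 l)) by exact: is_derive_sub.
have dF1 l (s : R) : is_derive s (1 : R) (F1 l) (P1' l (s - y 0 l)) by exact: is_derive_sub.
have cF2 l : continuous (fun s => P2' l (s - y 0 l)) by exact: continuous_sub.
have cF1 l : continuous (fun s => P1' l (s - y 0 l)) by exact: continuous_sub.
have t2 : test_function U (prodf F2).
  apply: (prodf_test dF2 cF2 (a := y) (b := b)) => // l s hs.
    by case: (left l (s - y 0 l)); rewrite ?subr_le0.
  by case: (right l (s - y 0 l)) => //; move: hs; rewrite bE; clear; lra.
have t1 : test_function U (prodf F1).
  apply: (prodf_test dF1 cF1 (a := y) (b := b)) => // l s hs.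
    by case: (left l (s - y 0 l)); rewrite ?subr_le0.
  by case: (right l (s - y 0 l)) => //; move: hs; rewrite bE; clear; lra.
have D2 x : 'D_(delta_mx 0 j) (prodf F2) x = prodf F1 x.
  rewrite (prodf_C1 dF2 cF2).2; apply: eq_bigr => l _; rewrite /F1 E1 /F2.
  by case: eqVneq => // ->.
have D1 x : 'D_(delta_mx 0 i) (prodf F1) x = \sum_(s <- S) s.1 * \prod_l bspline 2 e (x 0 l - s.2 0 l).
  rewrite (prodf_C1 dF1 cF1).2 -four; apply: eq_bigr => l _; rewrite E0.
  by case: eqVneq => // ->.
(* Two integrations by parts: the product of the [F1] is the derivative along [j] of the product of
   the [F2] and is itself the test function for the derivative along [i]. The two signs cancel. *)
have key : integral_Rn (fun x => d x * \sum_(s <- S) s.1 * \prod_l bspline 2 e (x 0 l - s.2 0 l)) =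
   integral_Rn (fun x => gij x * prodf F2 x).
  have := wi _ t1; have := wj _ t2.
  rewrite (intRn_ext (h := fun x => gi x * prodf F1 x)); last by move=> x; rewrite D2.
  move=> ->; rewrite opprK => <-; apply: intRn_ext => x; by rewrite D1.
have M0 : 0 <= M.
  apply: le_trans (gM y _); first exact: normr_ge0.
  by apply: Ub => l; rewrite lexx bE lerDl ltW.
have iF2 l : (@lebesgue_measure R).-integrable setT (EFin \o F2 l).
  have cP : continuous (P2 l).
    by move=> s; apply: differentiable_continuous; apply/derivable1_diffP; case: (d2 l s).
  apply: (@integrable_shift (P2 l) 0 (h + k + r)) => // s hs.
    by case: (left l s hs).
  by case: (right l s hs).
have upper : `|integral_Rn (fun x => gij x * prodf F2 x)| <= M * (h * k * (2 * e ^+ 3) ^+ N).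
  rewrite -I2E (eq_bigr (fun l => Rint (F2 l))); last by move=> l _; rewrite int2.
  apply: intRn_bound => // [l s|x]; first exact: P2ge0.
  have p0 : 0 <= prodf F2 x by apply: prodr_ge0 => l _; exact: P2ge0.
  rewrite normrM (ger0_norm p0).
  (* [gij] is bounded only on [U]; outside, the test function vanishes. *)
  have [Ux|nUx] := pselect (U x); first by rewrite ler_wpM2r// gM.
  suff p00 : prodf F2 x = 0 by rewrite -/(prodf F2 x) p00 !mulr0.
  case: t2 => _ [K [_ KU Kz]]; apply: Kz => Kx; apply: nUx; exact: KU.
have e3 : 0 < (2 * e ^+ 3) ^+ N by rewrite exprn_gt0// mulr_gt0// exprn_gt0.
have := spline_average S dl e0; rewrite key => lower.
rewrite -(ler_pM2r e3); move: upper lower; rewrite ler_norml => /andP[u1 u2].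
rewrite ler_distl => /andP[l1 l2].
have S4 : \sum_(s <- S) `|s.1| = 4 :> R.
  by rewrite !big_cons big_nil /= !normrN !normr1; ring.
rewrite S4 in l1 l2.
rewrite -[in leLHS](ger0_norm (ltW e3)) -normrM ler_norml.
by move: u1 u2 l1 l2; clear; move=> *; apply/andP; split; lra.
Qed.

End ProductTests.

(** * From weak derivatives to second-order expansions *)

Section MixedDifferences.
Context {R : realType} {N : nat}.
Local Notation V := 'rV[R]_N.
Local Notation Rint f := (Rintegral (@lebesgue_measure R) setT f).

Lemma prod_pick2 (i j : 'I_N) (h k m : R) :
  \prod_l ((if l == i then h else 1) * (if l == j then k else 1) * m) = h * k * m ^+ N.
Proof.
rewrite !big_split /= prodr_const card_ord.
by rewrite -!(big_mkcond (fun l => l == _)) /= !big_pred1_eq.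
Qed.

Lemma Rint_shift_bspline2 (e c : R) : 0 < e -> Rint (fun s => bspline 2 e (s - c)) = 2 * e ^+ 3.
Proof.
move=> e0; rewrite -(Rint_bspline2 e0); apply: (@Rint_shift R (bspline 2 e) (bspline 3 e) 0 (3 * e)).
- by rewrite mulr_gt0.
- exact: continuous_bspline.
- exact: is_derive_bspline.
- by move=> t t0; exact: bspline_left.
- by move=> t t0; exact: bspline2_right.
Qed.

Lemma continuous_bdiff1 (e h : R) : continuous (bdiff1 e h).
Proof. by move=> s; apply: cvgB; [exact: continuous_bspline|exact: (continuous_sub (@continuous_bspline R 3 e))]. Qed.

Lemma continuous_dbdiff1 (e h : R) : continuous (dbdiff1 e h).
Proof. by move=> s; apply: cvgB; [exact: continuous_bspline|exact: (continuous_sub (@continuous_bspline R 2 e))]. Qed.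

Lemma continuous_increment2 (e h k : R) m : continuous (fun s : R => (bspline m e s - bspline m e (s - h)) - (bspline m e (s - k) - bspline m e (s - k - h))).
Proof.
have c1 : continuous (fun s : R => bspline m e s - bspline m e (s - h)).
  by move=> s; apply: cvgB; [exact: continuous_bspline|exact: (continuous_sub (@continuous_bspline R m e))].
by move=> s; apply: cvgB; [exact: c1|exact: (continuous_sub c1)].
Qed.

Lemma Rint_shift_bdiff1 (e h c : R) : 0 < e -> 0 < h -> Rint (fun s => bdiff1 e h (s - c)) = h * (2 * e ^+ 3).
Proof.
move=> e0 h0; rewrite -(Rint_bdiff1 e0 h0).
apply: (@Rint_shift R (bdiff1 e h) (fun s => bspline 4 e s - bspline 4 e (s - h)) 0 (3 * e + h)).
- by rewrite addr_gt0// mulr_gt0.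
- exact: continuous_bdiff1.
- by apply: is_derive_increment => s; exact: is_derive_bspline.
- by move=> t t0; apply: bdiff1_left => //; exact: ltW.
- by move=> t t0; apply: bdiff1_right => //; exact: ltW.
Qed.

Lemma Rint_shift_bdiff2 (e h k c : R) : 0 < e -> 0 < h -> 0 < k ->
  Rint (fun s => bdiff2 e h k (s - c)) = h * k * (2 * e ^+ 3).
Proof.
move=> e0 h0 k0; rewrite -(Rint_bdiff2 e0 h0 k0).
apply: (@Rint_shift R (bdiff2 e h k) (fun s => (bspline 5 e s - bspline 5 e (s - h)) - (bspline 5 e (s - k) - bspline 5 e (s - k - h)))
  0 (3 * e + h + k)).
- by rewrite !addr_gt0// mulr_gt0.
- exact: continuous_increment2.
- move=> s; apply: (@is_derive_increment R (fun s => bspline 5 e s - bspline 5 e (s - h)) (fun s => bspline 4 e s - bspline 4 e (s - h))).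
  by apply: is_derive_increment => {}s; exact: is_derive_bspline.
- by move=> t t0; apply: bdiff2_left => //; exact: ltW.
- by move=> t t0; apply: bdiff2_right => //; exact: ltW.
Qed.

Lemma dbdiff1_left (e h s : R) : 0 < e -> 0 <= h -> s <= 0 -> dbdiff1 e h s = 0.
Proof. by move=> e0 h0 s0; rewrite /dbdiff1 !bspline_left ?subrr//; move: s0 h0; clear; lra. Qed.

Lemma dbdiff2_left (e h k s : R) : 0 < e -> 0 <= h -> 0 <= k -> s <= 0 -> dbdiff2 e h k s = 0.
Proof. by move=> e0 h0 k0 s0; rewrite /dbdiff2 !bspline_left; [rewrite !subrr|..] => //; move: s0 h0 k0; clear; lra. Qed.

Lemma dbdiff1_right (e h s : R) : 0 < e -> 0 <= h -> 3 * e + h <= s -> dbdiff1 e h s = 0.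
Proof. by move=> e0 h0 s0; rewrite /dbdiff1 !bspline_right//; [ring|..]; move: s0 h0; clear; lra. Qed.

Lemma dbdiff2_right (e h k s : R) : 0 < e -> 0 <= h -> 0 <= k -> 3 * e + h + k <= s -> dbdiff2 e h k s = 0.
Proof. by move=> e0 h0 k0 s0; rewrite /dbdiff2 !bspline_right//; [ring|..]; move: s0 h0 k0; clear; lra. Qed.

(** The spline is smeared over a length [h] along [i] and [k] along [j], so that differentiation
    leaves its copies at the four vertices of the second difference. When [i = j] both smearings act
    on one coordinate, hence the two cases. In the other coordinates [bspline 2] is smooth enough,
    its derivative [bspline 1] being continuous. *)
Lemma mixed_diff_eps (U : set V) (d gi gij : V -> R) (i j : 'I_N) (M h k r e : R) (y : V) :
  (forall x z, `|d x - d z| <= enorm (x - z)) ->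
  weak_partial U i d gi -> weak_partial U j gi gij -> (forall x, U x -> `|gij x| <= M) ->
  0 < h -> 0 < k -> 0 < r -> 0 < e -> 3 * e <= r ->
  (forall x : V, (forall l, y 0 l <= x 0 l <= y 0 l + (h + k + r)) -> U x) ->
  `|d (y + h *: delta_mx 0 i + k *: delta_mx 0 j) - d (y + h *: delta_mx 0 i)
    - d (y + k *: delta_mx 0 j) + d y| <= M * (h * k) + 4 * (N%:R * (3 * e)).
Proof.
move=> dl wi wj gM h0 k0 r0 e0 er hU.
have h0' := ltW h0; have k0' := ltW k0.
pose I2 (l : 'I_N) : R := (if l == i then h else 1) * (if l == j then k else 1) * (2 * e ^+ 3).
rewrite (_ : d _ - _ - _ + _ = \sum_(s <- [:: (1, y); (- 1, y + h *: delta_mx 0 i); (- 1, y + k *: delta_mx 0 j);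
              (1, y + h *: delta_mx 0 i + k *: delta_mx 0 j)]) s.1 * d s.2); last first.
  by rewrite !big_cons big_nil /=; ring.
have [ij|ij] := eqVneq i j.
  subst j.
  pose P2 (l : 'I_N) : R -> R := if l == i then bdiff2 e h k else bspline 2 e.
  pose P2' (l : 'I_N) : R -> R := if l == i then dbdiff2 e h k else bspline 1 e.
  pose P1 (l : 'I_N) : R -> R := if l == i then dbdiff2 e h k else bspline 2 e.
  pose P1' (l : 'I_N) : R -> R := if l == i then ddbdiff2 e h k else bspline 1 e.
  pose P0 (l : 'I_N) : R -> R := if l == i then ddbdiff2 e h k else bspline 2 e.
  apply: (@mixed_diff_core R N U d gi gij i i M h k r e y P2 P2' P1 P1' P0 I2) => //.
  - by move=> l s; rewrite /P2 /P2'; case: ifP => _; [exact: is_derive_bdiff2|exact: is_derive_bspline].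
  - by move=> l; rewrite /P2'; case: ifP => _; [exact: continuous_increment2|exact: continuous_bspline].
  - by move=> l s; rewrite /P1 /P1'; case: ifP => _; [exact: is_derive_dbdiff2|exact: is_derive_bspline].
  - by move=> l; rewrite /P1'; case: ifP => _; [exact: continuous_increment2|exact: continuous_bspline].
  - by move=> l; rewrite /P1 /P2' /P2 eqxx; case: ifP.
  - by move=> l; rewrite /P0 /P1' /P1 eqxx; case: ifP.
  - move=> l s s0; rewrite /P2 /P1; case: ifP => _; last by rewrite bspline_left.
    by rewrite bdiff2_left// dbdiff2_left.
  - move=> l s s0; rewrite /P2 /P1; case: ifP => _.
      by rewrite bdiff2_right ?dbdiff2_right//; move: s0 er; clear; lra.
    by rewrite bspline2_right//; move: s0 er h0 k0; clear; lra.
  - by move=> l s; rewrite /P2; case: ifP => _; [exact: bdiff2_ge0|exact: bspline2_ge0].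
  - move=> l c; rewrite /P2 /I2; case: ifP => _; first exact: Rint_shift_bdiff2.
    by rewrite Rint_shift_bspline2// !mul1r.
  - exact: prod_pick2.
  - move=> x; rewrite !big_cons big_nil /= addr0.
    pose Q : R := \prod_(l | l != i) bspline 2 e (x 0 l - y 0 l).
    have split (F : 'I_N -> R) : (forall l, l != i -> F l = bspline 2 e (x 0 l - y 0 l)) ->
        \prod_l F l = F i * Q.
      by move=> FQ; rewrite (bigD1 i)//=; congr (_ * _); apply: eq_bigr => l; exact: FQ.
    rewrite !split; try (move=> l /negbTE li; rewrite /P0 ?mxE /= ?li ?mulr0 ?addr0//).
    rewrite /P0 !mxE !eqxx /= !mulr1.
    rewrite /ddbdiff2; set q := x 0 i - y 0 i.
    have -> : x 0 i - (y 0 i + h) = q - h by rewrite /q; ring.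
    have -> : x 0 i - (y 0 i + k) = q - k by rewrite /q; ring.
    have -> : x 0 i - (y 0 i + h + k) = q - k - h by rewrite /q; ring.
    by ring.
have ji : (j == i) = false by rewrite eq_sym (negbTE ij).
have ij' := negbTE ij.
pose P2 (l : 'I_N) : R -> R := if l == i then bdiff1 e h else if l == j then bdiff1 e k else bspline 2 e.
pose P2' (l : 'I_N) : R -> R := if l == i then dbdiff1 e h else if l == j then dbdiff1 e k else bspline 1 e.
pose P1 (l : 'I_N) : R -> R := if l == i then bdiff1 e h else if l == j then dbdiff1 e k else bspline 2 e.
pose P1' (l : 'I_N) : R -> R := if l == i then dbdiff1 e h else
  if l == j then fun s => bspline 1 e s - bspline 1 e (s - k) else bspline 1 e.
pose P0 (l : 'I_N) : R -> R := if l == i then dbdiff1 e h else if l == j then dbdiff1 e k else bspline 2 e.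
have hr : 3 * e + h <= h + k + r by move: er k0; clear; lra.
have kr : 3 * e + k <= h + k + r by move: er h0; clear; lra.
apply: (@mixed_diff_core R N U d gi gij i j M h k r e y P2 P2' P1 P1' P0 I2) => //.
- by move=> l s; rewrite /P2 /P2'; do 2?case: ifP => _; [exact: is_derive_bdiff1|exact: is_derive_bdiff1|exact: is_derive_bspline].
- by move=> l; rewrite /P2'; do 2?case: ifP => _; [exact: continuous_dbdiff1|exact: continuous_dbdiff1|exact: continuous_bspline].
- move=> l s; rewrite /P1 /P1'; do 2?case: ifP => _; [exact: is_derive_bdiff1| |exact: is_derive_bspline].
  by apply: is_derive_increment => {}s; exact: is_derive_bspline.
- move=> l; rewrite /P1'; do 2?case: ifP => _; [exact: continuous_dbdiff1| |exact: continuous_bspline].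
  by move=> s; apply: cvgB; [exact: continuous_bspline|exact: (continuous_sub (@continuous_bspline R 1 e))].
- move=> l; rewrite /P1 /P2' /P2 eqxx ji; case: (eqVneq l i) => [->|_]; first by rewrite ij'.
  by case: (eqVneq l j).
- by move=> l; rewrite /P0 /P1' /P1 eqxx; case: ifP.
- move=> l s s0; rewrite /P2 /P1; do 2?case: ifP => _; last by rewrite bspline_left.
    by rewrite bdiff1_left.
  by rewrite bdiff1_left// dbdiff1_left.
- move=> l s s0; rewrite /P2 /P1; do 2?case: ifP => _.
  + by rewrite bdiff1_right//; exact: le_trans s0.
  + by rewrite bdiff1_right ?dbdiff1_right//; exact: le_trans s0.
  + by rewrite bspline2_right//; move: s0 er h0 k0; clear; lra.
- by move=> l s; rewrite /P2; do 2?case: ifP => _; [exact: bdiff1_ge0|exact: bdiff1_ge0|exact: bspline2_ge0].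
- move=> l c; rewrite /P2 /I2; case: eqVneq => [->|_].
    by rewrite ij' mulr1; exact: Rint_shift_bdiff1.
  by case: ifP => _; rewrite mul1r; [exact: Rint_shift_bdiff1|rewrite Rint_shift_bspline2// mul1r].
- exact: prod_pick2.
- move=> x; rewrite !big_cons big_nil /= addr0.
  pose Q : R := \prod_(l | (l != i) && (l != j)) bspline 2 e (x 0 l - y 0 l).
  pose p (l : 'I_N) : R := x 0 l - y 0 l.
  have split (F : 'I_N -> R) : (forall l, l != i -> l != j -> F l = bspline 2 e (x 0 l - y 0 l)) ->
      \prod_l F l = F i * (F j * Q).
    move=> FQ; rewrite (bigD1 i)//= (bigD1 j) ?ji//=; do 2!congr (_ * _).
    by apply: eq_bigr => l /andP[]; exact: FQ.
  rewrite !split; try (move=> l /negbTE li /negbTE lj; rewrite /P0 ?mxE /= ?li ?lj ?mulr0 ?addr0//).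
  rewrite /P0 !mxE !eqxx ij' ji /= !mulr1 !mulr0 !addr0 /dbdiff1.
  have -> : x 0 i - (y 0 i + h) = x 0 i - y 0 i - h by ring.
  have -> : x 0 j - (y 0 j + k) = x 0 j - y 0 j - k by ring.
  by ring.
Qed.

Lemma mixed_diff (U : set V) (d gi gij : V -> R) (i j : 'I_N) (M h k r : R) (y : V) :
  (forall x z, `|d x - d z| <= enorm (x - z)) ->
  weak_partial U i d gi -> weak_partial U j gi gij -> (forall x, U x -> `|gij x| <= M) ->
  0 < h -> 0 < k -> 0 < r ->
  (forall x : V, (forall l, y 0 l <= x 0 l <= y 0 l + (h + k + r)) -> U x) ->
  `|d (y + h *: delta_mx 0 i + k *: delta_mx 0 j) - d (y + h *: delta_mx 0 i)
    - d (y + k *: delta_mx 0 j) + d y| <= M * (h * k).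
Proof.
move=> dl wi wj gM h0 k0 r0 hU; apply/ler_addgt0Pr => eps eps0.
(* [e] tends to 0 with [h] and [k] fixed. The error is [12 N e]; [N + 1] avoids dividing by 0 in
   dimension 0. *)
pose e : R := Num.min (r / 3) (eps / (12 * N.+1%:R)).
have n0 : (0 : R) < 12 * N.+1%:R by rewrite mulr_gt0// ltr0n.
have e0 : 0 < e by rewrite lt_min !divr_gt0.
have er : 3 * e <= r by rewrite mulrC -ler_pdivlMr// ge_min lexx.
apply: le_trans (mixed_diff_eps dl wi wj gM h0 k0 r0 e0 er hU) _; rewrite lerD2l.
have ee : e <= eps / (12 * N.+1%:R) by rewrite ge_min lexx orbT.
rewrite ler_pdivlMr// in ee.
apply: le_trans ee; rewrite (_ : 4 * _ = e * (12 * N%:R)); last by ring.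
by rewrite ler_wpM2l ?(ltW e0)// ler_wpM2l// ler_nat.
Qed.

End MixedDifferences.

(* The second differences of [G] are positive, so its maximum is attained at an endpoint. *)
Lemma second_diff_le0 (R : realType) (G : R -> R) (h : R) : 0 < h ->
  {within `[0, h], continuous G} -> G 0 = 0 -> G h = 0 ->
  (forall s t : R, 0 < t -> 0 <= s - t -> s + t <= h -> 0 < G (s + t) - 2 * G s + G (s - t)) ->
  forall s, 0 <= s <= h -> G s <= 0.
Proof.
move=> h0 cG G0 Gh pos s sh.
have [c ch cmax] := EVT_max (ltW h0) cG.
have sc : G s <= G c by apply: cmax; rewrite in_itv.
move: ch; rewrite in_itv /= => /andP[c0 c1].
have [c00|c00] := eqVneq c 0; first by rewrite -G0 -c00.
have [ch|ch] := eqVneq c h; first by rewrite -Gh -ch.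
have cp : 0 < c by rewrite lt_def c00.
have cl : c < h by rewrite lt_def eq_sym ch.
pose t : R := Num.min c (h - c).
have t0 : 0 < t by rewrite lt_min cp subr_gt0.
have t1 : t <= c by rewrite ge_min lexx.
have t2 : t <= h - c by rewrite ge_min lexx orbT.
have h1 : 0 <= c - t by rewrite subr_ge0.
have h2 : c + t <= h by rewrite addrC -lerBrDr.
have := pos c t t0 h1 h2.
have m1 : G (c + t) <= G c by apply: cmax; rewrite in_itv /= h2 addr_ge0// ltW.
have m2 : G (c - t) <= G c.
  by apply: cmax; rewrite in_itv /= h1 (le_trans _ (ltW cl))// gerBl ltW.
by move: m1 m2; clear; lra.
Qed.

(** Subtract from [f] its chord and the parabola [(M + eps) s (h - s)]: the result vanishes at both
    ends and, thanks to [eps], has strictly positive second differences, so that [second_diff_le0]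
    applies. *)
Lemma quotient_mono (R : realType) (f : R -> R) (M rho : R) : 0 <= M ->
  (forall s, continuous_at s f) ->
  (forall s t : R, 0 < t -> 0 <= s - t -> s + t < rho ->
    - M * t ^+ 2 <= f (s + t) - 2 * f s + f (s - t)) ->
  forall s h, 0 < s -> s <= h -> h < rho -> (f s - f 0) / s <= (f h - f 0) / h + M * (h - s).
Proof.
move=> M0 cf sd s h s0 sh hr.
have h0 : 0 < h by exact: lt_le_trans sh.
pose q : R := (f h - f 0) / h.
suff key (eps : R) : 0 < eps -> f s - f 0 - s * q <= (M + eps) * (s * (h - s)).
  rewrite ler_pdivrMr// mulrDl; rewrite -/q.
  have [->|hs] := eqVneq s h; first by rewrite /q subrr mulr0 mul0r addr0 divfK// gt_eqF.
  have hs0 : 0 < s * (h - s) by rewrite mulr_gt0// subr_gt0 lt_def eq_sym hs.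
  suff : f s - f 0 - s * q <= M * (s * (h - s)).
    by move: (f s - f 0) => x; clear; nra.
  apply/ler_addgt0Pr => e e0.
  have := key (e / (s * (h - s))); rewrite divr_gt0// => /(_ isT) /le_trans; apply.
  by rewrite mulrDl divfK// gt_eqF.
move=> e0.
pose G (x : R) : R := f x - f 0 - x * q - (M + eps) * (x * (h - x)).
have cG : continuous G.
  move=> x; rewrite /G; apply: cvgB; last first.
    by apply: cvgM; [exact: cvg_cst|apply: cvgM; [exact: cvg_id|apply: cvgB; [exact: cvg_cst|exact: cvg_id]]].
  apply: cvgB; last by apply: cvgM; [exact: cvg_id|exact: cvg_cst].
  by apply: cvgB; [exact: cf|exact: cvg_cst].
suff : G s <= 0 by rewrite /G subr_le0.
apply: (@second_diff_le0 R G h h0) => //.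
- exact: continuous_subspaceT.
- by rewrite /G !mul0r mulr0 subrr !subr0.
- by rewrite /G subrr !mulr0 subr0 /q mulrCA divff ?mulr1 ?subrr// gt_eqF.
- move=> x t t0 x1 x2; have := sd x t t0 x1 (le_lt_trans x2 hr).
  have : 0 < eps * t ^+ 2 by rewrite mulr_gt0// exprn_gt0.
  have : 0 <= M * t ^+ 2 by rewrite mulr_ge0// sqr_ge0.
  rewrite /G; move: (f (x + t)) (f x) (f (x - t)) (f 0) => a b c d; clear; nra.
- by rewrite (ltW s0).
Qed.

(* The slope is the limit of [q h] as [h] decreases to 0. *)
Lemma slope_exists (R : realType) (q : R -> R) (M rho : R) : 0 <= M -> 0 < rho ->
  (forall s h, 0 < s -> s <= h -> h < rho -> `|q s - q h| <= M * (h - s)) ->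
  forall h, 0 < h < rho -> `|q h - inf [set q s + M * s | s in `]0, rho[]| <= M * h.
Proof.
move=> M0 r0 hq h /andP[h0 hr].
set S := [set q s + M * s | s in `]0, rho[].
have lb : lbound S (q h - M * h).
  move=> y [s hs0 <-]; move: hs0; rewrite /= in_itv /= => /andP[s0 sr].
  have Mh := mulr_ge0 M0 (ltW h0); have Ms := mulr_ge0 M0 (ltW s0).
  have [sh|hs] := leP s h.
    by have := hq s h s0 sh hr; rewrite ler_norml => /andP[]; move: Mh Ms; clear; lra.
  by have := hq h s h0 (ltW hs) sr; rewrite ler_norml => /andP[]; move: Mh Ms; clear; lra.
have Sh : S (q h + M * h) by exists h => //=; rewrite in_itv /= h0.
have h1 : q h - M * h <= inf S by apply: lb_le_inf => //; exists (q h + M * h).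
have h2 : inf S <= q h + M * h by apply: ge_inf => //; exists (q h - M * h).
by rewrite ler_norml; move: h1 h2; clear; move=> *; apply/andP; split; lra.
Qed.

Section Expansion.
Context {R : realType} {N : nat}.
Local Notation V := 'rV[R]_N.
Local Notation e_ i := (delta_mx 0 i : V).
Implicit Types (d : V -> R) (x y z : V).

Definition mixed_bound d z (M rho : R) := forall y i j (h k : R), `|y - z| < 2 * rho ->
  0 < h < rho -> 0 < k < rho ->
  `|d (y + h *: e_ i + k *: e_ j) - d (y + h *: e_ i) - d (y + k *: e_ j) + d y| <= M * (h * k).

(** The partial derivatives from the right: under [mixed_bound] the quotient plus [M s] is
    nondecreasing in [s], so that its infimum is its limit at 0. *)
Definition slope d (M rho : R) x : V :=
  \row_i inf [set (d (x + s *: e_ i) - d x) / s + M * s | s in `]0, rho[].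

Lemma norm_delta_le i : `|e_ i| <= 1.
Proof.
apply: le_trans (norm_le_enorm _) _; rewrite -(@ler_pXn2r _ 2)// ?nnegrE ?enorm_ge0// enorm2.
rewrite /dotv (bigD1 i)//= big1 ?addr0 ?mxE ?eqxx ?mulr1 ?expr1n// => j ji.
by rewrite !mxE /= (negbTE ji) mulr0.
Qed.

(** [mixed_bound] with [i = j] and [h = k] bounds the second differences of [d] along a line. *)
Lemma slope_pos d z (M rho : R) x i (h : R) : 0 <= M ->
  (forall x y, `|d x - d y| <= enorm (x - y)) -> mixed_bound d z M rho ->
  `|x - z| < rho -> 0 < h < rho -> `|d (x + h *: e_ i) - d x - h * slope d M rho x 0 i| <= M * h ^+ 2.
Proof.
move=> M0 dl mb xz /andP[h0 hr].
have r0 : 0 < rho by exact: lt_trans hr.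
pose f (s : R) : R := d (x + s *: e_ i).
have cf s : continuous_at s f.
  apply: (@continuous_comp _ _ _ (fun s : R => x + s *: e_ i) d); last exact: continuous_lip.
  by apply: cvgD; [exact: cvg_cst|apply: cvgZr_tmp; exact: cvg_id].
have sd s t : 0 < t -> 0 <= s - t -> s + t < rho -> `|f (s + t) - 2 * f s + f (s - t)| <= M * t ^+ 2.
  move=> t0 st sr.
  have tr : t < rho by move: st sr t0; clear; lra.
  have := mb (x + (s - t) *: e_ i) i i t t; rewrite t0 tr => /(_ _ isT isT).
  have E1 : x + (s - t) *: e_ i + t *: e_ i = x + s *: e_ i by rewrite -addrA -scalerDl subrK.
  have E2 : x + s *: e_ i + t *: e_ i = x + (s + t) *: e_ i by rewrite -addrA -scalerDl.
  rewrite E1 E2 -expr2 => H; rewrite /f.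
  suff : `|x + (s - t) *: e_ i - z| < 2 * rho.
    move=> /H; congr (_ <= _); congr `|_|; ring.
  rewrite addrAC; apply: le_lt_trans (ler_normD _ _) _; rewrite normrZ (ger0_norm st).
  have := ler_wpM2l st (norm_delta_le i); move: xz st sr t0; clear; lra.
have cNf s : continuous_at s (fun s => - f s) by apply: cvgN; exact: cf.
pose q (s : R) : R := (f s - f 0) / s.
have f0 : f 0 = d x by rewrite /f scale0r addr0.
have hq s k : 0 < s -> s <= k -> k < rho -> `|q s - q k| <= M * (k - s).
  move=> s0 sk kr; rewrite ler_norml; apply/andP; split.
    have := @quotient_mono R (fun s => - f s) M rho M0 cNf _ s k s0 sk kr.
    have sd' s' t : 0 < t -> 0 <= s' - t -> s' + t < rho -> - M * t ^+ 2 <= - f (s' + t) - 2 * - f s' + - f (s' - t).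
      by move=> a b c; have := sd s' t a b c; rewrite ler_norml => /andP[_]; clear; lra.
    move=> /(_ sd'); rewrite -!opprD !mulNr -/(q s) -/(q k); clear; lra.
  have sd' s' t : 0 < t -> 0 <= s' - t -> s' + t < rho -> - M * t ^+ 2 <= f (s' + t) - 2 * f s' + f (s' - t).
    by move=> a b c; have := sd s' t a b c; rewrite ler_norml => /andP[+ _]; clear; lra.
  by have := @quotient_mono R f M rho M0 cf sd' s k s0 sk kr; rewrite -/(q s) -/(q k); clear; lra.
have hh : 0 < h < rho by rewrite h0.
have := slope_exists M0 r0 hq hh; rewrite /slope mxE.
rewrite (_ : [set q s + M * s | s in `]0, rho[] =
    [set (d (x + s *: e_ i) - d x) / s + M * s | s in `]0, rho[]); last first.
  by rewrite /q f0.
move: (inf _) => p H; rewrite /q f0 in H.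
rewrite (_ : _ - _ - _ = h * ((f h - d x) / h - p)); last by rewrite /f; field; rewrite gt_eqF.
by rewrite normrM gtr0_norm// expr2 mulrCA ler_wpM2l// ltW.
Qed.

(** The mixed difference divided by [h] is the variation over [k e_j] of the difference quotient
    along [e_i]; let [h] tend to 0. *)
Lemma slope_lip1 d z (M rho : R) x i j (k : R) : 0 <= M ->
  (forall x y, `|d x - d y| <= enorm (x - y)) -> mixed_bound d z M rho ->
  `|x - z| < rho -> `|x + k *: e_ j - z| < rho -> 0 < k < rho ->
  `|slope d M rho (x + k *: e_ j) 0 i - slope d M rho x 0 i| <= M * k.
Proof.
move=> M0 dl mb xz xkz /andP[k0 kr]; have r0 := lt_trans k0 kr.
apply/ler_addgt0Pr => e e0.
pose h : R := Num.min (rho / 2) (e / (2 * (M + 1))).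
have M1 : 0 < 2 * (M + 1) by rewrite mulr_gt0// ltr_wpDl.
have h0 : 0 < h by rewrite lt_min !divr_gt0.
have hr : 0 < h < rho by rewrite h0 gt_min; apply/orP; left; move: r0; clear; lra.
have hM : 2 * M * h <= e.
  have : h <= e / (2 * (M + 1)) by rewrite ge_min lexx orbT.
  by rewrite ler_pdivlMr//; move: h0; clear; lra.
have h1 := slope_pos i M0 dl mb xz hr; have h2 := slope_pos i M0 dl mb xkz hr.
have := mb x i j h k _ hr; rewrite k0 kr => h3; have {}h3 := h3 _ isT.
have {}h3 : `|d (x + h *: e_ i + k *: e_ j) - d (x + h *: e_ i) - d (x + k *: e_ j) + d x| <= M * (h * k).
  by apply: h3; move: xz r0; clear; lra.
rewrite (addrAC x) in h3.
move: (slope _ _ _ _ _ _) (slope _ _ _ _ _ _) h1 h2 => p1 p2 h1 h2.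
rewrite -(ler_pM2l h0) -{1}(gtr0_norm h0) -normrM.
have hMh := ler_wpM2l (ltW h0) hM.
rewrite ler_norml in h1; rewrite ler_norml in h2; rewrite ler_norml in h3.
case/andP: h1 => a1 a2; case/andP: h2 => b1 b2; case/andP: h3 => c1 c2.
rewrite ler_norml; move: a1 a2 b1 b2 c1 c2 hMh; clear.
move: (d _) (d _) (d _) (d _) => u1 u2 u3 u4 *; apply/andP; split; lra.
Qed.

Lemma slope_lip2 d z (M rho : R) x i j (k : R) : 0 <= M ->
  (forall x y, `|d x - d y| <= enorm (x - y)) -> mixed_bound d z M rho ->
  `|x - z| < rho -> `|x + k *: e_ j - z| < rho -> `|k| < rho ->
  `|slope d M rho (x + k *: e_ j) 0 i - slope d M rho x 0 i| <= M * `|k|.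
Proof.
move=> M0 dl mb xz xkz kr; have [k0|k0|->] := ltgtP k 0; last first.
- by rewrite scale0r addr0 subrr normr0 mulr0.
- rewrite (gtr0_norm k0); rewrite (gtr0_norm k0) in kr; apply: (slope_lip1 i M0 dl mb xz xkz); by rewrite k0.
have E : x + k *: e_ j + (- k) *: e_ j = x by rewrite scaleNr addrK.
have := @slope_lip1 d z M rho (x + k *: e_ j) i j (- k) M0 dl mb xkz; rewrite E => /(_ xz).
rewrite distrC (ltr0_norm k0) oppr_gt0 k0 -(ltr0_norm k0) => /(_ kr); exact.
Qed.

(** For [h < 0] the expansion is taken from the other endpoint and its slope brought back by
    [slope_lip2], hence [2 M]. *)
Lemma slope_exp1 d z (M rho : R) x i (h : R) : 0 <= M ->
  (forall x y, `|d x - d y| <= enorm (x - y)) -> mixed_bound d z M rho ->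
  `|x - z| < rho -> `|x + h *: e_ i - z| < rho -> `|h| < rho ->
  `|d (x + h *: e_ i) - d x - h * slope d M rho x 0 i| <= 2 * M * h ^+ 2.
Proof.
move=> M0 dl mb xz xhz hr; have Mh := mulr_ge0 M0 (sqr_ge0 h).
have [h0|h0|->] := ltgtP h 0; last first.
- by rewrite scale0r addr0 subrr mul0r subrr normr0 expr0n mulr0.
- apply: le_trans (slope_pos i M0 dl mb xz _) _; first by rewrite (gtr0_norm h0) in hr; rewrite h0.
  by move: Mh; clear; lra.
have E : x + h *: e_ i + (- h) *: e_ i = x by rewrite scaleNr addrK.
have h1 := @slope_pos d z M rho (x + h *: e_ i) i (- h) M0 dl mb xhz; rewrite E in h1.
have h2 := slope_lip2 i M0 dl mb xz xhz hr.
have {}h1 := h1 _; rewrite oppr_gt0 h0 -(ltr0_norm h0) hr in h1; have {}h1 := h1 isT.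
have h3 := ler_wpM2l (normr_ge0 h) h2; rewrite -normrM mulrCA -expr2 real_normK ?num_real// in h3.
rewrite (ltr0_norm h0) sqrrN in h1.
rewrite ler_norml in h1; rewrite ler_norml in h3.
case/andP: h1 => a1 a2; case/andP: h3 => b1 b2.
rewrite ler_norml; move: a1 a2 b1 b2; clear.
move: (slope _ _ _ _ _ _) (slope _ _ _ _ _ _) (d _) (d _) => p1 p2 u1 u2 *; apply/andP; split; lra.
Qed.

End Expansion.

Section Telescope.
Context {R : realType} {N : nat}.
Local Notation V := 'rV[R]_N.
Local Notation e_ i := (delta_mx 0 i : V).
Implicit Types (d : V -> R) (x y z : V).

Lemma norm_lt_coord (u : V) (r : R) : 0 < r -> (forall i, `|u 0 i| < r) -> `|u| < r.
Proof.
move=> r0 h; rewrite [`|u|]mx_normrE; apply/bigmax_ltP; split => // -[i j] _ /=.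
by rewrite ord1.
Qed.

Definition path_pt x y (m : nat) : V := \row_l (if (l < m)%N then y 0 l else x 0 l).

Lemma path_pt0 x y : path_pt x y 0 = x.
Proof. by apply/rowP => l; rewrite mxE. Qed.

Lemma path_ptN x y : path_pt x y N = y.
Proof. by apply/rowP => l; rewrite mxE ltn_ord. Qed.

Lemma path_ptS x y (m : 'I_N) : path_pt x y m.+1 = path_pt x y m + (y 0 m - x 0 m) *: e_ m.
Proof.
apply/rowP => l; rewrite !mxE eqxx /= ltnS leq_eqVlt.
have [<-|lm] := eqVneq l m; first by rewrite eqxx ltnn /= mulr1; ring.
by rewrite (_ : (l == m :> nat) = false) ?mulr0 ?addr0//; apply/negbTE.
Qed.

Lemma path_pt_in x y z m (r : R) : `|x - z| < r -> `|y - z| < r -> `|path_pt x y m - z| < r.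
Proof.
move=> hx hy; apply: norm_lt_coord => [|l]; first exact: le_lt_trans hx.
rewrite !mxE; case: ifP => _.
  by have := coord_norm (y - z) l; rewrite !mxE => /le_lt_trans; apply.
by have := coord_norm (x - z) l; rewrite !mxE => /le_lt_trans; apply.
Qed.

Lemma sum_ltS (F : 'I_N -> R) (m : 'I_N) :
  \sum_(l < N | (l < m.+1)%N) F l = \sum_(l < N | (l < m)%N) F l + F m.
Proof.
rewrite (bigD1 m)//= addrC; congr (_ + _); apply: eq_bigl => l.
by rewrite ltnS leq_eqVlt -(inj_eq val_inj) /=; case: (ltngtP l m).
Qed.

(** [d] and its slopes are followed along the path that changes one coordinate at a time, and the
    slopes at the corners are replaced by those at [x]. The Euclidean radius [rho / 2] keeps the
    coordinate increments below [rho]. *)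
Lemma dist_hyp_of_mixed d z (M rho : R) : 0 <= M -> 0 < rho ->
  (forall x y, `|d x - d y| <= enorm (x - y)) -> mixed_bound d z M rho ->
  exists Cd, dist_hyp d (slope d M rho) (fun x => enorm (x - z) < rho / 2) Cd.
Proof.
move=> M0 r0 dl mb; set g := slope d M rho.
have small x y l : enorm (x - z) < rho / 2 -> enorm (y - z) < rho / 2 -> `|y 0 l - x 0 l| < rho.
  move=> hx hy; have -> : y 0 l - x 0 l = (y - x) 0 l by rewrite !mxE.
  apply: le_lt_trans (coord_enorm _ _) _.
  have := enorm_triangle y z x; rewrite (enormB z x); move: hx hy; clear; lra.
have ball x : enorm (x - z) < rho / 2 -> `|x - z| < rho.
  move=> hx; apply: le_lt_trans (norm_le_enorm _) _; move: hx r0; clear; lra.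
have cE x y l : `|y 0 l - x 0 l| <= enorm (y - x).
  by have := coord_enorm (y - x) l; rewrite !mxE.
have glip1 x y i m : enorm (x - z) < rho / 2 -> enorm (y - z) < rho / 2 -> (m <= N)%N ->
    `|g (path_pt x y m) 0 i - g x 0 i| <= m%:R * M * enorm (y - x).
  move=> hx hy; elim: m => [|m ih] mN; first by rewrite path_pt0 subrr normr0 !mul0r.
  have {}ih := ih (ltnW mN).
  pose o := Ordinal mN; have E := path_ptS x y o; rewrite /= in E.
  have h := @slope_lip2 R N d z M rho (path_pt x y m) i o (y 0 o - x 0 o) M0 dl mb
    (path_pt_in m (ball _ hx) (ball _ hy)).
  rewrite -E in h; have {}h := h (path_pt_in m.+1 (ball _ hx) (ball _ hy)) (small x y o hx hy).
  have h2 := ler_wpM2l M0 (cE x y o).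
  rewrite -natr1 2!mulrDl mul1r -[X in `|X|](subrKA (g (path_pt x y m) 0 i)) addrC.
  by apply: le_trans (ler_normD _ _) _; apply: lerD => //; exact: le_trans h h2.
have glip x y : enorm (x - z) < rho / 2 -> enorm (y - z) < rho / 2 ->
    enorm (g x - g y) <= N%:R * (N%:R * M * enorm (x - y)).
  move=> hx hy; apply: enorm_le_coord => [|i]; first by rewrite !mulr_ge0// enorm_ge0.
  by have := @glip1 y x i N hy hx (leqnn _); rewrite path_ptN !mxE.
have dexp x y m : enorm (x - z) < rho / 2 -> enorm (y - z) < rho / 2 -> (m <= N)%N ->
    `|d (path_pt x y m) - d x - \sum_(l < N | (l < m)%N) g x 0 l * (y 0 l - x 0 l)|
     <= m%:R * ((2 + N%:R) * M * enorm (y - x) ^+ 2).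
  move=> hx hy; elim: m => [|m ih] mN.
    by rewrite path_pt0 subrr big_pred0// subrr normr0 mul0r.
  have {}ih := ih (ltnW mN).
  pose o := Ordinal mN; have E := path_ptS x y o; rewrite /= in E.
  have h := @slope_exp1 R N d z M rho (path_pt x y m) o (y 0 o - x 0 o) M0 dl mb
    (path_pt_in m (ball _ hx) (ball _ hy)).
  rewrite -E in h; have {}h := h (path_pt_in m.+1 (ball _ hx) (ball _ hy)) (small x y o hx hy).
  have := glip1 x y o m hx hy (ltnW mN); rewrite -/g in h.
  rewrite (sum_ltS _ o) /=.
  move: (\sum_(l < N | _) _) ih (cE x y o) h => S; set D := y 0 o - x 0 o.
  have E0 := enorm_ge0 (y - x); set En := enorm (y - x) in E0 *.
  move: (g (path_pt x y m) 0 o) (g x 0 o) (d (path_pt x y m)) (d (path_pt x y m.+1)) => p1 p0 u0 u1.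
  move=> ih hD h hg.
  have hg' : `|(p1 - p0) * D| <= N%:R * M * En ^+ 2.
    rewrite normrM expr2 mulrA; apply: ler_pM => //; apply: le_trans hg _.
    by rewrite -!mulrA ler_wpM2r ?mulr_ge0// ler_nat ltnW.
  have hD2 : D ^+ 2 <= En ^+ 2 by rewrite -(real_normK (num_real D)) lerXn2r// nnegrE.
  have {}h : `|u1 - u0 - D * p1| <= 2 * M * En ^+ 2.
    by apply: le_trans h _; rewrite ler_wpM2l// mulr_ge0.
  rewrite -natr1 mulrDl mul1r.
  rewrite (_ : u1 - d x - (S + p0 * D) = (u0 - d x - S) + ((u1 - u0 - D * p1) + (p1 - p0) * D)); last by ring.
  apply: le_trans (ler_normD _ _) _; apply: lerD => //.
  apply: le_trans (ler_normD _ _) _; rewrite (_ : (2 + N%:R) * M * En ^+ 2 = 2 * M * En ^+ 2 + N%:R * M * En ^+ 2); last by ring.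
  exact: lerD.
pose C : R := Num.max (N%:R * (N%:R * M)) (N%:R * ((2 + N%:R) * M)).
have C1 : N%:R * (N%:R * M) <= C by rewrite le_max lexx.
have C2 : N%:R * ((2 + N%:R) * M) <= C by rewrite le_max lexx orbT.
have C0 : 0 <= C by apply: le_trans C1; rewrite !mulr_ge0.
have de x y : enorm (x - z) < rho / 2 -> enorm (y - z) < rho / 2 ->
    `|d y - d x - dotv (g x) (y - x)| <= C * enorm (y - x) ^+ 2.
  move=> hx hy; have := dexp x y N hx hy (leqnn N); rewrite path_ptN.
  rewrite (eq_bigl xpredT) => [|l]; last exact: ltn_ord.
  rewrite /dotv (eq_bigr (fun l => g x 0 l * (y - x) 0 l)); last by move=> l _; rewrite !mxE.
  by move=> h; apply: le_trans h _; rewrite mulrA ler_wpM2r ?sqr_ge0.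
exists C; split => //.
- move=> x y hx hy; apply: le_trans (glip x y hx hy) _.
  by rewrite mulrA ler_wpM2r ?enorm_ge0.
- move=> x hx; rewrite leNgt; apply/negP => g1.
  set G := enorm (g x) in g1; have G0 : 0 < G by exact: lt_trans g1.
  (* Moving by [s g x] increases [d] by about [s G^2], but by at most [s G] since [d] is
     1-Lipschitz; [s] is so small that the quadratic error does not fill the gap [G - 1]. *)
  pose s : R := Num.min ((rho / 2 - enorm (x - z)) / (2 * G)) ((G - 1) / (2 * (C * G + 1))).
  have CG : 0 < 2 * (C * G + 1) by rewrite mulr_gt0// ltr_wpDl// mulr_ge0// ltW.
  have s0 : 0 < s by rewrite lt_min !divr_gt0 ?subr_gt0// mulr_gt0.
  have s1 : s * (2 * G) <= rho / 2 - enorm (x - z).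
    by rewrite -ler_pdivlMr ?mulr_gt0// ge_min lexx.
  have s2 : s * (2 * (C * G + 1)) <= G - 1 by rewrite -ler_pdivlMr// ge_min lexx orbT.
  have E : x + s *: g x - x = s *: g x by rewrite addrC addKr.
  have nE : enorm (x + s *: g x - x) = s * G by rewrite E enormZ gtr0_norm.
  have hy : enorm (x + s *: g x - z) < rho / 2.
    apply: le_lt_trans (enorm_triangle _ x _) _; rewrite nE.
    by move: s1 (mulr_gt0 s0 G0); clear; lra.
  have h1 := de x _ hx hy; have h2 := dl (x + s *: g x) x.
  rewrite nE in h1 h2; rewrite E dotvZr -enorm2 -/G in h1.
  move: h1 h2; rewrite !ler_norml => /andP[h1 _] /andP[_ h2].
  have h3 : s * G ^+ 2 <= s * G + C * (s * G) ^+ 2 by move: h1 h2; clear; lra.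
  have h4 : G <= 1 + C * s * G.
    rewrite -(ler_pM2l (mulr_gt0 s0 G0)); move: h3; rewrite !expr2; clear; lra.
  by move: s2 h4 s0 g1; clear; lra.
Qed.

End Telescope.

(** * Geometry of the interface *)

Section W2Distance.
Context {R : realType} {N : nat}.
Local Notation V := 'rV[R]_N.
Implicit Types (d : V -> R) (x y z : V) (U : set V).

Lemma W2_mixed_bound U d z : open U -> U z -> Wkinfty 2 U d ->
  (forall x y, `|d x - d y| <= enorm (x - y)) ->
  exists M rho : R, [/\ 0 <= M, 0 < rho & mixed_bound d z M rho].
Proof.
move=> oU Uz [_ W] dl.
have /choice[Mf hM] : forall ij : 'I_N * 'I_N, exists M : R, 0 <= M /\ exists gi gij,
    [/\ weak_partial U ij.1 d gi, weak_partial U ij.2 gi gij & forall x, U x -> `|gij x| <= M].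
  move=> [i j]; have [gi [wi [_ W1]]] := W i; have [gij [wj [[_ [M hM]] _]]] := W1 j.
  exists `|M|; split => //; exists gi, gij; split => // x Ux.
  by apply: le_trans (hM x Ux) _; exact: ler_norm.
have [r0 r00 hr] : exists2 r0 : R, 0 < r0 & forall x, `|x - z| < r0 -> U x.
  have /nbhs_ballP[r0 /= r00 hr] : nbhs z U by exact: open_nbhs_nbhs.
  exists r0 => // x xz; apply: hr; by rewrite -ball_normE /= distrC.
(* Offset [2 rho], steps [h, k < rho] and margin [r0 / 8] add up to less than [r0], so that the test
   functions are supported in [U]. The sum over all pairs is a common bound. *)
exists (\sum_ij Mf ij), (r0 / 8); split; [by apply: sumr_ge0 => ij _; case: (hM ij)|by rewrite divr_gt0|].
move=> y i j h k yz /andP[h0 h1] /andP[k0 k1].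
have [M0 [gi [gij [wi wj bM]]]] := hM (i, j).
have r8 : 0 < r0 / 8 by rewrite divr_gt0.
apply: le_trans (mixed_diff dl wi wj bM h0 k0 r8 _) _.
  move=> x hx; apply: hr; apply: norm_lt_coord => // l.
  have := hx l => /andP[a1 a2]; have := coord_norm (y - z) l; rewrite !mxE => /le_lt_trans/(_ yz).
  rewrite ltr_norml => /andP[b1 b2]; rewrite ltr_norml.
  by move: a1 a2 b1 b2 h1 k1; clear; move=> *; apply/andP; split; lra.
apply: ler_wpM2r; first by rewrite mulr_ge0// ltW.
rewrite (bigD1 (i, j))//= lerDl; apply: sumr_ge0 => ij _.
by case: (hM ij).
Qed.

Lemma W2_dist_hyp U d z : open U -> U z -> Wkinfty 2 U d ->
  (forall x y, `|d x - d y| <= enorm (x - y)) ->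
  exists (g : V -> V) (Cd r : R), 0 < r /\ dist_hyp d g (fun x => enorm (x - z) < r) Cd.
Proof.
move=> oU Uz W dl; have [M [rho [M0 r0 mb]]] := W2_mixed_bound oU Uz W dl.
have [Cd hd] := dist_hyp_of_mixed M0 r0 dl mb.
by exists (slope d M rho), Cd, (rho / 2); split; first by rewrite divr_gt0.
Qed.

End W2Distance.

Section Interface.
Context {R : realType} {N : nat}.
Local Notation V := 'rV[R]_N.
Local Notation edist := Defs.edist.
Implicit Types (x y z v n : V) (H Omega : set V).

Lemma edist_ge0 x H : 0 <= edist x H.
Proof.
rewrite /edist; have [->|/set0P[z Hz]] := eqVneq H set0; first by rewrite image_set0 inf0.
by apply: lb_le_inf; [exists (enorm (x - z)), z|move=> _ [y Hy <-]; exact: enorm_ge0].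
Qed.

Lemma edist_le x z H : H z -> edist x H <= enorm (x - z).
Proof.
move=> Hz; apply: ge_inf; last by exists z.
by exists 0 => _ [y Hy <-]; exact: enorm_ge0.
Qed.

Lemma edist_adherent x H (e : R) : H !=set0 -> 0 < e ->
  exists2 z, H z & enorm (x - z) < edist x H + e.
Proof.
move=> [z Hz] e0.
have h : has_inf [set enorm (x - z) | z in H].
  by split; [exists (enorm (x - z)), z|exists 0 => _ [y Hy <-]; exact: enorm_ge0].
by have [_ [y Hy <-] hy] := inf_adherent e0 h; exists y.
Qed.

Lemma edist_lip x y H : H !=set0 -> edist x H <= edist y H + enorm (x - y).
Proof.
move=> H0; apply/ler_addgt0Pr => e e0; have [z Hz hz] := edist_adherent y H0 e0.
apply: le_trans (edist_le x Hz) _; apply: le_trans (enorm_triangle _ y _) _.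
by move: hz; clear; lra.
Qed.

(* The last point of the segment in [Omega] is a frontier point. *)
Lemma segment_frontier Omega x y : open Omega -> Omega x -> ~ Omega y ->
  exists2 p, frontier Omega p & enorm (x - p) + enorm (p - y) = enorm (x - y).
Proof.
move=> oO Ox Oy; pose S := [set s : R | 0 <= s <= 1 /\ Omega (x + s *: (y - x))].
have S0 : S 0 by split; [rewrite lexx ler01|rewrite scale0r addr0].
have bS : has_sup S by split; [exists 0|exists 1 => s [/andP[]]].
pose s := sup S; pose p := x + s *: (y - x).
have s0 : 0 <= s by apply: ub_le_sup => //; case: bS.
have s1 : s <= 1 by apply: sup_le_ub; [case: bS|move=> t [/andP[]]].
exists p; last first.
  have -> : x - p = (- s) *: (y - x) by rewrite /p opprD addrA subrr add0r scaleNr.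
  have -> : p - y = (s - 1) *: (y - x).
    by rewrite /p scalerBl scale1r opprB; apply/rowP => i; rewrite !mxE; ring.
  rewrite !enormZ normrN (ger0_norm s0) distrC ger0_norm ?subr_ge0// (enormB y x); ring.
split.
  move=> B /nbhs_ballP[r /= r0 hr].
  pose e : R := r / (`|y - x| + 1); have n0 : 0 < `|y - x| + 1 by rewrite ltr_wpDl.
  have e0 : 0 < e by rewrite divr_gt0.
  have [t [t01 Ot] ht] := sup_adherent e0 bS; exists (x + t *: (y - x)); split => //.
  apply: hr; rewrite -ball_normE /= /p opprD addrACA subrr add0r -scalerBl normrZ.
  have ts : t <= s by apply: ub_le_sup => //; case: bS.
  rewrite ger0_norm ?subr_ge0//; apply: (@le_lt_trans _ _ (e * `|y - x|)).
    by rewrite ler_wpM2r// lerBlDr -lerBlDl ltW.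
  by rewrite /e mulrAC ltr_pdivrMr// ltr_pM2l// ltrDl.
move=> /interior_subset Op.
have sl : s < 1.
  rewrite lt_neqAle s1 andbT; apply/eqP => s11; apply: Oy; move: Op.
  by rewrite /p s11 scale1r addrC subrK.
have /nbhs_ballP[r /= r0 hr] : nbhs p Omega by exact: open_nbhs_nbhs.
have n0 : 0 < `|y - x| + 1 by rewrite ltr_wpDl.
pose e : R := Num.min (1 - s) (r / (2 * (`|y - x| + 1))).
have e0 : 0 < e by rewrite lt_min subr_gt0 sl divr_gt0// mulr_gt0.
suff : S (s + e) by move=> /(ub_le_sup (proj2 bS)); rewrite leNgt -/s ltrDl e0.
split.
  rewrite addr_ge0 ?(ltW e0)//= -lerBrDl ge_min lexx//.
apply: hr; rewrite -ball_normE /= /p opprD addrACA subrr add0r -scalerBl normrZ.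
rewrite opprD addrA subrr add0r normrN gtr0_norm//.
have : e <= r / (2 * (`|y - x| + 1)) by rewrite ge_min lexx orbT.
rewrite ler_pdivlMr ?mulr_gt0//; have := normr_ge0 (y - x); move: e0 r0; clear; nra.
Qed.

Section Sdist.
Variables (Omega1 Omega2 H : set V).
Hypothesis HO : H_Omega Omega1 Omega2 H.
Let d := sdist Omega1 H.

Lemma omega1_H x : Omega1 x -> ~ H x.
Proof. by case: HO => /interior_id o1 _ _ [_ -> _ _] O [_]; rewrite o1. Qed.

Lemma omega2_H x : Omega2 x -> ~ H x.
Proof. by case: HO => _ /interior_id o2 _ [_ _ -> _] O [_]; rewrite o2. Qed.

Lemma omega_edist Omega x : open Omega -> (forall y, Omega y -> ~ H y) -> H !=set0 ->
  Omega x -> 0 < edist x H.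
Proof.
move=> oO OH [z0 Hz0] Ox.
have /nbhs_enorm[r r0 hr] : nbhs x Omega by exact: open_nbhs_nbhs.
apply: (lt_le_trans r0); apply: lb_le_inf; first by exists (enorm (x - z0)), z0.
move=> _ [z Hz <-]; rewrite leNgt; apply/negP => xz; apply: (OH z) => //; apply: hr.
by rewrite enormB.
Qed.

Lemma omega12 x : Omega2 x -> ~ Omega1 x.
Proof. by case: HO => _ _ O12 _ O2 O1; have : (Omega1 `&` Omega2) x by []; rewrite O12. Qed.

Lemma sdist_pos x : H !=set0 -> Omega1 x -> 0 < d x.
Proof.
move=> H0 O1; rewrite /d /sdist mem_set//.
by apply: (@omega_edist Omega1) => //; [case: HO|exact: omega1_H].
Qed.

Lemma sdist_neg x : H !=set0 -> Omega2 x -> d x < 0.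
Proof.
move=> H0 O2; rewrite /d /sdist memNset ?oppr_lt0; last exact: omega12.
by apply: (@omega_edist Omega2) => //; [case: HO|exact: omega2_H].
Qed.

Lemma sdist_H x : H x -> d x = 0.
Proof.
move=> Hx; rewrite /d /sdist memNset; last by move=> /omega1_H.
apply/eqP; rewrite oppr_eq0 eq_le edist_ge0 andbT.
by apply: le_trans (edist_le x Hx) _; rewrite subrr enorm0.
Qed.

Lemma omega_cases x : [\/ Omega1 x, Omega2 x | H x].
Proof.
by case: HO => _ _ _ [cov _ _ _]; have : setT x by []; rewrite cov => -[[]|]; [constructor 1|constructor 2|constructor 3].
Qed.

Lemma sdist_gt0 x : H !=set0 -> 0 < d x -> Omega1 x.
Proof.
move=> H0 dx; case: (omega_cases x) => [W1|W2|Hx]; first by [].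
  by have := sdist_neg H0 W2; rewrite ltNge (ltW dx).
by rewrite (sdist_H Hx) ltxx in dx.
Qed.

Lemma sdist_lt0 x : H !=set0 -> d x < 0 -> Omega2 x.
Proof.
move=> H0 dx; case: (omega_cases x) => [W1|//|Hx].
  by have := sdist_pos H0 W1; rewrite ltNge (ltW dx).
by rewrite (sdist_H Hx) ltxx in dx.
Qed.

Lemma sdist_eq0 x : H !=set0 -> d x = 0 -> H x.
Proof.
move=> H0 dx; case: (omega_cases x) => [W1|W2|Hx]; last by [].
  by have := sdist_pos H0 W1; rewrite dx ltxx.
by have := sdist_neg H0 W2; rewrite dx ltxx.
Qed.

Lemma sdist_ge0 x : H !=set0 -> 0 <= d x -> closure Omega1 x.
Proof.
move=> H0; rewrite le_eqVlt => /orP[/eqP dx|/(sdist_gt0 H0)]; last exact: subset_closure.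
by have := sdist_eq0 H0 (esym dx); case: HO => _ _ _ [_ -> _ _] [].
Qed.

Lemma sdist_le0 x : H !=set0 -> d x <= 0 -> closure Omega2 x.
Proof.
move=> H0; rewrite le_eqVlt => /orP[/eqP dx|/(sdist_lt0 H0)]; last exact: subset_closure.
by have := sdist_eq0 H0 dx; case: HO => _ _ _ [_ _ -> _] [].
Qed.

Lemma sdist_norm x : `|d x| = edist x H.
Proof.
have h := edist_ge0 x H; rewrite /d /sdist; case: ifP => _; first exact: ger0_norm.
by rewrite ler0_norm ?oppr_le0 // (opprK (edist x H)).
Qed.

(** A segment from [Omega1] to its complement meets [H], so that the two distances add up to at most
    its length; otherwise the distance itself is 1-Lipschitz or the signs help. *)
Lemma sdist_lip x y : H !=set0 -> `|d x - d y| <= enorm (x - y).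
Proof.
move=> H0.
suff key a b : d a - d b <= enorm (a - b).
  have h1 := key x y; have h2 := key y x; rewrite (enormB y x) in h2.
  by rewrite ler_norml; move: h1 h2; move=> *; apply/andP; split; lra.
have l1 := edist_lip a b H0; have l2 := edist_lip b a H0; rewrite (enormB b a) in l2.
rewrite /d /sdist; have [ha|ha] := pselect (Omega1 a); have [hb|hb] := pselect (Omega1 b).
- by rewrite !mem_set//; move: l1; lra.
- have oO : open Omega1 by case: HO.
  have [p Hp E] := segment_frontier oO ha hb; rewrite mem_set// memNset// -E.
  have {}Hp : H p by case: HO => _ _ _ [_ -> _ _].
  have := edist_le a Hp; have := edist_le b Hp; rewrite (enormB b p); lra.
- rewrite memNset// mem_set//.
  by have := edist_ge0 a H; have := edist_ge0 b H; have := enorm_ge0 (a - b); lra.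
- by rewrite !memNset//; move: l2; lra.
Qed.

End Sdist.
End Interface.

(** * Unit gradient, tangent vectors and normals *)

Section Normal.
Context {R : realType} {N : nat}.
Local Notation V := 'rV[R]_N.
Local Notation edist := Defs.edist.
Implicit Types (x y z v n : V) (H Omega : set V).

(* Almost closest points of [H] to points of [Omega1] tending to [z] show that the gradient of the
   distance has norm at least 1. *)
Lemma normal_unit Omega1 H (d : V -> R) (g : V -> V) Cd xb r z :
  dist_hyp d g (fun x => enorm (x - xb) < r) Cd ->
  (forall x, H x -> d x = 0) -> (forall x, Omega1 x -> 0 < d x) ->
  (forall x, Omega1 x -> d x = edist x H) ->
  enorm (z - xb) < r -> H z -> closure Omega1 z -> enorm (g z) = 1.
Proof.
move=> hd dH dpos dE zr Hz cz; have [C0 dl de gl g1] := hd.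
apply/eqP; rewrite eq_le g1//= leNgt; apply/negP => gz.
pose c : R := (1 - enorm (g z)) / 2.
have c0 : 0 < c by rewrite divr_gt0// subr_gt0.
have g0 := enorm_ge0 (g z).
have cE : enorm (g z) = 1 - 2 * c by rewrite /c; field.
have c1 : c <= 1 / 2 by move: g0 cE; clear; lra.
pose e : R := Num.min ((r - enorm (z - xb)) / 8) (c / (8 * (Cd + 1))).
have Cd1 : 0 < 8 * (Cd + 1) by rewrite mulr_gt0// ltr_wpDl.
have e0 : 0 < e by rewrite lt_min !divr_gt0// subr_gt0.
have e1 : e * 8 <= r - enorm (z - xb) by rewrite -ler_pdivlMr// ge_min lexx.
have e2 : e * (8 * (Cd + 1)) <= c by rewrite -ler_pdivlMr// ge_min lexx orbT.
have [|x [Ox xz]] := cz [set x | enorm (x - z) < e].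
  by apply/nbhs_enorm; exists e.
rewrite /= in xz.
have dx := dpos x Ox.
(* A closest point up to the relative error [c]. If [|g z| < 1], the expansion at [y] gives
   [d x <= (1 - c) |x - y|], against [|x - y| < (1 + c) d x]. *)
have [y Hy hy] : exists2 y, H y & enorm (x - y) < edist x H + c * d x.
  by apply: edist_adherent; [exists z|exact: mulr_gt0].
rewrite -(dE x Ox) in hy.
have dxz : d x <= enorm (x - z) by rewrite (dE x Ox); exact: edist_le.
have cdx : c * d x <= 1 / 2 * d x by rewrite ler_wpM2r// ltW.
have xy : enorm (x - y) < 2 * e by move: hy dxz cdx xz dx; clear; lra.
have yz : enorm (y - z) < 3 * e.
  by have := enorm_triangle y x z; rewrite (enormB y x); move: xy xz; clear; lra.
have yr : enorm (y - xb) < r.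
  by have := enorm_triangle y z xb; move: yz e1 e0; clear; lra.
have xr : enorm (x - xb) < r.
  by have := enorm_triangle x z xb; move: xz e1 e0; clear; lra.
have := de y x yr xr; rewrite (dH y Hy) subr0 ler_norml => /andP[_ h1].
have h2 := dotv_le (g y) (x - y).
have h3 := gl y z yr zr.
have h4 := enorm_triangle (g y) (g z) 0; rewrite !subr0 in h4.
have h5 : Cd * enorm (y - z) <= Cd * (3 * e) by rewrite ler_wpM2l// ltW.
have ye := enorm_ge0 (x - y).
have h6 : Cd * enorm (x - y) ^+ 2 <= Cd * (2 * e) * enorm (x - y).
  by rewrite expr2 mulrA ler_wpM2r// ler_wpM2l// ltW.
have h7 : enorm (g y) * enorm (x - y) <= (1 - 2 * c + Cd * (3 * e)) * enorm (x - y).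
  by rewrite ler_wpM2r//; move: h3 h4 h5 cE; clear; lra.
have h8 : 0 < enorm (x - y).
  rewrite lt_def ye andbT; apply/eqP => /enorm_eq0 /eqP; rewrite subr_eq0 => /eqP E.
  by rewrite E (dH y Hy) ltxx in dx.
have h9 : d x <= (1 - 2 * c + Cd * (5 * e)) * enorm (x - y).
  by move: h1 h2 h6 h7; clear; lra.
have h10 : Cd * (5 * e) <= c by have := mulr_ge0 C0 (ltW e0); move: e2 e0; clear; lra.
have h11 : d x <= (1 - c) * enorm (x - y).
  by apply: le_trans h9 _; rewrite ler_wpM2r//; move: h10; clear; lra.
move: h11 hy h8 c0 c1 dx; move: (enorm _) (d x) => a b; clear; nra.
Qed.

(* The implicit curve [s |-> z + s v + tau(s) g(z)], with [tau(s) = O(s^2)] given by the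
   intermediate value theorem. *)
Lemma tangent_orth H (d : V -> R) (g : V -> V) Cd xb r z v :
  dist_hyp d g (fun x => enorm (x - xb) < r) Cd ->
  (forall x, d x = 0 -> H x) -> d z = 0 -> enorm (z - xb) < r -> enorm (g z) = 1 ->
  dotv v (g z) = 0 -> tangent H z v.
Proof.
move=> hd dH dz zr gz vg; have [C0 dl de gl g1] := hd.
pose A : R := enorm v; have A0 : 0 <= A := enorm_ge0 v.
(* [K s^2] exceeds the error of the expansion for [|tau| <= |s|], so that [d] goes from nonpositive
   to nonnegative values between [tau = - K s^2] and [tau = K s^2]. *)
pose K : R := Cd * (A + 1) ^+ 2 + 1.
have K0 : 0 < K by rewrite ltr_wpDl// mulr_ge0// sqr_ge0.
pose h0 : R := Num.min (1 / K) ((r - enorm (z - xb)) / (2 * (A + 1))).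
have A1 : 0 < 2 * (A + 1) by rewrite mulr_gt0// ltr_wpDl.
have h00 : 0 < h0 by rewrite lt_min !divr_gt0// subr_gt0.
have key s : `|s| < h0 -> exists tau : R, `|tau| <= K * s ^+ 2 /\ d (z + s *: v + tau *: g z) = 0.
  move=> hs; pose t0 : R := K * s ^+ 2; have t00 : 0 <= t0 by rewrite mulr_ge0 ?sqr_ge0 ?ltW.
  have s1 : `|s| * K <= 1 by rewrite -ler_pdivlMr// ltW// (lt_le_trans hs)// ge_min lexx.
  have s2 : `|s| * (2 * (A + 1)) < r - enorm (z - xb).
    by rewrite -ltr_pdivlMr// (lt_le_trans hs)// ge_min lexx orbT.
  have s0 := normr_ge0 s.
  have t1 : t0 <= `|s| by rewrite /t0 -(real_normK (num_real s)) expr2 mulrA ler_piMl// mulrC.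
  pose p (tau : R) : V := z + s *: v + tau *: g z.
  have pz tau : p tau - z = s *: v + tau *: g z by apply/rowP => i; rewrite !mxE; ring.
  have np tau : `|tau| <= t0 -> enorm (p tau - z) <= `|s| * (A + 1).
    move=> ht; rewrite pz; apply: le_trans (enormD _ _) _; rewrite !enormZ gz mulr1 mulrDr mulr1.
    by rewrite lerD2l (le_trans ht).
  have pr tau : `|tau| <= t0 -> enorm (p tau - xb) < r.
    move=> ht; apply: le_lt_trans (enorm_triangle _ z _) _.
    by have := np tau ht; have := mulr_ge0 s0 A0; move: s2 s0; clear; lra.
  have ex tau : `|tau| <= t0 -> `|d (p tau) - tau| <= Cd * (A + 1) ^+ 2 * s ^+ 2.
    move=> ht; have := de z (p tau) zr (pr tau ht); rewrite dz subr0.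
    rewrite {1}pz dotvDr !dotvZr (dotvC (g z) v) vg mulr0 add0r -enorm2 gz expr1n mulr1 => h.
    apply: le_trans h _; rewrite -mulrA ler_wpM2l// -(real_normK (num_real s)) -exprMn.
    by rewrite lerXn2r ?nnegrE ?enorm_ge0 ?mulr_ge0 ?addr_ge0// mulrC np.
  have dp : d (p t0) >= 0.
    have := ex t0; rewrite ger0_norm// lexx => /(_ isT); rewrite ler_norml => /andP[h _].
    by move: h; rewrite /t0 /K; have := sqr_ge0 s; clear; lra.
  have dm : d (p (- t0)) <= 0.
    have := ex (- t0); rewrite normrN ger0_norm// lexx => /(_ isT); rewrite ler_norml => /andP[_ h].
    by move: h; rewrite /t0 /K; have := sqr_ge0 s; clear; lra.
  have cdp : continuous (fun tau => d (p tau)).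
    move=> tau; apply: (@continuous_comp _ _ _ p d); last exact: continuous_lip.
    by apply: cvgD; [exact: cvg_cst|apply: cvgZr_tmp; exact: cvg_id].
  have tt : - t0 <= t0 by rewrite ge0_cp.
  have [|tau ht dtau] := @IVT R (fun tau => d (p tau)) (- t0) t0 0 tt (continuous_subspaceT cdp).
    by rewrite ge_min dm /= le_max dp orbT.
  by exists tau; split => //; move: ht; rewrite in_itv /= ler_norml.
have /choice[tau htau] : forall s, exists tau : R, `|s| < h0 ->
    `|tau| <= K * s ^+ 2 /\ d (z + s *: v + tau *: g z) = 0.
  move=> s; have [hs|hs] := ltP `|s| h0; last by exists 0.
  by have [t ht] := key s hs; exists t.
have tau0 : tau 0 = 0.
  have [|h _] := htau 0; first by rewrite normr0.
  by move: h; rewrite expr0n mulr0 normr_le0 => /eqP.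
exists (fun s => z + s *: v + tau s *: g z); split.
- by rewrite tau0 !scale0r !addr0.
- near=> s; apply: dH; apply: (htau s _).2; near: s.
  exact: (@nbhs0_lt R R h0 h00).
- apply: (@quad_is_derive R V _ 0 v (K * `|g z|) h0 h00) => s hs.
  have [h _] := htau s hs.
  rewrite tau0 add0r !scale0r !addr0.
  rewrite (_ : _ - _ - _ = tau s *: g z); last by apply/rowP => i; rewrite !mxE; ring.
  by rewrite normrZ mulrAC ler_wpM2r.
Unshelve. all: by end_near. Qed.

(** By [tangent_orth] the vector [n - (n . g) g] is tangent, hence orthogonal to [n], so that [n] is
    [g] or [- g]. The choice [n = g] is excluded because [z - s n], which lies in [Omega1], would
    have [d < 0]. *)
Lemma normal_eq Omega1 H (d : V -> R) (g : V -> V) Cd xb r z n :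
  dist_hyp d g (fun x => enorm (x - xb) < r) Cd ->
  (forall x, d x = 0 -> H x) -> (forall x, Omega1 x -> 0 < d x) -> H = frontier Omega1 ->
  d z = 0 -> enorm (z - xb) < r -> enorm (g z) = 1 ->
  outward_normal Omega1 z n -> n = - g z.
Proof.
move=> hd dH dpos HE dz zr gz [n1 ntan nside]; have [C0 dl de gl g1] := hd.
pose c : R := dotv n (g z).
have gg : dotv (g z) (g z) = 1 by rewrite -enorm2 gz expr1n.
have nn : dotv n n = 1 by rewrite -enorm2 n1 expr1n.
have /ntan : tangent (frontier Omega1) z (n - c *: g z).
  by rewrite -HE; apply: (tangent_orth hd) => //; rewrite dotvBl dotvZl gg mulr1 subrr.
rewrite dotvBl dotvZl nn (dotvC (g z)) -/c => c2.
have {}c2 : c ^+ 2 = 1 by move: c2; rewrite expr2; clear; lra.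
have E : n = c *: g z.
  apply/eqP; rewrite -subr_eq0; apply/eqP; apply: enorm_eq0.
  suff : enorm (n - c *: g z) ^+ 2 = 0 by move/eqP; rewrite sqrf_eq0 => /eqP.
  rewrite enorm2 dotvBl !dotvBr !dotvZl !dotvZr nn gg (dotvC (g z)) -/c.
  by rewrite !mulr1 -expr2 c2; ring.
move/eqP: c2; rewrite sqrf_eq1 => /orP[/eqP c1|/eqP c1]; last by rewrite E c1 scaleN1r.
rewrite c1 scale1r in E; subst n; exfalso.
have rz : 0 < r - enorm (z - xb) by rewrite subr_gt0.
have : \forall s \near (0 : R)^'+, False.
  near=> s; have s0 : 0 < s by near: s; exact: nbhs_right_gt.
  have s1 : s < r - enorm (z - xb) by near: s; exact: nbhs_right_lt.
  have s2 : s < 1 / (Cd + 1) by near: s; apply: nbhs_right_lt; rewrite divr_gt0// ltr_wpDl.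
  have [w1 _] : Omega1 (z - s *: g z) /\ ~ closure Omega1 (z + s *: g z) by near: s.
  have zs : z - s *: g z - z = - (s *: g z) by rewrite addrC addKr.
  have ns : enorm (z - s *: g z - z) = s by rewrite zs enormN enormZ gz mulr1 gtr0_norm.
  have Q : enorm (z - s *: g z - xb) < r.
    by have := enorm_triangle (z - s *: g z) z xb; rewrite ns; move: s1; clear; lra.
  have := de z _ zr Q; rewrite ns zs dz subr0 dotvNr dotvZr gg mulr1 opprK ler_norml => /andP[_ h].
  have := dpos _ w1; move: h s2 s0; rewrite ltr_pdivlMr ?ltr_wpDl//; move: (d _) => a; clear; nra.
by move=> /filter_ex[].
Unshelve. all: by end_near. Qed.

End Normal.

(** * Tangential tests *)

Section TangentialTests.
Context {R : realType} {N : nat}.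
Local Notation V := 'rV[R]_N.

Lemma interface_geometry (Omega1 Omega2 H : set V) (n1 : V -> V) (z : V) :
  H_Omega Omega1 Omega2 H -> (forall z, H z -> outward_normal Omega1 z (n1 z)) -> H z ->
  exists (g : V -> V) (Cd r : R), [/\ 0 < r,
    dist_hyp (sdist Omega1 H) g (fun x => enorm (x - z) < r) Cd,
    forall x, H x -> enorm (x - z) < r -> n1 x = - g x &
    forall v, dotv v (n1 z) = 0 -> tangent H z v].
Proof.
move=> HO hn Hz; have H0 : H !=set0 by exists z.
have [_ _ _ [_ E1 _ [U [oU HU W]]]] := HO.
have [g [Cd [r [r0 hd]]]] := W2_dist_hyp oU (HU z Hz) W (fun x y => sdist_lip HO x y H0).
have g1 x : H x -> enorm (x - z) < r -> enorm (g x) = 1.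
  move=> Hx xr; apply: (normal_unit (Omega1 := Omega1) (H := H) hd) => //.
  - by move=> y; exact: (sdist_H HO).
  - by move=> y; exact: (sdist_pos HO).
  - move=> y hy; rewrite -(sdist_norm Omega1) ger0_norm// ltW//.
    exact: (sdist_pos HO).
  - by move: Hx; rewrite {1}E1 => -[].
have gn x : H x -> enorm (x - z) < r -> n1 x = - g x.
  move=> Hx xr; apply: (normal_eq (Omega1 := Omega1) (H := H) hd) => //.
  - by move=> y; exact: (sdist_eq0 HO).
  - by move=> y; exact: (sdist_pos HO).
  - exact: (sdist_H HO).
  - exact: g1.
  - exact: hn.
have zz : enorm (z - z) < r by rewrite subrr enorm0.
exists g, Cd, r; split => // v; rewrite gn// dotvNr => /eqP; rewrite oppr_eq0 => /eqP vg.
apply: (tangent_orth hd) => //; [by move=> y; exact: (sdist_eq0 HO)|exact: (sdist_H HO)|exact: g1].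
Qed.

Lemma sq_le_norm (D : V * R) : enorm D.1 ^+ 2 + D.2 ^+ 2 <= (N%:R ^+ 2 + 1) * `|D| ^+ 2.
Proof.
have h1 : enorm D.1 <= N%:R * `|D|.
  apply: le_trans (enorm_le_norm _) _; rewrite ler_wpM2l//.
  by rewrite prod_normE/= le_max lexx.
have h2 : `|D.2| <= `|D| by rewrite [leRHS]prod_normE/= le_max lexx orbT.
rewrite mulrDl mul1r -exprMn -(real_normK (num_real D.2)).
by apply: lerD; rewrite lerXn2r ?nnegrE ?enorm_ge0 ?mulr_ge0.
Qed.

Lemma cvg_dotv (Y : Type) (F : set_system Y) (FF : Filter F) (f g : Y -> V) (a b : V) :
  f y @[y --> F] --> a -> g y @[y --> F] --> b -> dotv (f y) (g y) @[y --> F] --> dotv a b.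
Proof.
have co (h : Y -> V) (c : V) i : h y @[y --> F] --> c -> h y 0 i @[y --> F] --> c 0 i.
  by move=> hc; apply: (@cvg_comp _ _ _ h (fun v : V => v 0 i) _ _ _ hc); exact: coord_continuous.
move=> fa gb; apply: (@cvg_big _ _ _ _ xpredT (@add_continuous R) Y F _ (fun i y => f y 0 i * g y 0 i)) => i _.
by apply: cvgM; exact: co.
Qed.

(* The quadratic test function is restricted to [H]; its tangential gradient is the projection
   of its gradient. *)
Lemma quadratic_tangential_C1 (H : set V) (n1 : V -> V) (T : R) (p : V) (a C : R) (x0 : V) (t0 : R)
    (d : V -> R) :
  (forall z, H z -> exists (g : V -> V) (Cd r : R), [/\ 0 < r,
    dist_hyp d g (fun x => enorm (x - z) < r) Cd,
    forall x, H x -> enorm (x - z) < r -> n1 x = - g x &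
    forall v, dotv v (n1 z) = 0 -> tangent H z v]) ->
  (forall z, H z -> d z = 0) -> (forall z, H z -> enorm (n1 z) = 1) ->
  let G (y : V * R) := p + (2 * C) *: (y.1 - x0) in
  tangential_C1 H T
    (fun y => dotv p (y.1 - x0) + a * (y.2 - t0) + C * (enorm (y.1 - x0) ^+ 2 + (y.2 - t0) ^+ 2))
    (fun y => G y - dotv (G y) (n1 y.1) *: n1 y.1)
    (fun y => a + 2 * C * (y.2 - t0)).
Proof.
move=> geo dH nH G; split.
- apply/subspace_continuousP => -[y s] [/= Hy _].
  have [g [Cd [r [r0 hd hn _]]]] := geo y Hy; have [Cd0 _ _ gl _] := hd.
  have cn : n1 z.1 @[z --> within (H `*` `[0, T]) (nbhs (y, s))] --> n1 y.
    apply/cvgrPdist_lt => e e0; apply/nbhs_enormT.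
    exists (Num.min r (e / (Cd + 1))); first by rewrite lt_min r0 divr_gt0// ltr_wpDl.
    move=> x' t'; rewrite !lt_min => /andP[xr hx] _ [/= Hx _].
    have yr : enorm (y - y) < r by rewrite subrr enorm0.
    apply: le_lt_trans (norm_le_enorm _) _; rewrite !hn// -opprD enormN.
    apply: le_lt_trans (gl y x' yr xr) _; rewrite enormB.
    move: hx; rewrite ltr_pdivlMr ?ltr_wpDl//; have := enorm_ge0 (x' - y); clear; lra.
  have cG : G z @[z --> within (H `*` `[0, T]) (nbhs (y, s))] --> G (y, s).
    suff cG : continuous G by apply: cvg_within_filter; exact: cG.
    move=> z; apply: cvgD; first exact: cvg_cst.
    by apply: cvgZ; [exact: cvg_cst|apply: cvgB; [exact: cvg_fst|exact: cvg_cst]].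
  have FW : Filter (within (H `*` `[0, T]) (nbhs (y, s))) by exact: within_filter.
  have cD := cvg_dotv FW cG cn.
  exact: (cvgB cG (cvgZ cD cn)).
- apply: continuous_subspaceT => y; apply: cvgD; first exact: cvg_cst.
  by apply: cvgM; [exact: cvg_cst|apply: cvgB; [exact: cvg_snd|exact: cvg_cst]].
- move=> [y s] [/= Hy _]; have [g [Cd [r [r0 _ _ ht]]]] := geo y Hy; apply: ht.
  by rewrite dotvBl dotvZl -[dotv (n1 y) (n1 y)]enorm2 nH// expr1n mulr1 subrr.
- move=> [y s] [/= Hy _] e e0; have [g [Cd [r [r0 hd hn _]]]] := geo y Hy.
  have [Cd0 _ de _ _] := hd.
  pose K : R := `|C| + `|dotv (G (y, s)) (n1 y)| * Cd.
  have K0 : 0 <= K by rewrite addr_ge0// mulr_ge0.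
  pose K2 : R := K * (N%:R ^+ 2 + 1) + 1.
  have K20 : 0 < K2 by rewrite ltr_wpDl// mulr_ge0// addr_ge0// sqr_ge0.
  have yr : enorm (y - y) < r by rewrite subrr enorm0.
  apply/nbhs_enormT; exists (Num.min r (e / K2)); first by rewrite lt_min r0 divr_gt0.
  move=> x' t'; rewrite !lt_min => /andP[y'r hx] /andP[_ ht].
  pose y' : V * R := (x', t'); rewrite -/y' => -[Hy' _].
  rewrite -[x']/y'.1 in y'r hx; rewrite -[t']/y'.2 in ht.
  set D := y' - (y, s).
  have D1 : D.1 = y'.1 - y by [].
  have D2 : D.2 = y'.2 - s by [].
  have small : `|D| < e / K2.
    by rewrite prod_normE/= gt_max ht andbT (le_lt_trans (norm_le_enorm _)).
  have exp := de y y'.1 yr y'r; rewrite (dH _ Hy') (dH _ Hy) subrr sub0r normrN in exp.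
  have hn1 : dotv (n1 y) (y'.1 - y) = - dotv (g y) (y'.1 - y) by rewrite hn// dotvNl.
  rewrite dotvBl dotvZl hn1.
  have -> : dotv p (y'.1 - x0) = dotv p (y - x0) + dotv p (y'.1 - y).
    by rewrite -dotvDr; congr dotv; apply/rowP => i; rewrite !mxE; ring.
  have := enorm_sq_expand (y) x0 (y'.1) => ->.
  rewrite /G /= dotvDl !dotvZl -D1 -D2.
  set m := dotv (p + _) (n1 y).
  rewrite (_ : y'.2 - t0 = (s - t0) + D.2); last by rewrite D2; ring.
  rewrite (_ : _ - _ - _ - _ = C * (enorm D.1 ^+ 2 + D.2 ^+ 2) - m * dotv (g y) D.1); last first.
    by ring.
  apply: (@le_trans _ _ (K * (enorm D.1 ^+ 2 + D.2 ^+ 2))).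
    apply: le_trans (ler_normB _ _) _; rewrite mulrDl !normrM.
    apply: lerD.
      by rewrite ler_wpM2l// [leLHS]ger0_norm// addr_ge0 ?sqr_ge0.
    rewrite -mulrA; apply: ler_wpM2l => //; apply: le_trans exp _.
    by rewrite ler_wpM2l// lerDl sqr_ge0.
  apply: le_trans (ler_wpM2l K0 (sq_le_norm D)) _.
  rewrite mulrA expr2 mulrA ler_wpM2r//.
  have := ltW small; rewrite ler_pdivlMr// mulrC; apply: le_trans.
  by rewrite ler_wpM2r// lerDl.
Qed.

End TangentialTests.

(* Makes a local quadratic test function global against a bounded function. *)
Lemma quad_dominates (R : realType) (M p a r C X t : R) : 0 <= M -> 0 <= p -> 0 <= a -> 0 < r ->
  0 <= X -> 0 <= t -> r <= X \/ r <= t -> 2 * M / r ^+ 2 + (p + a) / r <= C ->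
  2 * M + p * X + a * t <= C * (X ^+ 2 + t ^+ 2).
Proof.
move=> M0 p0 a0 r0 X0 t0 far hC; set S : R := X ^+ 2 + t ^+ 2.
have S0 : 0 <= S by rewrite addr_ge0 ?sqr_ge0.
have r2 : 0 < r ^+ 2 by rewrite exprn_gt0.
have hX := sqr_ge0 X; have ht := sqr_ge0 t.
have far2 : r ^+ 2 <= X ^+ 2 \/ r ^+ 2 <= t ^+ 2.
  by case: far => h; [left|right]; rewrite lerXn2r ?nnegrE// ltW.
have h1 : r ^+ 2 <= S by rewrite /S; case: far2 => h; move: h hX ht; clear; lra.
have h2 : X * r <= S.
  have [Xr|rX] := leP X r.
    by apply: le_trans h1; rewrite expr2 ler_wpM2r// ltW.
  apply: (@le_trans _ _ (X ^+ 2)); last by rewrite lerDl.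
  by rewrite expr2 ler_wpM2l// ltW.
have h3 : t * r <= S.
  have [Xr|rX] := leP t r.
    by apply: le_trans h1; rewrite expr2 ler_wpM2r// ltW.
  apply: (@le_trans _ _ (t ^+ 2)); last by rewrite lerDr.
  by rewrite expr2 ler_wpM2l// ltW.
apply: le_trans (ler_wpM2r S0 hC).
have -> : (2 * M / r ^+ 2 + (p + a) / r) * S = 2 * M * (S / r ^+ 2) + p * (S / r) + a * (S / r).
  by field; rewrite gt_eqF.
have l1 : 2 * M <= 2 * M * (S / r ^+ 2) by rewrite ler_peMr ?mulr_ge0// ler_pdivlMr// mul1r.
have l2 : p * X <= p * (S / r) by rewrite ler_wpM2l// ler_pdivlMr.
have l3 : a * t <= a * (S / r) by rewrite ler_wpM2l// ler_pdivlMr.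
by rewrite !lerD.
Qed.

Section TangentialJets.
Context {R : realType} {N : nat} {A1 A2 : metricType R}.
Local Notation V := 'rV[R]_N.

Lemma tangential_jet (b1 : V -> R -> A1 -> V) (l1 : V -> R -> A1 -> R)
    (b2 : V -> R -> A2 -> V) (l2 : V -> R -> A2 -> R) (H : set V) (n1 : V -> V) (T Mb Ml M : R)
    (d : V -> R) (u : V * R -> R) x t p a :
  (forall z, H z -> exists (g : V -> V) (Cd r : R), [/\ 0 < r,
    dist_hyp d g (fun x => enorm (x - z) < r) Cd,
    forall x, H x -> enorm (x - z) < r -> n1 x = - g x &
    forall v, dotv v (n1 z) = 0 -> tangent H z v]) ->
  (forall z, H z -> d z = 0) -> (forall z, H z -> enorm (n1 z) = 1) ->
  visc_sub_tangential H T (Ham_T b1 l1 b2 l2 n1) u ->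
  (forall y, (setT `*` `[0, T[) y -> `|u y| <= M) ->
  (forall i, enorm (b1 x t i) <= Mb) -> (forall i, `|l1 x t i| <= Ml) ->
  (forall i, enorm (b2 x t i) <= Mb) -> (forall i, `|l2 x t i| <= Ml) ->
  H x -> 0 < t < T -> sub_jet H u x t p a ->
  forall i j (m : R), 0 <= m <= 1 -> dotv (m *: b1 x t i + (1 - m) *: b2 x t j) (n1 x) = 0 ->
  a - dotv (m *: b1 x t i + (1 - m) *: b2 x t j) p - (m * l1 x t i + (1 - m) * l2 x t j) <= 0.
Proof.
move=> geo dH nH hu uM hb1 hl1 hb2 hl2 Hx tT [C [r [r0 h]]] i j m m01 bn.
have M0 : 0 <= M.
  by apply: le_trans (uM (x, t) _); rewrite ?normr_ge0//; split => //=; rewrite in_itv /= ltW; case/andP: tT.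
(* The jet is local, whereas the tangential inequality is tested at maxima over the whole of [H] and
   []0, T[]: with a large [K] the quadratic term beats the bounded [u] far away. *)
pose K : R := Num.max C (2 * M / r ^+ 2 + (enorm p + `|a|) / r).
have KC : C <= K by rewrite le_max lexx.
have KM : 2 * M / r ^+ 2 + (enorm p + `|a|) / r <= K by rewrite le_max lexx orbT.
have Dxt : (H `*` `]0, T[) (x, t) by split => //=; rewrite in_itv.
have := hu _ _ _ (x, t) (quadratic_tangential_C1 T p a K x t geo dH nH) Dxt.
rewrite /= !subrr scaler0 !(mulr0, addr0).
(* The tangential projection of [p], which controls orthogonal to the normal do not distinguish from
   [p]. *)
set p' : V := p - dotv p (n1 x) *: n1 x.
have E (k : V) : dotv k (n1 x) = 0 -> dotv k p' = dotv k p.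
  by move=> kn; rewrite dotvBr dotvZr kn mulr0 subr0.
move=> main; have {main} : a + Ham_T b1 l1 b2 l2 n1 x t p' <= 0.
  apply: main => -[x' t'] [/= Hx' t'T]; rewrite dotv0r enorm0 !expr0n /= !(mulr0, addr0) subr0.
  have [nearby|far] := pselect (enorm (x' - x) < r /\ `|t' - t| < r).
    have := h x' t' Hx' nearby.1 nearby.2.
    have := ler_wpM2r (addr_ge0 (sqr_ge0 (enorm (x' - x))) (sqr_ge0 (t' - t))) KC.
    by clear; lra.
  have {}far : r <= enorm (x' - x) \/ r <= `|t' - t|.
    have [|h1] := leP r (enorm (x' - x)); first by left.
    by right; rewrite leNgt; apply/negP => h2; apply: far.
  have := quad_dominates M0 (enorm_ge0 p) (normr_ge0 a) r0 (enorm_ge0 (x' - x)) (normr_ge0 (t' - t)) far KM.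
  rewrite (real_normK (num_real (t' - t))).
  have b1' : `|u (x', t')| <= M.
    by apply: uM; split => //=; move: t'T; rewrite !in_itv /= => /andP[/ltW -> ->].
  have b2' : `|u (x, t)| <= M.
    by apply: uM; split => //=; rewrite in_itv /=; case/andP: tT => /ltW -> ->.
  have b3' := dotv_abs p (x' - x); have b4' : `|a * (t' - t)| <= `|a| * `|t' - t| by rewrite normrM.
  move: b1' b2' b3' b4'; rewrite !ler_norml => /andP[_ c1] /andP[c2 _] /andP[c3 _] /andP[c4 _].
  by move: c1 c2 c3 c4; clear; lra.
have bd : forall y, [set - dotv (b_H b1 b2 x t c) p' - l_H l1 l2 x t c | c in A_0 b1 b2 n1 x t] y ->
    y <= Mb * enorm p' + Ml.
  move=> _ [[[i' j'] m'] [/= m'01 _] <-]; rewrite /b_H /l_H /=.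
  case/andP: m'01 => m0 m1; have m1' : 0 <= 1 - m' by rewrite subr_ge0.
  have e1 : `|dotv (m' *: b1 x t i' + (1 - m') *: b2 x t j') p'| <= Mb * enorm p'.
    apply: le_trans (dotv_abs _ _) _; rewrite ler_wpM2r ?enorm_ge0//.
    apply: le_trans (enormD _ _) _; rewrite !enormZ !ger0_norm//.
    have := ler_wpM2l m0 (hb1 i'); have := ler_wpM2l m1' (hb2 j'); clear; lra.
  have e2 : `|m' * l1 x t i' + (1 - m') * l2 x t j'| <= Ml.
    apply: le_trans (ler_normD _ _) _; rewrite !normrM (ger0_norm m0) (ger0_norm m1').
    have := ler_wpM2l m0 (hl1 i'); have := ler_wpM2l m1' (hl2 j'); clear; lra.
  move: e1 e2; rewrite !ler_norml => /andP[c1 _] /andP[c2 _]; move: c1 c2; clear; lra.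
have ub : - dotv (m *: b1 x t i + (1 - m) *: b2 x t j) p' - (m * l1 x t i + (1 - m) * l2 x t j)
    <= Ham_T b1 l1 b2 l2 n1 x t p'.
  apply: sup_upper_bound; last by exists (i, j, m).
  split; last by exists (Mb * enorm p' + Ml).
  by exists (- dotv (m *: b1 x t i + (1 - m) *: b2 x t j) p' - (m * l1 x t i + (1 - m) * l2 x t j)),
    (i, j, m).
rewrite (E _ bn) in ub; move: ub; move: (Ham_T _ _ _ _ _ _ _ _) (dotv _ _) (m * _ + _) => X Y Z.
by clear; lra.
Qed.

End TangentialJets.

(** * Penalization and conclusion *)

Lemma sqrt_expansion (R : realType) (s s0 : R) : 1 <= s0 -> 0 <= s ->
  `|Num.sqrt s - Num.sqrt s0 - (2 * Num.sqrt s0)^-1 * (s - s0)| <= 1 * (s - s0) ^+ 2.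
Proof.
move=> s1 s00; have s0' : 0 <= s0 by exact: le_trans s1.
have -> : s - s0 = Num.sqrt s ^+ 2 - Num.sqrt s0 ^+ 2 by rewrite !sqr_sqrtr.
have a1 : 1 <= Num.sqrt s0 by rewrite -{1}sqrtr1 ler_wsqrtr.
have b0 := sqrtr_ge0 s.
move: (Num.sqrt s0) (Num.sqrt s) a1 b0 => a b a1 b0.
have a0 : 0 < a by exact: lt_le_trans a1.
rewrite (_ : _ - _ - _ = - ((2 * a)^-1 * (b - a) ^+ 2)); last by field; rewrite gt_eqF.
have i0 : 0 <= (2 * a)^-1 by rewrite invr_ge0 mulr_ge0 ?ltW.
rewrite normrN ger0_norm; last exact: mulr_ge0 i0 (sqr_ge0 _).
rewrite mul1r.
have -> : (b ^+ 2 - a ^+ 2) ^+ 2 = (b + a) ^+ 2 * (b - a) ^+ 2 by ring.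
rewrite ler_wpM2r ?sqr_ge0//; apply: (@le_trans _ _ 1).
  by rewrite invf_le1 ?mulr_gt0//; move: a1; clear; lra.
by rewrite -{1}(expr1n _ 2) lerXn2r ?nnegrE ?addr_ge0 ?(ltW a0)//; move: a1 b0; clear; lra.
Qed.

Lemma inv_expansion (R : realType) (T s t : R) : t < T -> `|s - t| < (T - t) / 2 ->
  `|(T - s)^-1 - (T - t)^-1 - (T - t) ^- 2 * (s - t)| <= 2 / (T - t) ^+ 3 * (s - t) ^+ 2.
Proof.
move=> tT; have h0 : 0 < T - t by rewrite subr_gt0.
rewrite ltr_norml => /andP[_ hs].
have h1 : (T - t) / 2 <= T - s by move: hs; clear; lra.
have h2 : 0 < T - s by apply: lt_le_trans h1; rewrite divr_gt0.
rewrite (_ : _ - _ - _ = (s - t) ^+ 2 / ((T - t) ^+ 2 * (T - s))); last first.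
  by field; rewrite !gt_eqF.
have q0 : 0 < (T - t) ^+ 2 * (T - s) by rewrite mulr_gt0// exprn_gt0.
rewrite ger0_norm; last exact: divr_ge0 (sqr_ge0 _) (ltW q0).
rewrite mulrC; apply: ler_wpM2r; first exact: sqr_ge0.
have -> : 2 / (T - t) ^+ 3 = ((T - t) ^+ 2 * ((T - t) / 2))^-1.
  by field; rewrite gt_eqF.
by rewrite lef_pV2 ?posrE ?mulr_gt0 ?exprn_gt0 ?divr_gt0// ler_wpM2l ?sqr_ge0.
Qed.

Section Penalty.
Context {R : realType} {N : nat}.
Local Notation V := 'rV[R]_N.

(** The square root confines [x] and has gradient at most 1, the last term keeps [t] away from [T],
    and [K t], used with [K = Mb + 1], makes the time derivative dominate the drift term. *)
Definition penalty (beta K T : R) (y : V * R) : R :=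
  beta * (Num.sqrt (1 + enorm y.1 ^+ 2) + K * y.2 + (T - y.2)^-1).

Definition loc_penalty (beta K T : R) (xb : V) (tb : R) (y : V * R) : R :=
  penalty beta K T y + (enorm (y.1 - xb) ^+ 2 + (y.2 - tb) ^+ 2).

Definition loc_penalty_x (beta : R) (xb x : V) : V :=
  (beta / Num.sqrt (1 + enorm x ^+ 2)) *: x + 2 *: (x - xb).

Definition loc_penalty_t (beta K T tb t : R) : R := beta * (K + (T - t) ^- 2) + 2 * (t - tb).

Lemma qexp_sqd (y : V) x t : qexp (fun z : V * R => enorm (z.1 - y) ^+ 2) x t (2 *: (x - y)) 0.
Proof.
apply: (qexp_eq (qexp_sq y 0 x t)) => [z| |]; rewrite ?scaler0 ?addr0//.
by rewrite dotv0r mulr0.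
Qed.

Lemma qexp_penalty beta K T x t : t < T ->
  qexp (penalty beta K T) x t ((beta / Num.sqrt (1 + enorm x ^+ 2)) *: x) (beta * (K + (T - t) ^- 2)).
Proof.
move=> tT.
have h1 : qexp (fun z : V * R => 1 + enorm z.1 ^+ 2) x t (2 *: x) 0.
  apply: (qexp_eq (qexpD (qexp_cst 1 x t) (qexp_sqd 0 x t))) => [z| |] /=; rewrite ?subr0 ?add0r//.
have s1 : 1 <= 1 + enorm x ^+ 2 by rewrite lerDl sqr_ge0.
have sp : 0 < Num.sqrt (1 + enorm x ^+ 2) by rewrite sqrtr_gt0 (lt_le_trans _ s1).
have h2 := @qexp_comp R N Num.sqrt (2 * Num.sqrt (1 + enorm x ^+ 2))^-1 1 1 _ x t _ _ ltr01 ler01 _ h1.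
have {}h2 := h2 _.
have h3 := @qexp_comp R N (fun s => (T - s)^-1) ((T - t) ^- 2) (2 / (T - t) ^+ 3) ((T - t) / 2)
  _ x t _ _ _ _ _ (qexp_time x t).
apply: (qexp_eq (qexpZ beta (qexpD (qexpD (h2 _) (qexpZ K (qexp_time x t))) (h3 _ _ _)))) => //.
- move=> s hs; apply: sqrt_expansion => //; move: hs; rewrite ltr_norml => /andP[+ _].
  by move: s1; clear; lra.
- by rewrite divr_gt0// subr_gt0.
- by rewrite divr_ge0// exprn_ge0// subr_ge0 ltW.
- by move=> s hs; exact: inv_expansion.
- by rewrite !scaler0 !addr0 !scalerA; congr (_ *: _); field; rewrite gt_eqF.
- by rewrite /=; ring.
Qed.

Lemma qexp_loc_penalty beta K T xb tb x t : t < T ->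
  qexp (loc_penalty beta K T xb tb) x t (loc_penalty_x beta xb x) (loc_penalty_t beta K T tb t).
Proof.
move=> tT.
apply: (qexp_eq (qexpD (qexp_penalty beta K x tT) (qexpD (qexp_sqd xb x t) (qexp_tsq tb x t)))) => //.
  by rewrite addr0.
by rewrite add0r.
Qed.

(** [beta (Mb + 1)] exceeds the drift term, at most [beta Mb], by [beta]; the localizing squares
    cost at most [2 r (1 + Mb) <= beta / 2]. *)
Lemma loc_penalty_strict (beta Mb T : R) xb tb r (b x : V) t : 0 < beta -> 0 <= Mb ->
  r <= beta / (4 * (Mb + 1)) -> t < T -> near_pt xb tb r x t -> enorm b <= Mb ->
  beta / 2 <= loc_penalty_t beta (Mb + 1) T tb t - dotv b (loc_penalty_x beta xb x).
Proof.
move=> b0 M0 hr tT [xr tr] bM; rewrite /loc_penalty_t /loc_penalty_x dotvDr !dotvZr.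
have M1 : 0 < 4 * (Mb + 1) by rewrite mulr_gt0// ltr_wpDl.
rewrite ler_pdivlMr// in hr.
set S := Num.sqrt _; have S1 : enorm x <= S.
  by rewrite -{1}(ger0_norm (enorm_ge0 x)) -sqrtr_sqr ler_wsqrtr// lerDr.
have S0 : 0 < S by rewrite sqrtr_gt0 ltr_wpDr// sqr_ge0.
have e1 : beta / S * dotv b x <= beta * Mb.
  rewrite -mulrA ler_wpM2l ?(ltW b0)// mulrC ler_pdivrMr//.
  apply: le_trans (ler_norm _) _; apply: le_trans (dotv_abs _ _) _.
  by apply: ler_pM; rewrite ?enorm_ge0.
have e2 : dotv b (x - xb) <= Mb * r.
  apply: le_trans (ler_norm _) _; apply: le_trans (dotv_abs _ _) _.
  by apply: ler_pM; rewrite ?enorm_ge0// ltW.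
have e3 : 0 <= beta * (T - t) ^- 2 by rewrite mulr_ge0 ?(ltW b0)// invr_ge0 sqr_ge0.
move: tr; rewrite ltr_norml => /andP[e4 _].
by move: e1 e2 e3 e4 hr; clear; lra.
Qed.

Lemma sub_jet_shift (D : set V) (u Z : V * R -> R) x t p a P A : qexp Z x t P A ->
  sub_jet D (fun y => u y - Z y) x t p a -> sub_jet D u x t (p + P) (a + A).
Proof.
move=> [C [r [C0 r0 h]]] [C' [r' [r'0 h']]]; exists (C + C'), (Num.min r r').
split; first by rewrite lt_min r0.
move=> x' t' Dx; rewrite !lt_min => /andP[x1 x2] /andP[t1 t2].
have := h x' t' x1 t1; have := h' x' t' Dx x2 t2; rewrite ler_norml => h1 /andP[_ h2].
by rewrite dotvDl; move: h1 h2; clear; lra.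
Qed.

Lemma usc_on_locally (T : R) (u Z : V * R -> R) xb tb r :
  usc_on (setT `*` `[0, T[) u -> r <= tb -> r <= T - tb ->
  (forall x t, t < T -> {for (x, t), continuous Z}) ->
  locally_usc (near_pt xb tb r) (fun y => u y - Z y).
Proof.
move=> uu r1 r2 cZ x t [_]; rewrite ltr_norml => /andP[t1 t2] e e0.
have t0 : 0 < t by move: t1 r1; clear; lra.
have tT : t < T by move: t2 r2; clear; lra.
have e2 : 0 < e / 2 by rewrite divr_gt0.
have D : (setT `*` `[0, T[) (x, t) by split => //=; rewrite in_itv /= ltW.
have /nbhs_enormT[r' r'0 hu] := uu _ D _ e2.
have /cvgrPdist_lt/(_ _ e2)/nbhs_enormT[r'' r''0 hZ] := cZ x t tT.
apply/nbhs_enormT; exists (Num.min (Num.min r' r'') (Num.min t (T - t))).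
  by rewrite !lt_min r'0 r''0 t0 subr_gt0.
move=> x' t'; rewrite !lt_min => /andP[/andP[x1 x2] _] /andP[/andP[s1 s2] /andP[s3 s4]].
have h1 := hu x' t' x1 s1; have := hZ x' t' x2 s2; rewrite ltr_norml => /andP[h2 h3].
have D' : (setT `*` `[0, T[) (x', t').
  split => //=; rewrite in_itv /=; move: s3 s4; rewrite !ltr_norml => /andP[a1 a2] /andP[a3 a4].
  by apply/andP; split; move: a1 a2 a3 a4; clear; lra.
by have := h1 D'; move: h2 h3; clear; lra.
Qed.

End Penalty.

Section Control.
Context {R : realType} {N : nat}.
Local Notation V := 'rV[R]_N.

(** [ctrl_ge] and [ctrl_near] characterize [F] as a supremum over [I] without tying [I] to the
    original control set, which may be empty. *)
Record ctrl (I : Type) (b : V -> R -> I -> V) (l : V -> R -> I -> R) (cl : set V) (T : R)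
    (F : V -> R -> V -> R) (Mb Ml L : R) : Prop := Ctrl {
  ctrl_Mb : 0 <= Mb;
  ctrl_Ml : 0 <= Ml;
  ctrl_L : 0 <= L;
  ctrl_b : forall x t i, cl x -> 0 <= t <= T -> enorm (b x t i) <= Mb;
  ctrl_l : forall x t i, cl x -> 0 <= t <= T -> `|l x t i| <= Ml;
  ctrl_blip : forall x t x' t' i, cl x -> 0 <= t <= T -> cl x' -> 0 <= t' <= T ->
    enorm (b x t i - b x' t' i) <= L * (enorm (x - x') + `|t - t'|);
  ctrl_lcont : forall e : R, 0 < e -> exists2 r : R, 0 < r &
    forall x t x' t' i, cl x -> 0 <= t <= T -> cl x' -> 0 <= t' <= T ->
    enorm (x - x') + `|t - t'| < r -> `|l x t i - l x' t' i| <= e;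
  ctrl_ge : forall x t p i, cl x -> 0 <= t <= T -> - dotv (b x t i) p - l x t i <= F x t p;
  ctrl_near : forall x t p (e : R), cl x -> 0 <= t <= T -> 0 < e ->
    exists i, F x t p - e < - dotv (b x t i) p - l x t i }.

(** The maxima with 0 provide the signs of the constants, which the conditions do not state. *)
Lemma ctrl_of_cond (A : metricType R) (Omega : set V) (b : V -> R -> A -> V) (l : V -> R -> A -> R)
    (T Mb Lb Ml : R) (ml : R -> R) (i0 : A) :
  cond_C1 Omega T b Mb Lb -> cond_C2 Omega T l Ml ml ->
  ctrl b l (closure Omega) T (Ham b l) (Num.max Mb 0) (Num.max Ml 0) (Num.max Lb 0).
Proof.
move=> [_ _ hb hbl] [_ hl [ml0 _ mlc] hml].
have st x t : closure Omega x -> 0 <= t <= T -> space_time Omega T (x, t).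
  by move=> cx tT; split => //=; rewrite in_itv.
have hb' x t i : closure Omega x -> 0 <= t <= T -> enorm (b x t i) <= Num.max Mb 0.
  by move=> cx tT; rewrite le_max (hb x t i (st _ _ cx tT)).
have hl' x t i : closure Omega x -> 0 <= t <= T -> `|l x t i| <= Num.max Ml 0.
  by move=> cx tT; rewrite le_max (hl x t i (st _ _ cx tT)).
split => //.
- by rewrite le_max lexx orbT.
- by rewrite le_max lexx orbT.
- by rewrite le_max lexx orbT.
- move=> x t x' t' i cx tT cx' tT'; apply: le_trans (hbl _ _ _ _ i (st _ _ cx tT) (st _ _ cx' tT')) _.
  by rewrite ler_wpM2r ?addr_ge0 ?enorm_ge0// le_max lexx.
- move=> e e0.
  have : \forall r \near (0 : R)^'+, `|0 - ml r| < e by move/cvgrPdist_lt: mlc; apply.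
  move=> /nbhs_ballP[r /= r0 hr]; exists r => // x t x' t' i cx tT cx' tT' hs.
  apply: le_trans (hml _ _ _ _ i (st _ _ cx tT) (st _ _ cx' tT')) _.
  have s0 : 0 <= enorm (x - x') + `|t - t'| by rewrite addr_ge0 ?enorm_ge0.
  move: (enorm _ + _) s0 hs => s; rewrite le_eqVlt => /orP[/eqP <-|s0] hs; first by rewrite ml0 ltW.
  have := hr s; rewrite /ball /= sub0r normrN gtr0_norm// => /(_ hs s0).
  by rewrite sub0r normrN => /ltW; apply: le_trans; exact: ler_norm.
- by move=> x t p i cx tT; apply: Ham_ge => j; [exact: hb'|exact: hl'].
- move=> x t p e cx tT e0; apply: (Ham_near p i0 _ _ e0) => j; [exact: hb'|exact: hl'].
Qed.

Lemma convex_control (A : metricType R) (Omega : set V) (T : R) (b : V -> R -> A -> V)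
    (l : V -> R -> A -> R) x t i j (m : R) :
  cond_C3 Omega T b l -> closure Omega x -> 0 <= t <= T -> 0 <= m <= 1 ->
  exists k, b x t k = m *: b x t i + (1 - m) *: b x t j /\
    l x t k = m * l x t i + (1 - m) * l x t j.
Proof.
move=> h cx tT m01.
have [|_ cv] := h x t; first by split => //=; rewrite in_itv.
have Si : (b x t i, l x t i) \in range (fun a => (b x t a, l x t a)) by rewrite inE; exists i.
have Sj : (b x t j, l x t j) \in range (fun a => (b x t a, l x t a)) by rewrite inE; exists j.
have := cv _ _ (Itv01 (proj1 (andP m01)) (proj2 (andP m01))) Si Sj; rewrite inE => -[k _ E].
by exists k; split; [exact: (congr1 fst E)|exact: (congr1 snd E)].
Qed.

(* [sup set0 = 0], so an empty control set acts as the zero Hamiltonian. *)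
Lemma ctrl_empty (A : metricType R) (cl : set V) (b : V -> R -> A -> V) (l : V -> R -> A -> R)
    (T Mb Ml L : R) : 0 <= Mb -> 0 <= Ml -> 0 <= L -> ~ (exists i : A, True) ->
  ctrl (fun _ _ (_ : unit) => 0) (fun _ _ _ => 0) cl T (Ham b l) Mb Ml L.
Proof.
move=> Mb0 Ml0 L0 hA; split => //.
- by move=> x t i _ _; rewrite enorm0.
- by move=> x t i _ _; rewrite normr0.
- by move=> x t x' t' i *; rewrite subrr enorm0 mulr_ge0// addr_ge0 ?enorm_ge0.
- by move=> e e0; exists 1 => // *; rewrite subrr normr0 ltW.
- by move=> x t p i _ _; rewrite Ham_empty// dotv0l oppr0 addr0.
- by move=> x t p e _ _ e0; exists tt; rewrite Ham_empty// dotv0l oppr0 addr0 sub0r oppr_lt0.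
Qed.

Section Penalized.
Variables (I : Type) (b : V -> R -> I -> V) (l : V -> R -> I -> R) (cl : set V) (T : R).
Variables (F : V -> R -> V -> R) (Mb Ml L beta : R) (xb : V) (tb r0 : R) (u v : V * R -> R).
Hypothesis hc : ctrl b l cl T F Mb Ml L.
Hypothesis beta0 : 0 < beta.
Hypothesis r0_small : r0 <= beta / (4 * (Mb + 1)).
Hypothesis r0_tb : r0 <= tb.
Hypothesis r0_T : r0 <= T - tb.
Let Z := loc_penalty beta (Mb + 1) T xb tb.
Let w (y : V * R) := u y - Z y.

Lemma near_pt_time x t : near_pt xb tb r0 x t -> 0 < t < T.
Proof.
move=> [_]; rewrite ltr_norml => /andP[t1 t2].
by move: t1 t2 r0_tb r0_T => *; apply/andP; split; lra.
Qed.

Lemma penalized_control x t p a : near_pt xb tb r0 x t -> cl x ->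
  a + loc_penalty_t beta (Mb + 1) T tb t + F x t (p + loc_penalty_x beta xb x) <= 0 ->
  forall i, a - dotv (b x t i) p - l x t i <= - (beta / 2).
Proof.
move=> Px cx hu i; have tT := near_pt_time Px; case/andP: (tT) => t0 t1.
have tT' : 0 <= t <= T by rewrite !ltW.
have := ctrl_ge hc (p + loc_penalty_x beta xb x) i cx tT'; rewrite dotvDr.
have := loc_penalty_strict beta0 (ctrl_Mb hc) r0_small t1 Px (ctrl_b hc i cx tT').
move: hu; move: (dotv _ p) (dotv _ _) (loc_penalty_t _ _ _ _ _) (F _ _ _) (l x t i) => *; lra.
Qed.

Lemma penalized_sub_jet (D : set V) x t p a : near_pt xb tb r0 x t -> sub_jet D w x t p a ->
  sub_jet D u x t (p + loc_penalty_x beta xb x) (a + loc_penalty_t beta (Mb + 1) T tb t).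
Proof.
move=> /near_pt_time /andP[_ t1]; apply: sub_jet_shift; exact: qexp_loc_penalty.
Qed.

Lemma penalized_side_hyp (dom : set V) : dom `<=` cl ->
  visc_sub T (dom `*` `]0, T[) F u -> visc_super T (dom `*` `]0, T[) F v ->
  side_hyp b l dom cl w v (near_pt xb tb r0) (beta / 2) Mb Ml L.
Proof.
move=> dc hu hv.
have tm x t : near_pt xb tb r0 x t -> 0 <= t <= T.
  by move=> /near_pt_time /andP[a c]; rewrite !ltW.
split => //.
- by rewrite divr_gt0.
- exact: (ctrl_Mb hc).
- exact: (ctrl_Ml hc).
- exact: (ctrl_L hc).
- by move=> x t i /tm h cx; exact: (ctrl_b hc).
- by move=> x t i /tm h cx; exact: (ctrl_l hc).
- by move=> x t x' t' i /tm h /tm h' cx cx'; exact: (ctrl_blip hc).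
- move=> e /(ctrl_lcont hc)[r r00 hr]; exists r => // x t x' t' i /tm h /tm h' cx cx'.
  exact: hr.
- move=> x t p a Px dx hj; apply: penalized_control => //; first exact: dc.
  apply: (visc_sub_jet hu) (penalized_sub_jet Px hj).
  by split => //=; rewrite in_itv /=; apply: near_pt_time Px.
- move=> x t p a Px dx hj e e0.
  have h : 0 <= a + F x t p.
    by apply: (visc_super_jet hv) hj; split => //=; rewrite in_itv /=; apply: near_pt_time Px.
  have [i hi] := ctrl_near hc p (dc _ dx) (tm _ _ Px) e0; exists i.
  move: h hi; move: (F _ _ _) (dotv _ _) (l _ _ _) => *; lra.
Qed.

End Penalized.
End Control.

Section Cases.
Context {R : realType} {N : nat}.
Local Notation V := 'rV[R]_N.

Definition penalized_max (beta K T : R) (u v : V * R -> R) (xb : V) (tb : R) :=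
  forall x t, 0 <= t < T -> u (x, t) - v (x, t) - penalty beta K T (x, t) <=
    u (xb, tb) - v (xb, tb) - penalty beta K T (xb, tb).

Lemma penalized_strict (beta K T : R) (u v : V * R -> R) xb tb r0 (Z := loc_penalty beta K T xb tb) :
  penalized_max beta K T u v xb tb -> r0 <= tb -> r0 <= T - tb ->
  forall x t, near_pt xb tb r0 x t -> (x, t) <> (xb, tb) ->
  (u (x, t) - Z (x, t)) - v (x, t) < (u (xb, tb) - Z (xb, tb)) - v (xb, tb).
Proof.
move=> hm r1 r2 x t Px xt; have /andP[t0 t1] := near_pt_time r1 r2 Px.
have := hm x t; rewrite (ltW t0) t1 => /(_ isT) h.
rewrite /Z /loc_penalty /= !subrr enorm0 expr0n /= !addr0.
have q1 := sqr_ge0 (enorm (x - xb)); have q2 := sqr_ge0 (t - tb).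
suff : 0 < enorm (x - xb) ^+ 2 + (t - tb) ^+ 2 by move: h; clear; lra.
rewrite lt_def addr_ge0// andbT; apply/eqP => q0; apply: xt.
have e1 : enorm (x - xb) ^+ 2 = 0 by move: q0 q1 q2; clear; lra.
have e2 : (t - tb) ^+ 2 = 0 by move: q0 q1 q2; clear; lra.
move/eqP: e1; rewrite sqrf_eq0 => /eqP/enorm_eq0/eqP; rewrite subr_eq0 => /eqP ->.
by move/eqP: e2; rewrite sqrf_eq0 subr_eq0 => /eqP ->.
Qed.

Lemma loc_penalty_continuous (beta K T : R) xb tb (x : V) t : t < T ->
  {for (x, t), continuous (loc_penalty beta K T xb tb)}.
Proof. by move=> tT; apply: (qexp_cont (qexp_loc_penalty beta K xb tb x tT)). Qed.

Lemma lsc_on_locally (T : R) (v : V * R -> R) xb tb r :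
  lsc_on (setT `*` `[0, T[) v -> r <= tb -> r <= T - tb -> locally_usc (near_pt xb tb r) (\- v).
Proof.
move=> hv r1 r2.
have hv' : usc_on (setT `*` `[0, T[) (\- v).
  move=> y Dy e e0; have := hv y Dy e e0; apply: filterS => y' h; move: h; rewrite -[(\- v) y']/(- v y') -[(\- v) y]/(- v y); clear; lra.
have := @usc_on_locally R N T (\- v) (fun=> 0) xb tb r hv' r1 r2.
rewrite (_ : (fun y => _ - 0) = \- v); last by apply/funext => y; rewrite subr0.
by apply => x t _; exact: cvg_cst.
Qed.

Lemma interior_case (I : Type) (b : V -> R -> I -> V) (l : V -> R -> I -> R) (Omega : set V)
    (F : V -> R -> V -> R) (T Mb Ml L beta : R) (u v : V * R -> R) xb tb :
  ctrl b l (closure Omega) T F Mb Ml L -> open Omega -> Omega xb -> 0 < beta -> 0 < tb < T ->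
  visc_sub T (Omega `*` `]0, T[) F u -> visc_super T (Omega `*` `]0, T[) F v ->
  usc_on (setT `*` `[0, T[) u -> lsc_on (setT `*` `[0, T[) v ->
  ~ penalized_max beta (Mb + 1) T u v xb tb.
Proof.
move=> hc oO Oxb b0 /andP[t0 t1] hu hv uu lv hm.
have /nbhs_enorm[r r00 hr] : nbhs xb Omega by exact: open_nbhs_nbhs.
have M1 : 0 < 4 * (Mb + 1) by rewrite mulr_gt0// ltr_wpDl// (ctrl_Mb hc).
pose r0 : R := Num.min r (Num.min (beta / (4 * (Mb + 1))) (Num.min tb (T - tb))).
have rp : 0 < r0 by rewrite !lt_min r00 divr_gt0// t0 subr_gt0.
have rr : r0 <= r by rewrite ge_min lexx.
have r1 : r0 <= beta / (4 * (Mb + 1)) by rewrite !ge_min lexx !orbT.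
have r2 : r0 <= tb by rewrite !ge_min lexx !orbT.
have r3 : r0 <= T - tb by rewrite !ge_min lexx !orbT.
have S := penalized_side_hyp xb hc b0 r1 r2 r3 (@subset_closure _ Omega) hu hv.
apply: (interior_no_max S oO rp) => [x hx| | |].
- by apply: hr; exact: lt_le_trans rr.
- by apply: (usc_on_locally uu r2 r3) => x t; exact: loc_penalty_continuous.
- exact: (lsc_on_locally lv r2 r3).
- exact: (penalized_strict hm r2 r3).
Qed.

Lemma interface_case (A1 A2 : metricType R) (b1 : V -> R -> A1 -> V) (l1 : V -> R -> A1 -> R)
    (b2 : V -> R -> A2 -> V) (l2 : V -> R -> A2 -> R) (Omega1 Omega2 H : set V) (n1 n2 : V -> V)
    (T Mb Ml L delta beta : R) (u v : V * R -> R) xb tb :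
  H_Omega Omega1 Omega2 H ->
  (forall z, H z -> outward_normal Omega1 z (n1 z)) ->
  (forall z, H z -> outward_normal Omega2 z (n2 z)) ->
  ctrl b1 l1 (closure Omega1) T (Ham b1 l1) Mb Ml L ->
  ctrl b2 l2 (closure Omega2) T (Ham b2 l2) Mb Ml L ->
  cond_C3 Omega1 T b1 l1 -> cond_C3 Omega2 T b2 l2 -> 0 < delta ->
  cond_C4 T b1 H n1 delta -> cond_C4 T b2 H n2 delta ->
  Hminus_subsolution T Omega1 Omega2 H n1 b1 l1 b2 l2 u ->
  Hminus_supersolution T Omega1 Omega2 H b1 l1 b2 l2 v ->
  H xb -> 0 < beta -> 0 < tb < T -> ~ penalized_max beta (Mb + 1) T u v xb tb.
Proof.
move=> HO hn1 hn2 hc1 hc2 C31 C32 dl0 C41 C42 [[Mu uM] uu [hu1 hu2 huH huT]] [_ lv [hv1 hv2 hvH]].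
move=> Hxb b0 /andP[t0 t1] hm; have H0 : H !=set0 by exists xb.
have [op1 op2 _ [_ E1 E2 _]] := HO.
pose d := sdist Omega1 H.
have geo z (Hz : H z) := interface_geometry HO hn1 Hz.
have [g [Cd [r [r00 hd hn _]]]] := geo xb Hxb.
have [Cd0 dlip de gl g1] := hd.
have Mb0 := ctrl_Mb hc1; have L0 := ctrl_L hc1.
have M1 : 0 < 4 * (Mb + 1) by rewrite mulr_gt0// ltr_wpDl.
have K1 : 0 < 2 * (L + Mb * Cd + 1) by rewrite mulr_gt0// ltr_wpDl// addr_ge0// mulr_ge0.
(* The last term gives [L r0 + Mb Cd r0 <= delta / 2], so that half of the coercivity at [xb]
   survives nearby; the others ensure the expansion of [d], strictness, and times inside []0,
   T[]. *)
pose r0 : R := Num.min r (Num.min (beta / (4 * (Mb + 1))) (Num.min tb (Num.min (T - tb)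
  (delta / (2 * (L + Mb * Cd + 1)))))).
have rp : 0 < r0 by rewrite !lt_min r00 t0 subr_gt0 t1 /= !divr_gt0.
have rr : r0 <= r by rewrite ge_min lexx.
have r1 : r0 <= beta / (4 * (Mb + 1)) by rewrite !ge_min lexx !orbT.
have r2 : r0 <= tb by rewrite !ge_min lexx !orbT.
have r3 : r0 <= T - tb by rewrite !ge_min lexx !orbT.
have r4 : r0 <= delta / (2 * (L + Mb * Cd + 1)) by rewrite !ge_min lexx !orbT.
have tm x t : near_pt xb tb r0 x t -> 0 < t < T by move=> Px; exact: (near_pt_time r2 r3 Px).
have tm' x t : near_pt xb tb r0 x t -> 0 <= t <= T by move=> /tm/andP[? ?]; rewrite !ltW.
have inr x : enorm (x - xb) < r0 -> enorm (x - xb) < r by move=> /lt_le_trans; apply.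
have cl1 x : 0 <= d x -> closure Omega1 x by exact: (sdist_ge0 HO).
have cl2 x : d x <= 0 -> closure Omega2 x by exact: (sdist_le0 HO).
have dH x : H x -> d x = 0 by exact: (sdist_H HO).
have Hd x : d x = 0 -> H x by exact: (sdist_eq0 HO).
have xx : enorm (xb - xb) < r by rewrite subrr enorm0.
have gn1 : n1 xb = - g xb by exact: hn.
have gxb : enorm (g xb) = 1 by rewrite -enormN -gn1; case: (hn1 xb Hxb).
(* [- d] is the signed distance as seen from [Omega2], with gradient [- g], so that its outward
   normal is [g]. *)
have gn2 : n2 xb = g xb.
  rewrite -[g xb]opprK -/((\- g) xb).
  apply: (normal_eq (Omega1 := Omega2) (H := H) (dist_hypN hd)) => //.
  - by move=> x /= /eqP; rewrite oppr_eq0 => /eqP; exact: Hd.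
  - by move=> x O2; rewrite /= oppr_gt0; exact: (sdist_neg HO).
  - by rewrite /= [sdist _ _ _]dH// oppr0.
  - by rewrite /= enormN.
  - exact: hn2.
(* (C4) concerns points of [H] only; it is used at [xb], at the same time [t], and carried to [x] by
   the Lipschitz bounds on [b] and [g]. *)
have coer (I : Type) (b : V -> R -> I -> V) (Om : set V) (s : R) x t :
    (forall x t i, closure Om x -> 0 <= t <= T -> enorm (b x t i) <= Mb) ->
    (forall x t x' t' i, closure Om x -> 0 <= t <= T -> closure Om x' -> 0 <= t' <= T ->
      enorm (b x t i - b x' t' i) <= L * (enorm (x - x') + `|t - t'|)) ->
    closure Om xb -> near_pt xb tb r0 x t -> closure Om x -> forall i,
    `|dotv (b x t i) (g x) - dotv (b xb t i) (g xb)| <= delta / 2.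
  move=> hb hbl cxb Px cx i; have T' := tm' _ _ Px; have xr := Px.1.
  have e1 := hbl x t xb t i cx T' cxb T'; rewrite subrr normr0 addr0 in e1.
  have e2 := gl x xb (inr _ xr) xx; have e3 := hb xb t i cxb T'.
  have -> : dotv (b x t i) (g x) - dotv (b xb t i) (g xb) =
      dotv (b x t i - b xb t i) (g x) + dotv (b xb t i) (g x - g xb).
    by rewrite dotvBl dotvBr; ring.
  apply: le_trans (ler_normD _ _) _.
  have f1 : `|dotv (b x t i - b xb t i) (g x)| <= L * r0.
    apply: le_trans (dotv_abs _ _) _; rewrite -[leRHS]mulr1; apply: ler_pM; rewrite ?enorm_ge0//.
      by apply: le_trans e1 _; rewrite ler_wpM2l// ltW.
    exact: g1 (inr _ xr).
  have f2 : `|dotv (b xb t i) (g x - g xb)| <= Mb * (Cd * r0).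
    apply: le_trans (dotv_abs _ _) _; apply: ler_pM; rewrite ?enorm_ge0//.
    by apply: le_trans e2 _; rewrite ler_wpM2l// ltW.
  apply: le_trans (lerD f1 f2) _; move: r4; rewrite ler_pdivlMr// => r4.
  by move: r4 rp; clear; lra.
have cxb1 : closure Omega1 xb by apply: cl1; rewrite dH.
have cxb2 : closure Omega2 xb by apply: cl2; rewrite dH.
have dd1 : `[- delta, delta]%classic delta by rewrite /= in_itv /= lexx andbT ge0_cp// ltW.
have dd2 : `[- delta, delta]%classic (- delta) by rewrite /= in_itv /= lexx /= ge0_cp// ltW.
have tb' : near_pt xb tb r0 xb tb by split; rewrite ?subrr ?enorm0 ?normr0.
have S1 := penalized_side_hyp xb hc1 b0 r1 r2 r3 (@subset_closure _ Omega1) hu1 hv1.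
have S2 := penalized_side_hyp xb hc2 b0 r1 r2 r3 (@subset_closure _ Omega2) hu2 hv2.
have F : iface b1 l1 b2 l2 Omega1 Omega2 (closure Omega1) (closure Omega2)
    (fun y => u y - loc_penalty beta (Mb + 1) T xb tb y) v xb tb r0 (beta / 2) Mb Ml L d g Cd (delta / 2).
  split => //.
  - split => //.
    + by move=> x y hx hy; apply: de; exact: inr.
    + by move=> x y hx hy; apply: gl; exact: inr.
    + by move=> x hx; apply: g1; exact: inr.
  - by rewrite divr_gt0.
  - by move=> x _; exact: (sdist_gt0 HO).
  - by move=> x _; exact: (sdist_lt0 HO).
  - by move=> x _; exact: cl1.
  - by move=> x _; exact: cl2.
  - move=> x t Px dx; have cx := cl1 _ dx; have T' := tm' _ _ Px.
    have key := coer A1 b1 Omega1 0 x t (ctrl_b hc1) (ctrl_blip hc1) cxb1 Px cx.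
    have [i _ hi] := C41 xb t Hxb T' _ dd1; have [j _ hj] := C41 xb t Hxb T' _ dd2.
    rewrite gn1 dotvNr in hi; rewrite gn1 dotvNr in hj.
    split; [exists j; have := key j|exists i; have := key i]; rewrite ler_norml => /andP[k1 k2].
      by move: hj k1; clear; lra.
    by move: hi k2; clear; lra.
  - move=> x t Px dx; have cx := cl2 _ dx; have T' := tm' _ _ Px.
    have key := coer A2 b2 Omega2 0 x t (ctrl_b hc2) (ctrl_blip hc2) cxb2 Px cx.
    have [i _ hi] := C42 xb t Hxb T' _ dd1; have [j _ hj] := C42 xb t Hxb T' _ dd2.
    rewrite gn2 in hi; rewrite gn2 in hj.
    split; [exists i; have := key i|exists j; have := key j]; rewrite ler_norml => /andP[k1 k2].
      by move: hi k1; clear; lra.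
    by move: hj k2; clear; lra.
  - move=> x t p a Px dx hj; have cx1 : closure Omega1 x by apply: cl1; rewrite dx.
    have cx2 : closure Omega2 x by apply: cl2; rewrite dx.
    have DH : (H `*` `]0, T[) (x, t) by split; [exact: Hd|rewrite /= in_itv /=; apply: tm Px].
    have := visc_sub_jet huH DH (penalized_sub_jet r2 r3 Px hj).
    rewrite /Num.min; case: ifP => _ h; [left|right] => i.
      exact: (penalized_control hc1 b0 r1 r2 r3 Px cx1 h).
    exact: (penalized_control hc2 b0 r1 r2 r3 Px cx2 h).
  - by apply: (usc_on_locally uu r2 r3) => x t; exact: loc_penalty_continuous.
  - exact: (lsc_on_locally lv r2 r3).
apply: (interface_no_max F _ _ _ _ op1 op2 _ _ rp).
- move=> x t p a Px dx hj e e0; have cx1 : closure Omega1 x by apply: cl1; rewrite dx.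
  have cx2 : closure Omega2 x by apply: cl2; rewrite dx.
  have DH : (H `*` `]0, T[) (x, t) by split; [exact: Hd|rewrite /= in_itv /=; apply: tm Px].
  have := visc_super_jet hvH DH hj; rewrite /Num.max; case: ifP => _ h; [right|left].
    have [i hi] := ctrl_near hc2 p cx2 (tm' _ _ Px) e0; exists i.
    by move: h hi; move: (Ham _ _ _ _ _) (dotv _ _) (l2 _ _ _); clear => *; lra.
  have [i hi] := ctrl_near hc1 p cx1 (tm' _ _ Px) e0; exists i.
  by move: h hi; move: (Ham _ _ _ _ _) (dotv _ _) (l1 _ _ _); clear => *; lra.
- move=> x t p a Px dx hj i j m m01 bg; have cx1 : closure Omega1 x by apply: cl1; rewrite dx.
  have cx2 : closure Omega2 x by apply: cl2; rewrite dx.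
  have Hx := Hd _ dx; have T' := tm' _ _ Px; have /andP[_ tT] := tm _ _ Px.
  have dHE : [set x | d x = 0] = H by apply/seteqP; split => z; [exact: Hd|exact: dH].
  have hj' := penalized_sub_jet r2 r3 Px hj; rewrite dHE in hj'.
  have nH z : H z -> enorm (n1 z) = 1 by move=> Hz; case: (hn1 z Hz).
  have bn : dotv (m *: b1 x t i + (1 - m) *: b2 x t j) (n1 x) = 0.
    by rewrite (hn x Hx (inr _ Px.1)) dotvNr bg oppr0.
  have := tangential_jet geo dH nH huT uM (fun i => ctrl_b hc1 i cx1 T') (fun i => ctrl_l hc1 i cx1 T')
    (fun i => ctrl_b hc2 i cx2 T') (fun i => ctrl_l hc2 i cx2 T') Hx (tm _ _ Px) hj' m01 bn.
  case/andP: m01 => m0 m1; have m1' : 0 <= 1 - m by rewrite subr_ge0.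
  have bM : enorm (m *: b1 x t i + (1 - m) *: b2 x t j) <= Mb.
    apply: le_trans (enormD _ _) _; rewrite !enormZ !ger0_norm//.
    have := ler_wpM2l m0 (ctrl_b hc1 i cx1 T'); have := ler_wpM2l m1' (ctrl_b hc2 j cx2 T').
    by clear; lra.
  have := loc_penalty_strict b0 Mb0 r1 tT Px bM; rewrite dotvDr.
  move: (dotv _ p) (dotv _ _) (loc_penalty_t _ _ _ _ _) (m * _ + _); clear => *; lra.
- move=> x t i j m Px dx m01; apply: (convex_control i j C31) => //; last by apply: (tm' _ _ Px).
  by apply: cl1; rewrite dx.
- move=> x t i j m Px dx m01; apply: (convex_control i j C32) => //; last by apply: (tm' _ _ Px).
  by apply: cl2; rewrite dx.
- by move=> x; exact: (sdist_pos HO).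
- by move=> x; exact: (sdist_neg HO).
- exact: (penalized_strict hm r2 r3).
Qed.

End Cases.

Lemma penalized_max_exists (R : realType) (N : nat) (T K : R) (u v : 'rV[R]_N * R -> R) Mu Mv x0 t0 :
  0 <= K -> (forall y, (setT `*` `[0, T[) y -> `|u y| <= Mu) ->
  (forall y, (setT `*` `[0, T[) y -> `|v y| <= Mv) ->
  usc_on (setT `*` `[0, T[) u -> lsc_on (setT `*` `[0, T[) v ->
  (forall x, u (x, 0) <= v (x, 0)) -> 0 < t0 < T -> v (x0, t0) < u (x0, t0) ->
  exists (beta : R) xb tb, [/\ 0 < beta, 0 < tb < T & penalized_max beta K T u v xb tb].
Proof.
move=> K0 uM vM uu lv uv0 /andP[t00 t0T] gap.
have D x t : 0 <= t < T -> (setT `*` `[0, T[) ((x, t) : 'rV[R]_N * R).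
  by move=> tT; split => //=; rewrite in_itv.
pose S (x : 'rV[R]_N) (t : R) : R := Num.sqrt (1 + enorm x ^+ 2) + K * t + (T - t)^-1.
have S1 x t : 0 <= t < T -> enorm x + (T - t)^-1 <= S x t.
  move=> /andP[t1 t2]; rewrite /S -addrA; apply: lerD; last by rewrite lerDr mulr_ge0.
  by rewrite -{1}(ger0_norm (enorm_ge0 x)) -sqrtr_sqr ler_wsqrtr// lerDr.
have i0 x t : 0 <= t < T -> 0 < S x t.
  move=> tT; apply: lt_le_trans (S1 x t tT); case/andP: tT => _ tT.
  by rewrite ltr_wpDl ?enorm_ge0// invr_gt0 subr_gt0.
have T0 : 0 <= t0 < T by rewrite ltW.
have S00 := i0 x0 t0 T0.
(* With this [beta] half of the gap at [(x0, t0)] survives the penalty. *)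
pose beta : R := (u (x0, t0) - v (x0, t0)) / (2 * S x0 t0).
have b0 : 0 < beta by rewrite divr_gt0 ?subr_gt0// mulr_gt0.
pose F (y : 'rV[R]_N * R) := u y - v y - penalty beta K T y.
have FE x t : F (x, t) = u (x, t) - v (x, t) - beta * S x t by [].
have F0 : 0 < F (x0, t0).
  rewrite FE /beta.
  rewrite (_ : _ / _ * _ = (u (x0, t0) - v (x0, t0)) / 2); last by field; rewrite gt_eqF.
  by move: gap; clear; lra.
pose B : R := `|Mu| + `|Mv| + 1.
have B0 : 0 < B by rewrite ltr_wpDl// addr_ge0.
have uvB x t : 0 <= t < T -> u (x, t) - v (x, t) < B.
  move=> tT; have := uM _ (D x t tT); have := vM _ (D x t tT); rewrite !ler_norml => /andP[a _] /andP[_ c].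
  have := ler_norm Mu; have := ler_norm Mv; rewrite /B; move: a c; clear; lra.
(* Beyond the radius [Rr], or within [e] of the time [T], the penalty reaches [B], a strict upper
   bound of [u - v]. *)
pose Rr : R := B / beta; pose e : R := beta / B.
have neg x t : 0 <= t < T -> Rr < enorm x \/ T - e < t -> F (x, t) < 0.
  move=> tT far; have tp : 0 < T - t by case/andP: tT => _; rewrite subr_gt0.
  suff : B <= beta * S x t by rewrite FE; have := uvB x t tT; clear; lra.
  apply: le_trans (ler_wpM2l (ltW b0) (S1 x t tT)).
  have E0 := enorm_ge0 x; have I0 : 0 < (T - t)^-1 by rewrite invr_gt0.
  case: far => h.
    rewrite mulrDr; apply: ler_wpDr; first by rewrite mulr_ge0 ?ltW.
    by rewrite mulrC -ler_pdivrMr// ltW.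
  rewrite mulrDr; apply: ler_wpDl; first by rewrite mulr_ge0 // (ltW b0).
  rewrite ler_pdivlMr// mulrC -ler_pdivlMr//.
  by rewrite -/e; move: h; clear; lra.
pose Kc := [set y : 'rV[R]_N * R | enorm y.1 <= Rr /\ 0 <= y.2 <= T - e].
have e0 : 0 < e by rewrite divr_gt0.
have KD y : Kc y -> 0 <= y.2 < T.
  by move=> [_ /andP[h1 h2]]; rewrite h1/=; move: h2 e0; clear; lra.
have cK : compact Kc.
  have -> : Kc = [set x : 'rV[R]_N | enorm x <= Rr] `*` `[0, T - e]%classic.
    by apply/seteqP; split => y [h1 h2]; split => //; move: h2; rewrite /= in_itv.
  apply: compact_setX; last exact: segment_compact.
  rewrite (_ : [set x : 'rV[R]_N | _] = [set x | enorm (x - 0) <= Rr]); first exact: compact_cball.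
  by apply/seteqP; split => y; rewrite /= subr0.
have inK x t : 0 <= t < T -> 0 < F (x, t) -> Kc (x, t).
  move=> tT Fp; split => /=; last first.
    by case/andP: (tT) => -> _ /=; rewrite leNgt; apply/negP => h; have := neg x t tT (or_intror h); rewrite ltNge ltW.
  by rewrite leNgt; apply/negP => h; have := neg x t tT (or_introl h); rewrite ltNge ltW.
have uF : usc_in Kc F.
  move=> [x t] Ky eps eps0; have tT := KD _ Ky; have eps3 : 0 < eps / 3 by rewrite divr_gt0.
  have /cvgrPdist_lt/(_ _ eps3) a3 := qexp_cont (qexp_penalty beta K x (proj2 (andP tT))).
  have a1 : \forall y \near (x, t), (setT `*` `[0, T[) y -> u y < u (x, t) + eps / 3 := uu _ (D x t tT) _ eps3.
  have a2 : \forall y \near (x, t), (setT `*` `[0, T[) y -> v (x, t) - eps / 3 < v y := lv _ (D x t tT) _ eps3.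
  apply: filterS3 a1 a2 a3 => -[x' t'] h1 h2 h3 Ky'.
  have D' := D x' t' (KD _ Ky'); have {}h1 := h1 D'; have {}h2 := h2 D'.
  move: h3; rewrite ltr_norml => /andP[h3 h4]; rewrite /F; move: h1 h2 h3 h4; clear; lra.
have [[xb tb] Kb Fmax] := usc_in_max cK (ex_intro _ (x0, t0) (inK x0 t0 T0 F0)) uF.
have Fb : 0 < F (xb, tb) by apply: (lt_le_trans F0); apply: Fmax; exact: (inK _ _ T0 F0).
have /andP[tb0 tbT] := KD _ Kb; rewrite /= in tb0 tbT.
exists beta, xb, tb; split => //.
  (* At time 0 the penalized difference is negative because [u <= v] there. *)
  rewrite tbT andbT lt_neqAle tb0 andbT; apply/eqP => E.
  have := uv0 xb; move: Fb; rewrite FE -E.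
  have : 0 < beta * S xb 0 by rewrite mulr_gt0// i0// lexx (lt_trans t00).
  by clear; lra.
move=> x t tT; rewrite -/(F (x, t)) -/(F (xb, tb)).
have [h|h] := leP (F (x, t)) 0; first exact: le_trans h (ltW Fb).
by apply: Fmax; exact: (inK _ _ tT h).
Qed.

Theorem theorem4p2 (R : realType) (N : nat) (T : R)
  (Omega1 Omega2 H : set 'rV[R]_N) (n1 n2 : 'rV[R]_N -> 'rV[R]_N)
  (A1 A2 : metricType R)
  (b1 : 'rV[R]_N -> R -> A1 -> 'rV[R]_N) (l1 : 'rV[R]_N -> R -> A1 -> R)
  (b2 : 'rV[R]_N -> R -> A2 -> 'rV[R]_N) (l2 : 'rV[R]_N -> R -> A2 -> R)
  (Mb Lb Ml delta : R) (ml : R -> R) (u v : 'rV[R]_N * R -> R) :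
  0 < T ->
  H_Omega Omega1 Omega2 H ->
  (forall z, H z -> outward_normal Omega1 z (n1 z)) ->
  (forall z, H z -> outward_normal Omega2 z (n2 z)) ->
  cond_C1 Omega1 T b1 Mb Lb -> cond_C1 Omega2 T b2 Mb Lb ->
  cond_C2 Omega1 T l1 Ml ml -> cond_C2 Omega2 T l2 Ml ml ->
  cond_C3 Omega1 T b1 l1 -> cond_C3 Omega2 T b2 l2 ->
  0 < delta ->
  cond_C4 T b1 H n1 delta -> cond_C4 T b2 H n2 delta ->
  Hminus_subsolution T Omega1 Omega2 H n1 b1 l1 b2 l2 u ->
  Hminus_supersolution T Omega1 Omega2 H b1 l1 b2 l2 v ->
  (forall x, u (x, 0) <= v (x, 0)) ->
  forall (x : 'rV[R]_N) (t : R), 0 < t < T -> u (x, t) <= v (x, t).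
Proof.
move=> T0 HO hn1 hn2 C11 C12 C21 C22 C31 C32 d0 C41 C42 su sv uv0 x0 t0 tT.
rewrite leNgt; apply/negP => gap.
have [[Mu uM] uu [hu1 hu2 _ _]] := su; have [[Mv vM] lv [hv1 hv2 _]] := sv.
pose Mb' : R := Num.max Mb 0; pose Ml' : R := Num.max Ml 0; pose L' : R := Num.max Lb 0.
have Mb0 : 0 <= Mb' by rewrite le_max lexx orbT.
have Ml0 : 0 <= Ml' by rewrite le_max lexx orbT.
have L0 : 0 <= L' by rewrite le_max lexx orbT.
have K0 : 0 <= Mb' + 1 by rewrite addr_ge0.
have [beta [xb [tb [b0 tbT hm]]]] := penalized_max_exists K0 uM vM uu lv uv0 tT gap.
have [op1 op2 _ _] := HO.
have [h1|h2|hH] := omega_cases HO xb.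
(* The control set may be empty here, since (C4) provides controls only at points of [H]. *)
- have [[i0 _]|hA] := pselect (exists i : A1, True).
    exact: (interior_case (ctrl_of_cond i0 C11 C21) op1 h1 b0 tbT hu1 hv1 uu lv hm).
  exact: (interior_case (ctrl_empty _ _ _ _ Mb0 Ml0 L0 hA) op1 h1 b0 tbT hu1 hv1 uu lv hm).
- have [[i0 _]|hA] := pselect (exists i : A2, True).
    exact: (interior_case (ctrl_of_cond i0 C12 C22) op2 h2 b0 tbT hu2 hv2 uu lv hm).
  exact: (interior_case (ctrl_empty _ _ _ _ Mb0 Ml0 L0 hA) op2 h2 b0 tbT hu2 hv2 uu lv hm).
have tT' : 0 <= tb <= T by case/andP: tbT => ? ?; rewrite !ltW.
(* On the interface (C4) provides a control on each side. *)
have dd : `[- delta, delta]%classic delta by rewrite /= in_itv /= lexx andbT ge0_cp// ltW.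
have [i1 _ _] := C41 xb tb hH tT' _ dd; have [i2 _ _] := C42 xb tb hH tT' _ dd.
exact: (interface_case HO hn1 hn2 (ctrl_of_cond i1 C11 C21) (ctrl_of_cond i2 C12 C22) C31 C32 d0 C41 C42 su sv hH b0 tbT hm).
Qed.
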